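(* Let $f\in L^{1}(\mathbb{T})$ be real-valued. The following three statements are equivalent: $(V_1)$ $f\in \mathrm{VMO}(\mathbb{T})$; $(V_2)$ there exist a vanishing Carleson measure $\mu\in CM_0(\Delta)$ and a continuous function $g\in C(\mathbb{T})$ such that $$f(\zeta)=g(\zeta)+S\mu(\zeta)\quad\text{for almost every }\zeta\in\mathbb{T};$$ $(V_3)$ there exists a smooth function $F\in C^{\infty}(\Delta)$ such that (i) the radial limit $\lim_{r\to1^-}F(re^{i\theta})$ exists for almost every $\theta$, and the function $e^{i\theta}\mapsto \lim_{r\to 1^-}F(re^{i\theta})-f(e^{i\theta})$ belongs to $C(\mathbb{T})$ (that is, it agrees almost everywhere with a continuous function on $\mathbb{T}$); (ii) $|\nabla F|\,dx\,dy\in CM_0(\Delta)$.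
   Context: $\Delta=\{z\in\mathbb{C}:|z|<1\}$ is the open unit disk and $\mathbb{T}=\partial\Delta$ the unit circle. $C(\mathbb{T})$ is the space of continuous functions on $\mathbb{T}$, and $C^\infty(\Delta)$ the space of smooth functions on $\Delta$. Functions and measures are real-valued (measures on $\Delta$ are signed Borel measures); functions in $L^1(\mathbb{T})$ are identified when equal almost everywhere. For an interval (arc) $I\subset\mathbb{T}$, $|I|$ denotes its arclength and $f_I=\frac{1}{|I|}\int_I f(x)\,dx$ the mean of $f$ over $I$ (with respect to arclength). BMO and VMO: an integrable function $f$ on $\mathbb{T}$ is in $\mathrm{BMO}(\mathbb{T})$ if $\sup_{I}\frac{1}{|I|}\int_I|f(x)-f_I|\,dx<\infty$, the supremum being over all intervals $I\subset\mathbb{T}$. It is in $\mathrm{VMO}(\mathbb{T})$ if $f\in\mathrm{BMO}(\mathbb{T})$ and $\lim_{|I|\to0}\frac{1}{|I|}\int_I|f(x)-f_I|\,dx=0$ uniformly over intervals $I$. Carleson measures: for an interval $I\subset\mathbb{T}$, the Carleson square over $I$ is $\tilde I=\{r\zeta:\ \zeta\in I,\ 1-|I|/2\pi\le r\le 1\}$ (for a measure on $\Delta$ only the part of $\tilde I$ in $\Delta$ counts). A measure $\mu$ on $\Delta$, with total variation measure $|\mu|$, is a Carleson measure, $\mu\in CM(\Delta)$, if $\sup_I|\mu|(\tilde I)/|I|<\infty$. It is a vanishing Carleson measure, $\mu\in CM_0(\Delta)$, if in addition $\lim_{|I|\to0}|\mu|(\tilde I)/|I|=0$ (uniformly over intervals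 $I$). Balayage: for a finite signed measure $\mu$ on $\Delta$, $S\mu(\zeta)=\int_\Delta P_z(\zeta)\,d\mu(z)$ for $\zeta\in\mathbb{T}$, where $P_z(\zeta)=\frac{1-|z|^2}{|\zeta-z|^2}$ is the Poisson kernel; $S\mu(\zeta)$ is defined (absolutely convergent) for almost every $\zeta\in\mathbb{T}$. $\nabla F$ is the Euclidean gradient of $F$ in the coordinates $(x,y)$, $z=x+iy$, and $|\nabla F|\,dx\,dy$ denotes the measure on $\Delta$ with density $|\nabla F|$ with respect to planar Lebesgue measure. *)

(* Defs.v *)
From HB Require Import structures.
From mathcomp Require Import all_boot all_order all_algebra.
From mathcomp Require Import all_classical all_reals all_analysis.
From mathcomp Require Import measurable_realfun.

Set Implicit Arguments.
Unset Strict Implicit.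
Unset Printing Implicit Defensive.

Import Order.TTheory GRing.Theory Num.Theory.
Import numFieldNormedType.Exports.

Local Open Scope classical_set_scope.
Local Open Scope ring_scope.

(* The complex plane is R * R, z = x + iy being the pair (x, y).  The norm that
   the library puts on R * R is the sup norm, hence the explicit Euclidean
   expressions below.  Functions on the circle, resp. the disk, are functions
   on R * R of which only the values on the circle, resp. the disk, are used. *)

Section Plane.
Context {R : realType}.
Implicit Types (z : R * R) (I : set (R * R)).

Definition sqnorm z : R := z.1 ^+ 2 + z.2 ^+ 2.

Definition disk : set (R * R) := [set z | sqnorm z < 1].

Definition circle : set (R * R) := [set z | sqnorm z = 1].

Definition cis (t : R) : R * R := (cos t, sin t).

Lemma measurable_cis : measurable_fun setT cis.
Proof.
apply: measurable_fun_pair; apply: continuous_measurable_fun.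
- exact: continuous_cos.
- exact: continuous_sin.
Qed.

(* Arclength measure of the circle, as a Borel measure on the plane.  The
   measure structure of pushforward takes a proof that cis is measurable, which
   unification does not find; hence the explicit instance. *)
Definition arclength : set (R * R) -> \bar R :=
  pushforward (mrestr lebesgue_measure (measurable_itv `[0 : R, 2 * pi[)) cis.

HB.instance Definition _ := Measure.copy arclength
  (measure_function_pushforward__canonical__measure_function_Measure
    (mrestr lebesgue_measure (measurable_itv `[0 : R, 2 * pi[)) measurable_cis).

(* The nondegenerate arcs, with or without each end point; for b = a + 2 pi
   this gives the whole circle or the circle minus one point. *)
Definition circle_arc : set (set (R * R)) :=
  [set I | exists (a b : R) (x y : bool),
    [/\ a < b, b <= a + 2 * pi &
        I = cis @` [set` Interval (BSide x a) (BSide y b)]]].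

Definition len I : R := fine (arclength I).

Definition in_L1 (f : R * R -> R) : Prop :=
  arclength.-integrable circle (EFin \o f).

Definition mean (f : R * R -> R) I : R :=
  (\int[arclength]_(x in I) f x) / len I.

Definition oscillation (f : R * R -> R) I : R :=
  mean (fun x => `|f x - mean f I|) I.

Definition BMO (f : R * R -> R) : Prop :=
  in_L1 f /\ has_ubound [set oscillation f I | I in circle_arc].

Definition VMO (f : R * R -> R) : Prop :=
  BMO f /\ forall e : R, 0 < e -> exists2 d : R, 0 < d &
    forall I, circle_arc I -> len I < d -> oscillation f I < e.

Definition carleson_square I : set (R * R) :=
  [set r *: z | r in `[1 - len I / (2 * pi), 1] & z in I].

(* For a nonnegative set function nu; only its trace on the disk matters. *)
Definition carleson_ratio (nu : set (R * R) -> \bar R) I : \bar R :=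
  (nu (carleson_square I `&` disk) / (len I)%:E)%E.

Definition CM (nu : set (R * R) -> \bar R) : Prop :=
  (ereal_sup [set carleson_ratio nu I | I in circle_arc] < +oo)%E.

Definition CM0 (nu : set (R * R) -> \bar R) : Prop :=
  CM nu /\ forall e : R, 0 < e -> exists2 d : R, 0 < d &
    forall I, circle_arc I -> len I < d -> (carleson_ratio nu I < e%:E)%E.

Definition continuous_on_circle (g : R * R -> R) : Prop :=
  {within circle, continuous g}.

Definition unit_vector (b : bool) : R * R := if b then (0, 1) else (1, 0).

Definition partial (b : bool) (F : R * R -> R) : R * R -> R :=
  fun z => 'D_(unit_vector b) F z.

(* All iterated partial derivatives exist and are continuous in the disk. *)
Definition smooth_on_disk (F : R * R -> R) : Prop :=
  forall (s : seq bool) z, disk z ->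
    let G := foldr partial F s in
    {for z, continuous G} /\ forall b, derivable G z (unit_vector b).

Definition grad_norm (F : R * R -> R) z : R :=
  Num.sqrt (partial false F z ^+ 2 + partial true F z ^+ 2).

Definition grad_measure (F : R * R -> R) (A : set (R * R)) : \bar R :=
  (\int[lebesgue_measure \x lebesgue_measure]_(z in A `&` disk)
     (grad_norm F z)%:E)%E.

Definition radial (F : R * R -> R) z : R -> R := fun r => F (r *: z).

Definition poisson z (zeta : R * R) : R :=
  (1 - sqnorm z) / sqnorm (zeta - z).

End Plane.

(* A charge is a finite signed measure.  Signed measures on the disk are traces
   of charges on the plane: total variations are evaluated on subsets of the
   disk and integrals are taken over it.  Finiteness is no restriction, since
   the Carleson square of the full circle contains the disk. *)
Section SignedMeasure.
Context {R : realType}.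
Variable mu : {charge set (R * R)%type -> \bar R}.

Definition hahn_pos : set (R * R) := projT1 (cid (Hahn_decomposition mu)).

Definition hahn_neg : set (R * R) :=
  projT1 (cid (projT2 (cid (Hahn_decomposition mu)))).

Definition hahnP : hahn_decomposition mu hahn_pos hahn_neg :=
  projT2 (cid (projT2 (cid (Hahn_decomposition mu)))).

Definition abs_charge : {measure set (R * R) -> \bar R} :=
  charge_variation hahnP.

(* It is finite only where both integrals are, since +oo - +oo = -oo. *)
Definition balayage (zeta : R * R) : \bar R :=
  (\int[jordan_pos hahnP]_(z in disk) (poisson z zeta)%:E
   - \int[jordan_neg hahnP]_(z in disk) (poisson z zeta)%:E)%E.

End SignedMeasure.

(* Main.v *)
(* The equivalence is proved as the cycle V1 => V2 => V3 => V1.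

   V1 => V2.  Let F_n be a stopping process along the dyadic arcs: it moves to
   the mean of f over the current arc of generation n only when it has drifted
   away from this mean by more than twice the maximal oscillation w_n of f at
   that scale.  Its total variation after generation n, over an arc of that
   generation and of length l_n, is O(w_n l_n).  Let k_n = 2 P_r - P_(r^2) with
   P the Poisson kernel and r = exp (- 4 l_n / pi).  Then F_n * k_n tends to f
   in L^1.  By the semigroup property of P, its increments are sums of functions
   g * P_r, which are balayages of densities on circles; the vanishing of the
   first moment of the combinations of Poisson kernels gives them the decay
   y^2 / (y + |t|)^3 that makes the resulting measure a vanishing Carleson one.

   V2 => V3.  The balayage is extended to w in the disk by replacing
   |zeta - z|^2 by |1 - conj(z) w|^2 in the Poisson kernel.  The gradient in w
   of this kernel is integrable over the disk uniformly in z, and its mass on a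
   Carleson square of side h is O(4^-k) when z lies at distance 2^k h.

   V3 => V1.  The values of the radial limits of F on an arc of length h are
   compared with a single value of F, along a radius and then along a circular
   arc whose height, at distance O(h) from the boundary, is chosen by averaging.
   Polar coordinates bound both variations by the gradient mass. *)

Require Import Defs.
From HB Require Import structures.
From mathcomp Require Import all_boot all_order all_algebra.
From mathcomp Require Import all_classical all_reals all_analysis.
From mathcomp Require Import measurable_realfun ring lra zify.

Set Implicit Arguments.
Unset Strict Implicit.
Unset Printing Implicit Defensive.

Import Order.TTheory GRing.Theory Num.Theory.
Import numFieldNormedType.Exports.

Local Open Scope classical_set_scope.
Local Open Scope ring_scope.

(** * Measures on the plane *)

(** The averages of f over dyadic arcs are the obvious approximation, but their successive
    differences need not be summable in total variation. The stopping rule repairs this: a jump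
    exceeds twice the oscillation and is paid for by a decrease of the L^1 distance to f.

    The balayage of a density on the circle of radius r is its convolution with P_r, so an increment
    is usable only after a factor P_r with r < 1 has been split off. Halving l_n replaces r by its
    square root; hence the radii that occur between two generations are powers of exp (- l_n / pi),
    and the factor 4 in r leaves one such power to spare.

    Neighbouring values of F_n differ by O(w_n), so F_n is only known to grow linearly with the
    number of arcs. Against the decay y / t^2 of the Poisson kernel this would leave a logarithm at
    every generation; 2 P_r - P_(r^2) is a combination of mass 1 without a term of order y / t^2.

    All estimates from generation n on carry the factor w_n, which tends to 0 for f in VMO: it gives
    both the Carleson condition and its vanishing. *)

Lemma open_measurable_plane (R : realType) (A : set (R * R)) :
  open A -> measurable A.
Proof.
move=> oA.
(* The sigma-algebra of the plane is the product one, so an open set has to be written as a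
   countable union of boxes: those with rational corners that lie inside it. *)
pose box (q : (rat * rat) * (rat * rat)) : set (R * R) :=
  `]ratr q.1.1, ratr q.1.2[%classic `*` `]ratr q.2.1, ratr q.2.2[%classic.
pose F (n : nat) : set (R * R) :=
  if unpickle n is Some q then (if `[< box q `<=` A >] then box q else set0)
  else set0.
have -> : A = \bigcup_n F n.
  apply/seteqP; split=> [[x y] Axy|z [n _]]; last first.
    rewrite /F; case: (unpickle n) => [q|//].
    by case: asboolP => // qA /qA.
  have : nbhs (x, y) A by apply: open_nbhs_nbhs.
  rewrite nbhsE => -[U [oU Uxy] UA].
  have /nbhs_ballP[e /= e0 He] : nbhs (x, y) A by apply: open_nbhs_nbhs.
  have rb (u : R) : exists p : rat * rat,
      ratr p.1 < u < ratr p.2 /\ forall v, ratr p.1 < v < ratr p.2 -> `|u - v| < e.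
    have /rat_in_itvoo[p /itvP hp] : u - e / 2 < u by rewrite ltrBlDr ltrDl divr_gt0.
    have /rat_in_itvoo[q /itvP hq] : u < u + e / 2 by rewrite ltrDl divr_gt0.
    exists (p, q); split=> /=; first by rewrite hp hq.
    move=> v /andP[pv vq].
    have h1 : u - e / 2 < v by apply: lt_trans pv; rewrite hp.
    have h2 : v < u + e / 2 by apply: lt_trans vq _; rewrite hq.
    by rewrite ltr_norml; apply/andP; split; lra.
  have [p [p1 p2]] := rb x; have [q [q1 q2]] := rb y.
  exists (pickle (p, q)); first exact: I.
  rewrite /F pickleK.
  case: asboolP; first by move=> _; rewrite /box/=; split => /=; rewrite in_itv.
  case; move=> [u v] [/= hu hv]; apply: He; split => /=.
    by rewrite /ball/=; apply: p2; move: hu; rewrite in_itv.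
  by rewrite /ball/=; apply: q2; move: hv; rewrite in_itv.
apply: bigcupT_measurable => n; rewrite /F.
case: (unpickle n) => [q|]; last exact: measurable0.
case: asboolP => _; last exact: measurable0.
by apply: measurableX.
Qed.

Lemma closed_measurable_plane (R : realType) (A : set (R * R)) :
  closed A -> measurable A.
Proof.
by move=> cA; rewrite -[A]setCK; apply: measurableC; apply: open_measurable_plane;
  exact: closed_openC.
Qed.

Lemma compact_measurable_plane (R : realType) (A : set (R * R)) :
  compact A -> measurable A.
Proof.
by move=> cA; apply: closed_measurable_plane; apply: compact_closed.
Qed.

Lemma continuous_measurable_plane (R : realType) (D : set (R * R))
    (f : R * R -> R) :
  open D -> (forall z, D z -> {for z, continuous f}) -> measurable_fun D f.
Proof.
move=> oD cf; apply: (measurability _ (RGenOpens.measurableE R)).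
move=> _ [_ [a [b ->] <-]]; set B := `]a, b[%classic.
have oB : open B by exact: interval_open.
apply: open_measurable_plane.
rewrite openE => z [Dz Bz]; rewrite /interior.
near=> w; split; near: w; first by apply: open_nbhs_nbhs.
apply: (cf z Dz); exact: open_nbhs_nbhs.
Unshelve. all: by end_near. Qed.

(** * Measures given by a density *)

Section density.
Context d (T : measurableType d) (R : realType) (mu : {measure set T -> \bar R}).
Variables (g : T -> \bar R) (mg : measurable_fun setT g) (g0 : forall x, (0 <= g x)%E).
Local Open Scope ereal_scope.

(* The proofs are arguments so that the measure structure can be inferred. *)
Definition density of measurable_fun setT g & (forall x, 0 <= g x) :=
  fun A : set T => \int[mu]_(x in A) g x.

Let den := density mg g0.

Let den0 : den set0 = 0. Proof. exact: integral_set0. Qed.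

Let den_ge0 A : 0 <= den A. Proof. exact: integral_ge0. Qed.

Let den_sigma : semi_sigma_additive den.
Proof. exact: semi_sigma_additive_nng_induced. Qed.

HB.instance Definition _ := isMeasure.Build _ _ _ (density mg g0) den0 den_ge0 den_sigma.

Import HBNNSimple.

(** Monotone convergence along simple functions on both sides reduces the identity to indicators,
    where it is the definition of the measure. *)
Lemma ge0_integral_density D (h : T -> \bar R) : measurable D ->
  measurable_fun D h -> (forall x, D x -> 0 <= h x) ->
  \int[density mg g0]_(x in D) h x = \int[mu]_(x in D) (h x * g x).
Proof.
move=> mD mh h0.
pose s := nnsfun_approx mD mh.
have mgD : measurable_fun D g by exact: measurable_funTS.
transitivity (limn (fun n => \int[density mg g0]_(x in D) (s n x)%:E)).
  rewrite -monotone_convergence//.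
  - by apply: eq_integral => x /set_mem Dx; apply/esym/cvg_lim => //; apply: cvg_nnsfun_approx.
  - by move=> n; exact/measurable_EFinP/measurable_funTS.
  - by move=> *; rewrite lee_fin.
  - by move=> x _ m n mn; rewrite lee_fin; exact/lefP/nd_nnsfun_approx.
transitivity (limn (fun n => \int[mu]_(x in D) ((s n x)%:E * g x))); last first.
  rewrite -monotone_convergence//.
  - apply: eq_integral => x /set_mem Dx; apply/cvg_lim => //.
    have sh : (s n x)%:E @[n --> \oo] --> h x by apply: cvg_nnsfun_approx.
    have [gx|gx] := eqVneq (g x) 0.
      by rewrite gx mule0; under eq_fun do rewrite mule0; exact: cvg_cst.
    have nd : {homo (fun n => (s n x)%:E * g x) : m n / (m <= n)%N >-> m <= n}.
      move=> m n mn; apply: lee_wpmul2r => //.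
      by rewrite lee_fin; exact/lefP/nd_nnsfun_approx.
    (* An infinite value of the density is harmless for the limit: either [h x = 0] and all products
       vanish, or some [s n x] is positive and the products are [+oo] from there on. *)
    have [gy|gy] := eqVneq (g x) +oo.
      have [hx|hx] := eqVneq (h x) 0.
        have s0 n : (s n x)%:E = 0.
          apply/eqP; rewrite eq_le; apply/andP; split; last by rewrite lee_fin.
          rewrite -hx; apply: cvge_ge sh; exists n => // m /= nm.
          by rewrite lee_fin; exact/lefP/nd_nnsfun_approx.
        by rewrite hx mul0e; under eq_fun do rewrite s0 mul0e; exact: cvg_cst.
      have hx0 : 0 < h x by rewrite lt_neqAle eq_sym hx h0.
      have [N HN] : exists n, 0 < (s n x)%:E.
        apply/not_existsP => s0; move: hx0; rewrite ltNge => /negP; apply.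
        by apply: cvge_le sh; near=> n; rewrite leNgt; apply/negP.
      rewrite gy gt0_muley//; apply: cvg_near_cst.
      exists N => // n Nn /=; rewrite gt0_muley//; apply: (lt_le_trans HN).
      by rewrite lee_fin; exact/lefP/nd_nnsfun_approx.
    apply: cvgeMr => //; rewrite fin_numE gy andbT.
    by rewrite gt_eqF// (lt_le_trans _ (g0 x)).
  - move=> n; apply: emeasurable_funM => //.
    by exact/measurable_EFinP/measurable_funTS.
  - by move=> n x _; rewrite mule_ge0// lee_fin.
  - move=> x _ m n mn; apply: lee_wpmul2r => //.
    by rewrite lee_fin; exact/lefP/nd_nnsfun_approx.
congr (limn _); apply/funext => n.
have sE x : (s n x)%:E * g x =
    \sum_(r \in range (s n)) ((r * \1_(s n @^-1` [set r]) x)%:E * g x).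
  by rewrite fimfunE -fsumEFin// ge0_mule_fsuml// => r; rewrite nnfun_muleindic_ge0.
have sE1 x : (s n x)%:E =
    \sum_(r \in range (s n)) (r * \1_(s n @^-1` [set r]) x)%:E.
  by rewrite fimfunE -fsumEFin.
transitivity (\sum_(r \in range (s n)) \int[density mg g0]_(x in D)
    (r * \1_(s n @^-1` [set r]) x)%:E).
  under eq_integral do rewrite sE1.
  apply: (@ge0_integral_fsum _ _ _ (density mg g0)) => //.
  - by move=> r; exact/measurable_EFinP/measurable_funTS/measurableT_comp.
  - by move=> r x _; rewrite nnfun_muleindic_ge0.
transitivity (\sum_(r \in range (s n)) \int[mu]_(x in D)
    ((r * \1_(s n @^-1` [set r]) x)%:E * g x)); last first.
  under eq_integral do rewrite sE.
  apply/esym; apply: ge0_integral_fsum => //.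
  - move=> r; apply: emeasurable_funM => //.
    by exact/measurable_EFinP/measurable_funTS/measurableT_comp.
  - by move=> r x _; rewrite mule_ge0// nnfun_muleindic_ge0.
apply: eq_fsbigr => r _.
rewrite integralZl_indic_nnsfun// integral_indic//.
have mr : measurable (s n @^-1` [set r]) by [].
have [r0|r0] := ltP r 0%R.
  rewrite preimage_nnfun0// set0I measure0 mule0.
  by rewrite integral0_eq// => x _; rewrite indic0 mulr0 mul0e.
rewrite -[X in _ * X]/(\int[mu]_(x in _) g x) setIC integral_mkcondr -ge0_integralZl//; last first.
  - by move=> x _; exact: erestrict_ge0.
  - apply: measurable_funTS; apply/(measurable_restrictT _ mr).
    exact: measurable_funTS.
apply: eq_integral => x _; rewrite patchE indicE.
by case: ifPn => _; rewrite /= ?mulr1 // mulr0 mule0 mul0e.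
Unshelve. all: by end_near. Qed.

End density.

(** * Arcs and arclength *)

(** The restriction of [mu] to [D] is the measure of density [\1_D]. *)
Lemma ge0_integral_mrestr d (T : measurableType d) (R : realType)
    (mu : {measure set T -> \bar R}) (D A : set T) (mD : measurable D)
    (f : T -> \bar R) : measurable A -> measurable_fun A f ->
  (forall x, A x -> (0 <= f x)%E) ->
  (\int[mrestr mu mD]_(x in A) f x = \int[mu]_(x in A `&` D) f x)%E.
Proof.
move=> mA mf f0.
have mi : measurable_fun setT (fun x : T => (\1_D x : R)%:E).
  exact/measurable_EFinP.
have i0 (x : T) : (0 <= (\1_D x : R)%:E)%E by rewrite lee_fin.
rewrite [LHS](@eq_measure_integral _ _ _ _ (density mu mi i0)); last first.
  move=> B mB _; rewrite /= /mrestr /density integral_indic// setIC //.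
rewrite ge0_integral_density// integral_mkcondr; apply: eq_integral => x _.
by rewrite patchE indicE; case: ifPn => _; rewrite ?mule1 ?mule0.
Qed.

(** * Translations, dilations and periods in Lebesgue integrals *)

Section lebesgue_affine.
Context {R : realType}.
Implicit Types (A D : set R) (f : R -> \bar R).
Local Open Scope ereal_scope.
Local Notation lam := (@lebesgue_measure R).

Lemma measurable_shift (c : R) : measurable_fun setT ((fun x => x + c)%R : R -> measurableTypeR R).
Proof. by apply: measurable_funD. Qed.

Lemma measurable_scale (c : R) : measurable_fun setT ((fun x => c * x)%R : R -> measurableTypeR R).
Proof. by apply: measurable_funM. Qed.

Lemma lebesgue_measure_shift (c : R) A : measurable A ->
  pushforward lam ((fun x => x + c)%R : R -> measurableTypeR R) A = lam A.
Proof.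
move=> mA; apply/esym.
pose m := measure_function_pushforward__canonical__measure_function_Measure lam (measurable_shift c).
apply: (@lebesgue_measure_unique R m) => // _ [[a b]] _ <-.
rewrite /m /= /pushforward (_ : _ @^-1` _ = `]a - c, b - c]%classic)%R.
  rewrite !lebesgue_measure_itv /= !lte_fin ltrD2r; case: ifPn => // _.
  by rewrite -!EFinB; congr EFin; ring.
by apply/seteqP; split=> x /=; rewrite !in_itv/= ltrBlDr lerBrDr.
Qed.

Lemma lebesgue_measure_scale (k : R) A : (0 < k)%R -> measurable A ->
  k%:E * pushforward lam ((fun x => k * x)%R : R -> measurableTypeR R) A = lam A.
Proof.
move=> k0 mA; apply/esym.
pose m := measure_function_pushforward__canonical__measure_function_Measure lam (measurable_scale k).
pose kk : {nonneg R} := NngNum (ltW k0).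
apply: (@lebesgue_measure_unique R (mscale kk m)) => // _ [[a b]] _ <-.
change (lam `]a, b]%classic = k%:E * lam ((fun x => k * x)%R @^-1` `]a, b]%classic)).
rewrite (_ : _ @^-1` _ = `](a / k)%R, (b / k)%R]%classic)%R.
  rewrite !lebesgue_measure_itv /= !lte_fin ltr_pM2r ?invr_gt0//; case: ifPn => // _.
    rewrite -!EFinB -EFinM; congr EFin; field; exact: lt0r_neq0.
  by rewrite mule0.
by apply/seteqP; split=> x /=; rewrite !in_itv/= ltr_pdivrMr// ler_pdivlMr// (mulrC x).
Qed.

Lemma ge0_integral_shift (c : R) D f : measurable D -> measurable_fun D f ->
  (forall x, D x -> 0 <= f x) ->
  \int[lam]_(x in [set x | D (x + c)%R]) f (x + c)%R = \int[lam]_(x in D) f x.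
Proof.
move=> mD mf f0.
rewrite -(@ge0_integral_pushforward _ _ (measurableTypeR R) (measurableTypeR R) _ _ (measurable_shift c) lam D f)//; last first.
  by move=> x /set_mem; exact: f0.
pose m := measure_function_pushforward__canonical__measure_function_Measure lam (measurable_shift c).
apply: (eq_measure_integral lam (m1 := m)) => A mA _.
by have := lebesgue_measure_shift c mA.
Qed.

Lemma ge0_integral_scale (k : R) D f : (0 < k)%R -> measurable D ->
  measurable_fun D f -> (forall x, D x -> 0 <= f x) ->
  k%:E * \int[lam]_(x in [set x | D (k * x)%R]) f (k * x)%R = \int[lam]_(x in D) f x.
Proof.
move=> k0 mD mf f0.
rewrite -(@ge0_integral_pushforward _ _ (measurableTypeR R) (measurableTypeR R) _ _ (measurable_scale k) lam D f)//; last first.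
  by move=> x /set_mem; exact: f0.
pose m := measure_function_pushforward__canonical__measure_function_Measure lam (measurable_scale k).
pose kk : {nonneg R} := NngNum (ltW k0).
rewrite -(@ge0_integral_mscale _ _ _ m D mD kk f mf)//.
apply: eq_measure_integral => A mA _; have := lebesgue_measure_scale k0 mA; exact.
Qed.

Lemma ge0_integral_shift_itv (c a b : R) (x y : bool) f :
  measurable_fun [set` Interval (BSide x a) (BSide y b)] f ->
  (forall t, [set` Interval (BSide x a) (BSide y b)] t -> 0 <= f t) ->
  \int[lam]_(t in [set` Interval (BSide x (a - c)%R) (BSide y (b - c)%R)]) f (t + c)%R
    = \int[lam]_(t in [set` Interval (BSide x a) (BSide y b)]) f t.
Proof.
move=> mf f0; rewrite -[RHS](ge0_integral_shift c)//; congr (integral _ _ _).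
apply/seteqP; split=> t /=; rewrite !in_itv/=;
  by case: x {mf f0}; case: y; rewrite /= ?ltrBlDr ?lerBlDr ?ltrBrDr ?lerBrDr.
Qed.

(** The set of angles of an arc is an interval up to its end points. These form a null set, so that
    the four kinds of arcs need not be distinguished. *)
Lemma eq_integral_itv (a b : R) (S : set R) f : measurable S ->
  measurable_fun `[a, b] f -> `]a, b[ `<=` S -> S `<=` `[a, b] ->
  \int[lam]_(t in S) f t = \int[lam]_(t in `[a, b]) f t.
Proof.
move=> mS mf oS Sc.
rewrite [LHS]integral_mkcond [RHS]integral_mkcond.
have mab : measurable (`[a, b]%classic : set R) by [].
apply: ae_eq_integral => //.
- apply/(measurable_restrictT _ mS); exact: measurable_funS mf.
- by apply/(measurable_restrictT _ mab).
- exists ([set a] `|` [set b]); split.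
  + exact: measurableU.
  + apply/eqP; rewrite eq_le measure_ge0 andbT.
    apply: le_trans (measureU2 _ _ _) _ => //.
    have l0 (u : R) : lam [set u] = 0 by exact: lebesgue_measure_set1.
    by rewrite -[X in X + _]/(lam [set a]) -[X in _ + X]/(lam [set b]) !l0 adde0.
  + move=> t /= nt; apply: contrapT => /not_orP[ta tb].
    apply: nt => _; rewrite !patchE.
    case: ifPn => [/set_mem /Sc /mem_set -> //|/negP nS].
    case: ifPn => // /set_mem /=; rewrite in_itv/= => /andP[h1 h2].
    exfalso; apply: nS; apply/mem_set; apply: oS => /=; rewrite in_itv/= !lt_neqAle h1 h2 !andbT.
    by apply/andP; split; apply/eqP => // e; apply: ta.
Qed.

Lemma ge0_integral_period (T a : R) f : (0 < T)%R -> measurable_fun setT f ->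
  (forall t, 0 <= f t) -> (forall t, f (t + T)%R = f t) ->
  \int[lam]_(t in `[a, (a + T)%R[) f t = \int[lam]_(t in `[0%R, T[) f t.
Proof.
move=> T0 mf f0 fT.
have fTn (n : nat) t : f (t + T *+ n)%R = f t.
  by elim: n => [|n IH]; rewrite ?addr0// mulrS addrCA addrC fT.
have fTz (z : int) t : f (t + T *~ z)%R = f t.
  case: z => n; first exact: fTn.
  by rewrite NegzE mulrNz -(fTn n.+1 (t - T *+ n.+1)%R) subrK.
(* [b] represents [a] modulo [T] in [[0, T[]. The window that starts at [b] is cut at [T], and the
   part beyond is moved back by one period. *)
pose z := Num.floor (a / T); pose b := (a - T *~ z)%R.
have /andP[z1 z2] := floor_itv (a / T).
have b0 : (0 <= b)%R.
  by rewrite /b subr_ge0 -mulrzr mulrC -ler_pdivlMr.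
have bT : (b < T)%R.
  move: z2; rewrite ltr_pdivrMr// intrD mulrDl mul1r -/z /b ltrBlDr.
  by rewrite -(mulrzl T z) addrC.
have mitv (i : interval R) : measurable_fun [set` i] f by exact: measurable_funTS.
transitivity (\int[lam]_(t in `[b, (b + T)%R[) f t).
  rewrite -(ge0_integral_shift_itv (T *~ z))//.
  rewrite (_ : a + T - T *~ z = b + T)%R; last by rewrite /b; ring.
  by apply: eq_integral => t _; rewrite fTz.
have bTT : (T <= b + T)%R by rewrite lerDr.
rewrite (@itv_bndbnd_setU _ _ (BLeft b) (BLeft T) (BLeft (b + T)%R)) ?bnd_simp ?(ltW bT)//.
rewrite ge0_integral_setU//; last first.
  by apply/disj_set2P/seteqP; split=> // t /= []; rewrite !in_itv/= => /andP[_ h1] /andP[h2 _]; move: (lt_le_trans h1 h2); rewrite ltxx.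
  exact: measurable_funTS.
rewrite -[in X in _ + X](ge0_integral_shift_itv T)// subrr addrK.
rewrite (_ : \int[lam]_(t in `[0%R, b[) f (t + T)%R = \int[lam]_(t in `[0%R, b[) f t);
  last by apply: eq_integral => t _; rewrite fT.
rewrite addeC -ge0_integral_setU//; last first.
  by apply/disj_set2P/seteqP; split=> // t /= []; rewrite !in_itv/= => /andP[_ h1] /andP[h2 _]; move: (lt_le_trans h1 h2); rewrite ltxx.
  exact: measurable_funTS.
by rewrite -itv_bndbnd_setU// bnd_simp// ltW.
Qed.

Lemma integral_period (T a : R) f : (0 < T)%R -> measurable_fun setT f ->
  (forall t, f (t + T)%R = f t) ->
  \int[lam]_(t in `[a, (a + T)%R[) f t = \int[lam]_(t in `[0%R, T[) f t.
Proof.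
move=> T0 mf fT; rewrite [LHS]integralE [RHS]integralE; congr (_ - _).
- apply: ge0_integral_period => //; first exact: measurable_funepos.
  by move=> t; rewrite !funeposE fT.
- apply: ge0_integral_period => //; first exact: measurable_funeneg.
  by move=> t; rewrite !funenegE fT.
Qed.

End lebesgue_affine.

(** * Arclength in terms of the angle *)

Section circle_param.
Context {R : realType}.
Local Notation lam := (@lebesgue_measure R).

Lemma cisD2pi (t : R) : cis (t + 2 * pi) = cis t.
Proof. by rewrite /cis mulr_natl cosD2pi sinD2pi. Qed.

Lemma circle_cis (t : R) : circle (cis t).
Proof. by rewrite /circle /= /sqnorm /= cos2Dsin2. Qed.

Lemma cos_lt1 (u : R) : 0 < u < 2 * pi -> cos u < 1.
Proof.
move=> /andP[u0 u2].
have -> : u = (u / 2) *+ 2 by rewrite -mulr_natr divfK.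
rewrite cos_mulr2n cos2sin2.
have s0 : 0 < sin (u / 2) by apply: sin_gt0_pi; rewrite divr_gt0//= ltr_pdivrMr// mulrC.
have : 0 < sin (u / 2) ^+ 2 by rewrite exprn_gt0.
rewrite mulr2n; lra.
Qed.

Lemma cis_inj (a s t : R) : a <= s < a + 2 * pi -> a <= t < a + 2 * pi ->
  cis s = cis t -> s = t.
Proof.
move=> /andP[s1 s2] /andP[t1 t2] [e1 e2].
have c1 : cos (s - t) = 1 by rewrite cosB e1 e2 -!expr2 cos2Dsin2.
have c2 : cos (t - s) = 1 by rewrite cosB e1 e2 -!expr2 cos2Dsin2.
have [st|ts|//] := ltgtP s t.
- have : cos (t - s) < 1 by apply: cos_lt1; apply/andP; split; lra.
  by rewrite c2 ltxx.
- have : cos (s - t) < 1 by apply: cos_lt1; apply/andP; split; lra.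
  by rewrite c1 ltxx.
Qed.

Lemma cis_surj (c : R) z : circle z -> exists2 t, c <= t < c + 2 * pi & cis t = z.
Proof.
case: z => x y; rewrite /circle /= /sqnorm /= => xy.
have xb : -1 <= x <= 1.
  by rewrite -ler_norml -[_ <= _]ler_sqr ?nnegrE//= expr1n real_normK ?num_real//; have := sqr_ge0 y; lra.
have [t0 t0E] : exists t0, cis t0 = (x, y).
  have ca : cos (acos x) = x by rewrite acosK.
  have sa : sin (acos x) = Num.sqrt (1 - x ^+ 2) by rewrite sin_acos.
  have e : 1 - x ^+ 2 = y ^+ 2 by lra.
  have [y0|y0] := leP 0 y.
    by exists (acos x); rewrite /cis ca sa e sqrtr_sqr ger0_norm.
  by exists (- acos x); rewrite /cis cosN sinN ca sa e sqrtr_sqr ltr0_norm// opprK.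
have p0 : (0 : R) < 2 * pi by rewrite mulr_gt0// pi_gt0.
have cisz (z : int) (t : R) : cis (t + (2 * pi) *~ z) = cis t.
  have cisn (n : nat) (u : R) : cis (u + (2 * pi) *+ n) = cis u.
    by elim: n => [|n IH]; rewrite ?addr0// mulrS addrCA addrC cisD2pi.
  case: z => n; first exact: cisn.
  by rewrite NegzE mulrNz -(cisn n.+1 (t - (2 * pi) *+ n.+1)) subrK.
pose z := Num.floor ((t0 - c) / (2 * pi)).
have /andP[z1 z2] := floor_itv ((t0 - c) / (2 * pi)).
exists (t0 + (2 * pi) *~ (- z)); last by rewrite cisz.
move: z1 z2; rewrite -/z ler_pdivlMr// ltr_pdivrMr// intrD (mulrDl z%:~R) mul1r.
rewrite mulrNz -(mulrzl (2 * pi) z) => z1 z2.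
by apply/andP; split; lra.
Qed.

Lemma measurable_circle : measurable (@circle R).
Proof.
apply: closed_measurable_plane.
have cs : continuous (@sqnorm R).
  move=> z; rewrite /sqnorm; under eq_fun do rewrite !expr2.
  by apply: cvgD; apply: cvgM; (exact: cvg_fst || exact: cvg_snd).
rewrite (_ : circle = sqnorm @^-1` [set 1])//.
exact: closed_comp.
Qed.

Lemma integral_arclength (f : R * R -> \bar R) (A : set (R * R)) : measurable A ->
  measurable_fun A f ->
  (\int[arclength]_(z in A) f z =
   \int[lam]_(t in `[0%R, (2 * pi)%R[ `&` cis @^-1` A) f (cis t))%E.
Proof.
move=> mA mf.
suff H g : measurable_fun A g -> (forall z, 0 <= g z)%E ->
   (\int[arclength]_(z in A) g z =
   \int[lam]_(t in `[0%R, (2 * pi)%R[ `&` cis @^-1` A) g (cis t))%E.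
  rewrite [LHS]integralE [RHS]integralE.
  rewrite (_ : (fun t => f (cis t))^\+ = (fun t => f^\+ (cis t)))%E; last first.
    by apply/funext => t; rewrite !funeposE.
  rewrite (_ : (fun t => f (cis t))^\- = (fun t => f^\- (cis t)))%E; last first.
    by apply/funext => t; rewrite !funenegE.
  congr (_ - _)%E.
    by apply: H => //; exact: measurable_funepos.
  by apply: H => //; exact: measurable_funeneg.
move=> {}mf g0.
rewrite (@ge0_integral_pushforward _ _ (measurableTypeR R) _ _ _ measurable_cis (mrestr lam (measurable_itv `[0 : R, 2 * pi[)) A g)//.
have mcA : measurable (cis @^-1` A : set (measurableTypeR R)).
  by rewrite -[cis @^-1` A]setTI; exact: measurable_cis.
have mgc : measurable_fun (cis @^-1` A : set (measurableTypeR R)) (g \o cis).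
  apply: (measurable_comp mA) => //; first by move=> _ [t ? <-].
  by apply: measurable_funTS; exact: measurable_cis.
transitivity (\int[lam]_(x in cis @^-1` A `&` `[0%R, (2 * pi)%R[) (g \o cis) x)%E.
  by apply: (@ge0_integral_mrestr _ (measurableTypeR R) R lam _ _
    (measurable_itv `[0 : R, 2 * pi[) (g \o cis) mcA mgc) => t _; exact: g0.
by rewrite setIC.
Qed.

Lemma measurable_fun_cis d (T : measurableType d) (f : R * R -> T) :
  measurable_fun circle f -> measurable_fun setT (f \o cis).
Proof.
move=> mf; apply: (measurable_comp measurable_circle) => //.
  by move=> _ [t _ <-]; exact: circle_cis.
exact: measurable_cis.
Qed.

(** Arclength is defined through the angles in [[0, 2 pi[]. An arc that crosses the angle 0 is
    handled by starting the parametrisation at its own left end. *)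
Lemma integral_arclength_shift (c : R) (f : R * R -> \bar R) (A : set (R * R)) :
  measurable A -> A `<=` circle -> measurable_fun circle f ->
  (\int[arclength]_(z in A) f z =
   \int[lam]_(t in `[c, (c + 2 * pi)%R[ `&` cis @^-1` A) f (cis t))%E.
Proof.
move=> mA Ac mf; rewrite integral_arclength//; last by apply: measurable_funS mf => //; exact: measurable_circle.
rewrite !integral_mkcondr.
have mcA : measurable (cis @^-1` A).
  by rewrite -[X in measurable X]setTI; apply: measurable_cis.
rewrite integral_period//.
- by rewrite mulr_gt0// pi_gt0.
- apply/(measurable_restrictT _ mcA); apply: measurable_funTS.
  exact: (measurable_fun_cis mf).
- move=> t; rewrite !patchE cisD2pi; congr (if _ then _ else _).
  by apply/idP/idP => /set_mem h; apply/mem_set; move: h; rewrite /preimage/= cisD2pi.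
Qed.

End circle_param.

(** * Integrals over arcs *)

Section arcs.
Context {R : realType}.
Local Notation lam := (@lebesgue_measure R).
Local Notation itv x y a b := [set` Interval (BSide x a) (BSide y b)].

Lemma continuous_cis : continuous (@cis R).
Proof.
by move=> t; exact: (cvg_pair (continuous_cos (x := t)) (continuous_sin (x := t))).
Qed.

(** Serves measurability: an arc of any kind becomes a countable union of images of compact
    intervals under [cis], hence of compact sets. *)
Lemma itv_bigcup_closed (a b : R) (x y : bool) : a < b ->
  itv x y a b = \bigcup_n `[(if x then a else a + (b - a) / n.+2%:R),
                            (if y then b - (b - a) / n.+2%:R else b)]%classic.
Proof.
move=> ab; apply/seteqP; split=> [t|t [n _]] /=; last first.
  rewrite /= !in_itv/= => /andP[h1 h2].
  have p : 0 < (b - a) / n.+2%:R by rewrite divr_gt0// subr_gt0.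
  move: h1 h2; set q := (b - a) / _ in p * => h1 h2.
  by case: x h1 => /= h1; case: y h2 => /= h2; apply/andP; split; lra.
rewrite in_itv/= => /andP[h1 h2].
have [n1 hn1] : exists n1 : nat, forall n, (n1 <= n)%N ->
    (if x then a else a + (b - a) / n.+2%:R) <= t.
  case: x h1 => [h1|/= h1]; first by exists 0%N.
  exists (Num.truncn ((b - a) / (t - a))) => n hn.
  have ta : 0 < t - a by rewrite subr_gt0.
  rewrite -lerBrDl ler_pdivrMr// mulrC -ler_pdivrMr//.
  apply: le_trans (ltW (truncnS_gt _)) _.
  by rewrite ler_nat; apply: leq_trans (leqnSn _).
have [n2 hn2] : exists n2 : nat, forall n, (n2 <= n)%N ->
    t <= (if y then b - (b - a) / n.+2%:R else b).
  case: y h2 => [/= h2|h2]; last by exists 0%N.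
  exists (Num.truncn ((b - a) / (b - t))) => n hn.
  have ta : 0 < b - t by rewrite subr_gt0.
  rewrite lerBrDl -lerBrDr ler_pdivrMr// mulrC -ler_pdivrMr//.
  apply: le_trans (ltW (truncnS_gt _)) _.
  by rewrite ler_nat; apply: leq_trans (leqnSn _).
exists (maxn n1 n2) => //=; rewrite in_itv/=; apply/andP; split.
  by apply: hn1; rewrite leq_maxl.
by apply: hn2; rewrite leq_maxr.
Qed.

Lemma measurable_arc (I : set (R * R)) : circle_arc I -> measurable I.
Proof.
move=> [a [b [x [y [ab _ ->]]]]].
rewrite itv_bigcup_closed// image_bigcup; apply: bigcupT_measurable => n.
apply: compact_measurable_plane; apply: continuous_compact.
  by apply: continuous_subspaceT; exact: continuous_cis.
exact: segment_compact.
Qed.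

Lemma arc_sub_circle (I : set (R * R)) : circle_arc I -> I `<=` circle.
Proof. by move=> [a [b [x [y [_ _ ->]]]]] _ [t _ <-]; exact: circle_cis. Qed.

Lemma integral_arc (f : R * R -> \bar R) (a b : R) (x y : bool) :
  a < b -> b <= a + 2 * pi -> measurable_fun circle f ->
  (\int[arclength]_(z in cis @` itv x y a b) f z =
   \int[lam]_(t in `[a, b]) f (cis t))%E.
Proof.
move=> ab b2 mf.
have aI : circle_arc (cis @` itv x y a b) by exists a, b, x, y.
have mI := measurable_arc aI.
rewrite (integral_arclength_shift a mI (arc_sub_circle aI) mf).
have mfc := measurable_fun_cis mf.
have p0 : (0 : R) < 2 * pi by rewrite mulr_gt0// pi_gt0.
have mcI : measurable (cis @^-1` (cis @` itv x y a b)).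
  by rewrite -[X in measurable X]setTI; apply: measurable_cis.
apply: eq_integral_itv.
- exact: measurableI.
- exact: measurable_funTS mfc.
- move=> t /=; rewrite in_itv/= => /andP[at_ tb]; split.
    by rewrite in_itv/=; apply/andP; split; lra.
  exists t => //=; rewrite in_itv/=; apply/andP; split.
    by case: (x) => /=; rewrite ?(ltW at_).
  by case: (y) => /=; rewrite ?(ltW tb).
- move=> t [] /=; rewrite in_itv/= => /andP[at_ t2] [s].
  rewrite /= !in_itv/= => /andP[s1 s2] st.
  have as_ : a <= s by case: (x) s1 => //= /ltW.
  have sb : s <= b by case: (y) s2 => //= /ltW.
  apply/andP; split=> //.
  (* The value [s = a + 2 * pi] occurs only for a full turn that is closed on the right; its point
     is [cis a], so the angle sought is [a]. *)
  have [s3|s3] := ltP s (a + 2 * pi).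
    by rewrite -(@cis_inj R a s t)// ?as_ ?s3// at_ t2.
  have e : s = a + 2 * pi by apply/eqP; rewrite eq_le s3 andbT; lra.
  move: st; rewrite e cisD2pi => st.
  rewrite -(@cis_inj R a a t)// ?lexx ?at_ ?t2//=; first by rewrite ltW.
  by rewrite ltrDl p0.
Qed.

Lemma len_arc (a b : R) (x y : bool) : a < b -> b <= a + 2 * pi ->
  len (cis @` itv x y a b) = b - a.
Proof.
move=> ab b2; rewrite /len.
have aI : circle_arc (cis @` itv x y a b) by exists a, b, x, y.
have := @integral_arc (cst 1%E) a b x y ab b2 (measurable_cst _).
rewrite !integral_cst//=; last exact: measurable_arc.
rewrite !mul1e => ->.
by rewrite lebesgue_measure_itv/= lte_fin ab.
Qed.

End arcs.

(** * Integrals over intervals *)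

Section interval_integral.
Context {R : realType}.
Local Notation lam := (@lebesgue_measure R).
Implicit Types (g h : R -> R) (a b c : R).

Definition locint (g : R -> R) := forall a b, lam.-integrable `[a, b] (EFin \o g).

(** For [b < a] the interval is empty and the value is 0, not the opposite of the integral over
    [[b, a]]; hence the hypotheses on the order of the bounds below. *)
Definition iint (g : R -> R) a b := \int[lam]_(t in `[a, b]) g t.

Definition bddmeas (g : R -> R) :=
  measurable_fun setT g /\ exists M, forall t, `|g t| <= M.

Lemma bddmeas_locint g : bddmeas g -> locint g.
Proof.
move=> [mg [M gM]] a b; apply: measurable_bounded_integrable => //.
- by rewrite /= lebesgue_measure_itv/=; case: ifPn => _; rewrite -?EFinB ltry.
- exact: measurable_funTS.
- exists M; split; first exact: num_real.
  by move=> x Mx y _; rewrite /= (le_trans (gM y))// ltW.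
Qed.

Lemma locint_cst (k : R) : locint (cst k).
Proof. by apply: bddmeas_locint; split; [exact: measurable_cst|exists `|k|]. Qed.

Lemma locintD g h : locint g -> locint h -> locint (fun t => g t + h t).
Proof. by move=> lg lh a b; apply: (integrableD _ (lg a b) (lh a b)). Qed.

Lemma locintB g h : locint g -> locint h -> locint (fun t => g t - h t).
Proof. by move=> lg lh a b; apply: (integrableB _ (lg a b) (lh a b)). Qed.

Lemma locintZ (k : R) g : locint g -> locint (fun t => k * g t).
Proof. by move=> lg a b; apply: (integrableZl _ k (lg a b)). Qed.

Lemma locint_norm g : locint g -> locint (fun t => `|g t|).
Proof. by move=> lg a b; apply: (integrable_norm (lg a b)). Qed.

Lemma locint_sum (I : Type) (r : seq I) (P : pred I) (G : I -> R -> R) :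
  (forall i, P i -> locint (G i)) -> locint (fun t => \sum_(i <- r | P i) G i t).
Proof.
move=> lG; elim: r => [|i r IH].
  by under eq_fun do rewrite big_nil; exact: locint_cst.
have [Pi|Pi] := boolP (P i); last first.
  by under eq_fun do rewrite big_cons (negbTE Pi).
under eq_fun do rewrite big_cons Pi; apply: locintD => //; exact: lG.
Qed.

Lemma eq_iint g h a b : (forall t, a <= t <= b -> g t = h t) ->
  iint g a b = iint h a b.
Proof.
by move=> gh; apply: eq_Rintegral => t /set_mem/=; rewrite in_itv/=; exact: gh.
Qed.

Lemma iint_cst (k : R) a b : a <= b -> iint (cst k) a b = k * (b - a).
Proof.
move=> ab; rewrite /iint Rintegral_cst//= lebesgue_measure_itv/= lte_fin.
move: ab; rewrite le_eqVlt => /predU1P[->|ab]; first by rewrite ltxx subrr.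
by rewrite ab -EFinB.
Qed.

Lemma iintD g h a b : locint g -> locint h ->
  iint (fun t => g t + h t) a b = iint g a b + iint h a b.
Proof. by move=> lg lh; rewrite /iint RintegralD. Qed.

Lemma iintB g h a b : locint g -> locint h ->
  iint (fun t => g t - h t) a b = iint g a b - iint h a b.
Proof. by move=> lg lh; rewrite /iint RintegralB. Qed.

Lemma iintZ (k : R) g a b : locint g ->
  iint (fun t => k * g t) a b = k * iint g a b.
Proof. by move=> lg; rewrite /iint RintegralZl//; exact: lg. Qed.

Lemma iint_sum (I : Type) (r : seq I) (P : pred I) (G : I -> R -> R) a b :
  (forall i, P i -> locint (G i)) ->
  iint (fun t => \sum_(i <- r | P i) G i t) a b = \sum_(i <- r | P i) iint (G i) a b.
Proof.
move=> lG; elim: r => [|i r IH].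
  rewrite big_nil (@eq_iint _ (fun t => 0 * cst 0 t)).
    by rewrite iintZ ?mul0r//; exact: locint_cst.
  by move=> t _; rewrite big_nil mul0r.
rewrite big_cons -IH; case: ifPn => Pi; last first.
  by apply: eq_iint => t _; rewrite big_cons (negbTE Pi).
rewrite -iintD; last 2 first. exact: lG. exact: locint_sum.
by apply: eq_iint => t _; rewrite big_cons Pi.
Qed.

Lemma le_iint g h a b : locint g -> locint h ->
  (forall t, a <= t <= b -> g t <= h t) -> iint g a b <= iint h a b.
Proof.
move=> lg lh gh; apply: le_Rintegral => //.
Qed.

Lemma iint_ge0 g a b : (forall t, a <= t <= b -> 0 <= g t) -> 0 <= iint g a b.
Proof. by move=> g0; apply: Rintegral_ge0 => t /=; rewrite in_itv/=; exact: g0. Qed.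

Lemma le_norm_iint g a b : locint g -> `|iint g a b| <= iint (fun t => `|g t|) a b.
Proof. by move=> lg; apply: le_normr_Rintegral => //; exact: lg. Qed.

Lemma iint_split g a b c : locint g -> a <= b -> b <= c ->
  iint g a c = iint g a b + iint g b c.
Proof.
move=> lg ab bc; rewrite /iint -(@Rintegral_itv_obnd_cbnd _ b (BRight c) g); last first.
  by apply: integrableS (lg b c) => //; apply: subset_itvr; rewrite bnd_simp.
rewrite -(@Rintegral_itvB _ g (BLeft a) (BRight c) b) ?bnd_simp//.
by rewrite addrC subrK.
Qed.

Lemma iint_sub g a b c d : locint g -> (forall t, 0 <= g t) ->
  c <= a -> a <= b -> b <= d -> iint g a b <= iint g c d.
Proof.
move=> lg g0 ca ab bd.
rewrite (@iint_split g c a d)//; last exact: le_trans bd.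
rewrite (@iint_split g a b d)//.
have h1 : 0 <= iint g c a by apply: iint_ge0.
have h2 : 0 <= iint g b d by apply: iint_ge0.
lra.
Qed.

Lemma iint_co g a b : locint g ->
  \int[lam]_(t in `[a, b[) g t = iint g a b.
Proof.
move=> lg; apply: Rintegral_itv_bndo_bndc.
by apply: integrableS (lg a b) => //; apply: subset_itvl; rewrite bnd_simp.
Qed.

(** Dyadic blocks are half-open, and what holds on a block may fail at its right end point. The
    [_co] variants ignore this point. *)
Lemma eq_iint_co g h a b : locint g -> locint h ->
  (forall t, a <= t < b -> g t = h t) -> iint g a b = iint h a b.
Proof.
move=> lg lh gh; rewrite -!iint_co//.
by apply: eq_Rintegral => t /set_mem/=; rewrite in_itv/=; exact: gh.
Qed.

Lemma le_iint_co g h a b : locint g -> locint h ->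
  (forall t, a <= t < b -> g t <= h t) -> iint g a b <= iint h a b.
Proof.
move=> lg lh gh; rewrite -!iint_co//; apply: le_Rintegral => //.
- by apply: integrableS (lg a b) => //; apply: subset_itvl; rewrite bnd_simp.
- by apply: integrableS (lh a b) => //; apply: subset_itvl; rewrite bnd_simp.
Qed.

Lemma iint_bound g a b (M : R) : locint g -> a <= b ->
  (forall t, a <= t <= b -> g t <= M) -> iint g a b <= M * (b - a).
Proof.
by move=> lg ab gM; rewrite -iint_cst//; apply: le_iint => //; exact: locint_cst.
Qed.

Lemma iint_EFin g a b : locint g ->
  (iint g a b)%:E = (\int[lam]_(t in `[a, b]) (g t)%:E)%E.
Proof. by move=> lg; rewrite /iint /Rintegral fineK//; apply: integrable_fin_num => //; exact: lg. Qed.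

Lemma locint_measurable g : locint g -> measurable_fun setT g.
Proof.
move=> lg; have -> : [set: R] = \bigcup_n `[- n%:R, n%:R]%classic.
  apply/esym/seteqP; split=> // t _; exists (Num.truncn `|t|).+1 => //=.
  by rewrite in_itv/= -ler_norml; apply/ltW/truncnS_gt.
apply/measurable_fun_bigcup => // n.
by apply/measurable_EFinP; exact: (measurable_int lam (lg _ _)).
Qed.

Lemma integral_shiftT (c : R) (f : R -> \bar R) (a b : R) : measurable_fun setT f ->
  (\int[lam]_(t in `[(a - c)%R, (b - c)%R]) f (t + c)%R = \int[lam]_(t in `[a, b]) f t)%E.
Proof.
move=> mf; rewrite [LHS]integralE [RHS]integralE.
rewrite (_ : (fun t => f (t + c)%R)^\+ = (fun t => f^\+ (t + c)%R))%E; last first.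
  by apply/funext => t; rewrite !funeposE.
rewrite (_ : (fun t => f (t + c)%R)^\- = (fun t => f^\- (t + c)%R))%E; last first.
  by apply/funext => t; rewrite !funenegE.
congr (_ - _)%E; apply: ge0_integral_shift_itv => //; apply: measurable_funTS.
  exact: measurable_funepos.
exact: measurable_funeneg.
Qed.

Lemma iint_shift (c : R) g a b : measurable_fun setT g ->
  iint (fun t => g (t + c)) (a - c) (b - c) = iint g a b.
Proof.
move=> mg; rewrite /iint /Rintegral; congr fine.
by apply: (@integral_shiftT c (EFin \o g)); exact/measurable_EFinP.
Qed.

Lemma iint_period (T a : R) g : 0 < T -> locint g -> (forall t, g (t + T) = g t) ->
  iint g a (a + T) = iint g 0 T.
Proof.
move=> T0 lg gT; rewrite -!iint_co// /Rintegral; congr fine.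
apply: (@integral_period _ T a (EFin \o g)) => //.
  by apply/measurable_EFinP; exact: locint_measurable.
by move=> t; rewrite /= gT.
Qed.

Lemma iint_opp g a b : measurable_fun setT g ->
  iint (fun t => g (- t)) (- b) (- a) = iint g a b.
Proof.
move=> mg; rewrite /iint /Rintegral; congr fine.
pose m := measure_function_pushforward__canonical__measure_function_Measure lam
  (@oppr_measurable R setT : measurable_fun setT (-%R : measurableTypeR R -> measurableTypeR R)).
have H (h : R -> \bar R) : measurable_fun setT h -> (forall t, 0 <= h t)%E ->
   (\int[lam]_(t in `[(- b)%R, (- a)%R]) h (- t)%R = \int[lam]_(t in `[a, b]) h t)%E.
  move=> mh h0.
  have -> : `[(- b)%R, (- a)%R]%classic = (-%R : measurableTypeR R -> measurableTypeR R) @^-1` `[a, b]%classic.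
    by rewrite opp_preimage_itvbndbnd/=.
  rewrite -(@ge0_integral_pushforward _ _ (measurableTypeR R) (measurableTypeR R) R _
     (@oppr_measurable R setT) lam `[a, b]%classic h)//; last exact: measurable_funTS.
  apply: (eq_measure_integral lam (m1 := m)) => A mA _.
  exact: (@lebesgue_measureN R A mA).
rewrite [LHS]integralE [RHS]integralE.
rewrite (_ : (fun t => (g (- t))%:E)^\+ = (fun t => (EFin \o g)^\+ (- t)%R))%E; last first.
  by apply/funext => t; rewrite !funeposE.
rewrite (_ : (fun t => (g (- t))%:E)^\- = (fun t => (EFin \o g)^\- (- t)%R))%E; last first.
  by apply/funext => t; rewrite !funenegE.
have mg' : measurable_fun setT (EFin \o g) by exact/measurable_EFinP.
congr (_ - _)%E; apply: H => //; first exact: measurable_funepos.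
exact: measurable_funeneg.
Qed.

End interval_integral.

(** * Fubini for bounded functions on rectangles *)

Section iterated_integral.
Context {R : realType}.
Local Notation lam := (@lebesgue_measure R).
Implicit Types (G : R * R -> R) (a b c d M : R).

Local Notation slice G x := (fun t => G (x, t)).
Local Notation slice' G t := (fun x => G (x, t)).

Lemma bddmeas_slice G M x : measurable_fun setT G -> (forall z, `|G z| <= M) ->
  bddmeas (slice G x).
Proof.
move=> mG GM; split; last by exists M => t.
by apply: measurableT_comp => //; exact: measurable_fun_pair.
Qed.

Lemma bddmeas_slice' G M t : measurable_fun setT G -> (forall z, `|G z| <= M) ->
  bddmeas (slice' G t).
Proof.
move=> mG GM; split; last by exists M => x.
by apply: measurableT_comp => //; exact: measurable_fun_pair.
Qed.

Let box G a b c d (z : R * R) : \bar R :=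
  (G z * \1_(`[a, b]%classic) z.1 * \1_(`[c, d]%classic) z.2)%:E.

Let mbox G a b c d : measurable_fun setT G ->
  measurable_fun setT (box G a b c d).
Proof.
move=> mG; apply/measurable_EFinP; apply: measurable_funM.
  apply: measurable_funM => //.
  by apply: measurableT_comp => //; exact: measurable_fst.
by apply: measurableT_comp => //; exact: measurable_snd.
Qed.

Let box_int (g : R -> R) a b (k : R) :
  (\int[lam]_t (k * g t * \1_(`[a, b]%classic) t)%:E =
  \int[lam]_(t in `[a, b]) (k * g t)%:E)%E.
Proof.
rewrite [RHS]integral_mkcond; apply: eq_integral => t _.
by rewrite patchE indicE; case: ifPn => _; rewrite ?mulr1 ?mulr0.
Qed.

Lemma iint_swap0 G M a b c d : measurable_fun setT G ->
  (forall z, 0 <= G z <= M) ->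
  [/\ measurable_fun setT (fun x => iint (slice G x) c d),
      measurable_fun setT (fun t => iint (slice' G t) a b) &
      iint (fun x => iint (slice G x) c d) a b =
      iint (fun t => iint (slice' G t) a b) c d].
Proof.
move=> mG GM.
have GM' z : `|G z| <= M by have /andP[g0 gM] := GM z; rewrite ger0_norm.
have b0 z (a' b' c' d' : R) : (0 <= box G a' b' c' d' z)%E.
  rewrite /box lee_fin; have /andP[g0 _] := GM z.
  by rewrite !mulr_ge0.
have mF c' d' : measurable_fun setT (fun x => iint (slice G x) c' d').
  apply/measurable_EFinP.
  pose f (z : R * R) := (G z * \1_(`[c', d']%classic) z.2)%:E.
  have mf : measurable_fun setT f.
    apply/measurable_EFinP; apply: measurable_funM => //.
    by apply: measurableT_comp => //; exact: measurable_snd.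
  have f0 z : (0 <= f z)%E.
    by rewrite /f lee_fin; have /andP[g0 _] := GM z; rewrite mulr_ge0.
  have := @measurable_fun_fubini_tonelli_F _ _ (measurableTypeR R) (measurableTypeR R) R lam f mf f0.
  congr measurable_fun; apply/funext => x /=.
  rewrite (iint_EFin _ _ (bddmeas_locint (bddmeas_slice x mG GM'))).
  rewrite [RHS]integral_mkcond; apply: eq_integral => t _.
  by rewrite /f/= patchE indicE; case: ifPn => _; rewrite ?mulr1 ?mulr0.
have mF' a' b' : measurable_fun setT (fun t => iint (slice' G t) a' b').
  apply/measurable_EFinP.
  pose f (z : R * R) := (G z * \1_(`[a', b']%classic) z.1)%:E.
  have mf : measurable_fun setT f.
    apply/measurable_EFinP; apply: measurable_funM => //.
    by apply: measurableT_comp => //; exact: measurable_fst.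
  have f0 z : (0 <= f z)%E.
    by rewrite /f lee_fin; have /andP[g0 _] := GM z; rewrite mulr_ge0.
  have := @measurable_fun_fubini_tonelli_G _ _ (measurableTypeR R) (measurableTypeR R) R lam f mf f0.
  congr measurable_fun; apply/funext => x /=.
  rewrite (iint_EFin _ _ (bddmeas_locint (bddmeas_slice' x mG GM'))).
  rewrite [RHS]integral_mkcond; apply: eq_integral => t _.
  by rewrite /f/= patchE indicE; case: ifPn => _; rewrite ?mulr1 ?mulr0.
split; [exact: mF|exact: mF'|].
have := @fubini_tonelli _ _ (measurableTypeR R) (measurableTypeR R) R lam lam
  (box G a b c d) (mbox a b c d mG) (b0 ^~ a ^~ b ^~ c ^~ d).
have bF : bddmeas (fun x => iint (slice G x) c d).
  split=> //; exists (M * `|d - c|) => x.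
  have l := bddmeas_locint (bddmeas_slice x mG GM').
  rewrite ger0_norm; last by apply: iint_ge0 => t _; have /andP[] := GM (x, t).
  have [cd|dc] := leP c d.
    rewrite ger0_norm ?subr_ge0//; apply: iint_bound => // t _; by have /andP[] := GM (x, t).
  rewrite /iint set_itv_ge ?Rintegral_set0 ?bnd_simp -?ltNge//.
  by rewrite mulr_ge0//; have /andP[h1 h2] := GM (0, 0); exact: le_trans h2.
have bF' : bddmeas (fun t => iint (slice' G t) a b).
  split=> //; exists (M * `|b - a|) => x.
  have l := bddmeas_locint (bddmeas_slice' x mG GM').
  rewrite ger0_norm; last by apply: iint_ge0 => t _; have /andP[] := GM (t, x).
  have [cd|dc] := leP a b.
    rewrite ger0_norm ?subr_ge0//; apply: iint_bound => // t _; by have /andP[] := GM (t, x).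
  rewrite /iint set_itv_ge ?Rintegral_set0 ?bnd_simp -?ltNge//.
  by rewrite mulr_ge0//; have /andP[h1 h2] := GM (0, 0); exact: le_trans h2.
have -> : (\int[lam]_x \int[lam]_y box G a b c d (x, y) =
   (iint (fun x => iint (slice G x) c d) a b)%:E)%E.
  rewrite (iint_EFin _ _ (bddmeas_locint bF)) [RHS]integral_mkcond; apply: eq_integral => x _.
  rewrite /box/= -[LHS]/(\int[lam]_t (G (x, t) * \1_(`[a, b]%classic) x * \1_(`[c, d]%classic) t)%:E)%E.
  under eq_integral do rewrite (mulrC (G _)).
  rewrite (box_int (slice G x)) patchE indicE; case: ifPn => _ /=.
    by under eq_integral do rewrite mul1r; rewrite -iint_EFin//; exact: (bddmeas_locint (bddmeas_slice x mG GM')).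
  by under eq_integral do rewrite mul0r; rewrite integral0.
have -> : (\int[lam]_y \int[lam]_x box G a b c d (x, y) =
   (iint (fun t => iint (slice' G t) a b) c d)%:E)%E.
  rewrite (iint_EFin _ _ (bddmeas_locint bF')) [RHS]integral_mkcond; apply: eq_integral => t _.
  rewrite /box/=.
  under eq_integral do rewrite mulrAC (mulrC (G _)).
  rewrite (box_int (slice' G t)) patchE indicE; case: ifPn => _ /=.
    by under eq_integral do rewrite mul1r; rewrite -iint_EFin//; exact: (bddmeas_locint (bddmeas_slice' t mG GM')).
  by under eq_integral do rewrite mul0r; rewrite integral0.
by move=> [].
Qed.

Lemma iint_swap G M a b c d : measurable_fun setT G ->
  (forall z, `|G z| <= M) -> a <= b -> c <= d ->
  measurable_fun setT (fun x => iint (slice G x) c d) /\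
  iint (fun x => iint (slice G x) c d) a b =
  iint (fun t => iint (slice' G t) a b) c d.
Proof.
move=> mG GM ab cd.
(* Adding [M] makes the function nonnegative, so that Tonelli applies; the two constants that arise
   agree and cancel. *)
pose H z := G z + M.
have mH : measurable_fun setT H by exact: measurable_funD.
have HM z : 0 <= H z <= M + M.
  by have := GM z; rewrite ler_norml /H => /andP[h1 h2]; apply/andP; split; lra.
have HM' z : `|H z| <= M + M by have /andP[h1 h2] := HM z; rewrite ger0_norm.
have [mF mF' e] := iint_swap0 a b c d mH HM.
have lG x := bddmeas_locint (bddmeas_slice x mG GM).
have lG' x := bddmeas_locint (bddmeas_slice' x mG GM).
have e1 x : iint (slice H x) c d = iint (slice G x) c d + M * (d - c).
  by rewrite (iintD _ _ (lG x) (locint_cst _)) iint_cst.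
have e2 x : iint (slice' H x) a b = iint (slice' G x) a b + M * (b - a).
  by rewrite (iintD _ _ (lG' x) (locint_cst _)) iint_cst.
have mG1 : measurable_fun setT (fun x => iint (slice G x) c d).
  rewrite (_ : (fun x => _) = (fun x => iint (slice H x) c d - M * (d - c))).
    by apply: measurable_funB.
  by apply/funext => x; rewrite e1 addrK.
have mG2 : measurable_fun setT (fun x => iint (slice' G x) a b).
  rewrite (_ : (fun x => _) = (fun x => iint (slice' H x) a b - M * (b - a))).
    by apply: measurable_funB.
  by apply/funext => x; rewrite e2 addrK.
split; first exact: mG1.
have b1 : bddmeas (fun x => iint (slice G x) c d).
  split; [exact: mG1|]; exists (M * (d - c)) => x; apply: le_trans (le_norm_iint _ _ (lG x)) _.
  by apply: iint_bound => //; exact: locint_norm.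
have b2 : bddmeas (fun x => iint (slice' G x) a b).
  split; [exact: mG2|]; exists (M * (b - a)) => x; apply: le_trans (le_norm_iint _ _ (lG' x)) _.
  by apply: iint_bound => //; exact: locint_norm.
move: e; rewrite (eq_iint (h := fun x => iint (slice G x) c d + M * (d - c))); last by move=> x _; rewrite e1.
rewrite (eq_iint (g := fun t => iint (slice' H t) a b) (h := fun x => iint (slice' G x) a b + M * (b - a))); last by move=> x _; rewrite e2.
rewrite !iintD; try (exact: bddmeas_locint || exact: (locint_cst _)).
rewrite (iint_cst _ ab) (iint_cst _ cd) => e.
have : M * (d - c) * (b - a) = M * (b - a) * (d - c) by ring.
by move=> e3; move: e; rewrite e3 => /addIr.
Qed.

End iterated_integral.

(** * The Poisson kernel *)

Section ftc_iint.
Context {R : realType}.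
Local Notation lam := (@lebesgue_measure R).

Lemma integral_FTC (F f : R -> R) (a b : R) : a <= b ->
  (forall x, a <= x <= b -> is_derive x 1 F (f x)) ->
  (forall x, a <= x <= b -> {for x, continuous f}) ->
  (\int[lam]_(x in `[a, b]) (f x)%:E = (F b - F a)%:E)%E.
Proof.
rewrite le_eqVlt => /predU1P[<- _ _|ab dF cf].
  by rewrite subrr set_itv1 integral_set1.
have cF x : a <= x <= b -> {for x, continuous F}.
  move=> xab; have [dx _] := dF x xab.
  by apply: differentiable_continuous; apply/derivable1_diffP.
rewrite (@continuous_FTC2 _ f F)//.
- apply: continuous_in_subspaceT => x /set_mem/=; rewrite in_itv/=; exact: cf.
- split.
  + move=> x; rewrite in_itv/= => /andP[ax xb].
    by have [] := dF x; rewrite ?(ltW ax) ?(ltW xb).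
  + apply: cvg_at_right_filter; apply: cF; by rewrite lexx ltW.
  + apply: cvg_at_left_filter; apply: cF; by rewrite lexx ltW.
- move=> x; rewrite in_itv/= => /andP[ax xb].
  have h : a <= x <= b by rewrite !ltW.
  by rewrite derive1E; have := dF x h; move=> [_ ->].
Qed.

Lemma iint_FTC (F f : R -> R) (a b : R) : a <= b ->
  (forall x, a <= x <= b -> is_derive x 1 F (f x)) ->
  (forall x, a <= x <= b -> {for x, continuous f}) ->
  iint f a b = F b - F a.
Proof. by move=> ab dF cf; rewrite /iint /Rintegral (integral_FTC ab dF cf). Qed.

Lemma continuous_bddmeas_periodic (f : R -> R) (T : R) : 0 < T -> continuous f ->
  (forall t, f (t + T) = f t) -> bddmeas f.
Proof.
move=> T0 cf fT; split; first exact: continuous_measurable_fun.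
have := @compact_bounded _ _ (f @` `[0, T]%classic).
have cI : compact (f @` `[0, T]%classic).
  apply: continuous_compact; last exact: segment_compact.
  exact: continuous_subspaceT.
move=> /(_ cI) [M [Mr HM]].
exists (M + 1) => t.
pose z := Num.floor (t / T).
have fTn (n : nat) u : f (u + T *+ n) = f u.
  by elim: n => [|n IH]; rewrite ?addr0// mulrS addrCA addrC fT.
have fTz u : f (u + T *~ z) = f u.
  case: z => n; first exact: fTn.
  by rewrite NegzE mulrNz -(fTn n.+1 (u - T *+ n.+1)) subrK.
have /andP[z1 z2] := floor_itv (t / T).
rewrite -(subrK (T *~ z) t) fTz.
have /HM : M < M + 1 by rewrite ltrDl.
apply; exists (t - T *~ z) => //=; rewrite in_itv/=.
move: z1 z2; rewrite -/z ler_pdivlMr// ltr_pdivrMr// intrD (mulrDl z%:~R) mul1r.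
by rewrite -(mulrzl T z) => h1 h2; apply/andP; split; lra.
Qed.

End ftc_iint.

Section poisson_kernel.
Context {R : realType}.
Implicit Types (r s t x : R).

Definition pker r s := (1 - r ^+ 2) / (1 - 2 * r * cos s + r ^+ 2).

Lemma pker_den_ge r s : 0 <= r -> (1 - r) ^+ 2 <= 1 - 2 * r * cos s + r ^+ 2.
Proof.
move=> r0; have c1 := cos_le1 s.
have : 0 <= r * (1 - cos s) by rewrite mulr_ge0// subr_ge0.
by rewrite sqrrB expr1n; lra.
Qed.

Lemma pker_den_gt0 r s : 0 <= r < 1 -> 0 < 1 - 2 * r * cos s + r ^+ 2.
Proof.
move=> /andP[r0 r1]; apply: lt_le_trans (pker_den_ge s r0).
by rewrite exprn_gt0// subr_gt0.
Qed.

Lemma pker_ge0 r s : 0 <= r < 1 -> 0 <= pker r s.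
Proof.
move=> rr; rewrite /pker divr_ge0//; last exact: ltW (pker_den_gt0 _ rr).
by move/andP: rr => [r0 r1]; rewrite subr_ge0 expr_le1 // ltW.
Qed.

Lemma pker_le r s : 0 <= r < 1 -> pker r s <= 2 / (1 - r).
Proof.
move=> rr; have d0 := pker_den_gt0 s rr; move/andP: rr => [r0 r1].
have r10 : 0 < 1 - r by rewrite subr_gt0.
rewrite /pker ler_pdivrMr// mulrAC ler_pdivlMr//.
have := pker_den_ge s r0.
have : (1 - r ^+ 2) * (1 - r) = (1 + r) * (1 - r) ^+ 2 by ring.
move=> ->; have : 0 <= (1 - r) ^+ 2 by rewrite exprn_ge0// ltW.
nra.
Qed.

Lemma pkerN r s : pker r (- s) = pker r s.
Proof. by rewrite /pker cosN. Qed.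

Lemma pkerD2pi r s : pker r (s + 2 * pi) = pker r s.
Proof. by rewrite /pker (mulr_natl pi 2) cosD2pi. Qed.

Lemma continuous_pker r : 0 <= r < 1 -> continuous (pker r).
Proof.
move=> rr s; rewrite /pker; apply: cvgM; first exact: cvg_cst.
apply: cvgV; first by rewrite gt_eqF// pker_den_gt0.
apply: cvgD; last exact: cvg_cst.
apply: cvgB; first exact: cvg_cst.
by apply: cvgM; [exact: cvg_cst|exact: continuous_cos].
Qed.

(** Partial sum of the Fourier series of the Poisson kernel. Its remainder is explicit by [psumE],
    which replaces any discussion of the series itself. *)
Definition psum (N : nat) r s := 1 + 2 * \sum_(j < N) r ^+ j.+1 * cos (j.+1%:R * s).

Lemma psumE N r s : (1 - 2 * r * cos s + r ^+ 2) * psum N r s =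
  1 - r ^+ 2 - 2 * r ^+ N.+1 * cos (N.+1%:R * s) + 2 * r ^+ N.+2 * cos (N%:R * s).
Proof.
elim: N => [|N IH].
  rewrite /psum big_ord0 mul0r cos0 mul1r; ring.
have -> : psum N.+1 r s = psum N r s + 2 * (r ^+ N.+1 * cos (N.+1%:R * s)).
  by rewrite /psum big_ord_recr/= mulrDr addrA.
rewrite mulrDr IH.
have -> : cos (N.+2%:R * s) = 2 * cos s * cos (N.+1%:R * s) - cos (N%:R * s).
  have e1 : N.+2%:R * s = N.+1%:R * s + s by rewrite -[N.+2%:R]natr1 mulrDl mul1r.
  have e2 : N%:R * s = N.+1%:R * s - s by rewrite -[N.+1%:R]natr1 mulrDl mul1r addrK.
  by rewrite e1 e2 cosD cosB; ring.
by rewrite !exprS; ring.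
Qed.

Lemma psum_pker N r s : 0 <= r < 1 ->
  `|pker r s - psum N r s| <= 4 * r ^+ N.+1 / (1 - r) ^+ 2.
Proof.
move=> rr; have d0 := pker_den_gt0 s rr.
have dge := @pker_den_ge r s; move/andP: rr => [r0 r1].
have {}dge := dge r0.
set d := 1 - 2 * r * cos s + r ^+ 2 in d0 dge.
have -> : pker r s - psum N r s =
  (2 * r ^+ N.+1 * cos (N.+1%:R * s) - 2 * r ^+ N.+2 * cos (N%:R * s)) / d.
  apply: (mulfI (lt0r_neq0 d0)).
  rewrite mulrBr psumE /pker -/d !(mulrC d) !divfK ?gt_eqF//; ring.
rewrite normrM normfV (gtr0_norm d0).
apply: (@le_trans _ _ (4 * r ^+ N.+1 / d)).
  rewrite ler_pM2r ?invr_gt0//; apply: le_trans (ler_normB _ _) _.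
  have p0 : 0 <= r ^+ N.+1 by rewrite exprn_ge0.
  have p1 : 0 <= r ^+ N.+2 <= r ^+ N.+1.
    by rewrite exprn_ge0//= exprS ler_piMl// ltW.
  move: p0 p1; move: (r ^+ N.+1) (r ^+ N.+2) => A B p0 p1.
  have B0 : 0 <= B by case/andP: p1.
  rewrite !normrM (ger0_norm p0) (ger0_norm B0) normr_nat.
  have c1 := cos_max (N.+1%:R * s); have c2 := cos_max (N%:R * s).
  move/andP: p1 => [p1 p2].
  have : A * `|cos (N.+1%:R * s)| <= A by rewrite ler_piMr.
  have : B * `|cos (N%:R * s)| <= B by rewrite ler_piMr.
  lra.
apply: ler_wpM2l; first by rewrite mulr_ge0// exprn_ge0.
by rewrite lef_pV2 ?posrE// exprn_gt0 ?subr_gt0.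
Qed.


Lemma continuous_cos_affine (m c : R) : continuous (fun x : R => cos (m * x + c)).
Proof.
move=> x; apply: (@continuous_comp _ _ _ (fun x => m * x + c) cos); last exact: continuous_cos.
by apply: cvgD; [apply: cvgM; [exact: cvg_cst|exact: cvg_id]|exact: cvg_cst].
Qed.

Lemma iint_cos_affine (m c : R) : m != 0 -> sin (m * (2 * pi) + c) = sin c ->
  iint (fun x => cos (m * x + c)) 0 (2 * pi) = 0.
Proof.
move=> m0 sc.
have p0 : 0 <= 2 * pi :> R by rewrite mulr_ge0// pi_ge0.
have dF (x : R) : is_derive x 1 (fun x => m^-1 * sin (m * x + c)) (cos (m * x + c)).
  by apply: is_derive_eq; rewrite /GRing.scale/=; field.
rewrite (iint_FTC p0 (fun x _ => dF x) (fun x _ => @continuous_cos_affine m c x)).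
by rewrite sc mulr0 add0r subrr.
Qed.

Let sin_per (n : nat) (c : R) : sin (n%:R * (2 * pi) + c) = sin c.
Proof.
have -> : n%:R * (2 * pi) + c = c + (pi *+ 2) *+ n.
  by rewrite addrC -[in RHS]mulr_natl -(mulr_natl pi).
by rewrite (periodicn (@sinD2pi R)).
Qed.

Let sin_perN (n : nat) (c : R) : sin (- n%:R * (2 * pi) + c) = sin c.
Proof. by rewrite -(sin_per n (- n%:R * (2 * pi) + c)) addrA -mulrDl subrr mul0r add0r. Qed.

Lemma cos_bddmeas (m c : R) : bddmeas (fun x : R => cos (m * x + c)).
Proof.
split; last by exists 1 => t; exact: cos_max.
by apply: continuous_measurable_fun; exact: continuous_cos_affine.
Qed.

Lemma iint_cos_cos (j k : nat) (u v : R) : (0 < j)%N -> (0 < k)%N ->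
  iint (fun x => cos (j%:R * (x - u)) * cos (k%:R * (v - x))) 0 (2 * pi) =
  if j == k then pi * cos (j%:R * (v - u)) else 0.
Proof.
move=> j0 k0.
have p0 : 0 <= 2 * pi :> R by rewrite mulr_ge0// pi_ge0.
have l m c := bddmeas_locint (cos_bddmeas m c).
rewrite (@eq_iint _ _ (fun x => 2^-1 * (cos ((j%:R - k%:R) * x + (k%:R * v - j%:R * u))
   + cos ((j%:R + k%:R) * x + (- j%:R * u - k%:R * v))))); last first.
  move=> x _.
  have -> : (j%:R - k%:R) * x + (k%:R * v - j%:R * u) = j%:R * (x - u) + k%:R * (v - x) by ring.
  have -> : (j%:R + k%:R) * x + (- j%:R * u - k%:R * v) = j%:R * (x - u) - k%:R * (v - x) by ring.
  by rewrite cosD cosB; field.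
rewrite iintZ; last exact: locintD.
rewrite iintD// [X in _ + X]iint_cos_affine; last 2 first.
- by rewrite -natrD pnatr_eq0 addn_eq0 negb_and -!lt0n j0.
- by rewrite -natrD sin_per.
rewrite addr0; case: eqVneq => [->|jk].
  under eq_fun do rewrite subrr mul0r add0r.
  by rewrite iint_cst// subr0 mulrBr; field.
rewrite iint_cos_affine ?mulr0//.
  by rewrite subr_eq0 eqr_nat.
have [kj|jk'] := leqP k j.
  by rewrite -natrB// sin_per.
by rewrite -opprB -natrB ?(ltnW jk')// sin_perN.
Qed.

Lemma iint_cos_shift (k : nat) (v : R) : (0 < k)%N ->
  iint (fun x => cos (k%:R * (v - x))) 0 (2 * pi) = 0.
Proof.
move=> k0; rewrite (@eq_iint _ _ (fun x => cos (- k%:R * x + k%:R * v))).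
  rewrite iint_cos_affine ?sin_perN//; by rewrite oppr_eq0 pnatr_eq0 -lt0n.
by move=> x _; congr cos; ring.
Qed.

Lemma iint_cos_shift' (k : nat) (v : R) : (0 < k)%N ->
  iint (fun x => cos (k%:R * (x - v))) 0 (2 * pi) = 0.
Proof.
move=> k0; apply: etrans (iint_cos_shift v k0); apply: eq_iint => x _.
by rewrite -cosN; congr cos; ring.
Qed.

Let lcos (k : nat) (v : R) : locint (fun x => cos (k%:R * (v - x))).
Proof.
rewrite (_ : (fun x => _) = (fun x => cos (- k%:R * x + k%:R * v))).
  by apply: bddmeas_locint; exact: cos_bddmeas.
by apply/funext => x; congr cos; ring.
Qed.

Let lcos' (k : nat) (v : R) : locint (fun x => cos (k%:R * (x - v))).
Proof.
rewrite (_ : (fun x => _) = (fun x => cos (k%:R * (v - x)))); first exact: lcos.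
by apply/funext => x; rewrite -cosN; congr cos; ring.
Qed.

Let lcoscos (j k : nat) (u v : R) :
  locint (fun x => cos (j%:R * (x - u)) * cos (k%:R * (v - x))).
Proof.
apply: bddmeas_locint; split.
  by apply: measurable_funM; apply: locint_measurable; [exact: lcos'|exact: lcos].
by exists 1 => t; rewrite normrM mulr_ile1// cos_max.
Qed.

Lemma iint_psum (N : nat) r v : iint (fun x => psum N r (v - x)) 0 (2 * pi) = 2 * pi.
Proof.
have p0 : 0 <= 2 * pi :> R by rewrite mulr_ge0// pi_ge0.
have ls : locint (fun x => \sum_(j < N) r ^+ j.+1 * cos (j.+1%:R * (v - x))).
  by apply: locint_sum => j _; apply: locintZ; exact: lcos.
rewrite /psum iintD; [|exact: locint_cst|exact: locintZ].
rewrite iint_cst// iintZ// iint_sum; last by move=> j _; apply: locintZ; exact: lcos.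
rewrite big1 ?mulr0 ?addr0 ?mul1r ?subr0// => j _.
by rewrite iintZ ?iint_cos_shift ?mulr0.
Qed.

Lemma iint_psum_psum (N : nat) r s u v :
  iint (fun x => psum N r (x - u) * psum N s (v - x)) 0 (2 * pi) =
  2 * pi * psum N (r * s) (v - u).
Proof.
have p0 : 0 <= 2 * pi :> R by rewrite mulr_ge0// pi_ge0.
pose A x := \sum_(j < N) r ^+ j.+1 * cos (j.+1%:R * (x - u)).
pose B x := \sum_(j < N) s ^+ j.+1 * cos (j.+1%:R * (v - x)).
pose C x := \sum_(j < N) \sum_(k < N) (r ^+ j.+1 * s ^+ k.+1) *
   (cos (j.+1%:R * (x - u)) * cos (k.+1%:R * (v - x))).
have lA : locint A by apply: locint_sum => j _; apply: locintZ; exact: lcos'.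
have lB : locint B by apply: locint_sum => j _; apply: locintZ; exact: lcos.
have lC : locint C.
  apply: locint_sum => j _; apply: locint_sum => k _; apply: locintZ; exact: lcoscos.
rewrite (@eq_iint _ _ (fun x => (1 + 2 * A x) + (2 * B x + 4 * C x))); last first.
  move=> x _; rewrite /psum -/(A x) -/(B x).
  have -> : C x = A x * B x.
    rewrite /A /B big_distrl/=; apply: eq_bigr => j _; rewrite big_distrr/=.
    by apply: eq_bigr => k _; ring.
  by ring.
rewrite iintD; last 2 first.
- by apply: locintD; [exact: locint_cst|exact: locintZ].
- by apply: locintD; exact: locintZ.
rewrite iintD; [|exact: locint_cst|exact: locintZ].
rewrite iintD; [|exact: locintZ|exact: locintZ].
rewrite iint_cst// !iintZ//.
have -> : iint A 0 (2 * pi) = 0.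
  rewrite iint_sum; last by move=> j _; apply: locintZ; exact: lcos'.
  by rewrite big1// => j _; rewrite iintZ ?iint_cos_shift' ?mulr0//; exact: lcos'.
have -> : iint B 0 (2 * pi) = 0.
  rewrite iint_sum; last by move=> j _; apply: locintZ; exact: lcos.
  by rewrite big1// => j _; rewrite iintZ ?iint_cos_shift ?mulr0//; exact: lcos.
have -> : iint C 0 (2 * pi) = pi * \sum_(j < N) (r * s) ^+ j.+1 * cos (j.+1%:R * (v - u)).
  rewrite iint_sum; last first.
    by move=> j _; apply: locint_sum => k _; apply: locintZ; exact: lcoscos.
  rewrite big_distrr/=; apply: eq_bigr => j _.
  rewrite iint_sum; last by move=> k _; apply: locintZ; exact: lcoscos.
  rewrite (bigD1 j)//= big1 => [|k kj].
    by rewrite iintZ// iint_cos_cos// eqxx addr0 exprMn; ring.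
  rewrite iintZ// iint_cos_cos// eqSS ifN ?mulr0//.
  by rewrite eq_sym.
by rewrite /psum; ring.
Qed.

Lemma locint_pker r u : 0 <= r < 1 -> locint (fun x => pker r (x - u)).
Proof.
move=> rr; apply: bddmeas_locint; split.
  apply: continuous_measurable_fun => x.
  apply: (@continuous_comp _ _ _ (fun x => x - u)); last exact: continuous_pker.
  by apply: cvgB; [exact: cvg_id|exact: cvg_cst].
by exists (2 / (1 - r)) => t; rewrite ger0_norm ?pker_ge0// pker_le.
Qed.

Lemma locint_pker' r u : 0 <= r < 1 -> locint (fun x => pker r (u - x)).
Proof.
move=> rr; rewrite (_ : (fun x => _) = (fun x => pker r (x - u))).
  exact: locint_pker.
by apply/funext => x; rewrite -pkerN opprB.
Qed.

Let cvg_err r : 0 <= r < 1 -> forall e, 0 < e -> exists N, 4 * r ^+ N.+1 / (1 - r) ^+ 2 < e.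
Proof.
move=> /andP[r0 r1] e e0.
have : (fun n => r ^+ n) @ \oo --> (0 : R) by apply: cvg_expr; rewrite ger0_norm.
have k0 : 0 < e * (1 - r) ^+ 2 / 4 by rewrite divr_gt0// mulr_gt0// exprn_gt0// subr_gt0.
move/cvgrPdist_lt => /(_ _ k0)[N _ HN]; exists N.
have := HN N.+1 (leqnSn N); rewrite sub0r normrN ger0_norm ?exprn_ge0// => h.
rewrite ltr_pdivrMr ?exprn_gt0 ?subr_gt0//.
by move: h; rewrite ltr_pdivlMr// mulrC.
Qed.

Lemma iint_pker r v : 0 <= r < 1 -> iint (fun x => pker r (v - x)) 0 (2 * pi) = 2 * pi.
Proof.
move=> rr; apply/eqP; rewrite -subr_eq0 -normr_le0; apply/ler_addgt0Pl => e e0.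
have p0 : 0 < 2 * pi :> R by rewrite mulr_gt0// pi_gt0.
have [N HN] := cvg_err rr (divr_gt0 e0 p0).
have lp : locint (fun x => psum N r (v - x)).
  apply: locintD; [exact: locint_cst|apply: locintZ; apply: locint_sum => j _].
  by apply: locintZ; exact: lcos.
have lk := locint_pker' v rr.
have -> : iint (fun x => pker r (v - x)) 0 (2 * pi) - 2 * pi =
    iint (fun x => pker r (v - x) - psum N r (v - x)) 0 (2 * pi).
  by rewrite iintB// iint_psum.
apply: le_trans (le_norm_iint _ _ (locintB lk lp)) _.
rewrite addr0.
apply: (@le_trans _ _ (e / (2 * pi) * (2 * pi - 0))); last by rewrite subr0 divfK ?gt_eqF.
apply: iint_bound; [exact: locint_norm (locintB lk lp)|exact: ltW|move=> t _].
exact: le_trans (psum_pker N _ rr) (ltW HN).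
Qed.

(** For the partial sums of the Fourier series this is the orthogonality of the cosines, and the
    remainders are uniformly small. *)
Lemma pker_semigroup r s u v : 0 <= r < 1 -> 0 <= s < 1 ->
  iint (fun x => pker r (x - u) * pker s (v - x)) 0 (2 * pi) =
  2 * pi * pker (r * s) (v - u).
Proof.
move=> rr ss.
have p0 : 0 < 2 * pi :> R by rewrite mulr_gt0// pi_gt0.
have rs : 0 <= r * s < 1.
  move: rr ss => /andP[r0 r1] /andP[s0 s1]; rewrite mulr_ge0//=.
  by rewrite (le_lt_trans _ s1)// ler_piMl// ltW.
have bpr : bddmeas (fun x => pker r (x - u)).
  split; first exact: locint_measurable (locint_pker u rr).
  by exists (2 / (1 - r)) => t; rewrite ger0_norm ?pker_ge0// pker_le.
have bps : bddmeas (fun x => pker s (v - x)).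
  split; first exact: locint_measurable (locint_pker' v ss).
  by exists (2 / (1 - s)) => t; rewrite ger0_norm ?pker_ge0// pker_le.
pose Kr := 2 / (1 - r); pose Ks := 2 / (1 - s).
have Kr0 : 0 < Kr by rewrite divr_gt0// subr_gt0; case/andP: rr.
have Ks0 : 0 < Ks by rewrite divr_gt0// subr_gt0; case/andP: ss.
apply/eqP; rewrite -subr_eq0 -normr_le0; apply/ler_addgt0Pl => e e0; rewrite addr0.
(* [Kr] and [Ks] bound the two kernels. If every remainder is at most [e1 <= 1], the products differ
   by at most [(Kr + Ks + 1) * e1], and the kernel on the right adds one more [e1]. *)
pose e1 := Num.min 1 (e / (2 * pi * (Kr + Ks + 2))).
have S0 : 0 < 2 * pi * (Kr + Ks + 2) by rewrite mulr_gt0// !addr_gt0.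
have e10 : 0 < e1 by rewrite lt_min ltr01/= divr_gt0.
have [N1 H1] := cvg_err rr e10.
have [N2 H2] := cvg_err ss e10.
have [N3 H3] := cvg_err rs e10.
have mono (q : R) (N M : nat) : 0 <= q < 1 -> (N <= M)%N ->
   4 * q ^+ M.+1 / (1 - q) ^+ 2 <= 4 * q ^+ N.+1 / (1 - q) ^+ 2.
  move=> /andP[q0 q1] NM; rewrite ler_pM2r ?invr_gt0 ?exprn_gt0 ?subr_gt0//.
  by rewrite ler_pM2l// ler_wiXn2l// ltW.
pose N := maxn N1 (maxn N2 N3).
have h1 t : `|pker r t - psum N r t| <= e1.
  apply: le_trans (psum_pker N _ rr) _; apply: le_trans (ltW H1).
  by apply: mono => //; rewrite leq_maxl.
have h2 t : `|pker s t - psum N s t| <= e1.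
  apply: le_trans (psum_pker N _ ss) _; apply: le_trans (ltW H2).
  by apply: mono => //; rewrite /N maxnCA leq_maxl.
have h3 t : `|pker (r * s) t - psum N (r * s) t| <= e1.
  apply: le_trans (psum_pker N _ rs) _; apply: le_trans (ltW H3).
  by apply: mono => //; rewrite /N maxnA leq_maxr.
have lpr : locint (fun x => psum N r (x - u)).
  apply: locintD; [exact: locint_cst|apply: locintZ; apply: locint_sum => j _].
  by apply: locintZ; exact: lcos'.
have lps : locint (fun x => psum N s (v - x)).
  apply: locintD; [exact: locint_cst|apply: locintZ; apply: locint_sum => j _].
  by apply: locintZ; exact: lcos.
have be t : `|psum N r t| <= Kr + 1.
  have : `|psum N r t| <= `|pker r t| + `|pker r t - psum N r t|.
    by rewrite -[X in `|X| <= _](subKr (pker r t)) ler_normB.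
  have := h1 t; have : `|pker r t| <= Kr by rewrite ger0_norm ?pker_ge0// pker_le.
  have : e1 <= 1 by rewrite ge_min lexx.
  lra.
have be' t : `|psum N s t| <= Ks + 1.
  have : `|psum N s t| <= `|pker s t| + `|pker s t - psum N s t|.
    by rewrite -[X in `|X| <= _](subKr (pker s t)) ler_normB.
  have := h2 t; have : `|pker s t| <= Ks by rewrite ger0_norm ?pker_ge0// pker_le.
  have : e1 <= 1 by rewrite ge_min lexx.
  lra.
have lpp : locint (fun x => psum N r (x - u) * psum N s (v - x)).
  apply: bddmeas_locint; split.
    by apply: measurable_funM; exact: locint_measurable.
  by exists ((Kr + 1) * (Ks + 1)) => t; rewrite normrM ler_pM.
have lkk : locint (fun x => pker r (x - u) * pker s (v - x)).
  apply: bddmeas_locint; split.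
    by apply: measurable_funM; [case: bpr|case: bps].
  exists (Kr * Ks) => t; rewrite normrM ler_pM//.
    by rewrite ger0_norm ?pker_ge0// pker_le.
  by rewrite ger0_norm ?pker_ge0// pker_le.
have -> : iint (fun x => pker r (x - u) * pker s (v - x)) 0 (2 * pi) -
  2 * pi * pker (r * s) (v - u) =
  iint (fun x => pker r (x - u) * pker s (v - x) - psum N r (x - u) * psum N s (v - x)) 0 (2 * pi)
  - 2 * pi * (pker (r * s) (v - u) - psum N (r * s) (v - u)).
  by rewrite iintB// iint_psum_psum; ring.
apply: le_trans (ler_normB _ _) _.
have b1 : `|iint (fun x => pker r (x - u) * pker s (v - x) -
    psum N r (x - u) * psum N s (v - x)) 0 (2 * pi)| <= (Kr + Ks + 1) * e1 * (2 * pi - 0).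
  apply: le_trans (le_norm_iint _ _ (locintB lkk lpp)) _.
  apply: iint_bound; [exact: locint_norm (locintB lkk lpp)|exact: ltW|move=> t _].
  have -> : pker r (t - u) * pker s (v - t) - psum N r (t - u) * psum N s (v - t) =
     pker r (t - u) * (pker s (v - t) - psum N s (v - t)) +
     (pker r (t - u) - psum N r (t - u)) * psum N s (v - t) by ring.
  apply: le_trans (ler_normD _ _) _.
  have q1 : `|pker r (t - u) * (pker s (v - t) - psum N s (v - t))| <= Kr * e1.
    by rewrite normrM; apply: ler_pM => //; rewrite ger0_norm ?pker_ge0// pker_le.
  have q2 : `|(pker r (t - u) - psum N r (t - u)) * psum N s (v - t)| <= e1 * (Ks + 1).
    by rewrite normrM; apply: ler_pM.
  lra.
have b2 : `|2 * pi * (pker (r * s) (v - u) - psum N (r * s) (v - u))| <= 2 * pi * e1.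
  by rewrite normrM (gtr0_norm p0) ler_pM2l.
have : e1 * (2 * pi * (Kr + Ks + 2)) <= e.
  by rewrite -ler_pdivlMr// ge_min lexx orbT.
lra.
Qed.

End poisson_kernel.

(** * Decay of combinations of Poisson kernels *)

Section kernel_bounds.
Context {R : realType}.
Implicit Types (r s t x y : R).

(** The derivative of [sin t - t cos t] is [t sin t >= 0], which gives [u cos u <= sin u] for
    [u = x / 2]. The double angle formula and [2 cos u ^ 2 >= 1] conclude. *)
Lemma sin_ge_half x : 0 <= x <= pi / 2 -> x / 2 <= sin x.
Proof.
move=> /andP[x0 x2].
pose u := x / 2.
have u0 : 0 <= u by rewrite divr_ge0.
have u4 : u <= pi / 4 by rewrite /u; lra.
have su : u * cos u <= sin u.
  have dF (t : R) : is_derive t 1 (fun t => sin t - t * cos t) (t * sin t).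
    by apply: is_derive_eq; rewrite /GRing.scale/=; ring.
  have cF (t : R) : {for t, continuous (fun t : R => t * sin t)}.
    by apply: cvgM; [exact: cvg_id|exact: continuous_sin].
  have := iint_FTC u0 (fun t _ => dF t) (fun t _ => cF t).
  rewrite sin0 mul0r subrr subr0 => e.
  rewrite -subr_ge0 -e; apply: iint_ge0 => t /andP[t0 tu].
  rewrite mulr_ge0//; apply: sin_ge0_pi; rewrite t0/=.
  have := @pi_ge0 R; lra.
have c2 : 1 <= 2 * cos u ^+ 2.
  have : 0 <= cos (u *+ 2).
    rewrite (_ : u *+ 2 = x); last by rewrite mulr2n /u; field.
    apply: cos_ge0_pihalf; have := @pi_ge0 R; by move=> ?; apply/andP; split; lra.
  by rewrite cos_mulr2n mulr2n; lra.
have cu : 0 <= cos u by apply: cos_ge0_pihalf; have := @pi_ge0 R; move=> ?; apply/andP; split; lra.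
have -> : sin x = 2 * (sin u * cos u).
  by rewrite (_ : x = u *+ 2) ?sin_mulr2n ?mulr2n ?/u; [ring|field].
have : u * cos u * cos u <= sin u * cos u by rewrite ler_wpM2r.
have : u * 1 <= u * (2 * cos u ^+ 2) by rewrite ler_wpM2l.
rewrite -/u expr2; lra.
Qed.

Lemma one_cos_ge s : `|s| <= pi -> s ^+ 2 / 4 <= 2 - 2 * cos s.
Proof.
move=> sp.
have -> : cos s = cos `|s| by rewrite cos_norm.
have -> : s ^+ 2 = `|s| ^+ 2 by rewrite real_normK// num_real.
have := normr_ge0 s; move: sp; move: `|s| => u up u0.
have h : u / 2 / 2 <= sin (u / 2).
  by apply: sin_ge_half; apply/andP; split; [rewrite divr_ge0|rewrite ler_pM2r].
have -> : cos u = 1 - 2 * sin (u / 2) ^+ 2.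
  rewrite [in LHS](_ : u = (u / 2) *+ 2); last by rewrite mulr2n -splitr.
  by rewrite cos_mulr2n cos2sin2 mulr2n; ring.
have h0 : 0 <= u / 2 / 2 by rewrite !divr_ge0.
have : (u / 2 / 2) ^+ 2 <= sin (u / 2) ^+ 2 by rewrite lerXn2r// ?nnegrE// (le_trans h0).
rewrite !expr2; lra.
Qed.

Section pow.
Variables (c : R) (c0 : 0 < c).

(** For [r = exp (- y)], [alpha r = 2 cosh y - 2] and [beta r = 2 sinh y], of orders [y ^ 2] and
    [y]. A power of [r] becomes a multiple of [y], and [pker_alpha_beta] writes the Poisson kernel
    in these terms. *)
Definition alpha r := (1 - r) ^+ 2 / r.
Definition beta r := r^-1 - r.

Lemma one_sub_exp r (e : nat) : 0 <= r <= 1 -> 0 <= 1 - r ^+ e <= e%:R * (1 - r).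
Proof.
move=> /andP[r0 r1]; elim: e => [|e /andP[IH0 IH]].
  by rewrite expr0 subrr mul0r lexx.
rewrite exprS -natr1.
have : 0 <= r ^+ e by rewrite exprn_ge0.
by move=> h; apply/andP; split; nra.
Qed.

Lemma pow_A (e : nat) : exists2 C, 0 <= C & forall r, c <= r < 1 ->
  0 <= alpha (r ^+ e) <= C * alpha r.
Proof.
exists (e%:R ^+ 2 * c ^- e).
  by rewrite mulr_ge0// ?exprn_ge0// invr_ge0 exprn_ge0// ltW.
move=> r /andP[cr r1].
have r0 : 0 < r by exact: lt_le_trans cr.
have re0 : 0 < r ^+ e by rewrite exprn_gt0.
have /andP[h1 h2] : 0 <= 1 - r ^+ e <= e%:R * (1 - r) by apply: one_sub_exp; rewrite !ltW.
rewrite /alpha; apply/andP; split; first by rewrite divr_ge0 ?sqr_ge0// ltW.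
have i1 : (1 - r ^+ e) ^+ 2 <= e%:R ^+ 2 * (1 - r) ^+ 2.
  by rewrite -exprMn lerXn2r// nnegrE// (le_trans h1).
have i2 : (r ^+ e)^-1 <= c ^- e.
  by rewrite lef_pV2 ?posrE ?exprn_gt0// lerXn2r ?nnegrE// ltW.
apply: (@le_trans _ _ (e%:R ^+ 2 * (1 - r) ^+ 2 * c ^- e)).
  by apply: ler_pM => //; [exact: sqr_ge0|rewrite invr_ge0 ltW].
set c' := c ^- e.
have -> : e%:R ^+ 2 * c' * ((1 - r) ^+ 2 / r) = e%:R ^+ 2 * (1 - r) ^+ 2 * c' * r^-1 by ring.
rewrite ler_peMr//; last by rewrite ltW// invf_gt1.
have c'0 : 0 <= c' by rewrite invr_ge0 exprn_ge0// ltW.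
by apply: mulr_ge0 => //; apply: mulr_ge0; rewrite ?sqr_ge0.
Qed.

Lemma beta_gt0 r : 0 < r < 1 -> 0 < beta r.
Proof.
move=> /andP[r0 r1]; rewrite /beta subr_gt0 (lt_trans r1)// invf_gt1//.
Qed.

(** For [r = exp (- y)] the quantity is twice [sinh (e y) - e sinh y], which is of third order in
    [y], as is [alpha r * beta r]. *)
Lemma pow_B (e : nat) : exists2 C, 0 <= C & forall r, c <= r < 1 ->
  0 <= beta (r ^+ e) - e%:R * beta r <= C * (alpha r * beta r).
Proof.
elim: e => [|e [C C0 IH]].
  by exists 0 => // r _; rewrite expr0 /beta invr1 subrr mul0r subrr mul0r lexx.
exists (C + e%:R * e.+1%:R * c ^- e).
  by rewrite addr_ge0// !mulr_ge0// invr_ge0 exprn_ge0// ltW.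
move=> r /[dup] cr1 /andP[cr r1].
have r0 : 0 < r by exact: lt_le_trans cr.
have rr : 0 <= r <= 1 by rewrite !ltW.
have re0 : 0 < r ^+ e by rewrite exprn_gt0.
have /andP[IH1 IH2] := IH r cr1.
have /andP[h1 h2] := one_sub_exp e rr.
have /andP[h3 h4] := one_sub_exp e.+1 rr.
have e1 : beta (r ^+ e.+1) - e.+1%:R * beta r = (beta (r ^+ e) - e%:R * beta r) +
   (1 - r) * (1 - r ^+ e) * (1 - r ^+ e.+1) / (r ^+ e * r).
  rewrite /beta exprS -[e.+1%:R]natr1; field.
  by rewrite !gt_eqF.
have p1 : 0 <= (1 - r) * (1 - r ^+ e) * (1 - r ^+ e.+1) / (r ^+ e * r).
  by rewrite divr_ge0// ?mulr_ge0// ?subr_ge0 ltW.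
rewrite e1; apply/andP; split; first exact: addr_ge0.
rewrite [leRHS]mulrDl; apply: lerD => //.
have i2 : (r ^+ e)^-1 <= c ^- e.
  by rewrite lef_pV2 ?posrE ?exprn_gt0// lerXn2r ?nnegrE// ltW.
have -> : (1 - r) * (1 - r ^+ e) * (1 - r ^+ e.+1) / (r ^+ e * r) =
   ((1 - r ^+ e) * (1 - r ^+ e.+1)) * ((1 - r) / r) * (r ^+ e)^-1.
  by rewrite exprS; field; rewrite !gt_eqF.
have ab : (1 - r) ^+ 2 * ((1 - r) / r) <= alpha r * beta r.
  rewrite /alpha /beta -[leRHS]mulrA; apply: ler_wpM2l; first exact: sqr_ge0.
  have -> : r^-1 * (r^-1 - r) = (1 - r) / r * ((1 + r) / r) by field; rewrite gt_eqF.
  have : 1 <= (1 + r) / r by rewrite ler_pdivlMr// mul1r lerDr.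
  have : 0 <= (1 - r) / r by rewrite divr_ge0 ?subr_ge0 ?ltW.
  by nra.
have q0 : 0 <= (1 - r) / r by rewrite divr_ge0 ?subr_ge0 ?ltW.
have i3 : (1 - r ^+ e) * (1 - r ^+ e.+1) <= e%:R * e.+1%:R * (1 - r) ^+ 2.
  apply: le_trans (ler_pM h1 h3 h2 h4) _.
  rewrite expr2; lra.
apply: (@le_trans _ _ ((e%:R * e.+1%:R * (1 - r) ^+ 2) * ((1 - r) / r) * c ^- e)).
  apply: ler_pM => //.
  - by apply: mulr_ge0 => //; exact: mulr_ge0.
  - by rewrite invr_ge0 ltW.
  - by apply: ler_wpM2r.
have c'0 : 0 <= e%:R * e.+1%:R * c ^- e by rewrite mulr_ge0// invr_ge0 exprn_ge0// ltW.
apply: le_trans (ler_wpM2l c'0 ab); set q := (1 - r) / r; set c' := c ^- e.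
by rewrite -[e%:R * _ / _]/(e%:R * e.+1%:R * c') [leLHS](_ : _ = e%:R * e.+1%:R * c' * ((1 - r) ^+ 2 * q))//; ring.
Qed.

Lemma pker_alpha_beta r s : 0 < r < 1 ->
  pker r s = beta r / (alpha r + (2 - 2 * cos s)).
Proof.
move=> /andP[r0 r1].
have d0 : 0 < 1 - 2 * r * cos s + r ^+ 2 by apply: pker_den_gt0; rewrite ltW.
have -> : alpha r + (2 - 2 * cos s) = (1 - 2 * r * cos s + r ^+ 2) / r.
  by rewrite /alpha; field; rewrite gt_eqF.
rewrite /pker /beta; field.
by rewrite !gt_eqF.
Qed.

(** Away from [s = 0] the leading term of [pker (r ^+ e) s] is proportional to [e]. A combination
    loses it when its first moment, the sum of coefficients times exponents, is zero. *)
Lemma pker_pow_bound (e : nat) : (0 < e)%N -> exists2 C, 0 <= C & forall r s,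
  c <= r < 1 -> 0 < 2 - 2 * cos s ->
  `|pker (r ^+ e) s - e%:R * (beta r / (2 - 2 * cos s))| <=
     C * (alpha r * beta r / (2 - 2 * cos s) ^+ 2).
Proof.
move=> e0; have [CA CA0 HA] := pow_A e; have [CB CB0 HB] := pow_B e.
exists (4 * CB + e%:R * CA); first by rewrite addr_ge0 ?mulr_ge0.
move=> r s cr1; have /andP[A0 A1] := HA r cr1; have /andP[B0 B1] := HB r cr1.
move/andP: cr1 => [cr r1].
have r0 : 0 < r by exact: lt_le_trans cr.
have re : 0 < r ^+ e < 1.
  by rewrite exprn_gt0//= exprn_ilt1// ?ltW// -lt0n.
have b0 : 0 < beta r by apply: beta_gt0; rewrite r0.
have a0 : 0 <= alpha r by rewrite /alpha divr_ge0 ?sqr_ge0// ltW.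
rewrite pker_alpha_beta//; set q := 2 - 2 * cos s => q0.
have q4 : q <= 4 by rewrite /q; have := cos_geN1 s; lra.
set Ae := alpha (r ^+ e) in A0 A1 *; set Be := beta (r ^+ e) in B0 B1 *.
have Aq : 0 < Ae + q by rewrite ltr_wpDl.
have -> : Be / (Ae + q) - e%:R * (beta r / q) =
   ((Be - e%:R * beta r) * q - e%:R * beta r * Ae) / (q * (Ae + q)).
  by field; rewrite !gt_eqF.
have qq : 0 < q ^+ 2 by rewrite exprn_gt0.
rewrite normrM normfV (gtr0_norm (mulr_gt0 q0 Aq)).
have n1 : `|(Be - e%:R * beta r) * q - e%:R * beta r * Ae| <=
   (4 * CB + e%:R * CA) * (alpha r * beta r).
  apply: le_trans (ler_normB _ _) _.
  rewrite (ger0_norm (mulr_ge0 B0 (ltW q0))) (ger0_norm (mulr_ge0 (mulr_ge0 _ (ltW b0)) A0))//.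
  have i1 : (Be - e%:R * beta r) * q <= CB * (alpha r * beta r) * 4.
    by apply: ler_pM => //; exact: ltW.
  have i2 : e%:R * beta r * Ae <= e%:R * beta r * (CA * alpha r).
    by apply: ler_wpM2l => //; rewrite mulr_ge0// ltW.
  apply: le_trans (lerD i1 i2) _.
  lra.
rewrite [leRHS]mulrA; apply: ler_pM => //.
  by rewrite invr_ge0 mulr_ge0// ltW.
rewrite lef_pV2 ?posrE ?mulr_gt0// expr2 ler_pM2l//.
by rewrite lerDr.
Qed.

End pow.

Definition kcomb (l : seq (R * nat)) r s := \sum_(p <- l) p.1 * pker (r ^+ p.2) s.

(** Its integral over the line is 1, and that of [(y + |s|) * kmaj y s] is [2 y]: one power of decay
    is left to absorb linear growth. *)
Definition kmaj y s := y ^+ 2 / (y + `|s|) ^+ 3.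

Lemma expRN_ge x : 0 <= x <= 2 -> 10^-1 <= expR (- x).
Proof.
move=> /andP[x0 x2].
(* [expR (- x / 8)] is at least [1 - x / 8 >= 3 / 4], and [(3 / 4) ^ 8] is just above [1 / 10]. *)
have -> : expR (- x) = expR (- x / 8) ^+ 8.
  by rewrite -expRM_natl; congr expR; field.
have h : 3 / 4 <= expR (- x / 8) by apply: le_trans (expR_ge1Dx _); lra.
apply: (@le_trans _ _ ((3 / 4) ^+ 8)); last by rewrite lerXn2r// nnegrE ?expR_ge0//.
lra.
Qed.

Lemma expRN_le y : 0 < y <= 2 -> 1 - y <= expR (- y) <= 1 - y / 3.
Proof.
move=> /andP[y0 y2]; apply/andP; split.
  by apply: le_trans (expR_ge1Dx _); rewrite lexx.
rewrite expRN.
have h : 1 + y <= expR y by exact: expR_ge1Dx.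
have h0 : 0 < 1 + y by lra.
(* For [y > 0], [(1 + y) (1 - y / 3) >= 1] amounts to [y <= 2], which is the range of
   [ell n / pi]. *)
apply: (@le_trans _ _ (1 + y)^-1); first by rewrite lef_pV2 ?posrE ?expR_gt0.
rewrite -[leLHS]mul1r ler_pdivrMr//; nra.
Qed.

(** For [|s| <= y] the trivial bound of order [1 / y] has the right size. For [|s| > y] the leading
    terms cancel because the first moment vanishes, and the remainder
    [alpha * beta / (2 - 2 cos s) ^ 2] is of order [y ^ 3 / s ^ 4], which is below
    [y ^ 2 / |s| ^ 3]. *)
Lemma kcomb_bound (l : seq (R * nat)) : all (fun p => 0 < p.2)%N l ->
  \sum_(p <- l) p.1 * p.2%:R = 0 ->
  exists2 C, 0 < C & forall y s, 0 < y <= 2 -> `|s| <= pi ->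
    `|kcomb l (expR (- y)) s| <= C * kmaj y s.
Proof.
move=> al sl.
have c0 : 0 < 10^-1 :> R by [].
have [C1 C10 H1] : exists2 C, 0 <= C & forall r s, 10^-1 <= r < 1 ->
    0 < 2 - 2 * cos s ->
    `|kcomb l r s - (\sum_(p <- l) p.1 * p.2%:R) * (beta r / (2 - 2 * cos s))| <=
     C * (alpha r * beta r / (2 - 2 * cos s) ^+ 2).
  elim: l al {sl} => [_|[a e] l IH /= /andP[e0 al]].
    by exists 0 => // r s _ _; rewrite /kcomb !big_nil mul0r subrr normr0 mul0r.
  have [C C0 HC] := IH al; have [C' C'0 HC'] := pker_pow_bound c0 e0.
  exists (C + `|a| * C'); first by rewrite addr_ge0// mulr_ge0.
  move=> r s cr q0; rewrite /kcomb !big_cons/=.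
  set X := \sum_(j <- l) _; set Y := \sum_(j <- l) _; set q := beta r / _.
  have -> : a * pker (r ^+ e) s + X - (a * e%:R + Y) * q =
    (X - Y * q) + a * (pker (r ^+ e) s - e%:R * q) by ring.
  apply: le_trans (ler_normD _ _) _; rewrite mulrDl lerD//; first exact: HC.
  by rewrite (normrM a) -[leRHS]mulrA; apply: ler_wpM2l => //; exact: HC'.
have cc0 : (0 : R) <= 16 * 200 by lra.
have cc8 : (0 : R) <= 16 * 200 * 8 by lra.
pose S := \sum_(p <- l) `|p.1|.
have S0 : 0 <= S by apply: sumr_ge0.
(* [200] bounds [alpha * beta] by [10 y ^ 2 * 20 y], [16] comes from [(s ^ 2 / 4) ^ 2] and [8] from
   [(y + |s|) ^ 3 <= (2 |s|) ^ 3]. The [6] in [K1] comes from [2 / (1 - r) <= 6 / y]. *)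
have [D [D0 hD]] : exists D : R, 0 <= D /\ 16 * 200 * 8 <= D by exists (16 * 200 * 8); split; lra.
pose K1 := 6 * S; pose K2 := C1 * D.
exists (8 * (K1 + K2) + 1); first by rewrite ltr_pwDr// mulr_ge0// addr_ge0 ?mulr_ge0.
move=> y s /[dup] yy /andP[y0 y2] sp.
set r := expR (- y).
have r1 : 10^-1 <= r by apply: expRN_ge; rewrite ltW.
have /andP[r2 r3] : 1 - y <= r <= 1 - y / 3 by exact: expRN_le.
have r0 : 0 < r by exact: expR_gt0.
have r11 : r < 1 by apply: le_lt_trans r3 _; rewrite gtrBl divr_gt0.
have B1 : `|kcomb l r s| <= K1 / y.
  have : `|kcomb l r s| <= \sum_(p <- l) `|p.1| * (6 / y).
    apply: le_trans (ler_norm_sum _ _ _) _.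
    rewrite big_seq_cond [leRHS]big_seq_cond; apply: ler_sum => -[a e]/= /andP[/(allP al)/= e0 _].
    rewrite (normrM a) ler_wpM2l//.
    have re : 0 <= r ^+ e < 1 by rewrite exprn_ge0 ?ltW//= exprn_ilt1// ?ltW// -lt0n.
    rewrite ger0_norm ?pker_ge0//; apply: le_trans (pker_le _ re) _.
    have rer : r ^+ e <= r by case: (e) e0 => // n _; rewrite exprS; apply: ler_piMr; [exact: ltW|apply: exprn_ile1; exact: ltW].
    rewrite ler_pdivrMr ?subr_gt0//; last by case/andP: re.
    rewrite mulrAC ler_pdivlMr//; lra.
  by rewrite -mulr_suml -/S /K1 mulrA (mulrC 6).
have S3 : 0 < (y + `|s|) ^+ 3 by rewrite exprn_gt0// ltr_pwDl.
have kge : 0 <= kmaj y s by rewrite /kmaj divr_ge0 ?sqr_ge0// ltW.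
have K10 : 0 <= K1 by rewrite mulr_ge0.
have K20 : 0 <= K2 by rewrite mulr_ge0.
have K28 : K2 <= 8 * (K1 + K2) by move: K10 K20; clear; lra.
suff : `|kcomb l r s| <= 8 * (K1 + K2) * kmaj y s.
  by move=> h; apply: le_trans h _; rewrite ler_wpM2r// lerDl.
have [sy|ys] := leP `|s| y.
  apply: le_trans B1 _; rewrite /kmaj mulrA ler_pdivlMr// mulrAC ler_pdivrMr//.
  have h : (y + `|s|) ^+ 3 <= (2 * y) ^+ 3.
    have yy2 : y + `|s| <= 2 * y by move: sy; clear; lra.
    by rewrite lerXn2r// nnegrE ?(le_trans _ yy2)// addr_ge0// ltW.
  have h3 : K1 * (y + `|s|) ^+ 3 <= K1 * (2 * y) ^+ 3 by rewrite ler_wpM2l.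
  have h4 : 0 <= K2 * y ^+ 3 by rewrite mulr_ge0// exprn_ge0// ltW.
  have -> : 8 * (K1 + K2) * y ^+ 2 * y = K1 * (2 * y) ^+ 3 + 8 * (K2 * y ^+ 3) by ring.
  lra.
have s0 : 0 < `|s| by exact: lt_trans ys.
have q1 := one_cos_ge sp.
have s2 : 0 < s ^+ 2 by rewrite exprn_even_gt0//= -normr_gt0.
have q0 : 0 < 2 - 2 * cos s by apply: lt_le_trans q1; rewrite divr_gt0.
have := H1 r s; rewrite r1 r11 q0 sl mul0r subr0 => /(_ isT isT) h1.
apply: le_trans h1 _.
have a1 : alpha r <= 10 * y ^+ 2.
  rewrite /alpha ler_pdivrMr//.
  have yr : 1 - r <= y by move: r2; clear; lra.
  have h5 : (1 - r) ^+ 2 <= y ^+ 2 by rewrite lerXn2r// nnegrE ?subr_ge0 ltW.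
  have h6 : 0 <= y ^+ 2 by exact: sqr_ge0.
  have : y ^+ 2 * 10^-1 <= y ^+ 2 * r by rewrite ler_wpM2l.
  move: h5 h6; clear; lra.
have a0 : 0 <= alpha r by rewrite /alpha divr_ge0 ?sqr_ge0// ltW.
have yr' : 1 - r <= y by move: r2; clear; lra.
have b1 : beta r <= 20 * y.
  have -> : beta r = (1 - r) * (1 + r) / r by rewrite /beta; field; rewrite gt_eqF.
  rewrite ler_pdivrMr//; move: r1 r11 yr' y0; clear; nra.
have b0 : 0 < beta r by apply: beta_gt0; rewrite r0.
have ab : alpha r * beta r <= 200 * y ^+ 3.
  apply: le_trans (ler_pM a0 (ltW b0) a1 b1) _.
  by rewrite (_ : 10 * y ^+ 2 * (20 * y) = 200 * y ^+ 3)//; clear; ring.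
have n4 : s ^+ 2 = `|s| ^+ 2 by rewrite real_normK// num_real.
have q2 : `|s| ^+ 4 / 16 <= (2 - 2 * cos s) ^+ 2.
  have -> : `|s| ^+ 4 / 16 = (s ^+ 2 / 4) ^+ 2 by rewrite n4; field.
  by rewrite lerXn2r// nnegrE ?ltW// divr_gt0.
have h2 : alpha r * beta r / (2 - 2 * cos s) ^+ 2 <= 200 * y ^+ 3 / (`|s| ^+ 4 / 16).
  apply: ler_pM => //; first by rewrite mulr_ge0// ltW.
  by rewrite lef_pV2 ?posrE// ?exprn_gt0// divr_gt0// exprn_gt0.
have h3 : 200 * y ^+ 3 / (`|s| ^+ 4 / 16) <= D * kmaj y s.
  rewrite /kmaj.
  have -> : 200 * y ^+ 3 / (`|s| ^+ 4 / 16) = 16 * 200 * y ^+ 3 / `|s| ^+ 4.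
    by field; rewrite gt_eqF.
  rewrite ler_pdivrMr ?exprn_gt0// [D * _]mulrA [leRHS]mulrAC ler_pdivlMr//.
  have h : (y + `|s|) ^+ 3 <= (2 * `|s|) ^+ 3.
    have yy2 : y + `|s| <= 2 * `|s| by move: ys; clear; lra.
    by rewrite lerXn2r// nnegrE ?(le_trans _ yy2)// addr_ge0// ltW.
  have y3 : 0 <= y ^+ 3 by rewrite exprn_ge0// ltW.
  apply: (@le_trans _ _ (16 * 200 * y ^+ 3 * (2 * `|s|) ^+ 3)).
    exact: (ler_wpM2l (mulr_ge0 cc0 y3) h).
  have -> : 16 * 200 * y ^+ 3 * (2 * `|s|) ^+ 3 = 16 * 200 * 8 * (y ^+ 2 * `|s| ^+ 3 * y) by ring.
  have -> : D * y ^+ 2 * `|s| ^+ 4 = D * (y ^+ 2 * `|s| ^+ 3 * `|s|) by ring.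
  have p0 : 0 <= y ^+ 2 * `|s| ^+ 3 by rewrite mulr_ge0 ?sqr_ge0 ?exprn_ge0.
  have : y ^+ 2 * `|s| ^+ 3 * y <= y ^+ 2 * `|s| ^+ 3 * `|s| by rewrite ler_wpM2l// ltW.
  have p1 : 0 <= y ^+ 2 * `|s| ^+ 3 * `|s| by rewrite mulr_ge0.
  move=> p2; apply: (@le_trans _ _ (16 * 200 * 8 * (y ^+ 2 * `|s| ^+ 3 * `|s|))); last by rewrite ler_wpM2r.
  exact: (ler_wpM2l cc8 p2).
apply: (@le_trans _ _ (K2 * kmaj y s)).
  rewrite /K2 -[leRHS]mulrA; apply: ler_wpM2l => //; exact: le_trans h2 h3.
exact: (ler_wpM2r kge K28).
Qed.

Lemma continuous_kcomb (l : seq (R * nat)) r : 0 <= r < 1 ->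
  all (fun p => 0 < p.2)%N l -> continuous (kcomb l r).
Proof.
move=> /andP[r0 r1] al s; rewrite /kcomb.
elim: l al => [_|[a e] l IH /= /andP[e0 al]].
  by under eq_fun do rewrite big_nil; exact: cvg_cst.
rewrite (_ : (fun _ => _) = (fun s0 => a * pker (r ^+ e) s0) \+
  (fun s => \sum_(p <- l) p.1 * pker (r ^+ p.2) s)); last first.
  by apply/funext => t; rewrite big_cons.
apply: continuousD; last exact: IH.
apply: continuousM; first exact: cvg_cst.
by apply: continuous_pker; rewrite /= exprn_ge0//= exprn_ilt1// -lt0n.
Qed.

Lemma kcombD2pi (l : seq (R * nat)) r s : kcomb l r (s + 2 * pi) = kcomb l r s.
Proof. by apply: eq_bigr => p _; rewrite pkerD2pi. Qed.

Lemma iint_kmaj y (L b : R) : 0 < y -> 0 <= L -> L <= b ->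
  iint (fun s => kmaj y s) L b <= y ^+ 2 / (y + L) ^+ 2.
Proof.
move=> y0 L0 Lb.
rewrite (@eq_iint _ _ (fun s => y ^+ 2 * (y + s) ^- 3)); last first.
  by move=> s /andP[Ls _]; rewrite /kmaj ger0_norm// (le_trans L0).
have pos s : L <= s <= b -> 0 < y + s.
  by move=> /andP[Ls _]; rewrite ltr_wpDr// (le_trans L0).
have dF s : L <= s <= b -> is_derive s 1 (fun s : R => - (y ^+ 2 / 2) * (y + s) ^- 2)
    (y ^+ 2 * (y + s) ^- 3).
  move=> /pos ps.
  have ne : (y + s) ^+ 2 != 0 by rewrite expf_neq0// gt_eqF.
  apply: is_derive_eq; rewrite /GRing.scale/=; field.
  by rewrite gt_eqF.
have cF s : L <= s <= b -> {for s, continuous (fun s : R => y ^+ 2 * (y + s) ^- 3)}.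
  move=> /pos ps; apply: cvgM; first exact: cvg_cst.
  apply: cvgV; first by rewrite expf_neq0// gt_eqF.
  have cs : continuous (fun s : R => y + s).
    by move=> u; apply: cvgD; [exact: cvg_cst|exact: cvg_id].
  by apply: (@continuous_comp _ _ _ (fun s => y + s) (fun u => u ^+ 3)); [exact: cs|exact: exprn_continuous].
rewrite (iint_FTC Lb dF cF).
have pL : 0 < (y + L) ^+ 2 by rewrite exprn_gt0// pos// lexx Lb.
have pb : 0 < (y + b) ^+ 2 by rewrite exprn_gt0// pos// lexx Lb.
have h1 : 0 <= y ^+ 2 / (y + L) ^+ 2 by rewrite divr_ge0 ?sqr_ge0// ltW.
have h2 : 0 <= y ^+ 2 / (y + b) ^+ 2 by rewrite divr_ge0 ?sqr_ge0// ltW.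
have -> : - (y ^+ 2 / 2) * (y + b) ^- 2 - - (y ^+ 2 / 2) * (y + L) ^- 2 =
  (y ^+ 2 / (y + L) ^+ 2 - y ^+ 2 / (y + b) ^+ 2) / 2.
  by field; rewrite !gt_eqF// pos// lexx Lb.
lra.
Qed.

Lemma iint_kmaj1 y (L b : R) : 0 < y -> 0 <= L -> L <= b ->
  iint (fun s => (y + `|s|) * kmaj y s) L b <= y ^+ 2 / (y + L).
Proof.
move=> y0 L0 Lb.
have pos s : L <= s <= b -> 0 < y + s.
  by move=> /andP[Ls _]; rewrite ltr_wpDr// (le_trans L0).
rewrite (@eq_iint _ _ (fun s => y ^+ 2 * (y + s) ^- 2)); last first.
  move=> s /[dup] /pos ps /andP[Ls _]; rewrite /kmaj ger0_norm ?(le_trans L0)//.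
  by field; rewrite gt_eqF.
have dF s : L <= s <= b -> is_derive s 1 (fun s : R => - y ^+ 2 * (y + s)^-1)
    (y ^+ 2 * (y + s) ^- 2).
  move=> /pos ps.
  have ne : (y + s) != 0 by rewrite gt_eqF.
  apply: is_derive_eq; rewrite /GRing.scale/=; field.
  by rewrite gt_eqF.
have cF s : L <= s <= b -> {for s, continuous (fun s : R => y ^+ 2 * (y + s) ^- 2)}.
  move=> /pos ps; apply: cvgM; first exact: cvg_cst.
  apply: cvgV; first by rewrite expf_neq0// gt_eqF.
  have cs : continuous (fun s : R => y + s).
    by move=> u; apply: cvgD; [exact: cvg_cst|exact: cvg_id].
  by apply: (@continuous_comp _ _ _ (fun s => y + s) (fun u => u ^+ 2)); [exact: cs|exact: exprn_continuous].
rewrite (iint_FTC Lb dF cF).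
have h2 : 0 <= y ^+ 2 / (y + b) by rewrite divr_ge0 ?sqr_ge0// ltW// pos// lexx Lb.
rewrite !mulNr opprK; lra.
Qed.

End kernel_bounds.

(** * The dyadic stopping process *)

Section dyadic.
Context {R : realType}.
Implicit Types (x t a b : R) (n N M : nat) (i j : int).

Definition ell n : R := 2 * pi / 2 ^+ n.

Lemma ell_gt0 n : 0 < ell n.
Proof. by rewrite /ell divr_gt0// ?exprn_gt0// mulr_gt0// pi_gt0. Qed.

Lemma ellS n : ell n = 2 * ell n.+1.
Proof. by rewrite /ell exprS; field; rewrite expf_neq0. Qed.

Lemma ell_le2pi n : ell n <= 2 * pi.
Proof.
rewrite /ell ler_pdivrMr ?exprn_gt0// ler_peMr//.
  by rewrite mulr_ge0// pi_ge0.
by rewrite exprn_ege1// ler1n.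
Qed.

Lemma ell_mono n m : (n <= m)%N -> ell m <= ell n.
Proof.
move=> nm; rewrite /ell ler_pM2l ?mulr_gt0 ?pi_gt0//.
by rewrite lef_pV2 ?posrE ?exprn_gt0// ler_eXn2l// ltr1n.
Qed.

(** Blocks are indexed along the whole line instead of the circle, so that neighbours exist without
    wrapping around; [blkD2pi] expresses the periodicity. *)
Definition blk n x : int := Num.floor (x / ell n).

Definition lo n j : R := j%:~R * ell n.

Lemma loD1 n j : lo n (j + 1) = lo n j + ell n.
Proof. by rewrite /lo intrD mulrDl mul1r. Qed.

Lemma blk_itv n x : lo n (blk n x) <= x < lo n (blk n x) + ell n.
Proof.
have e0 := ell_gt0 n; rewrite -loD1 /lo /blk.
have /andP[h1 h2] := floor_itv (x / ell n).
by rewrite -ler_pdivlMr// h1/= -ltr_pdivrMr.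
Qed.

Lemma blk_def n j x : lo n j <= x < lo n j + ell n -> blk n x = j.
Proof.
have e0 := ell_gt0 n; rewrite -loD1 /lo /blk => /andP[h1 h2].
by apply: floor_def; rewrite ler_pdivlMr// h1/= ltr_pdivrMr.
Qed.

Lemma blk_lo n j : blk n (lo n j) = j.
Proof. by apply: blk_def; rewrite lexx ltrDl ell_gt0. Qed.

Lemma lo_half n j : lo n j = lo n.+1 (2 * j).
Proof. by rewrite /lo (ellS n) intrM; ring. Qed.

Lemma lo_half1 n j : lo n.+1 (2 * j + 1) = lo n j + ell n.+1.
Proof. by rewrite loD1 -lo_half. Qed.

Lemma blkS n x : exists b : bool, blk n.+1 x = 2 * blk n x + b%:Z.
Proof.
have /andP[h1 h2] := blk_itv n x; have e0 := ell_gt0 n.+1.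
have [h|h] := ltP x (lo n (blk n x) + ell n.+1).
  by exists false; rewrite addr0; apply: blk_def; rewrite -lo_half h1 h.
exists true; apply: blk_def; rewrite lo_half1 h/=.
by rewrite -addrA -mulr2n -[_ *+ 2]mulr_natl -ellS.
Qed.

Lemma blk_eqS n x y : blk n.+1 x = blk n.+1 y -> blk n x = blk n y.
Proof.
have [b hb] := blkS n x; have [c hc] := blkS n y; rewrite hb hc.
by case: b {hb}; case: c {hc} => /=; lia.
Qed.

Lemma blk_eq_le n m x y : (n <= m)%N -> blk m x = blk m y -> blk n x = blk n y.
Proof.
move=> /subnK <-; elim: (m - n)%N => [//|k IH] /blk_eqS; exact: IH.
Qed.

Lemma blkD2pi n x : blk n (x + 2 * pi) = blk n x + (2 ^ n)%N%:Z.
Proof.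
have /andP[h1 h2] := blk_itv n x; apply: blk_def.
have -> : lo n (blk n x + (2 ^ n)%N%:Z) = lo n (blk n x) + 2 * pi.
  rewrite /lo intrD mulrDl; congr (_ + _); rewrite /ell.
  by rewrite -pmulrn natrX; field; rewrite expf_neq0.
by rewrite lerD2r h1/=; lra.
Qed.

Lemma measurable_blk n (g : R -> R) :
  (forall x y, blk n x = blk n y -> g x = g y) -> measurable_fun setT g.
Proof.
move=> gE _ B mB; rewrite setTI.
pose S j := if `[< B (g (lo n j)) >] then `[lo n j, lo n j + ell n[%classic else (set0 : set R).
have mS j : measurable (S j) by rewrite /S; case: asboolP.
have -> : g @^-1` B = (\bigcup_(k : nat) S k%:Z) `|` (\bigcup_(k : nat) S (- k%:Z)).
  apply/seteqP; split=> x /=.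
    move=> Bx; have hx := blk_itv n x.
    have Sx : S (blk n x) x.
      rewrite /S; case: asboolP => [_|]; first by rewrite /= in_itv.
      by case; rewrite (gE _ x)// blk_lo.
    case: (blk n x) Sx => k Sx; [left|right].
      by exists k.
    by exists k.+1 => //; rewrite -NegzE.
  have h j : S j x -> B (g x).
    rewrite /S; case: asboolP => // Bj; rewrite /= in_itv/= => hj.
    by rewrite (gE x (lo n j))// blk_lo; exact: blk_def.
  by move=> [[k _ /h//]|[k _ /h//]].
by apply: measurableU; exact: bigcupT_measurable.
Qed.

Lemma iint_blk_half (g : R -> R) n j : locint g ->
  iint g (lo n j) (lo n j + ell n) =
  iint g (lo n.+1 (2 * j)) (lo n.+1 (2 * j) + ell n.+1) +
  iint g (lo n.+1 (2 * j + 1)) (lo n.+1 (2 * j + 1) + ell n.+1).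
Proof.
move=> lg; have e0 := ell_gt0 n.+1.
rewrite lo_half1 -lo_half -addrA (_ : ell n.+1 + ell n.+1 = ell n); last first.
  by rewrite (ellS n) mulrDl mul1r.
by apply: iint_split => //; rewrite ?lerDl ?lerD2l ?(ltW e0)// (ellS n); lra.
Qed.

Lemma iint_blk_le (g h : R -> R) n m : locint g -> locint h -> (n <= m)%N ->
  (forall j, iint g (lo m j) (lo m j + ell m) <= iint h (lo m j) (lo m j + ell m)) ->
  forall j, iint g (lo n j) (lo n j + ell n) <= iint h (lo n j) (lo n j + ell n).
Proof.
move=> lg lh /subnK <-; elim: (m - n)%N => [//|k IH] H j.
apply: IH => {}j; rewrite (iint_blk_half _ _ lg) (iint_blk_half _ _ lh).
apply: lerD; exact: H.
Qed.

Section stopping.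
Variables (phi : R -> R) (w : nat -> R).
Hypothesis lphi : locint phi.
Hypothesis phi2pi : forall x, phi (x + 2 * pi) = phi x.
Hypothesis w0 : forall n, 0 <= w n.
Hypothesis wdec : forall n m, (n <= m)%N -> w m <= w n.
Definition avg a b := iint phi a b / (b - a).
Hypothesis osc : forall n a b, a < b -> b <= a + 2 * pi -> b - a <= 2 * ell n ->
  iint (fun x => `|phi x - avg a b|) a b <= w n * (b - a).

Definition Av n x := avg (lo n (blk n x)) (lo n (blk n x) + ell n).

Fixpoint Fn n : R -> R :=
  if n is m.+1 then
    fun x => if 2 * w n < `|Av n x - Fn m x| then Av n x else Fn m x
  else fun=> avg 0 (2 * pi).

Definition Dn n x := Fn n.+1 x - Fn n x.

Let p0 : 0 < 2 * pi :> R. Proof. by rewrite mulr_gt0// pi_gt0. Qed.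

Lemma Av_blk n x y : blk n x = blk n y -> Av n x = Av n y.
Proof. by rewrite /Av => ->. Qed.

Lemma Fn_blk n x y : blk n x = blk n y -> Fn n x = Fn n y.
Proof.
elim: n => [//|n IH] e /=.
by rewrite (Av_blk e) (IH (blk_eqS e)).
Qed.

Lemma Fn_blk_le n m x y : (n <= m)%N -> blk m x = blk m y -> Fn n x = Fn n y.
Proof. by move=> nm /(blk_eq_le nm); exact: Fn_blk. Qed.

Lemma Dn_blk n x y : blk n.+1 x = blk n.+1 y -> Dn n x = Dn n y.
Proof. by move=> e; rewrite /Dn (Fn_blk e) (Fn_blk (blk_eqS e)). Qed.

Lemma avg_period a b : a <= b -> avg (a + 2 * pi) (b + 2 * pi) = avg a b.
Proof.
move=> ab; rewrite /avg; congr (_ / _); last by ring.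
rewrite -(iint_shift (2 * pi) _ _ (locint_measurable lphi)) !addrK.
by apply: eq_iint => t _; rewrite phi2pi.
Qed.

Lemma Av_period n x : Av n (x + 2 * pi) = Av n x.
Proof.
rewrite /Av blkD2pi.
have -> : lo n (blk n x + (2 ^ n)%N%:Z) = lo n (blk n x) + 2 * pi.
  rewrite /lo intrD mulrDl; congr (_ + _); rewrite /ell.
  by rewrite -pmulrn natrX; field; rewrite expf_neq0.
by rewrite [X in avg _ X]addrAC avg_period// lerDl ltW// ell_gt0.
Qed.

Lemma Fn_period n x : Fn n (x + 2 * pi) = Fn n x.
Proof. by elim: n => [//|n IH] /=; rewrite Av_period IH. Qed.

Lemma ell0 : ell 0 = 2 * pi. Proof. by rewrite /ell expr0 divr1. Qed.

Lemma Av0 x : Av 0 x = avg 0 (2 * pi).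
Proof.
rewrite /Av ell0 /avg; congr (_ / _); last by ring.
exact: iint_period.
Qed.

Lemma Fn_Av n x : `|Fn n x - Av n x| <= 2 * w n.
Proof.
case: n => [|n].
  by rewrite Av0 subrr normr0 mulr_ge0.
rewrite /=; case: ifPn; first by rewrite subrr normr0 mulr_ge0.
by rewrite -leNgt distrC.
Qed.

Let nphi := iint (fun t => `|phi t|) 0 (2 * pi).

Let nphi0 : 0 <= nphi. Proof. exact: iint_ge0. Qed.

Lemma Av_bound n x : `|Av n x| <= nphi / ell n.
Proof.
have e0 := ell_gt0 n.
rewrite /Av /avg addrAC subrr add0r normrM normfV (gtr0_norm e0).
rewrite ler_pM2r ?invr_gt0//; apply: le_trans (le_norm_iint _ _ lphi) _.
have l1 : locint (fun t => `|phi t|) by exact: locint_norm.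
rewrite /nphi -(@iint_period _ (2 * pi) (lo n (blk n x)))//; last by move=> t; rewrite phi2pi.
by apply: iint_sub => //; rewrite ?lerDl ?(ltW e0)// lerD2l ell_le2pi.
Qed.

Lemma Fn_bound n x : `|Fn n x| <= nphi / ell n.
Proof.
elim: n => [|n IH] /=; first by rewrite -(Av0 x) Av_bound.
case: ifPn => _; first exact: Av_bound.
apply: le_trans IH _; apply: ler_wpM2l => //.
by rewrite lef_pV2 ?posrE ?ell_gt0//; apply: ell_mono.
Qed.

Lemma Fn_bddmeas n : bddmeas (Fn n).
Proof.
split; last by exists (nphi / ell n); exact: Fn_bound.
by apply: (@measurable_blk n); exact: Fn_blk.
Qed.

Lemma Dn_bddmeas n : bddmeas (Dn n).
Proof.
split; first by apply: (@measurable_blk n.+1); exact: Dn_blk.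
exists (nphi / ell n.+1 + nphi / ell n) => x.
by apply: le_trans (ler_normB _ _) _; rewrite lerD// Fn_bound.
Qed.

Lemma locint_Fn n : locint (Fn n). Proof. exact: bddmeas_locint (Fn_bddmeas n). Qed.

Lemma locint_Dn n : locint (Dn n). Proof. exact: bddmeas_locint (Dn_bddmeas n). Qed.

Lemma locint_phiF n : locint (fun x => `|phi x - Fn n x|).
Proof. by apply: locint_norm; apply: locintB => //; exact: locint_Fn. Qed.

Lemma osc_blk n j :
  iint (fun x => `|phi x - Av n (lo n j)|) (lo n j) (lo n j + ell n) <= w n * ell n.
Proof.
have e0 := ell_gt0 n.
have := @osc n (lo n j) (lo n j + ell n).
rewrite ltrDl e0 lerD2l ell_le2pi addrAC subrr add0r => /(_ isT isT).
rewrite /Av blk_lo; apply; lra.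
Qed.

Lemma phiF_blk n j :
  iint (fun x => `|phi x - Fn n x|) (lo n j) (lo n j + ell n) <= 3 * w n * ell n.
Proof.
have e0 := ell_gt0 n.
have l1 : locint (fun x => `|phi x - Av n (lo n j)|).
  by apply: locint_norm; apply: locintB => //; exact: locint_cst.
apply: (@le_trans _ _ (iint (fun x => `|phi x - Av n (lo n j)| + cst (2 * w n) x)
    (lo n j) (lo n j + ell n))).
  apply: le_iint_co; [exact: locint_phiF|apply: locintD => //; exact: locint_cst|].
  move=> t /blk_def ht.
  have -> : Fn n t = Fn n (lo n j) by apply: Fn_blk; rewrite ht blk_lo.
  have -> : phi t - Fn n (lo n j) = (phi t - Av n (lo n j)) - (Fn n (lo n j) - Av n (lo n j)) by ring.
  apply: le_trans (ler_normB _ _) _; rewrite lerD2l; exact: Fn_Av.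
rewrite iintD//; last exact: locint_cst.
rewrite iint_cst; last by rewrite lerDl ltW.
rewrite addrAC subrr add0r; have := osc_blk n j; lra.
Qed.

(* If the process jumps on a block, it jumps onto the average from a distance v
   with v > 2 w, and the jump v * ell is paid by the decrease of the integral. *)
Lemma potential_blk n j :
  iint (fun x => `|Dn n x| + 2 * `|phi x - Fn n.+1 x|) (lo n.+1 j) (lo n.+1 j + ell n.+1) <=
  iint (fun x => 2 * `|phi x - Fn n x|) (lo n.+1 j) (lo n.+1 j + ell n.+1).
Proof.
have e0 := ell_gt0 n.+1; set u := lo n.+1 j; set v := u + ell n.+1.
have uv : u <= v by rewrite lerDl ltW.
have vu : v - u = ell n.+1 by rewrite /v addrAC subrr add0r.
have lD : locint (fun x => `|Dn n x|) by apply: locint_norm; exact: locint_Dn.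
have l2 m : locint (fun x => 2 * `|phi x - Fn m x|) by apply: locintZ; exact: locint_phiF.
have lc (c : R) : locint (fun x => `|phi x - c|).
  by apply: locint_norm; apply: locintB => //; exact: locint_cst.
pose c := Fn n u; pose m := Av n.+1 u.
have bu : blk n.+1 u = j by exact: blk_lo.
have FnE t : u <= t < v -> Fn n t = c.
  by move=> /blk_def ht; apply: (@Fn_blk_le n n.+1) => //; rewrite ht bu.
have AvE t : u <= t < v -> Av n.+1 t = m.
  by move=> /blk_def ht; apply: Av_blk; rewrite ht bu.
rewrite (@eq_iint_co _ (fun x => 2 * `|phi x - Fn n x|) (fun x => 2 * `|phi x - c|))//; last 2 first.
- exact: locintZ.
- by move=> t ht; rewrite FnE.
have [jump|nojump] := boolP (2 * w n.+1 < `|m - c|).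
  rewrite (@eq_iint_co _ _ (fun x => cst (`|m - c|) x + 2 * `|phi x - m|))//; last 3 first.
  - exact: locintD.
  - by apply: locintD; [exact: locint_cst|exact: locintZ].
  - by move=> t ht; rewrite /Dn /= FnE// AvE// jump.
  rewrite iintD; [|exact: locint_cst|exact: locintZ].
  rewrite iint_cst// !iintZ// vu.
  have h1 : iint (fun x => `|phi x - m|) u v <= w n.+1 * ell n.+1 by exact: osc_blk.
  have h2 : `|m - c| * ell n.+1 <= iint (fun x => `|phi x - c|) u v.
    have lpc : locint (fun x => phi x - c) by apply: locintB => //; exact: locint_cst.
    apply: le_trans (le_norm_iint _ _ lpc).
    rewrite iintB//; last exact: locint_cst.
    rewrite iint_cst// vu.
    have -> : iint phi u v = m * ell n.+1.
      by rewrite /m /Av bu /avg -/u -/v vu divfK// gt_eqF.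
    by rewrite -mulrBl normrM (gtr0_norm e0).
  have h3 : 2 * w n.+1 * ell n.+1 <= `|m - c| * ell n.+1.
    by rewrite ler_wpM2r// ltW.
  lra.
rewrite (@eq_iint_co _ _ (fun x => 2 * `|phi x - c|))//.
- exact: locintD.
- exact: locintZ.
- by move=> t ht; rewrite /Dn /= FnE// AvE// (negbTE nojump) subrr normr0 add0r.
Qed.

Lemma potential N n j : (N <= n.+1)%N ->
  iint (fun x => `|Dn n x|) (lo N j) (lo N j + ell N) +
  2 * iint (fun x => `|phi x - Fn n.+1 x|) (lo N j) (lo N j + ell N) <=
  2 * iint (fun x => `|phi x - Fn n x|) (lo N j) (lo N j + ell N).
Proof.
move=> Nn.
have lD : locint (fun x => `|Dn n x|) by apply: locint_norm; exact: locint_Dn.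
have l2 m : locint (fun x => 2 * `|phi x - Fn m x|) by apply: locintZ; exact: locint_phiF.
rewrite -!iintZ; [|exact: locint_phiF|exact: locint_phiF].
rewrite -iintD//.
apply: (iint_blk_le _ (l2 n) Nn); first exact: locintD.
by move=> i; exact: potential_blk.
Qed.

(** The inequality [potential] telescopes: all jumps from generation [N] on cost at most twice the
    distance of [phi] to [Fn N], which is at most [3 * w N * ell N]. *)
Lemma sum_Dn N M j :
  \sum_(N <= k < M) iint (fun x => `|Dn k x|) (lo N j) (lo N j + ell N) <=
    6 * w N * ell N.
Proof.
have F0 m : 0 <= iint (fun x => `|phi x - Fn m x|) (lo N j) (lo N j + ell N) by exact: iint_ge0.
have [MN|NM] := leqP M N.
  by rewrite big_geq//; have := ell_gt0 N; have := w0 N; nra.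
suff H : \sum_(N <= k < M) iint (fun x => `|Dn k x|) (lo N j) (lo N j + ell N) +
  2 * iint (fun x => `|phi x - Fn M x|) (lo N j) (lo N j + ell N) <=
  2 * iint (fun x => `|phi x - Fn N x|) (lo N j) (lo N j + ell N).
  have := F0 M; have := phiF_blk N j; lra.
move: NM; rewrite leq_eqVlt => /predU1P[<-|NM].
  by rewrite big_nat1; exact: potential.
have {NM}/subnK <- : (N <= M)%N by apply: ltnW; exact: ltnW.
elim: (M - N)%N => [|k IH]; first by rewrite big_geq// add0r.
rewrite addSn big_nat_recr/= ?leq_addl//.
have := @potential N (k + N)%N j (leqW (leq_addl _ _)); lra.
Qed.

(** Four errors of size [2 * w n]: each of the two values is compared with the average over its
    block, and each of these averages with the one over the union of both blocks. *)
Lemma Fn_adj n j : `|Fn n (lo n (j + 1)) - Fn n (lo n j)| <= 8 * w n.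
Proof.
(* At generation 0 the union of two blocks would be longer than the circle, but there the process is
   constant. *)
case: n => [|n]; first by rewrite /= subrr normr0 mulr_ge0.
set m := n.+1; have e0 := ell_gt0 m.
set u := lo m j; set v := u + ell m; set z := v + ell m.
have vE : lo m (j + 1) = v by rewrite loD1.
have z2 : z <= u + 2 * pi.
  rewrite /z /v -addrA lerD2l -mulr2n -[_ *+ 2]mulr_natl -ellS; exact: ell_le2pi.
have zu : z - u = 2 * ell m by rewrite /z /v; ring.
have uv : u <= v by rewrite lerDl ltW.
have vz : v <= z by rewrite lerDl ltW.
have h := @osc m u z.
rewrite zu lexx in h; have {}h : iint (fun x => `|phi x - avg u z|) u z <= w m * (2 * ell m).
  by apply: h => //; rewrite /z /v; lra.
have lp : locint (fun x => phi x - avg u z) by apply: locintB => //; exact: locint_cst.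
have ln : locint (fun x => `|phi x - avg u z|) by exact: locint_norm.
have sub a b : u <= a -> b <= z -> b - a = ell m -> `|avg a b - avg u z| <= 2 * w m.
  move=> ua bz ba.
  have ab : a <= b by rewrite -subr_ge0 ba ltW.
  have -> : avg a b - avg u z = iint (fun x => phi x - avg u z) a b / ell m.
    rewrite iintB//; last exact: locint_cst.
    rewrite iint_cst// ba /avg ba; field; rewrite gt_eqF//=.
    by rewrite zu mulf_neq0// gt_eqF.
  rewrite normrM normfV (gtr0_norm e0) ler_pdivrMr//.
  apply: le_trans (le_norm_iint _ _ lp) _.
  apply: le_trans (iint_sub ln _ ua ab bz) _ => //.
  by apply: le_trans h _; lra.
have h1 : `|avg u v - avg u z| <= 2 * w m by apply: sub => //; rewrite /v; ring.
have h2 : `|avg v z - avg u z| <= 2 * w m by apply: sub => //; rewrite /z; ring.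
have a1 : Av m u = avg u v by rewrite /Av blk_lo.
have a2 : Av m v = avg v z by rewrite /Av -[X in blk _ X]vE blk_lo vE.
have f1 := Fn_Av m u; have f2 := Fn_Av m v.
rewrite vE.
have -> : Fn m v - Fn m u = (Fn m v - Av m v) + (avg v z - avg u z) - (avg u v - avg u z) - (Fn m u - Av m u).
  by rewrite a1 a2; ring.
apply: le_trans (ler_normB _ _) _; apply: le_trans (lerD (ler_normB _ _) (lexx _)) _.
have := ler_normD (Fn m v - Av m v) (avg v z - avg u z); lra.
Qed.

Lemma Fn_chain n j (k : nat) : `|Fn n (lo n (j + k%:Z)) - Fn n (lo n j)| <= 8 * w n * k%:R.
Proof.
elim: k => [|k IH]; first by rewrite addr0 subrr normr0 mulr0.
have -> : j + k.+1%:Z = (j + k%:Z) + 1 by rewrite -addrA -PoszD addn1.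
have := Fn_adj n (j + k%:Z); rewrite -[k.+1%:R]natr1 mulrDr mulr1 => h.
apply: le_trans (ler_distD (Fn n (lo n (j + k%:Z))) _ _) _; lra.
Qed.

Lemma Fn_lo n x : Fn n x = Fn n (lo n (blk n x)).
Proof. by apply: Fn_blk; rewrite blk_lo. Qed.

(** The number of block boundaries between [x] and [t] is at most [1 + |x - t| / ell n], and each of
    them costs [8 * w n]. *)
Lemma Fn_dist n x t : `|Fn n t - Fn n x| <= 8 * w n * (1 + `|x - t| / ell n).
Proof.
wlog xt : x t / x <= t.
  move=> H; have [xt|tx] := leP x t; first exact: H.
  by rewrite distrC (distrC x); apply: H; exact: ltW.
have e0 := ell_gt0 n.
have /andP[x1 x2] := blk_itv n x; have /andP[t1 t2] := blk_itv n t.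
have bxt : blk n x <= blk n t.
  by rewrite /blk; apply: le_floor; rewrite ler_pM2r// invr_gt0.
rewrite (Fn_lo n t) (Fn_lo n x).
have [k hk] : exists k : nat, blk n t = blk n x + k%:Z.
  exists `|blk n t - blk n x|%N; rewrite gez0_abs ?subr_ge0//; lia.
rewrite hk; apply: le_trans (Fn_chain _ _ _) _.
rewrite ler_wpM2l ?mulr_ge0// distrC ger0_norm ?subr_ge0//.
rewrite -(ler_pM2r e0) mulrDl divfK ?gt_eqF// mul1r.
move: t1; rewrite hk {1}/lo intrD mulrDl -/(lo n _) -pmulrn; lra.
Qed.

End stopping.
End dyadic.

(** * Double integrals of bounded functions over squares *)

Section double_integral.
Context {R : realType}.
Implicit Types (g h : R * R -> R) (c d : R).

Definition bddmeas2 g := measurable_fun setT g /\ exists M, forall z, `|g z| <= M.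

Definition iint2 g c d := iint (fun x => iint (fun t => g (x, t)) c d) c d.

Lemma bddmeas2D g h : bddmeas2 g -> bddmeas2 h -> bddmeas2 (fun z => g z + h z).
Proof.
move=> [mg [M gM]] [mh [K hK]]; split; first exact: measurable_funD.
by exists (M + K) => z; apply: le_trans (ler_normD _ _) _; rewrite lerD.
Qed.

Lemma bddmeas2M g h : bddmeas2 g -> bddmeas2 h -> bddmeas2 (fun z => g z * h z).
Proof.
move=> [mg [M gM]] [mh [K hK]]; split; first exact: measurable_funM.
by exists (M * K) => z; rewrite normrM ler_pM.
Qed.

Lemma bddmeas2_cst (k : R) : bddmeas2 (cst k).
Proof. by split; [exact: measurable_cst|exists `|k|]. Qed.

Lemma bddmeas2_norm g : bddmeas2 g -> bddmeas2 (fun z => `|g z|).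
Proof.
move=> [mg [M gM]]; split; first exact: measurableT_comp.
by exists M => z; rewrite normr_id.
Qed.

Lemma bddmeas2_sum (I : Type) (r : seq I) (G : I -> R * R -> R) :
  (forall i, bddmeas2 (G i)) -> bddmeas2 (fun z => \sum_(i <- r) G i z).
Proof.
move=> bG; elim: r => [|i r IH].
  by under eq_fun do rewrite big_nil; exact: bddmeas2_cst.
by under eq_fun do rewrite big_cons; exact: bddmeas2D.
Qed.

Lemma bddmeas2_fst (f : R -> R) : bddmeas f -> bddmeas2 (fun z => f z.1).
Proof.
move=> [mf [M fM]]; split; last by exists M => z.
by apply: measurableT_comp => //; exact: measurable_fst.
Qed.

Lemma bddmeas2_snd (f : R -> R) : bddmeas f -> bddmeas2 (fun z => f z.2).
Proof.
move=> [mf [M fM]]; split; last by exists M => z.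
by apply: measurableT_comp => //; exact: measurable_snd.
Qed.

Lemma bddmeas2_sub (f : R -> R) : bddmeas f -> bddmeas2 (fun z => f (z.1 - z.2)).
Proof.
move=> [mf [M fM]]; split; last by exists M => z.
apply: measurableT_comp => //.
by apply: measurable_funB; [exact: measurable_fst|exact: measurable_snd].
Qed.

Lemma bddmeas2_slice g x : bddmeas2 g -> bddmeas (fun t => g (x, t)).
Proof. by move=> [mg [M gM]]; exact: bddmeas_slice gM. Qed.

Lemma bddmeas2_iint g c d : c <= d -> bddmeas2 g -> bddmeas (fun x => iint (fun t => g (x, t)) c d).
Proof.
move=> cd /[dup] bg [mg [M gM]]; split.
  by have [] := @iint_swap R g M c d c d mg gM cd cd.
exists (M * (d - c)) => x.
have l := bddmeas_locint (bddmeas2_slice x bg).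
apply: le_trans (le_norm_iint _ _ l) _; apply: iint_bound => //; exact: locint_norm.
Qed.

Lemma iint2D g h c d : c <= d -> bddmeas2 g -> bddmeas2 h ->
  iint2 (fun z => g z + h z) c d = iint2 g c d + iint2 h c d.
Proof.
move=> cd bg bh; rewrite /iint2 -iintD; last 2 first.
- by apply: bddmeas_locint; exact: bddmeas2_iint.
- by apply: bddmeas_locint; exact: bddmeas2_iint.
apply: eq_iint => x _.
by rewrite iintD//; apply: bddmeas_locint; exact: bddmeas2_slice.
Qed.

Lemma iint2Z (k : R) g c d : c <= d -> bddmeas2 g ->
  iint2 (fun z => k * g z) c d = k * iint2 g c d.
Proof.
move=> cd bg; rewrite /iint2 -iintZ; last by apply: bddmeas_locint; exact: bddmeas2_iint.
apply: eq_iint => x _.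
by rewrite iintZ//; apply: bddmeas_locint; exact: bddmeas2_slice.
Qed.

Lemma iint2_sum (I : Type) (r : seq I) (G : I -> R * R -> R) c d : c <= d ->
  (forall i, bddmeas2 (G i)) ->
  iint2 (fun z => \sum_(i <- r) G i z) c d = \sum_(i <- r) iint2 (G i) c d.
Proof.
move=> cd bG; elim: r => [|i r IH].
  have -> : (fun z : R * R => \sum_(i <- [::]) G i z) = cst 0.
    by apply/funext => z; rewrite big_nil.
  rewrite big_nil /iint2.
  have -> : (fun x : R => iint (fun t => cst 0 (x, t)) c d) = cst 0.
    by apply/funext => x; rewrite iint_cst ?mul0r.
  by rewrite iint_cst ?mul0r.
have -> : (fun z : R * R => \sum_(j <- i :: r) G j z) =
    (fun z => G i z + \sum_(j <- r) G j z).
  by apply/funext => z; rewrite big_cons.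
rewrite iint2D; [|exact: cd|exact: bG|exact: bddmeas2_sum].
by rewrite big_cons IH.
Qed.

Lemma le_iint2 g h c d : c <= d -> bddmeas2 g -> bddmeas2 h ->
  (forall x t, c <= x < d -> c <= t < d -> g (x, t) <= h (x, t)) ->
  iint2 g c d <= iint2 h c d.
Proof.
move=> cd bg bh gh; apply: le_iint_co.
- by apply: bddmeas_locint; exact: bddmeas2_iint.
- by apply: bddmeas_locint; exact: bddmeas2_iint.
- move=> x xcd; apply: le_iint_co.
  + by apply: bddmeas_locint; exact: bddmeas2_slice.
  + by apply: bddmeas_locint; exact: bddmeas2_slice.
  + by move=> t; exact: gh.
Qed.

Lemma iint2_swap g c d : c <= d -> bddmeas2 g ->
  iint2 g c d = iint2 (fun z => g (z.2, z.1)) c d.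
Proof.
by move=> cd [mg [M gM]]; have [_] := @iint_swap R g M c d c d mg gM cd cd.
Qed.

End double_integral.

Section kmaj_lemmas.
Context {R : realType}.
Implicit Types (x t y : R).

Lemma kmaj_ge0 y t : 0 < y -> 0 <= kmaj y t.
Proof.
by move=> y0; rewrite /kmaj divr_ge0 ?sqr_ge0// exprn_ge0// addr_ge0// ltW.
Qed.

Lemma kmaj_le y t : 0 < y -> kmaj y t <= y^-1.
Proof.
move=> y0; have h : 0 < y + `|t| by rewrite ltr_pwDl.
rewrite /kmaj ler_pdivrMr ?exprn_gt0//.
have -> : y ^+ 2 = y^-1 * y ^+ 3 by field; rewrite gt_eqF.
by rewrite ler_pM2l ?invr_gt0// lerXn2r// ?nnegrE ?lerDl// ltW.
Qed.

Lemma kmajN y t : kmaj y (- t) = kmaj y t.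
Proof. by rewrite /kmaj normrN. Qed.

Lemma continuous_kmaj y : 0 < y -> continuous (kmaj y).
Proof.
move=> y0 t; apply: cvgM; first exact: cvg_cst.
apply: cvgV; first by rewrite expf_neq0// gt_eqF// ltr_pwDl.
have cs : continuous (fun s : R => y + `|s|).
  by move=> u; apply: cvgD; [exact: cvg_cst|exact: norm_continuous].
by apply: (@continuous_comp _ _ _ (fun s => y + `|s|) (fun u => u ^+ 3)); [exact: cs|exact: exprn_continuous].
Qed.

Lemma bddmeas_kmaj y : 0 < y -> bddmeas (kmaj y).
Proof.
move=> y0; split; first by apply: continuous_measurable_fun; exact: continuous_kmaj.
by exists y^-1 => t; rewrite ger0_norm ?kmaj_ge0// kmaj_le.
Qed.

Lemma iint_translate (g : R -> R) x a b : measurable_fun setT g ->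
  iint (fun t => g (t - x)) a b = iint g (a - x) (b - x).
Proof.
by move=> mg; rewrite -(@iint_shift _ (- x) g (a - x) (b - x))// !opprK !subrK.
Qed.

Lemma iint_reflect (g : R -> R) x a b : measurable_fun setT g ->
  iint (fun t => g (x - t)) a b = iint g (x - b) (x - a).
Proof.
move=> mg; have mg' : measurable_fun setT (fun t => g (- t)) by exact: measurableT_comp.
transitivity (iint (fun t => g (- (t - x))) a b).
  by apply: eq_iint => t _; rewrite opprB.
rewrite (iint_translate _ _ _ mg').
by rewrite -(iint_opp (x - b) (x - a) mg) !opprB.
Qed.

End kmaj_lemmas.

(** * Mean and semigroup law for combinations of Poisson kernels *)

Section kcomb_integral.
Context {R : realType}.

Lemma bddmeas_kcomb (l : seq (R * nat)) (r : R) : 0 <= r < 1 ->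
  all (fun p => 0 < p.2)%N l -> bddmeas (kcomb l r).
Proof.
move=> rr al; apply: (@continuous_bddmeas_periodic _ _ (2 * pi)).
- by rewrite mulr_gt0// pi_gt0.
- exact: continuous_kcomb.
- exact: kcombD2pi.
Qed.

Lemma exprn_01 (r : R) (e : nat) : 0 <= r < 1 -> (0 < e)%N -> 0 <= r ^+ e < 1.
Proof. by move=> /andP[r0 r1] e0; rewrite exprn_ge0//= exprn_ilt1// -lt0n. Qed.

Lemma iint_kcomb (l : seq (R * nat)) (r v : R) : 0 <= r < 1 ->
  all (fun p => 0 < p.2)%N l ->
  iint (fun x => kcomb l r (v - x)) 0 (2 * pi) = 2 * pi * \sum_(p <- l) p.1.
Proof.
move=> rr al.
have p0 : 0 <= 2 * pi :> R by rewrite mulr_ge0// pi_ge0.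
elim: l al => [_|[a e] l IH /= /andP[e0 al]].
  rewrite /kcomb; under eq_fun do rewrite big_nil.
  by rewrite iint_cst// mul0r big_nil mulr0.
have lk : locint (fun x => kcomb l r (v - x)).
  apply: bddmeas_locint; have [mk [M kM]] := bddmeas_kcomb rr al; split; last by exists M.
  by apply: measurableT_comp => //; exact: measurable_funB.
rewrite /kcomb; under eq_fun do rewrite big_cons.
rewrite iintD//; last by apply: locintZ; apply: locint_pker'; exact: exprn_01.
rewrite iintZ; last by apply: locint_pker'; exact: exprn_01.
rewrite iint_pker ?exprn_01// IH// big_cons/=; ring.
Qed.

Lemma kcomb_semigroup (l : seq (R * nat)) (r s u v : R) : 0 <= r < 1 -> 0 <= s < 1 ->
  all (fun p => 0 < p.2)%N l ->
  iint (fun x => kcomb l r (x - u) * pker s (v - x)) 0 (2 * pi) =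
  2 * pi * \sum_(p <- l) p.1 * pker (r ^+ p.2 * s) (v - u).
Proof.
move=> rr ss al.
have p0 : 0 <= 2 * pi :> R by rewrite mulr_ge0// pi_ge0.
have bs : bddmeas (fun x => pker s (v - x)).
  split; first exact: locint_measurable (locint_pker' v ss).
  by exists (2 / (1 - s)) => t; rewrite ger0_norm ?pker_ge0// pker_le.
elim: l al => [_|[a e] l IH /= /andP[e0 al]].
  rewrite /kcomb; under eq_fun do rewrite big_nil mul0r.
  by rewrite iint_cst// mul0r big_nil mulr0.
have re := exprn_01 rr e0.
have lk : locint (fun x => kcomb l r (x - u) * pker s (v - x)).
  apply: bddmeas_locint; have [mk [M kM]] := bddmeas_kcomb rr al.
  have [ms [K sK]] := bs; split.
    by apply: measurable_funM => //; apply: measurableT_comp => //; exact: measurable_funB.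
  by exists (M * K) => t; rewrite normrM ler_pM.
have lp : locint (fun x => pker (r ^+ e) (x - u) * pker s (v - x)).
  apply: bddmeas_locint; have [ms [K sK]] := bs; split.
    by apply: measurable_funM => //; exact: locint_measurable (locint_pker u re).
  exists (2 / (1 - r ^+ e) * K) => t; rewrite normrM ler_pM//.
  by rewrite ger0_norm ?pker_ge0// pker_le.
rewrite (@eq_iint _ _ (fun x => a * (pker (r ^+ e) (x - u) * pker s (v - x)) +
    kcomb l r (x - u) * pker s (v - x))); last first.
  by move=> x _; rewrite /kcomb big_cons/= mulrDl -mulrA.
rewrite iintD//; last exact: locintZ.
by rewrite iintZ// pker_semigroup// IH// big_cons/=; ring.
Qed.

End kcomb_integral.

(** * Kernel mass across the boundaries of dyadic blocks *)

Section block_boundary.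
Context {R : realType}.
Implicit Types (x t y : R) (n N g : nat) (j : int).

Definition cross g (z : R * R) : R := (blk g z.1 != blk g z.2)%:R.

Lemma measurable_blk2 g : measurable_fun setT (cross g).
Proof.
have mf : measurable_fun setT (fun x : R => (blk g x)%:~R : R).
  by apply: (@measurable_blk _ g) => x y ->.
have -> : cross g = fun z => (\1_(~` [set z : R * R | (blk g z.1)%:~R - (blk g z.2)%:~R = 0 :> R]) z).
  apply/funext => z; rewrite /cross /= indicE; congr (nat_of_bool _)%:R.
  apply/idP/idP => [zz|/set_mem/=].
    by apply/mem_set => /= /eqP; rewrite subr_eq0 eqr_int; exact/negP.
  by apply: contra_notN => /eqP ->; rewrite subrr.
apply: measurable_indic; apply: measurableC.
have -> : [set z : R * R | (blk g z.1)%:~R - (blk g z.2)%:~R = 0 :> R] =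
   setT `&` (fun z : R * R => (blk g z.1)%:~R - (blk g z.2)%:~R : R) @^-1` [set 0].
  by rewrite setTI.
have mh : measurable_fun setT (fun z : R * R => (blk g z.1)%:~R - (blk g z.2)%:~R : R).
  exact: (measurable_funB (measurableT_comp mf measurable_fst) (measurableT_comp mf measurable_snd)).
by apply: mh.
Qed.

Lemma bddmeas2_cross g : bddmeas2 (cross g).
Proof.
split; first exact: measurable_blk2.
by exists 1 => z; rewrite /cross; case: eqP; rewrite ?normr0 ?normr1.
Qed.

Lemma cross_ge0 g z : 0 <= cross g z. Proof. by rewrite /cross ler0n. Qed.

Lemma cross_sym g z : cross g (z.2, z.1) = cross g z.
Proof. by rewrite /cross/= eq_sym. Qed.

Lemma bddmeas_kmaj1 y : 0 < y -> bddmeas (fun s => (y + `|s|) * kmaj y s).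
Proof.
move=> y0; have h (s : R) : 0 < y + `|s| by rewrite ltr_pwDl.
split.
  apply: measurable_funM; last by have [] := bddmeas_kmaj y0.
  by apply: measurable_funD => //; exact: measurableT_comp.
exists 1 => s; rewrite ger0_norm; last by rewrite mulr_ge0 ?kmaj_ge0// ltW.
rewrite /kmaj mulrA ler_pdivrMr ?exprn_gt0// mul1r.
rewrite exprS (exprS _ 2) ler_pM2l// !expr2.
by apply: ler_pM; rewrite ?lerDl// ltW.
Qed.

(** A point [t] in another block lies beyond one end of the block of [x]. The mass of [kmaj y]
    beyond the distance [L] is at most [y ^ 2 / (y + L) ^ 2], that is [(y + L) * kmaj y L]. *)
Lemma cross_mass g y x p q : 0 < y -> p <= q ->
  iint (fun t => cross g (x, t) * kmaj y (x - t)) p q <=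
  (y + `|x - lo g (blk g x)|) * kmaj y (x - lo g (blk g x)) +
  (y + `|x - (lo g (blk g x) + ell g)|) * kmaj y (x - (lo g (blk g x) + ell g)).
Proof.
move=> y0 pq; set u := lo g _; set v := u + ell g.
have e0 := @ell_gt0 R g; have /andP[ux xv] := blk_itv g x; rewrite -/u -/v in ux xv.
have bk : bddmeas2 (fun z => cross g z * kmaj y (z.1 - z.2)).
  by apply: bddmeas2M; [exact: bddmeas2_cross|apply: bddmeas2_sub; exact: bddmeas_kmaj].
have lk : locint (fun t => cross g (x, t) * kmaj y (x - t)).
  exact: bddmeas_locint (bddmeas2_slice x bk).
have lk' : locint (fun t => kmaj y (x - t)).
  exact: bddmeas_locint (bddmeas2_slice x (bddmeas2_sub (bddmeas_kmaj y0))).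
have k0 t : 0 <= cross g (x, t) * kmaj y (x - t) by rewrite mulr_ge0 ?cross_ge0 ?kmaj_ge0.
have kle t : cross g (x, t) * kmaj y (x - t) <= kmaj y (x - t).
  by rewrite ler_piMl ?kmaj_ge0// /cross; case: eqP.
pose p' := Num.min p u; pose q' := Num.max q v.
have p'p : p' <= p by rewrite /p' ge_min lexx.
have p'u : p' <= u by rewrite /p' ge_min lexx orbT.
have qq' : q <= q' by rewrite /q' le_max lexx.
have vq' : v <= q' by rewrite /q' le_max lexx orbT.
have uv : u <= v by rewrite lerDl ltW.
apply: le_trans (iint_sub lk k0 p'p pq qq') _.
rewrite (@iint_split _ _ p' u q')//; last exact: le_trans vq'.
rewrite (@iint_split _ _ u v q')//.
have -> : iint (fun t => cross g (x, t) * kmaj y (x - t)) u v = 0.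
  rewrite (@eq_iint_co _ _ (cst 0))//; first by rewrite iint_cst// mul0r.
    exact: locint_cst.
  by move=> t tuv; rewrite /cross/= (blk_def tuv) eqxx mul0r.
rewrite add0r; apply: lerD.
- apply: (@le_trans _ _ (iint (fun t => kmaj y (x - t)) p' u)); first by apply: le_iint.
  rewrite (@iint_reflect _ (kmaj y)); last by have [] := bddmeas_kmaj y0.
  apply: le_trans (iint_kmaj y0 _ _) _; [lra|lra|].
  rewrite (@ger0_norm _ (x - u)); last lra.
  rewrite /kmaj (@ger0_norm _ (x - u)); last lra.
  have : 0 < y + (x - u) by lra.
  move: (y + (x - u)) => s s0; rewrite le_eqVlt; apply/orP; left; apply/eqP.
  by field; rewrite gt_eqF.
- apply: (@le_trans _ _ (iint (fun t => kmaj y (x - t)) v q')); first by apply: le_iint.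
  rewrite (@eq_iint _ _ (fun t => kmaj y (t - x))); last by move=> t _; rewrite -(kmajN y (x - t)) opprB.
  rewrite (@iint_translate _ (kmaj y)); last by have [] := bddmeas_kmaj y0.
  apply: le_trans (iint_kmaj y0 _ _) _; [lra|lra|].
  rewrite (distrC x v) (@ger0_norm _ (v - x)); last lra.
  rewrite /kmaj (distrC x v) (@ger0_norm _ (v - x)); last lra.
  have : 0 < y + (v - x) by lra.
  move: (y + (v - x)) => s s0; rewrite le_eqVlt; apply/orP; left; apply/eqP.
  by field; rewrite gt_eqF.
Qed.

Lemma iint_blk3 (h : R -> R) N (c : int) : locint h ->
  iint h (lo N (c - 1)) (lo N (c + 1) + ell N) =
  iint h (lo N (c - 1)) (lo N (c - 1) + ell N) +
  iint h (lo N c) (lo N c + ell N) +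
  iint h (lo N (c + 1)) (lo N (c + 1) + ell N).
Proof.
move=> lh; have e0 := @ell_gt0 R N.
have h1 : lo N (c - 1) + ell N = lo N c :> R by rewrite -loD1 subrK.
have h2 : lo N c + ell N = lo N (c + 1) :> R by rewrite loD1.
rewrite (@iint_split _ _ (lo N (c - 1)) (lo N c)) ?h1 ?h2//; last 2 first.
- by rewrite -h1; lra.
- by rewrite -h2; lra.
rewrite (@iint_split _ _ (lo N c) (lo N (c + 1))) ?addrA//; last 2 first.
- by rewrite -h2; lra.
- by lra.
Qed.

(** On a block of generation [g] the weight [h] is constant, and the bound of [cross_mass]
    integrates to at most [y] for each end. Thus [2 * y / ell g] is the share of the block that
    feels its boundary. The window is the block [c] of generation [N] with both neighbours. *)
Lemma cross_blk g N (c : int) y (h : R -> R) : 0 < y -> (N <= g)%N ->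
  bddmeas h -> (forall x, 0 <= h x) -> (forall x t, blk g x = blk g t -> h x = h t) ->
  iint2 (fun z => h z.1 * (cross g z * kmaj y (z.1 - z.2))) (lo N (c - 1)) (lo N (c + 1) + ell N)
  <= 2 * y / ell g * iint h (lo N (c - 1)) (lo N (c + 1) + ell N).
Proof.
move=> y0 Ng bh h0 hblk; set p := lo N (c - 1); set q := _ + ell N.
have eN := @ell_gt0 R N; have eg := @ell_gt0 R g.
have pq : p <= q by rewrite /p /q /lo intrB intrD; nra.
pose B x := (y + `|x - lo g (blk g x)|) * kmaj y (x - lo g (blk g x)) +
  (y + `|x - (lo g (blk g x) + ell g)|) * kmaj y (x - (lo g (blk g x) + ell g)).
have bk : bddmeas2 (fun z => cross g z * kmaj y (z.1 - z.2)).
  by apply: bddmeas2M; [exact: bddmeas2_cross|apply: bddmeas2_sub; exact: bddmeas_kmaj].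
have [mk1 [K kK]] := bddmeas_kmaj1 y0.
have bB : bddmeas B.
  have ml : measurable_fun setT (fun x : R => lo g (blk g x) : R).
    by apply: (@measurable_blk _ g) => x z ->.
  split.
    apply: measurable_funD.
      exact: (measurableT_comp mk1 (measurable_funB (@measurable_id _ _ setT) ml)).
    have mr : measurable_fun setT (fun x : R => lo g (blk g x) + ell g : R) by exact: measurable_funD.
    exact: (measurableT_comp mk1 (measurable_funB (@measurable_id _ _ setT) mr)).
  by exists (K + K) => x; apply: le_trans (ler_normD _ _) _; apply: lerD.
have bhB : bddmeas (fun x => h x * B x).
  have [mh [M hM]] := bh; have [mB [M' BM]] := bB; split; first exact: measurable_funM.
  by exists (M * M') => x; rewrite normrM ler_pM.
have lhB := bddmeas_locint bhB; have lh := bddmeas_locint bh.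
have bhk := bddmeas2M (bddmeas2_fst bh) bk.
apply: (@le_trans _ _ (iint (fun x => h x * B x) p q)).
  apply: le_iint => //; first exact: bddmeas_locint (bddmeas2_iint pq bhk).
  move=> x _; rewrite /= iintZ; last exact: bddmeas_locint (bddmeas2_slice x bk).
  by rewrite ler_wpM2l//; exact: cross_mass.
rewrite -iintZ// /p /q !iint_blk3//; last exact: locintZ.
have key j : iint (fun x => h x * B x) (lo N j) (lo N j + ell N) <=
   iint (fun x => 2 * y / ell g * h x) (lo N j) (lo N j + ell N).
  apply: (iint_blk_le _ _ Ng) => //; first exact: locintZ.
  move=> {}j; set u := lo g j; set v := u + ell g.
  have uv : u <= v by rewrite lerDl ltW.
  have lc (a : R) : locint (fun x => (y + `|x - a|) * kmaj y (x - a)).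
    apply: bddmeas_locint; split; last by exists K => x.
    exact: (measurableT_comp mk1 (measurable_funB (@measurable_id _ _ setT) (measurable_cst a))).
  rewrite (@eq_iint_co _ _ (fun x => h u * ((y + `|x - u|) * kmaj y (x - u) + (y + `|x - v|) * kmaj y (x - v))))//; last 2 first.
  - by apply: locintZ; exact: locintD.
  - move=> x xuv; have bx := blk_def xuv; rewrite /B bx; congr (_ * _).
    by apply: hblk; rewrite bx /u blk_lo.
  rewrite iintZ; last exact: locintD.
  rewrite iintD//.
  rewrite [leRHS](@eq_iint_co _ _ (cst (2 * y / ell g * h u))); last 3 first.
  - exact: locintZ.
  - exact: locint_cst.
  - move=> x xuv; have bx := blk_def xuv; congr (_ * _).
    by apply: hblk; rewrite bx /u blk_lo.
  rewrite iint_cst// (_ : v - u = ell g); last by rewrite /v addrAC subrr add0r.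
  have -> : 2 * y / ell g * h u * ell g = h u * (y + y) by field; rewrite gt_eqF.
  apply: ler_wpM2l => //; apply: lerD.
  + rewrite (@iint_translate _ (fun s => (y + `|s|) * kmaj y s))// subrr.
    apply: le_trans (iint_kmaj1 y0 _ _) _; rewrite ?subr_ge0// addr0.
    by rewrite expr2 mulfK// gt_eqF.
  + rewrite (@eq_iint _ _ (fun x => (y + `|v - x|) * kmaj y (v - x))); last first.
      by move=> x _; rewrite distrC -(kmajN y (x - v)) opprB.
    rewrite (@iint_reflect _ (fun s => (y + `|s|) * kmaj y s))// subrr.
    apply: le_trans (iint_kmaj1 y0 _ _) _; rewrite ?subr_ge0// addr0.
    by rewrite expr2 mulfK// gt_eqF.
by rewrite !lerD.
Qed.

Lemma iint2_sym (G : R * R -> R) a b : a <= b -> bddmeas2 G ->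
  iint2 (fun z => G (z.2, z.1)) a b = iint2 G a b.
Proof. by move=> ab bG; rewrite [RHS]iint2_swap. Qed.

End block_boundary.

(** * Total variation of the smoothed process *)

Section carleson_levels.
Context {R : realType}.
Variables (F ker : nat -> R -> R) (w : nat -> R) (C : R).
Hypothesis Fb : forall n, bddmeas (F n).
Hypothesis Fblk : forall n x t, blk n x = blk n t -> F n x = F n t.
Hypothesis Fper : forall n x, F n (x + 2 * pi) = F n x.
Hypothesis w0 : forall n, 0 <= w n.
Hypothesis wdec : forall n m, (n <= m)%N -> w m <= w n.
Hypothesis Fdist : forall n x t, `|F n t - F n x| <= 8 * w n * (1 + `|x - t| / ell n).
Let D n x := F n.+1 x - F n x.
Hypothesis Dsum : forall N M j,
  \sum_(N <= k < M) iint (fun x => `|D k x|) (lo N j) (lo N j + ell N) <= 6 * w N * ell N.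
Let y n : R := ell n / pi.
Hypothesis C0 : 0 < C.
Hypothesis kb : forall n, bddmeas (ker n).
Hypothesis kper : forall n s, ker n (s + 2 * pi) = ker n s.
Hypothesis kmean : forall n x, iint (fun t => ker n (x - t)) 0 (2 * pi) = 0.
Hypothesis kbd : forall n s, `|s| <= pi -> `|ker n s| <= C * kmaj (y n) s.

(** The convolution is taken without the factor [1 / (2 * pi)]; the normalisation is made in
    [den]. *)
Definition level n x := iint (fun t => F n t * ker n (x - t)) 0 (2 * pi).

Let p0 : 0 < pi :> R. Proof. exact: pi_gt0. Qed.
Let p20 : 0 < 2 * pi :> R. Proof. by rewrite mulr_gt0. Qed.

Let y0 n : 0 < y n. Proof. by rewrite /y divr_gt0// ell_gt0. Qed.

Let E n (z : R * R) := `|F n z.2 - F n z.1| * kmaj (y n) (z.1 - z.2).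

Let bE n : bddmeas2 (E n).
Proof.
apply: bddmeas2M; last by apply: bddmeas2_sub; exact: bddmeas_kmaj.
apply: bddmeas2_norm; apply: bddmeas2D; first exact: bddmeas2_snd.
have [mF [M FM]] := Fb n; split; last by exists M => z; rewrite normrN.
by apply: measurableT_comp => //; exact: (measurableT_comp mF measurable_fst).
Qed.

Let bk' n x : bddmeas (fun t => ker n (x - t)).
Proof. exact: bddmeas2_slice x (bddmeas2_sub (kb n)). Qed.

Lemma bddmeas2_level n : bddmeas2 (fun z => F n z.2 * ker n (z.1 - z.2)).
Proof. by apply: bddmeas2M; [exact: bddmeas2_snd|exact: bddmeas2_sub]. Qed.

Lemma bddmeas_level n : bddmeas (level n).
Proof. exact: bddmeas2_iint (ltW p20) (bddmeas2_level n). Qed.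

(** Since the kernel has mean zero, [F n x] can be subtracted from [F n t]. By periodicity the
    window is centred at [x], which brings [x - t] into the range [|s| <= pi] of the kernel
    bound. *)
Lemma level_le n x : `|level n x| <= C * iint (fun t => E n (x, t)) (x - pi) (x + pi).
Proof.
have lk := bddmeas_locint (bk' n x).
have lFk : locint (fun t => F n t * ker n (x - t)).
  exact: bddmeas_locint (bddmeas2_slice x (bddmeas2_level n)).
have lE : locint (fun t => E n (x, t)) by exact: bddmeas_locint (bddmeas2_slice x (bE n)).
have lh : locint (fun t => F n t * ker n (x - t) - F n x * ker n (x - t)).
  by apply: locintB => //; exact: locintZ.
have -> : level n x = iint (fun t => F n t * ker n (x - t) - F n x * ker n (x - t)) (x - pi) (x + pi).
  rewrite (_ : x + pi = x - pi + 2 * pi); last by rewrite -addrA; congr (_ + _); ring.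
  rewrite iint_period//; last first.
    move=> t; rewrite Fper; congr (_ * _ - _ * _); rewrite -(kper n (x - (t + 2 * pi)));
    by congr ker; ring.
  by rewrite iintB//; [rewrite iintZ// kmean mulr0 subr0|exact: locintZ].
apply: le_trans (le_norm_iint _ _ lh) _; rewrite -iintZ//; apply: le_iint => //.
- exact: locint_norm.
- exact: locintZ.
move=> t /andP[t1 t2]; rewrite -mulrBl (normrM (F n t - F n x)) /E/= [leRHS]mulrCA.
apply: ler_wpM2l => //; apply: kbd; rewrite ler_norml; lra.
Qed.

(** Linear growth against cubic decay: as [ell n = pi * y n >= y n], [Fdist] gives the factor
    [(y n + |x - t|) / y n], and [iint_kmaj1] evaluates what remains. The two alternatives are the
    two sides of [x]. *)
Let far n L x a b : 0 <= L -> L <= pi -> 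
  (a = x - pi /\ b = x - L) \/ (a = x + L /\ b = x + pi) ->
  iint (fun t => E n (x, t)) a b <= 8 * w n * (y n / (y n + L)).
Proof.
move=> L0 Lp ab; have yn := y0 n; have en := @ell_gt0 R n.
have [mk1 [K kK]] := bddmeas_kmaj1 yn.
have lE : locint (fun t => E n (x, t)) by exact: bddmeas_locint (bddmeas2_slice x (bE n)).
have lk : locint (fun t => (y n + `|x - t|) * kmaj (y n) (x - t)).
  exact: bddmeas_locint (bddmeas2_slice x (bddmeas2_sub (bddmeas_kmaj1 yn))).
have yL : 0 < y n + L by rewrite ltr_pwDl.
apply: (@le_trans _ _ (iint (fun t => 8 * w n / y n * ((y n + `|x - t|) * kmaj (y n) (x - t))) a b)).
  apply: le_iint => //; first exact: locintZ.
  move=> t _; rewrite /E/= mulrA; apply: ler_wpM2r; first exact: kmaj_ge0.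
  apply: le_trans (Fdist _ _ _) _; rewrite -[leRHS]mulrA; apply: ler_wpM2l.
    by rewrite mulr_ge0.
  have -> : ell n = pi * y n by rewrite /y mulrC divfK// gt_eqF.
  rewrite mulrDr mulVf ?gt_eqF// lerD2l [leRHS]mulrC.
  apply: ler_wpM2l => //; rewrite lef_pV2 ?posrE//; last exact: mulr_gt0.
  by have := pi_ge2 R; nra.
rewrite iintZ//.
have -> : 8 * w n * (y n / (y n + L)) = 8 * w n / y n * (y n ^+ 2 / (y n + L)).
  by field; rewrite !gt_eqF.
apply: ler_wpM2l; first by apply: divr_ge0; [exact: mulr_ge0|exact: ltW].
have : iint (fun t => (y n + `|x - t|) * kmaj (y n) (x - t)) a b =
    iint (fun s => (y n + `|s|) * kmaj (y n) s) L pi.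
  case: ab => -[-> ->].
    rewrite (@iint_reflect _ (fun s => (y n + `|s|) * kmaj (y n) s))//.
    have -> : x - (x - L) = L by ring.
    by have -> : x - (x - pi) = pi by ring.
  rewrite (@eq_iint _ _ (fun t => (y n + `|t - x|) * kmaj (y n) (t - x))); last first.
    by move=> t _; rewrite distrC -(kmajN (y n) (x - t)) opprB.
  rewrite (@iint_translate _ (fun s => (y n + `|s|) * kmaj (y n) s))//.
  have -> : x + L - x = L by ring.
  by have -> : x + pi - x = pi by ring.
by move=> ->; exact: iint_kmaj1.
Qed.

Lemma kmaj_mass n x :
  iint (fun t => `|F n t - F n x| * kmaj (y n) (x - t)) (x - pi) (x + pi) <= 16 * w n.
Proof.
have lE : locint (fun t => E n (x, t)) by exact: bddmeas_locint (bddmeas2_slice x (bE n)).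
have pi0 := @pi_gt0 R.
rewrite (@iint_split _ (fun t => E n (x, t)) (x - pi) x)//; [|lra|lra].
have := @far n 0 x (x - pi) (x - 0) (lexx _) (ltW p0) (or_introl (conj erefl erefl)).
have := @far n 0 x (x + 0) (x + pi) (lexx _) (ltW p0) (or_intror (conj erefl erefl)).
rewrite subr0 !addr0 divff ?gt_eqF//; lra.
Qed.

Lemma level_near_far N n (c : int) x : (N <= n)%N -> lo N c <= x < lo N c + ell N ->
  `|level n x| <= C * (iint (fun t => E n (x, t)) (lo N (c - 1)) (lo N (c + 1) + ell N)
                       + 32 * w N * y n / ell N).
Proof.
move=> Nn /andP[xl xr]; have eN := @ell_gt0 R N; have yn := y0 n.
have lE : locint (fun t => E n (x, t)) by exact: bddmeas_locint (bddmeas2_slice x (bE n)).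
have E0 t : 0 <= E n (x, t) by rewrite /E/= mulr_ge0 ?kmaj_ge0.
apply: le_trans (level_le _ _) _; apply: ler_wpM2l; first exact: ltW.
(* The window only extends to the distance [pi], which caps [L]; since [ell N <= 2 * pi], still
   [ell N <= 2 * L]. *)
pose L : R := Num.min (ell N) pi.
have L0 : 0 < L by rewrite /L lt_min eN p0.
have Lp : L <= pi by rewrite /L ge_min lexx orbT.
have Le : L <= ell N by rewrite /L ge_min lexx.
have eL : ell N <= 2 * L.
  by rewrite /L; case: (leP (ell N) pi) => _; [lra|exact: ell_le2pi].
rewrite (@iint_split _ _ (x - pi) (x - L)) //; [|lra|lra].
rewrite (@iint_split _ _ (x - L) (x + L) (x + pi)) //; [|lra|lra].
have h1 := @far n L x (x - pi) (x - L) (ltW L0) Lp (or_introl (conj erefl erefl)).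
have h2 := @far n L x (x + L) (x + pi) (ltW L0) Lp (or_intror (conj erefl erefl)).
have h3 : iint (fun t => E n (x, t)) (x - L) (x + L) <=
  iint (fun t => E n (x, t)) (lo N (c - 1)) (lo N (c + 1) + ell N).
  have : lo N (c - 1) = lo N c - ell N :> R by rewrite /lo intrB; ring.
  have : lo N (c + 1) = lo N c + ell N :> R by rewrite loD1.
  by move=> e1 e2; apply: iint_sub => //; rewrite ?e1 ?e2; lra.
have h4 : 8 * w n * (y n / (y n + L)) <= 16 * w N * y n / ell N.
  apply: (@le_trans _ _ (8 * w N * (y n / (y n + L)))).
    by apply: ler_wpM2r; [rewrite divr_ge0 ?addr_ge0// ltW|rewrite ler_wpM2l// wdec].
  rewrite -[leRHS]mulrA (_ : 16 * w N * (y n / ell N) = 8 * w N * (2 * y n / ell N)); last by ring.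
  apply: ler_wpM2l; first by rewrite mulr_ge0.
  rewrite ler_pdivrMr ?addr_gt0// mulrAC ler_pdivlMr//; nra.
have e : 32 * w N * y n / ell N = 16 * w N * y n / ell N + 16 * w N * y n / ell N by ring.
lra.
Qed.

Let bD k : bddmeas (fun x => `|D k x|).
Proof.
have [m1 [M1 F1]] := Fb k; have [m2 [M2 F2]] := Fb k.+1; split.
  by apply: measurableT_comp => //; exact: measurable_funB.
exists (M2 + M1) => x; rewrite normr_id; apply: le_trans (ler_normB _ _) _.
exact: lerD.
Qed.

(** [F n t - F n x] is telescoped from generation [N] on; the jump [D k] contributes only if [x] and
    [t] lie in different blocks of generation [k + 1]. Points of the window are at most [3 * ell N]
    apart, so that [Fdist] bounds the term of generation [N] by [8 * w N * (1 + 3)]. *)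
Lemma E_le N n (c : int) x t : (N <= n)%N ->
  lo N (c - 1) <= x < lo N (c + 1) + ell N -> lo N (c - 1) <= t < lo N (c + 1) + ell N ->
  E n (x, t) <= 32 * w N * (cross N (x, t) * kmaj (y n) (x - t)) +
    \sum_(N <= k < n) (`|D k x| * (cross k.+1 (x, t) * kmaj (y n) (x - t)) +
                       `|D k t| * (cross k.+1 (x, t) * kmaj (y n) (x - t))).
Proof.
move=> Nn xP tP; have eN := @ell_gt0 R N.
under eq_bigr do rewrite -mulrDl mulrA.
rewrite -big_distrl/= mulrA -mulrDl; apply: ler_wpM2r; first exact: kmaj_ge0.
have -> : F n t - F n x = (F N t - F N x) + \sum_(N <= k < n) (D k t - D k x).
  by rewrite sumrB !telescope_sumr//; ring.
apply: le_trans (ler_normD _ _) _; apply: lerD.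
  rewrite /cross/=; case: eqP => [/Fblk ->|_]; first by rewrite subrr normr0 mulr0.
  rewrite mulr1; apply: le_trans (Fdist _ _ _) _.
  have -> : 32 * w N = 8 * w N * 4 by ring.
  apply: ler_wpM2l; first by rewrite mulr_ge0.
  have : `|x - t| / ell N <= 3.
    rewrite ler_pdivrMr// ler_norml.
    have e1 : lo N (c - 1) = lo N c - ell N :> R by rewrite /lo intrB; ring.
    have e2 : lo N (c + 1) = lo N c + ell N :> R by rewrite loD1.
    move: xP tP; rewrite e1 e2 => /andP[? ?] /andP[? ?]; lra.
  lra.
apply: le_trans (ler_norm_sum _ _ _) _; apply: ler_sum => k _.
rewrite /cross/=; case: eqP => [e|_].
  by rewrite /D (Fblk e) (Fblk (blk_eqS e)) subrr normr0 mulr0.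
by rewrite /= mulr1 [leRHS]addrC; exact: ler_normB.
Qed.

Lemma level_blk N n (c : int) : (N <= n)%N ->
  iint (fun x => `|level n x|) (lo N c) (lo N c + ell N) <=
  C * (224 * w N * y n + \sum_(N <= k < n) 4 * y n / ell k.+1 *
    iint (fun x => `|D k x|) (lo N (c - 1)) (lo N (c + 1) + ell N)).
Proof.
move=> Nn; set p := lo N (c - 1); set q := lo N (c + 1) + ell N.
have eN := @ell_gt0 R N; have yn := y0 n.
have pE : p = lo N c - ell N by rewrite /p /lo intrB; ring.
have qE : q = lo N c + 2 * ell N by rewrite /q loD1; ring.
have pq : p <= q by lra.
have bEi := bddmeas2_iint pq (bE n).
have lEi := bddmeas_locint bEi.
have lL := bddmeas_locint (bddmeas_level n).
have lc (a : R) : locint (fun x => iint (fun t => E n (x, t)) p q + cst a x).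
  by apply: locintD => //; exact: locint_cst.
have E0 z : 0 <= E n z by rewrite /E/= mulr_ge0 ?kmaj_ge0.
apply: (@le_trans _ _ (iint (fun x => C * (iint (fun t => E n (x, t)) p q
                       + cst (32 * w N * y n / ell N) x)) (lo N c) (lo N c + ell N))).
  apply: le_iint_co; [exact: locint_norm|exact: locintZ|].
  by move=> x xc; exact: level_near_far.
rewrite iintZ//; apply: ler_wpM2l; first exact: ltW.
rewrite iintD//; last exact: locint_cst.
rewrite iint_cst; last lra.
have -> : 32 * w N * y n / ell N * (lo N c + ell N - lo N c) = 32 * w N * y n.
  by field; rewrite gt_eqF.
(* Of the [224], the far part has used [32]; the other [192] is [32 * 2 * 3], from [cross_blk] at
   generation [N] over a window of length [3 * ell N]. *)
suff : iint (fun x => iint (fun t => E n (x, t)) p q) (lo N c) (lo N c + ell N) <=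
  192 * w N * y n + \sum_(N <= k < n) 4 * y n / ell k.+1 * iint (fun x => `|D k x|) p q.
  by lra.
apply: (@le_trans _ _ (iint2 (E n) p q)).
  by apply: iint_sub => //; [move=> x; exact: iint_ge0|lra|lra|lra].
have bc g : bddmeas2 (fun z => cross g z * kmaj (y n) (z.1 - z.2)).
  by apply: bddmeas2M; [exact: bddmeas2_cross|apply: bddmeas2_sub; exact: bddmeas_kmaj].
pose T1 k (z : R * R) := `|D k z.1| * (cross k.+1 z * kmaj (y n) (z.1 - z.2)).
pose T2 k (z : R * R) := `|D k z.2| * (cross k.+1 z * kmaj (y n) (z.1 - z.2)).
pose T0 (z : R * R) := cst (32 * w N) z.1 * (cross N z * kmaj (y n) (z.1 - z.2)).
have b1 k : bddmeas2 (T1 k) by apply: bddmeas2M => //; exact: (bddmeas2_fst (bD k)).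
have b2 k : bddmeas2 (T2 k) by apply: bddmeas2M => //; exact: (bddmeas2_snd (bD k)).
have bcst : bddmeas (cst (32 * w N) : R -> R) by split => //; exists `|32 * w N|.
have b0 : bddmeas2 T0 by apply: bddmeas2M => //; exact: (bddmeas2_fst bcst).
have b12 k : bddmeas2 (fun z => T1 k z + T2 k z) by exact: bddmeas2D.
apply: (@le_trans _ _ (iint2 (fun z => T0 z + \sum_(k <- index_iota N n) (T1 k z + T2 k z)) p q)).
  apply: le_iint2 => //; first by apply: bddmeas2D => //; exact: bddmeas2_sum.
  by move=> x t xp tp; exact: (E_le Nn xp tp).
rewrite iint2D//; last exact: bddmeas2_sum.
rewrite iint2_sum//; apply: lerD.
  apply: le_trans (@cross_blk R N N c (y n) (cst (32 * w N)) _ (leqnn N) _ _ _) _ => //.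
    by move=> x; rewrite mulr_ge0.
  rewrite iint_cst// (_ : q - p = 3 * ell N); last by lra.
  rewrite le_eqVlt; apply/orP; left; apply/eqP; by field; rewrite gt_eqF.
rewrite !big_nat; apply: ler_sum => k /andP[Nk kn].
have Dk x t : blk k.+1 x = blk k.+1 t -> `|D k x| = `|D k t|.
  by move=> e; rewrite /D (Fblk e) (Fblk (blk_eqS e)).
have k1 : iint2 (T1 k) p q <= 2 * y n / ell k.+1 * iint (fun x => `|D k x|) p q.
  by apply: cross_blk => //; exact: (leq_trans Nk).
rewrite iint2D// -(iint2_sym pq (b2 k)).
have -> : (fun z => T2 k (z.2, z.1)) = T1 k.
  apply/funext => z.
  transitivity (`|D k z.1| * (cross k.+1 (z.2, z.1) * kmaj (y n) (z.2 - z.1))); first by [].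
  by rewrite cross_sym -(kmajN _ (z.2 - z.1)) opprB.
have -> : 4 * y n / ell k.+1 * iint (fun x => `|D k x|) p q =
  2 * y n / ell k.+1 * iint (fun x => `|D k x|) p q +
  2 * y n / ell k.+1 * iint (fun x => `|D k x|) p q by ring.
exact: lerD.
Qed.

(** The sum over [n] is taken before the one over [k]: the [y n] form a geometric series, so
    [y n / ell k.+1] sums to a constant over [n > k]. The jumps of each generation are then charged
    a bounded number of times, and [Dsum] applies on three blocks. *)
Lemma level_sum N M (c : int) : (N <= M)%N ->
  \sum_(N <= n < M) iint (fun x => `|level n x|) (lo N c) (lo N c + ell N) <=
  296 * C * w N * ell N.
Proof.
move=> NM; have eN := @ell_gt0 R N.
pose a k := iint (fun x => `|D k x|) (lo N (c - 1)) (lo N (c + 1) + ell N).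
have a0 k : 0 <= a k by exact: iint_ge0.
have p2 := pi_ge2 R.
have sa : \sum_(N <= k < M) a k <= 18 * w N * ell N.
  rewrite (eq_bigr _ (fun k _ => iint_blk3 N c (bddmeas_locint (bD k)))) !big_split/=.
  have := Dsum N M (c - 1); have := Dsum N M c; have := Dsum N M (c + 1); lra.
have yS n : y n = 2 * y n.+1 by rewrite /y ellS; ring.
apply: (@le_trans _ _ (\sum_(N <= n < M) C * (224 * w N * y n + \sum_(N <= k < n) 4 * y n / ell k.+1 * a k))).
  by rewrite !big_nat; apply: ler_sum => n /andP[Nn _]; exact: level_blk.
(* The geometric sums are kept exact: the [y n] with [N <= n < M] add up to [2 * (y N - y M)], those
   with [k < n < M] to [2 * (y k.+1 - y M)]. The induction on [M] is then an identity at each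
   step. *)
apply: (@le_trans _ _ (C * (448 * w N * (y N - y M) +
    \sum_(N <= k < M) 8 * (y k.+1 - y M) / ell k.+1 * a k))).
  elim: M NM {sa} => [|M IH NM].
    by rewrite leqn0 => /eqP ->; rewrite !(big_geq (leqnn 0)) subrr !mulr0 addr0 mulr0; exact: lexx.
  move: NM; rewrite leq_eqVlt => /predU1P[<-|].
    by rewrite !(big_geq (leqnn N)) subrr !mulr0 addr0 mulr0; exact: lexx.
  rewrite ltnS => NM; rewrite !big_nat_recr//=.
  apply: le_trans (lerD (IH NM) (lexx _)) _.
  rewrite -mulrDr; apply: ler_wpM2l; first exact: ltW.
  rewrite subrr mulr0 mul0r mul0r addr0.
  have -> : \sum_(N <= k < M) 8 * (y k.+1 - y M.+1) / ell k.+1 * a k =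
    \sum_(N <= k < M) 8 * (y k.+1 - y M) / ell k.+1 * a k +
    \sum_(N <= k < M) 4 * y M / ell k.+1 * a k.
    by rewrite -big_split/=; apply: eq_bigr => k _; rewrite (yS M); ring.
  by rewrite (yS M) le_eqVlt; apply/orP; left; apply/eqP; ring.
(* [296 = 224 + 4 * 18]: the first part uses [2 * y N <= ell N], and [18] is [6] for each of the
   three blocks. *)
have -> : 296 * C * w N * ell N = C * (296 * w N * ell N) by ring.
apply: ler_wpM2l; first exact: ltW.
have h1 : 448 * w N * (y N - y M) <= 224 * w N * ell N.
  have := y0 M; have yp : y N * pi = ell N by rewrite /y divfK// gt_eqF.
  have := y0 N; have := w0 N => wN yN yM.
  have : 2 * y N <= ell N by rewrite -yp; nra.
  nra.
have h2 : \sum_(N <= k < M) 8 * (y k.+1 - y M) / ell k.+1 * a k <= 4 * \sum_(N <= k < M) a k.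
  rewrite big_distrr/=; apply: ler_sum => k _; apply: ler_wpM2r => //.
  have ek := @ell_gt0 R k.+1; rewrite ler_pdivrMr//.
  have yp : y k.+1 * pi = ell k.+1 by rewrite /y divfK// gt_eqF.
  have := y0 M; have := y0 k.+1; rewrite -yp => ? ?; nra.
lra.
Qed.

End carleson_levels.

(** * Balayage of measures on the disk *)

Section disk_geometry.
Context {R : realType}.
Implicit Types (z zeta : R * R) (r t x : R) (I : set (R * R)).

Lemma sqnorm_ge0 z : 0 <= sqnorm z.
Proof. by rewrite /sqnorm addr_ge0// sqr_ge0. Qed.

Lemma sqnorm_cis r t : sqnorm (r *: cis t) = r ^+ 2.
Proof. by rewrite /sqnorm/= !exprMn -mulrDr cos2Dsin2 mulr1. Qed.

Lemma polarP z : exists r t, 0 <= r /\ z = r *: cis t.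
Proof.
have [z0|z0] := eqVneq (sqnorm z) 0.
  exists 0, 0; split => //; move: z0; case: z => x y /eqP; rewrite /sqnorm/=.
  by rewrite paddr_eq0 ?sqr_ge0// !sqrf_eq0 => /andP[/eqP -> /eqP ->]; rewrite scale0r.
set r := Num.sqrt (sqnorm z).
have r0 : 0 < r by rewrite sqrtr_gt0 lt_neqAle eq_sym z0 sqnorm_ge0.
have : circle (r^-1 *: z).
  rewrite /circle/= /sqnorm/= !exprMn -mulrDr -/(sqnorm z) exprVn sqr_sqrtr ?sqnorm_ge0//.
  by rewrite mulVf.
move=> /(cis_surj 0)[t _ tE]; exists r, t; split; first exact: ltW.
by rewrite tE scalerA divff ?scale1r// gt_eqF.
Qed.

Lemma disk_cis r t : 0 <= r -> disk (r *: cis t) <-> r < 1.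
Proof.
by move=> r0; rewrite /disk/= sqnorm_cis -[X in _ < X](expr1n _ 2) ltr_pXn2r// nnegrE.
Qed.

Lemma poisson_cis r t x : poisson (r *: cis t) (cis x) = pker r (x - t).
Proof.
rewrite /poisson sqnorm_cis /pker; congr (_ / _).
rewrite /sqnorm/= cosB.
have := cos2Dsin2 t; have := cos2Dsin2 x.
move: (cos x) (sin x) (cos t) (sin t) => c s c' s' h1 h2.
transitivity ((c ^+ 2 + s ^+ 2) - 2 * r * (c * c' + s * s') + r ^+ 2 * (c' ^+ 2 + s' ^+ 2)).
  by rewrite /GRing.scale/=; ring.
by rewrite h1 h2 mulr1.
Qed.

Lemma poisson_ge0 z zeta : disk z -> 0 <= poisson z zeta.
Proof. by move=> dz; rewrite /poisson divr_ge0 ?sqnorm_ge0// subr_ge0 ltW. Qed.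

Lemma continuous_sqnorm : continuous (@sqnorm R).
Proof.
move=> z; rewrite /sqnorm; under eq_fun do rewrite !expr2.
by apply: cvgD; apply: cvgM; (exact: cvg_fst || exact: cvg_snd).
Qed.

Lemma open_disk : open (@disk R).
Proof.
rewrite (_ : disk = (@sqnorm R) @^-1` [set x | x < 1])//.
by apply: open_comp => //; move=> z _; exact: continuous_sqnorm.
Qed.

Lemma measurable_disk : measurable (@disk R).
Proof. by apply: open_measurable_plane; exact: open_disk. Qed.

Lemma measurable_fun_sqnorm : measurable_fun setT (@sqnorm R).
Proof.
by apply: (continuous_measurable_plane openT) => z _; exact: continuous_sqnorm.
Qed.

(** The inverse is continuous except at 0, which is split off as a measurable point. *)
Lemma measurable_fun_inv d (T : measurableType d) (f : T -> R) :
  measurable_fun setT f -> measurable_fun setT (fun y => (f y)^-1).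
Proof.
move=> mf.
have mi : measurable_fun setT (@GRing.inv R).
  have -> : [set: R] = [set 0] `|` ~` [set 0] by rewrite setUv.
  apply/measurable_funU => //; first exact: measurableC.
  split; first exact: measurable_fun_set1.
  apply: open_continuous_measurable_fun; first exact: closed_openC.
  by move=> x /set_mem/= /eqP x0; apply: inv_continuous.
exact: measurableT_comp.
Qed.

Lemma measurable_poisson : measurable_fun setT (fun p : (R * R) * (R * R) => poisson p.1 p.2).
Proof.
apply: measurable_funM.
  by apply: measurable_funB => //; exact: (measurableT_comp measurable_fun_sqnorm).
apply: measurable_fun_inv; apply: (measurableT_comp measurable_fun_sqnorm).
have m1 : measurable_fun setT (fun p : (R * R) * (R * R) => p.1.1) by exact: measurableT_comp.
have m2 : measurable_fun setT (fun p : (R * R) * (R * R) => p.1.2) by exact: measurableT_comp.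
have m3 : measurable_fun setT (fun p : (R * R) * (R * R) => p.2.1) by exact: measurableT_comp.
have m4 : measurable_fun setT (fun p : (R * R) * (R * R) => p.2.2) by exact: measurableT_comp.
by apply: measurable_fun_pair; exact: measurable_funB.
Qed.

(** The square is a countable union of images of compact rectangles under polar coordinates, one for
    each compact piece of the arc. *)
Lemma measurable_carleson_square I : circle_arc I -> measurable (carleson_square I).
Proof.
move=> aI; have [a [b [x [y [ab b2 IE]]]]] := aI.
pose J n : set R := [set` `[(if x then a else a + (b - a) / n.+2%:R),
                            (if y then b - (b - a) / n.+2%:R else b)]].
pose g (p : R * R) : R * R := p.1 *: cis p.2.
have -> : carleson_square I = \bigcup_n (g @` (`[1 - len I / (2 * pi), 1] `*` J n)).
  apply/seteqP; split => z.
    move=> [r /= rI [v Iv <-]]; move: Iv; rewrite {1}IE => -[t tab <-].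
    move: tab; rewrite itv_bigcup_closed// => -[n _ tn].
    by exists n => //; exists (r, t).
  move=> [n _ [[r t] [/= rI tn] <-]]; exists r => //; exists (cis t) => //.
  by rewrite IE; exists t => //; rewrite itv_bigcup_closed//; exists n.
apply: bigcupT_measurable => n; apply: compact_measurable_plane; apply: continuous_compact.
  apply: continuous_subspaceT => p; apply: cvgZ; first exact: cvg_fst.
  by apply: continuous_comp; [exact: cvg_snd|exact: continuous_cis].
by apply: compact_setX; exact: segment_compact.
Qed.

End disk_geometry.

(** * Balayage of the difference of two measures *)

Section signed_difference.
Context {R : realType}.
Local Open Scope ereal_scope.
Variables m1 m2 : {finite_measure set (R * R)%type -> \bar R}.

Definition signed_difference : {charge set (R * R)%type -> \bar R} :=
  cadd (charge_of_finite_measure m1) (copp (charge_of_finite_measure m2)).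

Lemma signed_differenceE A : measurable A -> signed_difference A = m1 A - m2 A.
Proof. by []. Qed.

Let mu := signed_difference.

(** The positive part of [A] is [m1 - m2] on the intersection of [A] with the positive Hahn set,
    hence at most [m1 A]. *)
Let jp_le A : measurable A -> jordan_pos (hahnP mu) A <= m1 A.
Proof.
move=> mA; have [[mP _] _ _ _] := hahnP mu.
rewrite jordan_posE cjordan_posE /crestr0 mem_set// /crestr.
have mAP : measurable (A `&` hahn_pos mu) by exact: measurableI.
rewrite signed_differenceE//.
apply: (@le_trans _ _ (m1 (A `&` hahn_pos mu))).
  by rewrite geeDl// oppe_le0.
by apply: le_measure; rewrite ?inE.
Qed.

Let jn_le A : measurable A -> jordan_neg (hahnP mu) A <= m2 A.
Proof.
move=> mA; have [_ [mN _] _ _] := hahnP mu.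
rewrite jordan_negE cjordan_negE /crestr0 mem_set// /crestr.
have mAP : measurable (A `&` hahn_neg mu) by exact: measurableI.
rewrite signed_differenceE// fin_num_oppeB ?fin_num_measure// addeC.
apply: (@le_trans _ _ (m2 (A `&` hahn_neg mu))).
  by rewrite geeDl// oppe_le0.
by apply: le_measure; rewrite ?inE.
Qed.

Lemma abs_signed_difference A : measurable A -> abs_charge mu A <= m1 A + m2 A.
Proof. by move=> mA; apply: leeD; [exact: jp_le|exact: jn_le]. Qed.

Let le_int (p q : {measure set (R * R)%type -> \bar R}) D (h : R * R -> \bar R) :
  measurable D -> measurable_fun setT h -> (forall z, D z -> 0 <= h z) ->
  (forall A, measurable A -> p A <= q A) ->
  \int[p]_(z in D) h z <= \int[q]_(z in D) h z.
Proof.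
move=> mD mh h0 pq.
have e (m : {measure set (R * R)%type -> \bar R}) :
    \int[m]_(z in D) h z = \int[m]_(z in D) `|h z|.
  by apply: eq_integral => z /set_mem Dz; rewrite gee0_abs// h0.
by rewrite !e; apply: ge0_le_measure_integral => //; exact: measurableT_comp.
Qed.

(** The Jordan parts are only dominated by [m1] and [m2]. But positive part plus [m2] equals
    negative part plus [m1] as measures, and this equality can be rearranged after integration
    because the four integrals are finite. *)
Lemma balayage_signed_difference zeta :
  \int[m1]_(z in disk) (poisson z zeta)%:E < +oo ->
  \int[m2]_(z in disk) (poisson z zeta)%:E < +oo ->
  balayage mu zeta = \int[m1]_(z in disk) (poisson z zeta)%:E
                   - \int[m2]_(z in disk) (poisson z zeta)%:E.
Proof.
pose h z : \bar R := (poisson z zeta)%:E.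
have mD := @measurable_disk R.
have mh : measurable_fun setT h.
  by apply/measurable_EFinP; exact: (measurableT_comp measurable_poisson (pair2_measurable zeta)).
have mhD : measurable_fun disk h by exact: measurable_funTS.
have h0 z : disk z -> 0 <= h z by move=> dz; rewrite lee_fin poisson_ge0.
move=> f1 f2.
have fp : \int[jordan_pos (hahnP mu)]_(z in disk) h z \is a fin_num.
  rewrite ge0_fin_numE ?integral_ge0//; apply: le_lt_trans f1.
  by apply: le_int => //; exact: jp_le.
have fn : \int[jordan_neg (hahnP mu)]_(z in disk) h z \is a fin_num.
  rewrite ge0_fin_numE ?integral_ge0//; apply: le_lt_trans f2.
  by apply: le_int => //; exact: jn_le.
have f1' : \int[m1]_(z in disk) h z \is a fin_num by rewrite ge0_fin_numE ?integral_ge0.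
have f2' : \int[m2]_(z in disk) h z \is a fin_num by rewrite ge0_fin_numE ?integral_ge0.
have : \int[jordan_pos (hahnP mu)]_(z in disk) h z + \int[m2]_(z in disk) h z =
       \int[jordan_neg (hahnP mu)]_(z in disk) h z + \int[m1]_(z in disk) h z.
  rewrite -!ge0_integral_measure_add//; apply: eq_measure_integral => A mA _.
  transitivity (jordan_pos (hahnP mu) A + m2 A); first exact: measure_addE.
  transitivity (jordan_neg (hahnP mu) A + m1 A); last exact/esym/measure_addE.
  have := jordan_decomp (hahnP mu) mA; rewrite signed_differenceE//.
  rewrite /cadd/= /cscale/=.
  have : jordan_pos (hahnP mu) A \is a fin_num by exact: fin_num_measure.
  have : jordan_neg (hahnP mu) A \is a fin_num by exact: fin_num_measure.
  have : m1 A \is a fin_num by exact: fin_num_measure.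
  have : m2 A \is a fin_num by exact: fin_num_measure.
  move=> /fineK <- /fineK <- /fineK <- /fineK <-.
  rewrite -EFinB -EFinM -!EFinD => -[e]; congr EFin; move: e; lra.
rewrite /balayage -/(h _); move: fp fn f1' f2'.
move=> /fineK <- /fineK <- /fineK <- /fineK <-.
by rewrite -!EFinB -!EFinD => -[e]; congr EFin; move: e; lra.
Qed.

End signed_difference.

(** * Poisson integrals of finite measures are finite almost everywhere *)

Section poisson_integral.
Context {R : realType}.
Local Open Scope ereal_scope.

Lemma arclength_circle : arclength (@circle R) = (2 * pi)%:E.
Proof.
have : \int[arclength]_(z in @circle R) 1 = (2 * pi)%:E.
  rewrite integral_arclength//; last exact: measurable_circle.
  rewrite (_ : `[0%R, (2 * pi)%R[ `&` cis @^-1` circle = `[0%R, (2 * pi)%R[)%classic; last first.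
    by apply/seteqP; split => [t []//|t ht]; split => //; exact: circle_cis.
  rewrite integral_cst//= lebesgue_measure_itv/= lte_fin mulr_gt0 ?pi_gt0// mul1e.
  by rewrite -EFinB subr0.
by rewrite integral_cst ?mul1e//; exact: measurable_circle.
Qed.

Lemma arclength_setT : arclength [set: R * R] = (2 * pi)%:E.
Proof.
rewrite -arclength_circle /arclength /pushforward /mrestr/=; congr (lebesgue_measure _).
by apply/seteqP; split => t [] _ ht; split => //; exact: circle_cis.
Qed.

Let arclength_fin : fin_num_fun (@arclength R).
Proof.
by have h : arclength [set: R * R] < +oo; [rewrite arclength_setT ltry|exact: lty_fin_num_fun h].
Qed.

HB.instance Definition _ := Measure_isFinite.Build _ _ _ (@arclength R) arclength_fin.

Lemma ge0_integral_arclength_setT (h : R * R -> \bar R) : measurable_fun setT h ->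
  (forall z, 0 <= h z) -> \int[arclength]_z h z = \int[arclength]_(z in circle) h z.
Proof.
move=> mh h0; have mC := @measurable_circle R.
rewrite !integral_arclength//; last exact: measurable_funTS.
congr (integral _ _ _); apply/seteqP; split => t [? _]; split => //; exact: circle_cis.
Qed.

Variable m : {finite_measure set (R * R)%type -> \bar R}.

Definition poisson_integral (zeta : R * R) : \bar R :=
  \int[m]_(z in disk) (poisson z zeta)%:E.

Let P (p : (R * R) * (R * R)) : \bar R := ((\1_disk p.1)%:E * (poisson p.1 p.2)%:E).

Let mP : measurable_fun setT P.
Proof.
apply: emeasurable_funM; apply/measurable_EFinP; last exact: measurable_poisson.
by apply: measurableT_comp => //; apply: measurable_indic; exact: measurable_disk.
Qed.

Let P0 p : 0 <= P p.
Proof.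
rewrite /P indicE; have [/set_mem d|_] := boolP (p.1 \in _); last by rewrite mul0e.
by rewrite mul1e lee_fin poisson_ge0.
Qed.

Let PE zeta : poisson_integral zeta = \int[m]_z P (z, zeta).
Proof.
rewrite /poisson_integral [LHS]integral_mkcond; apply: eq_integral => z _.
by rewrite patchE /P indicE/=; case: ifPn => _; rewrite ?mul1e ?mul0e.
Qed.

Lemma measurable_poisson_integral : measurable_fun setT poisson_integral.
Proof.
rewrite (_ : poisson_integral = fun zeta => \int[m]_z P (z, zeta)); last exact/funext.
exact: (@measurable_fun_fubini_tonelli_G _ _ _ _ _ m P mP P0).
Qed.

Lemma integral_poisson_circle (z : R * R) : disk z ->
  \int[arclength]_(zeta in circle) (poisson z zeta)%:E = (2 * pi)%:E.
Proof.
have [r [t [r0 ->]]] := polarP z; rewrite disk_cis// => r1.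
have rr : (0 <= r < 1)%R by rewrite r0.
rewrite integral_arclength; [|exact: measurable_circle|]; last first.
  apply: measurable_funTS; apply/measurable_EFinP.
  exact: (measurableT_comp measurable_poisson (pair1_measurable (r *: cis t))).
rewrite (_ : `[0%R, (2 * pi)%R[ `&` cis @^-1` circle = `[0%R, (2 * pi)%R[)%classic; last first.
  by apply/seteqP; split => [x []//|x hx]; split => //; exact: circle_cis.
transitivity (\int[lebesgue_measure]_(x in `[0%R, (2 * pi)%R[) (pker r (t - x))%:E).
  by apply: eq_integral => x _; rewrite poisson_cis -pkerN opprB.
transitivity ((iint (fun x => pker r (t - x)) 0 (2 * pi))%:E); last by rewrite iint_pker.
rewrite iint_EFin; last exact: locint_pker'.
apply: integral_itv_bndo_bndc.
by apply/measurable_EFinP; apply: measurable_funTS; apply: locint_measurable; exact: locint_pker'.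
Qed.

(** Tonelli, with the fact that every Poisson kernel has integral [2 * pi] over the circle.
    Finiteness almost everywhere is read off from it. *)
Lemma integral_poisson_integral :
  \int[arclength]_(zeta in circle) poisson_integral zeta = (2 * pi)%:E * m disk.
Proof.
have mD := @measurable_disk R; have mC := @measurable_circle R.
rewrite -ge0_integral_arclength_setT; last 2 first.
- exact: measurable_poisson_integral.
- by move=> zeta; rewrite PE integral_ge0.
rewrite (eq_integral _ _ (fun zeta _ => PE zeta)).
rewrite -(fubini_tonelli _ mP P0).
transitivity (\int[m]_z ((2 * pi)%:E * (\1_disk z)%:E)).
  apply: eq_integral => z _; have mPz : measurable_fun setT (fun zeta => P (z, zeta)).
    exact: (measurableT_comp mP (pair1_measurable z)).
  have [/set_mem dz|dz] := boolP (z \in (disk : set (R * R))).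
    rewrite indicE mem_set// mule1 -(integral_poisson_circle dz).
    transitivity (\int[arclength]_(zeta in circle) P (z, zeta)).
      exact: ge0_integral_arclength_setT.
    by apply: eq_integral => zeta _; rewrite /P indicE mem_set// mul1e.
  rewrite indicE (negbTE dz) mule0.
  apply: integral0_eq => zeta _; by rewrite /P indicE (negbTE dz) mul0e.
have mI : measurable_fun setT (fun z : R * R => (\1_disk z : R)%:E).
  by apply/measurable_EFinP; exact: measurable_indic.
rewrite ge0_integralZl//; last by rewrite lee_fin mulr_ge0// pi_ge0.
by rewrite integral_indic// setIT.
Qed.

Lemma poisson_integral_fin_ae :
  {ae arclength, forall zeta, circle zeta -> poisson_integral zeta < +oo}.
Proof.
have mC := @measurable_circle R.
have P1 zeta : 0 <= poisson_integral zeta by rewrite PE integral_ge0.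
have ip : arclength.-integrable circle poisson_integral.
  apply/integrableP; split; first by apply: measurable_funTS; exact: measurable_poisson_integral.
  under eq_integral do rewrite gee0_abs//.
  rewrite integral_poisson_integral lte_mul_pinfty//; last by rewrite -ge0_fin_numE// fin_num_measure//; exact: measurable_disk.
  by rewrite lee_fin mulr_ge0// pi_ge0.
apply: filterS (integrable_ae mC ip) => zeta h cz.
by rewrite -ge0_fin_numE//; exact: h.
Qed.

End poisson_integral.

Section as_finite.
Context d (T : measurableType d) (R : realType) (m : {measure set T -> \bar R}).
Variable mfin : fin_num_fun m.

Definition as_finite of fin_num_fun m : set T -> \bar R := m.

HB.instance Definition _ := Measure.copy (as_finite mfin) m.
HB.instance Definition _ := Measure_isFinite.Build _ _ _ (as_finite mfin) mfin.

End as_finite.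

(** * Charges carried by countably many circles *)

Section layers.
Context {R : realType}.
Local Open Scope ereal_scope.
Let lam : {measure set (measurableTypeR R) -> \bar R} := @lebesgue_measure R.

Lemma measurable_radial_circle (r : R) :
  measurable_fun setT ((fun t => r *: cis t) : measurableTypeR R -> R * R).
Proof.
have mc := @measurable_cis R.
by apply: measurable_fun_pair; apply: measurable_funM => //; [exact: (measurableT_comp measurable_fst mc)|exact: (measurableT_comp measurable_snd mc)].
Qed.

(** The measure is the sum of the densities [g i], each carried by the circle of radius [r i]; [K]
    bounds its total mass. It is described through its integrals because only these are used. *)
Lemma layered_measure (r : nat -> R) (g : nat -> R -> R) (K : R) :
  (forall i, bddmeas (g i)) -> (forall i t, (0 <= g i t)%R) ->
  (forall M, (\sum_(i < M) iint (g i) 0 (2 * pi) <= K)%R) ->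
  exists m : {finite_measure set (R * R)%type -> \bar R},
    forall h, measurable_fun setT h -> (forall z, 0 <= h z) ->
      \int[m]_z h z =
      \sum_(i <oo) \int[lebesgue_measure]_(t in `[0%R, (2 * pi)%R[) (h (r i *: cis t) * (g i t)%:E).
Proof.
move=> bg g0 gK.
have mI : measurable (`[0%R, (2 * pi)%R[%classic : set (measurableTypeR R)) by [].
have mg i : measurable_fun setT ((EFin \o g i) : measurableTypeR R -> \bar R).
  by apply/measurable_EFinP; have [] := bg i.
have g0' i (t : measurableTypeR R) : 0 <= (EFin \o g i) t by rewrite lee_fin.
pose lm i : {measure set (R * R)%type -> \bar R} :=
  measure_function_pushforward__canonical__measure_function_Measure
    (density (mrestr lam mI) (mg i) (g0' i)) (measurable_radial_circle (r i)).
pose m0 : {measure set (R * R)%type -> \bar R} := mseries lm 0.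
have int h : measurable_fun setT h -> (forall z, 0 <= h z) -> \int[m0]_z h z =
    \sum_(i <oo) \int[lebesgue_measure]_(t in `[0%R, (2 * pi)%R[) (h (r i *: cis t) * (g i t)%:E).
  move=> mh h0; rewrite ge0_integral_measure_series//.
  apply: eq_eseriesr => i _.
  have mhr : measurable_fun setT ((fun t => h (r i *: cis t)) : measurableTypeR R -> \bar R).
    exact: measurableT_comp mh (measurable_radial_circle (r i)).
  transitivity (\int[density (mrestr lam mI) (mg i) (g0' i)]_t h (r i *: cis t)).
    exact: (@ge0_integral_pushforward _ _ (measurableTypeR R) (R * R)%type R _ (measurable_radial_circle (r i)) (density (mrestr lam mI) (mg i) (g0' i)) setT h).
  rewrite ge0_integral_density//.
  rewrite (@ge0_integral_mrestr _ (measurableTypeR R))//; last 2 first.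
  - exact: emeasurable_funM.
  - by move=> t _; rewrite mule_ge0.
  by rewrite setTI.
have mT : m0 setT < +oo.
  have := int (cst 1) (measurable_cst _) (fun _ => lee01).
  rewrite integral_cst// mul1e => ->.
  apply: (@le_lt_trans _ _ K%:E); last exact: ltry.
  apply: lime_le.
    by apply: is_cvg_nneseries => i _ _; apply: integral_ge0 => t _; rewrite mul1e lee_fin.
  apply: nearW => M; rewrite big_mkord.
  apply: (@le_trans _ _ (\sum_(i < M) iint (g i) 0 (2 * pi))%:E); last by rewrite lee_fin.
  rewrite -sumEFin; apply: lee_sum => i _.
  rewrite iint_EFin; last exact: bddmeas_locint.
  under eq_integral do rewrite mul1e.
  by rewrite integral_itv_bndo_bndc//; apply: measurable_funTS; exact: mg.
have fin : fin_num_fun m0 by exact: lty_fin_num_fun mT.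
by exists (as_finite fin) => h mh h0; rewrite -int.
Qed.

Lemma measurable_balayage (mu : {charge set (R * R)%type -> \bar R}) : measurable_fun setT (balayage mu).
Proof. by apply: emeasurable_funB; exact: measurable_poisson_integral. Qed.

(** Positive and negative parts of the densities give two layered measures, of which the charge is
    the difference. Wherever both Poisson integrals are finite, each is a convergent series of
    nonnegative terms, and their difference is the limit of the partial sums of the convolutions of
    [h i] with the Poisson kernels. *)
Lemma layered_charge (r : nat -> R) (h : nat -> R -> R) (K : R) :
  (forall i, (0 <= r i < 1)%R) -> (forall i, bddmeas (h i)) ->
  (forall M, (\sum_(i < M) iint (fun t => `|h i t|) 0 (2 * pi) <= K)%R) ->
  exists mu : {charge set (R * R)%type -> \bar R},
    (forall A, measurable A -> abs_charge mu A <=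
       \sum_(i <oo) \int[lebesgue_measure]_(t in `[0%R, (2 * pi)%R[)
          ((\1_A (r i *: cis t))%:E * `|h i t|%:E)) /\
    {ae arclength, forall zeta, circle zeta -> forall x, cis x = zeta ->
       balayage mu zeta \is a fin_num /\
       (fun M => \sum_(i < M) iint (fun t => (h i t * pker (r i) (x - t))%R) 0 (2 * pi))%R @ \oo
          --> fine (balayage mu zeta)}.
Proof.
move=> rr bh hK.
pose hp i t : R := ((`|h i t| + h i t) / 2)%R.
pose hn i t : R := ((`|h i t| - h i t) / 2)%R.
have hpn i t : (hp i t + hn i t = `|h i t|)%R by rewrite /hp /hn; lra.
have hpB i t : (hp i t - hn i t = h i t)%R by rewrite /hp /hn; lra.
have p0 i t : (0 <= hp i t)%R.
  by rewrite /hp; have := ler_norm (- h i t)%R; rewrite normrN; lra.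
have n0 i t : (0 <= hn i t)%R by rewrite /hn; have := ler_norm (h i t); lra.
have ple i t : (hp i t <= `|h i t|)%R by have := n0 i t; have := hpn i t; lra.
have nle i t : (hn i t <= `|h i t|)%R by have := p0 i t; have := hpn i t; lra.
have mnh i : measurable_fun setT (fun t => `|h i t|)%R.
  by apply: measurableT_comp => //; exact: (bh i).1.
have bp i : bddmeas (hp i).
  have [mh [M hM]] := bh i; split.
    by apply: measurable_funM => //; exact: measurable_funD.
  by exists M => t; rewrite ger0_norm// (le_trans _ (hM t)).
have bn i : bddmeas (hn i).
  have [mh [M hM]] := bh i; split.
    by apply: measurable_funM => //; exact: measurable_funB.
  by exists M => t; rewrite ger0_norm// (le_trans _ (hM t)).
have labs i : locint (fun t => `|h i t|%R) by exact/locint_norm/bddmeas_locint.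
have pK M : (\sum_(i < M) iint (hp i) 0 (2 * pi) <= K)%R.
  apply: le_trans (hK M); apply: ler_sum => i _; apply: le_iint => //; exact: bddmeas_locint.
have nK M : (\sum_(i < M) iint (hn i) 0 (2 * pi) <= K)%R.
  apply: le_trans (hK M); apply: ler_sum => i _; apply: le_iint => //; exact: bddmeas_locint.
have [m1 m1E] := layered_measure r bp p0 pK.
have [m2 m2E] := layered_measure r bn n0 nK.
exists (signed_difference m1 m2); split.
  move=> A mA; apply: le_trans (abs_signed_difference _ _ mA) _.
  have m1A : m1 A = \int[m1]_z (\1_A z)%:E by rewrite integral_indic// setIT.
  have m2A : m2 A = \int[m2]_z (\1_A z)%:E by rewrite integral_indic// setIT.
  have mi : measurable_fun setT (fun z : R * R => (\1_A z : R)%:E).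
    by apply/measurable_EFinP; exact: measurable_indic.
  have i0 z : 0 <= (\1_A z : R)%:E by rewrite lee_fin.
  have mir i : measurable_fun setT (fun t : R => (\1_A (r i *: cis t) : R)%:E).
    exact: (measurableT_comp mi (measurable_radial_circle (r i))).
  have mih i (g : R -> R) : bddmeas g -> measurable_fun `[0%R, (2 * pi)%R[
      ((fun t => (\1_A (r i *: cis t))%:E * (g t)%:E) : measurableTypeR R -> \bar R).
    move=> [mg _]; apply: measurable_funTS; apply: emeasurable_funM; first exact: mir.
    exact/measurable_EFinP.
  rewrite m1A m2A m1E// m2E//.
  rewrite -nneseriesD//; last 2 first.
  - by move=> i _ _; apply: integral_ge0 => t _; rewrite mule_ge0// lee_fin.
  - by move=> i _ _; apply: integral_ge0 => t _; rewrite mule_ge0// lee_fin.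
  apply: lee_nneseries.
    by move=> i _ _; apply: adde_ge0; apply: integral_ge0 => t _; rewrite mule_ge0// lee_fin.
  move=> i _; rewrite -ge0_integralD//; last 4 first.
  - by move=> t _; rewrite mule_ge0// lee_fin.
  - exact: (mih _ _ (bp i)).
  - by move=> t _; rewrite mule_ge0// lee_fin.
  - exact: (mih _ _ (bn i)).
  rewrite le_eqVlt; apply/orP; left; apply/eqP; apply: eq_integral => t _.
  by rewrite -!EFinM -EFinD -mulrDr hpn.
have fin1 := poisson_integral_fin_ae m1; have fin2 := poisson_integral_fin_ae m2.
apply: (filterS2 _ _ fin1 fin2) => zeta f1 f2 cz x xz.
have {}f1 := f1 cz; have {}f2 := f2 cz.
pose q (m : {finite_measure set (R * R)%type -> \bar R}) := poisson_integral m zeta.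
have qE (m : {finite_measure set (R * R)%type -> \bar R}) (g : nat -> R -> R) :
  (forall i, bddmeas (g i)) -> (forall i t, (0 <= g i t)%R) ->
  (forall h, measurable_fun setT h -> (forall z, 0 <= h z) ->
      \int[m]_z h z =
      \sum_(i <oo) \int[lebesgue_measure]_(t in `[0%R, (2 * pi)%R[) (h (r i *: cis t) * (g i t)%:E)) ->
   q m = \sum_(i <oo) (iint (fun t => g i t * pker (r i) (x - t)) 0 (2 * pi))%:E.
  move=> bg g0 mE.
  transitivity (\int[m]_z ((\1_disk z)%:E * `|(poisson z zeta)%:E|)).
    rewrite /q /poisson_integral [LHS]integral_mkcond; apply: eq_integral => z _.
    rewrite patchE indicE; case: ifPn => [/set_mem dz|_]; rewrite ?mul0e// mul1e.
    by rewrite gee0_abs// lee_fin poisson_ge0.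
  rewrite mE; last 2 first.
  - apply: emeasurable_funM.
      by apply/measurable_EFinP; apply: measurable_indic; exact: measurable_disk.
    apply: measurableT_comp => //; apply/measurable_EFinP.
    exact: (measurableT_comp measurable_poisson (pair2_measurable zeta)).
  - by move=> z; rewrite mule_ge0// lee_fin.
  apply: eq_eseriesr => i _; have /andP[r0 r1] := rr i.
  have lgp : locint (fun t => (g i t * pker (r i) (x - t))%R).
    apply: bddmeas_locint; have [mg [M gM]] := bg i; split.
      by apply: measurable_funM => //; exact: locint_measurable (locint_pker' x (rr i)).
    exists (M * (2 / (1 - r i)))%R => t; rewrite normrM ler_pM//.
    by rewrite ger0_norm ?pker_ge0// pker_le.
  rewrite iint_EFin//.
  transitivity (\int[lebesgue_measure]_(t in `[0%R, (2 * pi)%R[) (g i t * pker (r i) (x - t))%:E).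
    apply: eq_integral => t _; rewrite indicE mem_set ?mul1e; last exact/disk_cis.
    rewrite -xz poisson_cis gee0_abs ?lee_fin ?pker_ge0//.
    by rewrite -EFinM mulrC.
  apply: integral_itv_bndo_bndc; apply/measurable_EFinP; apply: measurable_funTS.
  exact: locint_measurable.
have q1 := qE m1 _ bp p0 m1E; have q2 := qE m2 _ bn n0 m2E.
have conv (m : {finite_measure set (R * R)%type -> \bar R}) (g : nat -> R -> R) :
  (forall i t, (0 <= g i t)%R) -> q m < +oo ->
   q m = \sum_(i <oo) (iint (fun t => g i t * pker (r i) (x - t)) 0 (2 * pi))%:E ->
   q m \is a fin_num /\
   (fun M => \sum_(i < M) iint (fun t => (g i t * pker (r i) (x - t))%R) 0 (2 * pi))%R @ \oo --> fine (q m).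
  move=> g0 qf qS.
  have i0 i : (0 <= iint (fun t => g i t * pker (r i) (x - t)) 0 (2 * pi))%R.
    by apply: iint_ge0 => t _; rewrite mulr_ge0// pker_ge0.
  have qfin : q m \is a fin_num.
    by rewrite ge0_fin_numE// qS; apply: nneseries_ge0 => i _ _; rewrite lee_fin.
  split => //.
  have cv : (fun M => \sum_(0 <= i < M) (iint (fun t => g i t * pker (r i) (x - t)) 0 (2 * pi))%:E) @ \oo --> q m.
    by rewrite qS; apply: is_cvg_nneseries => i _ _; rewrite lee_fin.
  have -> : (fun M => \sum_(i < M) iint (fun t => (g i t * pker (r i) (x - t))%R) 0 (2 * pi))%R =
      fine \o (fun M => \sum_(0 <= i < M) (iint (fun t => g i t * pker (r i) (x - t)) 0 (2 * pi))%:E).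
    by apply/funext => M /=; rewrite sumEFin big_mkord.
  by apply: fine_cvg; rewrite fineK.
have [fq1 c1] := conv _ _ p0 f1 q1; have [fq2 c2] := conv _ _ n0 f2 q2.
rewrite balayage_signed_difference//.
split; first by rewrite fin_numB fq1.
rewrite fineB//.
have -> : (fun M => \sum_(i < M) iint (fun t => (h i t * pker (r i) (x - t))%R) 0 (2 * pi))%R =
  ((fun M => \sum_(i < M) iint (fun t => (hp i t * pker (r i) (x - t))%R) 0 (2 * pi)) \-
   (fun M => \sum_(i < M) iint (fun t => (hn i t * pker (r i) (x - t))%R) 0 (2 * pi)))%R.
  apply/funext => M /=; rewrite -sumrB; apply: eq_bigr => i _.
  have lg (g : nat -> R -> R) : bddmeas (g i) -> locint (fun t => (g i t * pker (r i) (x - t))%R).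
    move=> bg; have /andP[r0 r1] := rr i.
    apply: bddmeas_locint; have [mg [M' gM]] := bg; split.
      by apply: measurable_funM => //; exact: locint_measurable (locint_pker' x (rr i)).
    exists (M' * (2 / (1 - r i)))%R => t; rewrite normrM ler_pM//.
    by rewrite ger0_norm ?pker_ge0// pker_le.
  rewrite -iintB; [|exact: lg|exact: lg].
  by apply: eq_iint => t _; rewrite -mulrBl hpB.
exact: cvgB.
Qed.

End layers.

(** * From VMO to vanishing Carleson measures *)

Section circle_functions.
Context {R : realType}.
Implicit Types (f B : R * R -> R) (a b : R).

(** The sequence [U n] tends to [B] almost everywhere and to [f] in L^1. By Fatou the integral of
    [|f - B|] is at most the lower limit of [e n], which is 0. *)
Lemma ae_eq_of_L1 f B (U : nat -> R -> R) (e : nat -> R) :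
  measurable_fun circle f -> measurable_fun setT B ->
  (forall n, locint (U n)) -> locint (f \o cis) ->
  {ae arclength, forall zeta, circle zeta -> forall x, cis x = zeta ->
     U ^~ x @ \oo --> B zeta} ->
  (\forall n \near \oo, iint (fun x => `|f (cis x) - U n x|) 0 (2 * pi) <= e n) ->
  e @ \oo --> 0 ->
  {ae arclength, forall zeta, circle zeta -> f zeta = B zeta}.
Proof.
move=> mf mB lU lf [N [mN N0 sub]] ULe e0.
have mC := @measurable_circle R.
pose C := circle `&` ~` N; have mCN : measurable C by apply: measurableI => //; exact: measurableC.
pose psi z : \bar R := (f z - B z)%:E.
have mpsi : measurable_fun C psi.
  apply/measurable_EFinP; apply: measurable_funB; last exact: measurable_funTS.
  by apply: measurable_funS mf => //; exact: subIsetl.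
have key : (\int[arclength]_(z in C) `|psi z| = 0)%E.
  apply/eqP; rewrite eq_le; apply/andP; split; last by apply: integral_ge0.
  rewrite integral_arclength//; last exact: measurableT_comp.
  set D := _ `&` _.
  have mD : measurable D.
    apply: measurableI => //; rewrite -[X in measurable X]setTI.
    exact: (@measurable_cis R).
  have mUn n : measurable_fun setT (fun x => `|(f (cis x) - U n x)%:E|%E).
    apply: measurableT_comp => //; apply/measurable_EFinP; apply: measurable_funB.
      exact: (locint_measurable lf).
    exact: locint_measurable (lU n).
  apply: (@le_trans _ _ (\int[lebesgue_measure]_(x in D) limn_einf (fun n => `|(f (cis x) - U n x)%:E|%E))%E).
    rewrite le_eqVlt; apply/orP; left; apply/eqP; apply: eq_integral => x /set_mem[x2 [cx Nx]].
    have cv : U ^~ x @ \oo --> B (cis x).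
      by apply: contrapT => ncv; apply: Nx; apply: sub => /= /(_ cx x erefl).
    suff cv2 : (fun n => `|(f (cis x) - U n x)%:E|%E) @ \oo --> `|psi (cis x)|%E.
      by have [-> _] := cvg_limn_einf_sup cv2.
    apply: cvg_abse; apply: cvg_EFin; first exact: nearW.
    by apply: cvgB => //; exact: cvg_cst.
  apply: (@le_trans _ _ (limn_einf (fun n => \int[lebesgue_measure]_(x in D) `|(f (cis x) - U n x)%:E|)%E)).
    apply: (@fatou _ (measurableTypeR R) R lebesgue_measure D mD (fun n x => `|(f (cis x) - U n x)%:E|%E)) => //.
    by move=> n; exact: (measurable_funTS (mUn n)).
  have e0' : (EFin \o e) @ \oo --> 0%E by apply: cvg_EFin => //; exact: nearW.
  have [<- _] := cvg_limn_einf_sup e0'.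
  rewrite !limn_einf_lim; apply: lee_lim; [exact: is_cvg_einfs|exact: is_cvg_einfs|].
  case: ULe => m _ mU; exists m => // n /= mn.
  apply: le_ereal_inf_tmp => _ [k /= nk <-]; apply: (@le_trans _ _ (\int[lebesgue_measure]_(x in D) `|(f (cis x) - U k x)%:E|)%E).
    by apply: ereal_inf_lbound; exists k.
  apply: (@le_trans _ _ (iint (fun x => `|f (cis x) - U k x|) 0 (2 * pi))%:E).
    rewrite iint_EFin; last by apply: locint_norm; exact: locintB.
    apply: ge0_subset_integral => //.
    - exact: (measurable_funTS (mUn k)).
    - by move=> x [/= xx _]; move: xx; rewrite !in_itv/= => /andP[-> /ltW ->].
  by rewrite lee_fin; apply: mU; exact: leq_trans nk.
have /(ae_eq_integral_abs _ mCN mpsi)[N' [mN' N'0 sub']] := key.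
exists (N `|` N'); split; first exact: measurableU.
  by rewrite measureU0.
move=> z /= /not_implyP[cz fB]; have [Nz|Nz] := pselect (N z); [by left|right].
apply: sub' => /= /(_ (conj cz Nz)) /eqP; rewrite eqe subr_eq0 => /eqP; exact: fB.
Qed.

Lemma in_L1_measurable f : in_L1 f -> measurable_fun circle f.
Proof. by case/integrableP => /measurable_EFinP. Qed.

Lemma in_L1_locint f : in_L1 f -> locint (f \o cis).
Proof.
move=> hf; have mf := in_L1_measurable hf.
have mp : measurable_fun setT (f \o cis) by exact: measurable_fun_cis.
have p0 : 0 < 2 * pi :> R by rewrite mulr_gt0// pi_gt0.
have mabs : measurable_fun setT (fun t => `|(f (cis t))%:E|%E).
  by apply: measurableT_comp => //; exact/measurable_EFinP.
have fin (n : nat) a : (\int[lebesgue_measure]_(t in `[a, (a + (2 * pi) *+ n)%R[) `|(f (cis t))%:E| < +oo)%E.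
  elim: n => [|n IH]; first by rewrite mulr0n addr0 set_itvco0 integral_set0 ltry.
  have aT : a <= a + 2 * pi *+ n by rewrite lerDl mulrn_wge0// ltW.
  rewrite (_ : `[a, (a + 2 * pi *+ n.+1)%R[%classic =
    `[a, (a + 2 * pi *+ n)%R[%classic `|` `[(a + 2 * pi *+ n)%R, (a + 2 * pi *+ n + 2 * pi)%R[%classic); last first.
    rewrite -itv_bndbnd_setU ?bnd_simp//; first by rewrite mulrSr addrA.
    by rewrite lerDl ltW.
  rewrite ge0_integral_setU//; last 2 first.
  - exact: measurable_funTS.
  - apply/disj_setPS => x [/=]; rewrite !in_itv/= => /andP[_ h1] /andP[h2 _].
    by move: (lt_le_trans h1 h2); rewrite ltxx.
  rewrite lte_add_pinfty// (@ge0_integral_period _ (2 * pi) _ (fun t => `|(f (cis t))%:E|%E))//; last first.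
    by move=> t; rewrite cisD2pi.
  have /integrableP[_] := hf; rewrite integral_arclength; [|exact: measurable_circle|by apply: measurableT_comp => //; exact/measurable_EFinP].
  by rewrite (_ : _ `&` _ = `[0%R, (2 * pi)%R[%classic)//; apply/seteqP; split => [t []//|t ht]; split => //; exact: circle_cis.
move=> a b; apply/integrableP; split; first by apply: measurable_funTS; exact/measurable_EFinP.
pose n := (Num.truncn ((b - a) / (2 * pi))).+1.
apply: le_lt_trans (fin n a); apply: ge0_subset_integral => //.
  exact: measurable_funTS.
move=> t /=; rewrite !in_itv/= => /andP[-> tb]; apply: le_lt_trans tb _.
by rewrite -ltrBlDl -(mulr_natr (2 * pi) n) -ltr_pdivrMl// mulrC truncnS_gt.
Qed.

Lemma mean_arc f a b (x y : bool) : in_L1 f -> a < b -> b <= a + 2 * pi ->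
  mean f (cis @` [set` Interval (BSide x a) (BSide y b)]) = avg (f \o cis) a b.
Proof.
move=> hf ab b2; rewrite /mean len_arc// /avg /iint /Rintegral; congr (fine _ / _).
by apply: (@integral_arc _ (EFin \o f)) => //; apply/measurable_EFinP; exact: in_L1_measurable.
Qed.

Lemma oscillation_arc f a b (x y : bool) : in_L1 f -> a < b -> b <= a + 2 * pi ->
  oscillation f (cis @` [set` Interval (BSide x a) (BSide y b)]) =
  iint (fun t => `|f (cis t) - avg (f \o cis) a b|) a b / (b - a).
Proof.
move=> hf ab b2; rewrite /oscillation (@mean_arc f a b x y hf ab b2); rewrite /mean len_arc//.
rewrite /iint /Rintegral; congr (fine _ / _).
apply: (@integral_arc _ (fun z => `|f z - avg (f \o cis) a b|%:E)) => //.
apply/measurable_EFinP; apply: measurableT_comp => //; apply: measurable_funB => //; exact: in_L1_measurable.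
Qed.

Definition max_oscillation f n : R :=
  sup [set oscillation f I | I in [set I | circle_arc I /\ len I <= 2 * ell n]].

Let arc_ell n : exists2 I : set (R * R), circle_arc I & len I <= 2 * ell n.
Proof.
have e0 := @ell_gt0 R n; have := @ell_le2pi R n => e2.
exists (cis @` [set` Interval (BSide true 0) (BSide true (ell n))]).
  by exists 0, (ell n), true, true; split => //; rewrite add0r.
by rewrite len_arc ?add0r//; lra.
Qed.

Lemma oscillation_ge0 f I : 0 <= len I -> 0 <= oscillation f I.
Proof. by move=> l0; rewrite /oscillation /mean divr_ge0// Rintegral_ge0. Qed.

Lemma len_ge0 (I : set (R * R)) : 0 <= len I.
Proof. by rewrite /len fine_ge0. Qed.

Section bmo.
Variables (f : R * R -> R) (hf : BMO f).

Let osc_has_sup n : has_sup [set oscillation f I | I in [set I | circle_arc I /\ len I <= 2 * ell n]].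
Proof.
split; first by have [I aI lI] := arc_ell n; exists (oscillation f I); exists I.
by have [_ [M fM]] := hf; exists M => _ [I [aI _] <-]; apply: fM; exists I.
Qed.

Lemma max_oscillation_ge n I : circle_arc I -> len I <= 2 * ell n ->
  oscillation f I <= max_oscillation f n.
Proof. by move=> aI lI; apply: ub_le_sup; [exact: (osc_has_sup n).2|exists I]. Qed.

Lemma max_oscillation_ge0 n : 0 <= max_oscillation f n.
Proof.
have [I aI lI] := arc_ell n; apply: le_trans (max_oscillation_ge aI lI).
by apply: oscillation_ge0; exact: len_ge0.
Qed.

Lemma max_oscillation_dec n m : (n <= m)%N -> max_oscillation f m <= max_oscillation f n.
Proof.
move=> nm; apply: ge_sup; first exact: (osc_has_sup m).1.
move=> _ [I [aI lI] <-]; apply: max_oscillation_ge => //.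
by apply: le_trans lI _; rewrite ler_pM2l//; exact: ell_mono.
Qed.

Lemma avg_oscillation n a b : a < b -> b <= a + 2 * pi -> b - a <= 2 * ell n ->
  iint (fun x => `|(f \o cis) x - avg (f \o cis) a b|) a b <= max_oscillation f n * (b - a).
Proof.
move=> ab b2 be; rewrite -ler_pdivrMr ?subr_gt0//.
rewrite -(@oscillation_arc f a b true true)//; last exact: hf.1.
apply: max_oscillation_ge; first by exists a, b, true, true.
by rewrite len_arc.
Qed.

End bmo.

Lemma ell_small (d : R) : 0 < d -> exists n, ell n < d.
Proof.
move=> d0; have p0 := @pi_gt0 R.
exists (Num.truncn (2 * pi / d)).+1; set k := _.+1.
have h : 2 * pi / d < k%:R by exact: truncnS_gt.
have k2 : k%:R < 2 ^+ k :> R by rewrite -natrX ltr_nat; exact: ltn_expl.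
by rewrite /ell ltr_pdivrMr ?exprn_gt0// [ltRHS]mulrC -ltr_pdivrMr//; exact: lt_trans k2.
Qed.

Lemma max_oscillation_cvg0 f : VMO f -> max_oscillation f @ \oo --> 0.
Proof.
move=> [hf vf]; apply/cvgrPdist_le => e e0.
have [d d0 fd] := vf e e0.
have [N Nd] : exists n, ell n < d / 2 by apply: ell_small; rewrite divr_gt0.
exists N => // n /= Nn; rewrite sub0r normrN ger0_norm; last exact: max_oscillation_ge0.
apply: ge_sup; first by have [I aI lI] := arc_ell n; exists (oscillation f I); exists I.
move=> _ [I [aI lI] <-]; apply/ltW/fd => //; apply: le_lt_trans lI _.
by have := @ell_mono R _ _ Nn; lra.
Qed.

Lemma ell_between (h : R) : 0 < h <= 2 * pi -> exists n, ell n.+1 < h <= ell n.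
Proof.
move=> /andP[h0 h2]; have ex := ell_small h0.
case: (ex_minnP ex) => -[|n] nh minn; first by move: nh; rewrite ell0; lra.
exists n; rewrite nh/= leNgt; apply/negP => /minn; by rewrite ltnn.
Qed.

End circle_functions.

(** * Decomposition of a function into layers *)

Section decomposition.
Context {R : realType}.
Implicit Types (x t : R) (n N M i : nat).

(** Halving [ell n] takes the square root, see [decayS], so that the Poisson kernels of neighbouring
    generations have powers of one radius. *)
Definition decay n : R := expR (- (ell n / pi)).

Lemma decay_gt0 n : 0 < decay n. Proof. exact: expR_gt0. Qed.

Lemma decay01 n : 0 <= decay n < 1.
Proof.
rewrite ltW ?decay_gt0//= /decay -[ltRHS]expR0 ltr_expR oppr_lt0.
by rewrite divr_gt0 ?pi_gt0// ell_gt0.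
Qed.

Lemma decayS n : decay n = decay n.+1 ^+ 2.
Proof. by rewrite /decay -expRM_natl ellS; congr expR; ring. Qed.

(** Lists of coefficients with exponents. [kl] has mass 1 and first moment [2 - 2 = 0]. The
    difference of two successive [kern0] has coefficients 2, -3, 1 at the powers 2, 4, 8 of
    [decay n]; taking off one factor [decay n] gives the exponents 1, 3, 7 of [ml], of mass 0 and
    first moment [2 - 9 + 7 = 0]. *)
Definition kl : seq (R * nat) := [:: (2, 1%N); (-1, 2%N)].
Definition ml : seq (R * nat) := [:: (2, 1%N); (-3, 3%N); (1, 7%N)].

Definition kern n := kcomb ml (decay n).
(** With the square instead of the fourth power, the difference of two generations would contain
    [decay n] to the power 1, and nothing of that kernel would remain once the factor [decay n] is
    split off. *)
Definition kern0 n := kcomb kl (decay n ^+ 4).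

Lemma decay4 n : 0 <= decay n ^+ 4 < 1. Proof. exact/exprn_01/isT/decay01. Qed.
Lemma decay2 n : 0 <= decay n ^+ 2 < 1. Proof. exact/exprn_01/isT/decay01. Qed.

Lemma kern0S n x : kern0 n.+1 x =
  2 * pker (decay n ^+ 2) x - pker (decay n ^+ 4) x.
Proof.
have e : decay n.+1 ^+ 4 = decay n ^+ 2 by rewrite (decayS n) -exprM.
rewrite /kern0 /kcomb e !big_cons big_nil/= addr0 expr1 -exprM; ring.
Qed.

Lemma kern0_diff n x : \sum_(p <- ml) p.1 * pker (decay n ^+ p.2 * decay n) x =
  kern0 n.+1 x - kern0 n x.
Proof.
rewrite kern0S /kern0 /kcomb !big_cons !big_nil/= -!exprSr !expr1 -exprM.
ring.
Qed.

Section stopped.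
Variables (phi : R -> R) (w : nat -> R).
Hypothesis lphi : locint phi.
Hypothesis phi2pi : forall x, phi (x + 2 * pi) = phi x.
Hypothesis w0 : forall n, 0 <= w n.
Hypothesis wdec : forall n m, (n <= m)%N -> w m <= w n.
Hypothesis osc : forall n a b, a < b -> b <= a + 2 * pi -> b - a <= 2 * ell n ->
  iint (fun x => `|phi x - avg phi a b|) a b <= w n * (b - a).

Let F := Fn phi w.
Let D n x := F n.+1 x - F n x.
Let G := level F kern.
Let p0 : 0 < 2 * pi :> R. Proof. by rewrite mulr_gt0// pi_gt0. Qed.

Let Fb n : bddmeas (F n). Proof. exact: Fn_bddmeas. Qed.
Let Db n : bddmeas (D n). Proof. exact: Dn_bddmeas. Qed.
Let kb n : bddmeas (kern n). Proof. by rewrite /kern; apply: bddmeas_kcomb => //; exact: decay01. Qed.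
Let k0b n : bddmeas (kern0 n). Proof. by rewrite /kern0; apply: bddmeas_kcomb => //; exact: decay4. Qed.
Let Gb n : bddmeas (G n). Proof. exact: (bddmeas_level Fb kb). Qed.

(* Layer 3n + j carries the j-th of the densities produced at generation n. *)
Definition rad i : R :=
  let n := (i %/ 3)%N in
  if (i %% 3)%N is j.+1 then if j is _.+1 then decay n else decay n ^+ 4
  else decay n ^+ 2.

(** One factor [(2 * pi)^-1] normalises the convolution in [approx]. The second one, in front of
    [G n], compensates the [2 * pi] of the semigroup law. *)
Definition den i t : R :=
  let n := (i %/ 3)%N in
  (2 * pi)^-1 *
  (if (i %% 3)%N is j.+1 then if j is _.+1 then (2 * pi)^-1 * G n t else - D n t
   else 2 * D n t).

Lemma rad01 i : 0 <= rad i < 1.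
Proof. by rewrite /rad; case: (i %% 3)%N => [|[|j]]; [exact: decay2|exact: decay4|exact: decay01]. Qed.

Lemma rad_gt0 i : 0 < rad i.
Proof. by rewrite /rad; case: (i %% 3)%N => [|[|j]]; rewrite ?exprn_gt0// decay_gt0. Qed.

Lemma rad_le i : rad i <= decay (i %/ 3)%N.
Proof.
have /andP[d0 d1] := decay01 (i %/ 3)%N.
rewrite /rad; case: (i %% 3)%N => [|[|j]]//.
- by rewrite expr2 ler_piMr// ltW.
- by rewrite exprS ler_piMr// exprn_ile1// ltW.
Qed.

Let bddZ (c : R) (g : R -> R) : bddmeas g -> bddmeas (fun t => c * g t).
Proof.
move=> [mg [M gM]]; split; first exact: measurable_funM.
by exists (`|c| * M) => t; rewrite normrM ler_wpM2l.
Qed.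

Lemma den_bddmeas i : bddmeas (den i).
Proof.
rewrite /den; apply: bddZ; case: (i %% 3)%N => [|[|j]].
- exact: bddZ.
- by under eq_fun do rewrite -mulN1r; exact: bddZ.
- exact: bddZ.
Qed.

Lemma den0 n t : den (n * 3) t = (2 * pi)^-1 * (2 * D n t).
Proof. by rewrite /den modnMl mulnK. Qed.

Lemma den1 n t : den (n * 3).+1 t = (2 * pi)^-1 * (- D n t).
Proof.
have e1 : ((n * 3).+1 %/ 3 = n)%N by lia.
have e2 : ((n * 3).+1 %% 3 = 1)%N by lia.
by rewrite /den e1 e2.
Qed.

Lemma den2 n t : den (n * 3).+2 t = (2 * pi)^-1 * ((2 * pi)^-1 * G n t).
Proof.
have e1 : ((n * 3).+2 %/ 3 = n)%N by lia.
have e2 : ((n * 3).+2 %% 3 = 2)%N by lia.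
by rewrite /den e1 e2.
Qed.

Lemma rad0 n : rad (n * 3) = decay n ^+ 2.
Proof. by rewrite /rad modnMl mulnK. Qed.

Lemma rad1 n : rad (n * 3).+1 = decay n ^+ 4.
Proof.
have e1 : ((n * 3).+1 %/ 3 = n)%N by lia.
have e2 : ((n * 3).+1 %% 3 = 1)%N by lia.
by rewrite /rad e1 e2.
Qed.

Lemma rad2 n : rad (n * 3).+2 = decay n.
Proof.
have e1 : ((n * 3).+2 %/ 3 = n)%N by lia.
have e2 : ((n * 3).+2 %% 3 = 2)%N by lia.
by rewrite /rad e1 e2.
Qed.

Definition approx N x := (2 * pi)^-1 * iint (fun t => F N t * kern0 N (x - t)) 0 (2 * pi).

Let bprod (f g : R -> R) x : bddmeas f -> bddmeas g -> locint (fun t => f t * g (x - t)).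
Proof.
move=> bf bg; apply: bddmeas_locint.
exact: bddmeas2_slice x (bddmeas2M (bddmeas2_snd bf) (bddmeas2_sub bg)).
Qed.

Let bpker (r : R) : 0 <= r < 1 -> bddmeas (pker r).
Proof.
move=> rr; split; first by apply: continuous_measurable_fun; exact: continuous_pker.
by exists (2 / (1 - r)) => t; rewrite ger0_norm ?pker_ge0// pker_le.
Qed.

(** Fubini and the semigroup law put back the factor that was split off: the balayage of the density
    [G n] on the circle of radius [decay n] is the change of the smoothing kernel, applied to
    [F n]. *)
Lemma level_pker n x : iint (fun t => G n t * pker (decay n) (x - t)) 0 (2 * pi) =
  2 * pi * iint (fun u => F n u * (kern0 n.+1 (x - u) - kern0 n (x - u))) 0 (2 * pi).
Proof.
have bp := bpker (decay01 n).
pose H (z : R * R) := F n z.2 * kern n (z.1 - z.2) * pker (decay n) (x - z.1).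
have bxp : bddmeas (fun t => pker (decay n) (x - t)).
  exact: bddmeas2_slice x (bddmeas2_sub bp).
have bH : bddmeas2 H.
  apply: bddmeas2M; last exact: (bddmeas2_fst bxp).
  by apply: bddmeas2M; [exact: bddmeas2_snd|exact: bddmeas2_sub].
transitivity (iint2 H 0 (2 * pi)).
  apply: eq_iint => t _; rewrite /G /level mulrC -iintZ; last exact: bprod.
  by apply: eq_iint => u _; rewrite /H mulrC.
rewrite iint2_swap ?(ltW p0)// /iint2 -iintZ; last first.
  apply: (@bprod (F n) (fun s => kern0 n.+1 s - kern0 n s)) => //.
  have [m1 [M1 k1]] := k0b n.+1; have [m2 [M2 k2]] := k0b n; split; first exact: measurable_funB.
  by exists (M1 + M2) => s; apply: le_trans (ler_normB _ _) _; rewrite lerD.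
apply: eq_iint => u _; rewrite /H /=.
have lk : locint (fun t => kern n (t - u) * pker (decay n) (x - t)).
  apply: bddmeas_locint; have [mk [M1 k1]] := kb n; have [mp [M2 k2]] := bxp; split.
    apply: measurable_funM => //; apply: (measurableT_comp mk).
    exact: measurable_funB.
  by exists (M1 * M2) => t; rewrite normrM ler_pM.
under eq_fun do rewrite -mulrA.
by rewrite iintZ// kcomb_semigroup ?decay01// kern0_diff mulrCA.
Qed.

(** The increment is [D N] smoothed by [kern0 N.+1] plus [F N] smoothed by [kern0 N.+1 - kern0 N].
    The first term is a combination of two Poisson kernels and gives two layers, the second one
    gives the third. *)
Lemma approxS N x : approx N.+1 x = approx N x +
  (iint (fun t => den (N * 3) t * pker (rad (N * 3)) (x - t)) 0 (2 * pi) +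
   iint (fun t => den (N * 3).+1 t * pker (rad (N * 3).+1) (x - t)) 0 (2 * pi) +
   iint (fun t => den (N * 3).+2 t * pker (rad (N * 3).+2) (x - t)) 0 (2 * pi)).
Proof.
have b2 := bpker (decay2 N); have b4 := bpker (decay4 N); have b1 := bpker (decay01 N).
have dP (c r : R) (g : R -> R) : bddmeas g -> bddmeas (pker r) ->
    iint (fun t => c * g t * pker r (x - t)) 0 (2 * pi) = c * iint (fun t => g t * pker r (x - t)) 0 (2 * pi).
  move=> bg bp; rewrite -iintZ; last exact: bprod.
  by apply: eq_iint => t _; rewrite mulrA.
have -> : iint (fun t => den (N * 3) t * pker (rad (N * 3)) (x - t)) 0 (2 * pi) =
   (2 * pi)^-1 * 2 * iint (fun t => D N t * pker (decay N ^+ 2) (x - t)) 0 (2 * pi).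
  rewrite -dP//; apply: eq_iint => t _; rewrite den0 rad0; ring.
have -> : iint (fun t => den (N * 3).+1 t * pker (rad (N * 3).+1) (x - t)) 0 (2 * pi) =
   - (2 * pi)^-1 * iint (fun t => D N t * pker (decay N ^+ 4) (x - t)) 0 (2 * pi).
  rewrite -dP//; apply: eq_iint => t _; rewrite den1 rad1; ring.
have -> : iint (fun t => den (N * 3).+2 t * pker (rad (N * 3).+2) (x - t)) 0 (2 * pi) =
   (2 * pi)^-1 * (2 * pi)^-1 * iint (fun t => G N t * pker (decay N) (x - t)) 0 (2 * pi).
  rewrite -dP//; apply: eq_iint => t _; rewrite den2 rad2; ring.
have l1 := bprod x (Fb N) (k0b N.+1); have l2 := bprod x (Fb N) (k0b N).
rewrite level_pker.
have -> : iint (fun u => F N u * (kern0 N.+1 (x - u) - kern0 N (x - u))) 0 (2 * pi) =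
  iint (fun u => F N u * kern0 N.+1 (x - u)) 0 (2 * pi) - iint (fun u => F N u * kern0 N (x - u)) 0 (2 * pi).
  by rewrite -iintB//; apply: eq_iint => t _; rewrite mulrBr.
rewrite /approx.
have -> : iint (fun t => F N.+1 t * kern0 N.+1 (x - t)) 0 (2 * pi) =
  iint (fun u => F N u * kern0 N.+1 (x - u)) 0 (2 * pi) +
  (2 * iint (fun t => D N t * pker (decay N ^+ 2) (x - t)) 0 (2 * pi) -
   iint (fun t => D N t * pker (decay N ^+ 4) (x - t)) 0 (2 * pi)).
  have ld2 := bprod x (Db N) b2; have ld4 := bprod x (Db N) b4.
  rewrite -iintZ// -iintB//; last exact: locintZ.
  rewrite -iintD//; last by apply: locintB => //; exact: locintZ.
  by apply: eq_iint => t _; rewrite kern0S /D; ring.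
have alg (p a b c d : R) : p != 0 -> p^-1 * (a + (2 * c - d)) =
  p^-1 * b + (p^-1 * 2 * c + - p^-1 * d + p^-1 / p * (p * (a - b))).
  by move=> pn; field.
by apply: alg; rewrite gt_eqF.
Qed.

Lemma approxE N x : approx N x = avg phi 0 (2 * pi) +
  \sum_(i < N * 3) iint (fun t => den i t * pker (rad i) (x - t)) 0 (2 * pi).
Proof.
elim: N => [|N IH].
  rewrite big_ord0 addr0 /approx /F/=.
  rewrite iintZ; last exact: bddmeas_locint (bddmeas2_slice x (bddmeas2_sub (k0b 0))).
  rewrite iint_kcomb ?decay4// !big_cons big_nil/=.
  rewrite (_ : 2 + (-1 + 0) = 1); last by ring.
  by rewrite mulr1 mulrCA mulVf ?mulr1// gt_eqF.
rewrite approxS IH mulSn -[(3 + _)%N]/(_.+3) !big_ord_recr/= -!addrA.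
by congr (_ + (_ + _)).
Qed.

Let Fdist n x t : `|F n t - F n x| <= 8 * w n * (1 + `|x - t| / ell n).
Proof. exact: Fn_dist. Qed.

Lemma approx_locint N : locint (approx N).
Proof.
apply: locintZ; apply: bddmeas_locint.
exact: (bddmeas2_iint (ltW p0) (bddmeas2M (bddmeas2_snd (Fb N)) (bddmeas2_sub (k0b N)))).
Qed.

Let kmaj4 (y s : R) : 0 < y -> kmaj (4 * y) s <= 16 * kmaj y s.
Proof.
move=> y0; have h : 0 < y + `|s| by rewrite ltr_pwDl.
rewrite /kmaj (_ : 16 * (y ^+ 2 / (y + `|s|) ^+ 3) = (4 * y) ^+ 2 / (y + `|s|) ^+ 3); last by ring.
apply: ler_wpM2l; first exact: sqr_ge0.
rewrite lef_pV2 ?posrE ?exprn_gt0//; last by rewrite ltr_pwDl// mulr_gt0.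
by rewrite lerXn2r ?nnegrE ?lerD2r; lra.
Qed.

(** As [kern0 N] has mean 1, the difference is the integral of [F N t - F N x] against [kern0 N], to
    which [kmaj_mass] applies. *)
Lemma approx_dist : exists2 C, 0 <= C & forall N x, (2 <= N)%N -> `|approx N x - F N x| <= C * w N.
Proof.
have [|C C0 HC] := @kcomb_bound R kl isT; first by rewrite !big_cons big_nil/=; ring.
have pp := pi_gt0 R.
exists ((2 * pi)^-1 * (16 * C * 16)).
  by rewrite mulr_ge0 ?invr_ge0 ?(ltW p0)//; lra.
move=> N x N2; have eN := @ell_gt0 R N.
pose y : R := ell N / pi; have y0 : 0 < y by rewrite divr_gt0.
(* The radius of [kern0 N] is [expR (- (4 * y))], and [N >= 2] brings [4 * y] into the range of
   [kcomb_bound]. *)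
have y2 : 4 * y <= 2.
  rewrite /y mulrA ler_pdivrMr//; have := @ell_mono R _ _ N2; rewrite /ell.
  by rewrite (_ : 2 ^+ 2 = 4); [lra|ring].
have kb4 s : `|s| <= pi -> `|kern0 N s| <= C * kmaj (4 * y) s.
  move=> sp; rewrite /kern0 /decay -expRM_natl mulrN; apply: HC => //.
  by rewrite y2 andbT mulr_gt0.
have lk := bddmeas_locint (bddmeas2_slice x (bddmeas2_sub (k0b N))).
have lFk := bprod x (Fb N) (k0b N).
have lh : locint (fun t => F N t * kern0 N (x - t) - F N x * kern0 N (x - t)).
  by apply: locintB => //; exact: locintZ.
have lE : locint (fun t => `|F N t - F N x| * kmaj y (x - t)).
  apply: bddmeas_locint; have [mF [M1 FM]] := Fb N.
  have [mk [M2 kM]] : bddmeas (fun t => kmaj y (x - t)).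
    exact: bddmeas2_slice x (bddmeas2_sub (bddmeas_kmaj y0)).
  split.
    apply: measurable_funM => //; apply: measurableT_comp => //; exact: measurable_funB.
  exists ((M1 + M1) * M2) => t; rewrite normrM normr_id ler_pM//.
  by apply: le_trans (ler_normB _ _) _; rewrite lerD.
have -> : approx N x - F N x = (2 * pi)^-1 *
  iint (fun t => F N t * kern0 N (x - t) - F N x * kern0 N (x - t)) 0 (2 * pi).
  rewrite iintB//; last exact: locintZ.
  rewrite iintZ// iint_kcomb ?decay4// !big_cons big_nil/= (_ : 2 + (-1 + 0) = 1); last by ring.
  by rewrite mulr1 mulrBr /approx; congr (_ - _); rewrite mulrCA mulVf ?mulr1// gt_eqF.
rewrite (normrM (2 * pi)^-1) ger0_norm ?invr_ge0 ?(ltW p0)// -[leRHS]mulrA.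
apply: ler_wpM2l; first by rewrite invr_ge0 ltW.
rewrite -(@iint_period _ (2 * pi) (x - pi))//; last first.
  move=> t; have -> : kern0 N (x - (t + 2 * pi)) = kern0 N (x - t).
    by rewrite /kern0 -(kcombD2pi _ _ (x - (t + 2 * pi))); congr kcomb; ring.
  by rewrite /F Fn_period.
apply: le_trans (le_norm_iint _ _ lh) _.
have -> : x - pi + 2 * pi = x + pi by ring.
apply: (@le_trans _ _ (iint (fun t => 16 * C * (`|F N t - F N x| * kmaj y (x - t))) (x - pi) (x + pi))).
  apply: le_iint; [exact: locint_norm|exact: locintZ|].
  move=> t /andP[t1 t2]; rewrite -mulrBl (normrM (F N t - F N x)) [leRHS]mulrCA.
  apply: ler_wpM2l => //; apply: le_trans (kb4 _ _) _; first by rewrite ler_norml; lra.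
  by rewrite (mulrC 16) -mulrA; apply: ler_wpM2l (kmaj4 _ y0); exact: ltW.
rewrite iintZ// -!mulrA; do 2! (apply: ler_wpM2l; first by rewrite ?ltW).
exact: (kmaj_mass Fb w0 Fdist).
Qed.

Lemma approx_L1 : exists2 C, 0 <= C & forall N, (2 <= N)%N ->
  iint (fun x => `|phi x - approx N x|) 0 (2 * pi) <= C * w N.
Proof.
have [C C0 HC] := approx_dist; exists (2 * pi * (3 + C)).
  by rewrite mulr_ge0 ?(ltW p0)// addr_ge0.
move=> N N2; have lF := bddmeas_locint (Fb N); have lA := approx_locint N.
have lpF : locint (fun x => `|phi x - F N x|) by apply: locint_norm; exact: locintB.
apply: (@le_trans _ _ (iint (fun x => `|phi x - F N x| + cst (C * w N) x) 0 (2 * pi))).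
  apply: le_iint; [by apply: locint_norm; exact: locintB|by apply: locintD => //; exact: locint_cst|].
  move=> x _; apply: le_trans (ler_distD (F N x) _ _) _; rewrite lerD2l distrC; exact: HC.
rewrite iintD//; last exact: locint_cst.
rewrite iint_cst ?(ltW p0)// subr0.
suff : iint (fun x => `|phi x - F N x|) 0 (2 * pi) <= 3 * w N * (2 * pi) by lra.
have := @iint_blk_le R (fun x => `|phi x - F N x|) (cst (3 * w N)) 0 N lpF (locint_cst _) (leq0n N).
move=> /(_ _ 0); rewrite /lo mul0r add0r ell0 iint_cst ?(ltW p0)// subr0; apply=> j.
rewrite iint_cst; last by rewrite lerDl ltW// ell_gt0.
by rewrite addrAC subrr add0r; exact: phiF_blk.
Qed.

Lemma den_sum : exists2 K, 0 <= K & forall N M (c : int), (N <= M)%N ->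
  \sum_(N * 3 <= i < M * 3) iint (fun t => `|den i t|) (lo N c) (lo N c + ell N) <= K * w N * ell N.
Proof.
have [|C C0 HC] := @kcomb_bound R ml isT; first by rewrite !big_cons big_nil/=; ring.
have pp := pi_gt0 R; have q0 : 0 <= (2 * pi)^-1 :> R by rewrite invr_ge0 ltW.
(* The first two layers of a generation weigh [2 + 1] times [D n], and [sum_Dn] costs [6]; this
   makes [18]. The other term is the bound of [level_sum] for the third layer. *)
exists ((2 * pi)^-1 * 18 + (2 * pi)^-1 * (2 * pi)^-1 * (296 * C)).
  rewrite -mulrA -mulrDr; apply: mulr_ge0; first exact: q0.
  by have := mulr_ge0 q0 (ltW C0); lra.
move=> N M c NM.
have HG := @level_sum R F kern w C Fb (@Fn_blk R phi w) (Fn_period w lphi phi2pi) w0 wdec Fdist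
  (sum_Dn lphi phi2pi w0 osc) C0 kb _ _ _ N M c NM.
have {}HG : \sum_(N <= n < M) iint (fun x => `|G n x|) (lo N c) (lo N c + ell N) <= 296 * C * w N * ell N.
  apply: HG.
  - by move=> n s; exact: kcombD2pi.
  - move=> n x; rewrite /kern iint_kcomb ?decay01// !big_cons big_nil/=.
    by rewrite (_ : 2 + _ = 0) ?mulr0//; ring.
  - move=> n s sp; rewrite /kern /decay; apply: HC => //.
    rewrite divr_gt0 ?ell_gt0//= ler_pdivrMr//; exact: ell_le2pi.
have HD := sum_Dn lphi phi2pi w0 osc N M c.
pose a i := iint (fun t => `|den i t|) (lo N c) (lo N c + ell N).
have -> : \sum_(N * 3 <= i < M * 3) a i =
    (2 * pi)^-1 * 3 * \sum_(N <= n < M) iint (fun x => `|D n x|) (lo N c) (lo N c + ell N) +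
    (2 * pi)^-1 * (2 * pi)^-1 * \sum_(N <= n < M) iint (fun x => `|G n x|) (lo N c) (lo N c + ell N).
  elim: M NM {HG HD} => [|M IH NM].
    by rewrite leqn0 => /eqP ->; rewrite !(big_geq (leqnn _)) !mulr0 addr0.
  move: NM; rewrite leq_eqVlt => /predU1P[<-|].
    by rewrite !(big_geq (leqnn _)) !mulr0 addr0.
  rewrite ltnS => NM; rewrite mulSn -[(3 + _)%N]/(_.+3).
  have N3 : (N * 3 <= M * 3)%N by rewrite leq_mul2r NM orbT.
  have -> : \sum_(N * 3 <= i < (M * 3).+3) a i =
      \sum_(N * 3 <= i < M * 3) a i + a (M * 3)%N + a (M * 3).+1 + a (M * 3).+2.
    by rewrite !big_nat_recr//; lia.
  have step (h : nat -> R) : \sum_(N <= n < M.+1) h n = \sum_(N <= n < M) h n + h M.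
    by rewrite big_nat_recr.
  rewrite !step.
  rewrite (IH NM).
  have lD := locint_norm (bddmeas_locint (Db M)); have lG := locint_norm (bddmeas_locint (Gb M)).
  have -> : a (M * 3)%N = (2 * pi)^-1 * 2 * iint (fun x => `|D M x|) (lo N c) (lo N c + ell N).
    rewrite -iintZ//; apply: eq_iint => t _; rewrite den0 (normrM (2 * pi)^-1) (normrM 2).
    by rewrite (@ger0_norm _ (2 * pi)^-1)// (@ger0_norm _ 2)// mulrA.
  have -> : a (M * 3).+1 = (2 * pi)^-1 * iint (fun x => `|D M x|) (lo N c) (lo N c + ell N).
    rewrite -iintZ//; apply: eq_iint => t _; rewrite den1 (normrM (2 * pi)^-1) normrN.
    by rewrite (@ger0_norm _ (2 * pi)^-1).
  have -> : a (M * 3).+2 = (2 * pi)^-1 * (2 * pi)^-1 * iint (fun x => `|G M x|) (lo N c) (lo N c + ell N).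
    rewrite -iintZ//; apply: eq_iint => t _; rewrite den2 (normrM (2 * pi)^-1) (normrM (2 * pi)^-1).
    by rewrite (@ger0_norm _ (2 * pi)^-1)// mulrA.
  move: ((2 * pi)^-1) (\sum_(N <= n < M) _) (\sum_(N <= n < M) _) => q S1 S2.
  by move: (iint _ _ _) (iint _ _ _) => x1 x2; ring.
have e1 : (2 * pi)^-1 * 3 * \sum_(N <= n < M) iint (fun x => `|D n x|) (lo N c) (lo N c + ell N)
   <= (2 * pi)^-1 * 3 * (6 * w N * ell N) by apply: ler_wpM2l => //; rewrite mulr_ge0.
have e2 : (2 * pi)^-1 * (2 * pi)^-1 * \sum_(N <= n < M) iint (fun x => `|G n x|) (lo N c) (lo N c + ell N)
   <= (2 * pi)^-1 * (2 * pi)^-1 * (296 * C * w N * ell N) by apply: ler_wpM2l => //; rewrite mulr_ge0.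
apply: le_trans (lerD e1 e2) _; rewrite le_eqVlt; apply/orP; left; apply/eqP.
by move: ((2 * pi)^-1) => q; ring.
Qed.

End stopped.
End decomposition.

(** * The charge of the decomposition is a vanishing Carleson measure *)

Section vmo_balayage.
Context {R : realType}.
Variable f : R * R -> R.
Hypothesis hf : VMO f.

Let phi := f \o cis.
Let w := max_oscillation f.
Let bmo : BMO f. Proof. by case: hf. Qed.
Let lphi : locint phi. Proof. exact: in_L1_locint bmo.1. Qed.
Let phi2pi x : phi (x + 2 * pi) = phi x. Proof. by rewrite /phi/= cisD2pi. Qed.
Let w0 n : 0 <= w n. Proof. exact: max_oscillation_ge0. Qed.
Let wdec n m : (n <= m)%N -> w m <= w n. Proof. exact: max_oscillation_dec. Qed.
Let osc n a b : a < b -> b <= a + 2 * pi -> b - a <= 2 * ell n ->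
  iint (fun x => `|phi x - avg phi a b|) a b <= w n * (b - a).
Proof. exact: avg_oscillation. Qed.

Let h := den phi w.
Let p0 : 0 < 2 * pi :> R. Proof. by rewrite mulr_gt0// pi_gt0. Qed.

Let hb i : bddmeas (h i). Proof. exact: den_bddmeas. Qed.
Let lh i : locint (fun t => `|h i t|). Proof. exact/locint_norm/bddmeas_locint. Qed.

Let h_period i t : h i (t + 2 * pi) = h i t.
Proof.
rewrite /h /den Fn_period// Fn_period//; congr (_ * _).
case: (i %% 3)%N => [//|[//|j]]; congr (_ * _).
apply: eq_iint => u _; congr (_ * _); rewrite /kern -(kcombD2pi _ _ (t - u)); congr kcomb; ring.
Qed.

Variable K : R.
Hypothesis K0 : 0 <= K.
Hypothesis hK : forall N M (c : int), (N <= M)%N ->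
  \sum_(N * 3 <= i < M * 3) iint (fun t => `|h i t|) (lo N c) (lo N c + ell N) <= K * w N * ell N.

Let mass M : \sum_(i < M) iint (fun t => `|h i t|) 0 (2 * pi) <= K * w 0 * (2 * pi).
Proof.
have := @hK 0 M 0 (leq0n _); rewrite mul0n /lo mul0r add0r ell0; apply: le_trans.
rewrite -(big_mkord xpredT (fun i => iint (fun t => `|h i t|) 0 (2 * pi))).
rewrite (@big_cat_nat _ _ _ M 0 (M * 3))//=; last by rewrite leq_pmulr.
by rewrite lerDl; apply: sumr_ge0 => i _; exact: iint_ge0.
Qed.

Let layer I i := (\int[lebesgue_measure]_(t in `[0%R, (2 * pi)%R[)
  ((\1_(carleson_square I `&` disk) (rad i *: cis t))%:E * `|h i t|%:E))%E.

Let square_layer I i (t : R) : circle_arc I -> len I <= 2 * pi ->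
  carleson_square I (rad i *: cis t) -> 1 - len I / (2 * pi) <= rad i /\ I (cis t).
Proof.
move=> aI l2 [r rI [v Iv e]].
have r0 : 0 <= r.
  move: rI; rewrite /= in_itv/= => /andP[+ _]; apply: le_trans.
  by rewrite subr_ge0 ler_pdivrMr// mul1r.
have ri := rad_gt0 (R := R) i.
have : r = rad i.
  have cv := arc_sub_circle aI Iv; have [s _ sv] := cis_surj 0 cv.
  have := congr1 sqnorm e; rewrite -sv !sqnorm_cis => /eqP.
  by rewrite eqrXn2// ?(ltW ri)// => /eqP.
move=> rE; split; first by move: rI; rewrite /= in_itv/= rE => /andP[].
move: e; rewrite rE => /(congr1 (fun z => (rad i)^-1 *: z)).
by rewrite !scalerA mulVf ?gt_eqF// !scale1r => <-.
Qed.

(** The layers of generation [n < N] lie too deep: with [y = ell n / pi] their radii are at most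
    [1 - y / 3], whereas [len I <= ell n / 2] limits the depth of the square to [y / 4]. *)
Let layer_small I N i : circle_arc I -> len I <= ell N -> (i < N * 3)%N -> layer I i = 0%E.
Proof.
move=> aI lI iN; apply: integral0_eq => t _; rewrite indicE memNset ?mul0e// => -[sq _].
have l2 : len I <= 2 * pi by apply: le_trans lI _; exact: ell_le2pi.
have [+ _] := square_layer aI l2 sq; apply/negP; rewrite -ltNge.
apply: le_lt_trans (rad_le i) _.
set n := (i %/ 3)%N; have nN : (n < N)%N by rewrite ltn_divLR.
have pp := pi_gt0 R; have en := @ell_gt0 R n; have eN := @ell_gt0 R N.
have e2 : 2 * ell N <= ell n :> R by rewrite [leRHS]ellS ler_pM2l//; exact: ell_mono.
have y2 : 0 < (ell n / pi : R) <= 2.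
  by rewrite divr_gt0//= ler_pdivrMr//; exact: ell_le2pi.
have /andP[_ ] := expRN_le y2; rewrite -/(decay n) => d3.
have l4 : len I / (2 * pi) <= ell n / pi / 4 :> R.
  by rewrite -mulrA -invfM ler_pdivrMr// mulrAC ler_pdivlMr ?mulr_gt0//; nra.
have : 0 < ell n / pi :> R by case/andP: y2.
lra.
Qed.

(** An arc not longer than a block of generation [N] is covered by the block that contains its left
    end and the next one. *)
Let layer_large I N : circle_arc I -> len I <= ell N -> exists c : int,
  forall i, (layer I i <= (iint (fun t => `|h i t|) (lo N c) (lo N c + ell N) +
   iint (fun t => `|h i t|) (lo N (c + 1)) (lo N (c + 1) + ell N))%:E)%E.
Proof.
move=> aI; have [a [b [x [y [ab b2 IE]]]]] := aI; rewrite {1}IE len_arc// => be.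
exists (blk N a) => {}i; have eN := @ell_gt0 R N.
have /andP[la al] := blk_itv N a.
have l2 : len I <= 2 * pi by rewrite IE len_arc//; lra.
pose c := blk N a; rewrite -/c in la al *.
have l1 : lo N (c + 1) = lo N c + ell N :> R by rewrite loD1.
have mh : measurable_fun setT (fun t => `|h i t|%:E).
  by apply/measurable_EFinP; apply: measurableT_comp => //; exact: (hb i).1.
have mI : measurable_fun setT (fun t : R => (\1_I (cis t) : R)%:E).
  apply/measurable_EFinP; apply: (measurableT_comp _ (@measurable_cis R)).
  by apply: measurable_indic; exact: measurable_arc.
have mA : measurable_fun setT (fun t : R => (\1_(carleson_square I `&` disk) (rad i *: cis t) : R)%:E).
  apply/measurable_EFinP; apply: (measurableT_comp _ (measurable_radial_circle (rad i))).
  by apply: measurable_indic; apply: measurableI; [exact: measurable_carleson_square|exact: measurable_disk].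
apply: (@le_trans _ _ (\int[lebesgue_measure]_(t in `[0%R, (2 * pi)%R[) ((\1_I (cis t))%:E * `|h i t|%:E))%E).
  apply: ge0_le_integral => //.
  - by apply: measurable_funTS; exact: emeasurable_funM.
  - by apply: measurable_funTS; exact: emeasurable_funM.
  move=> t _; rewrite -!EFinM lee_fin; apply: ler_wpM2r => //; rewrite !indicE.
  have [/set_mem[sq _]|//] := boolP (rad i *: cis t \in _).
  by rewrite mem_set//; have [] := square_layer aI l2 sq.
have mP : measurable_fun setT (fun t : R => (\1_I (cis t))%:E * `|h i t|%:E)%E by exact: emeasurable_funM.
have P0 (t : R) : (0 <= (\1_I (cis t))%:E * `|h i t|%:E)%E by rewrite mule_ge0// lee_fin.
have PT (t : R) : ((\1_I (cis (t + 2 * pi)))%:E * `|h i (t + 2 * pi)|%:E =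
   (\1_I (cis t))%:E * `|h i t|%:E)%E by rewrite cisD2pi h_period.
(* The angles are counted from the left end [a], so that the arc does not wrap around. *)
rewrite -(ge0_integral_period a p0 mP P0 PT).
apply: (@le_trans _ _ (iint (fun t => `|h i t|) a b)%:E); last first.
  rewrite lee_fin l1 -iint_split//; [|lra|lra].
  by apply: iint_sub => //; lra.
rewrite iint_EFin//.
rewrite [X in (X <= _)%E]integral_mkcond [X in (_ <= X)%E]integral_mkcond.
apply: ge0_le_integral => //.
- by move=> t _; rewrite patchE; case: ifPn => // _; rewrite mule_ge0// lee_fin.
- by apply/(measurable_restrictT _ _).1 => //; apply: measurable_funTS; exact: emeasurable_funM.
- by apply/(measurable_restrictT _ _).1 => //; exact: measurable_funTS.
move=> t _; rewrite !patchE; case: ifPn => [/set_mem/=|_]; last by case: ifPn => // _; rewrite lee_fin.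
rewrite in_itv/= => /andP[ta t2]; rewrite indicE.
have [/set_mem|_] := boolP (cis t \in I); last first.
  by rewrite mul0e; case: ifPn => // _; rewrite lee_fin.
rewrite mul1e {1}IE => -[s ss se]; rewrite mem_set// /= in_itv/= ta/=.
have /andP[as1 sb] : a <= s <= b.
  move: ss; rewrite /= itv_boundlr => /andP[h1 h2].
  by apply/andP; split; [move: h1; case: (x); rewrite bnd_simp// => /ltW|move: h2; case: (y); rewrite bnd_simp// => /ltW].
have [s2|s2] := ltP s (a + 2 * pi); last lra.
by rewrite (@cis_inj _ a t s)// ?ta ?as1.
Qed.

Lemma layers_square I N : circle_arc I -> len I <= ell N ->
  (\sum_(i <oo) layer I i <= (2 * (K * w N * ell N))%:E)%E.
Proof.
move=> aI lI; have [c large] := layer_large aI lI.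
have l0 i : (0 <= layer I i)%E by apply: integral_ge0 => t _; rewrite mule_ge0// lee_fin.
pose b i := iint (fun t => `|h i t|) (lo N c) (lo N c + ell N) +
   iint (fun t => `|h i t|) (lo N (c + 1)) (lo N (c + 1) + ell N).
have b0 i : 0 <= b i by rewrite addr_ge0//; exact: iint_ge0.
apply: lime_le; first by apply: is_cvg_nneseries.
apply: nearW => M.
apply: (@le_trans _ _ (\sum_(0 <= i < (N + M) * 3) layer I i)%E).
  rewrite [leRHS](@big_cat_nat _ _ _ M)//=; last by lia.
  by rewrite leeDl//; apply: sume_ge0.
rewrite (@big_cat_nat _ _ _ (N * 3))//=; last by lia.
rewrite big_nat big1 ?add0e; last by move=> i /andP[_ iN]; exact: (layer_small aI lI).
apply: (@le_trans _ _ (\sum_(N * 3 <= i < (N + M) * 3) (b i)%:E)%E).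
  by apply: lee_sum => i _; exact: large.
rewrite sumEFin lee_fin /b big_split/=.
have := @hK N (N + M) c (leq_addr _ _); have := @hK N (N + M) (c + 1) (leq_addr _ _).
lra.
Qed.

Variable C : R.
Hypothesis C0 : 0 <= C.
Hypothesis hC : forall N, (2 <= N)%N ->
  iint (fun x => `|phi x - approx phi w N x|) 0 (2 * pi) <= C * w N.

Lemma vmo_balayage_of_bounds : exists mu : {charge set (R * R)%type -> \bar R},
  CM0 (abs_charge mu) /\ {ae arclength, forall zeta, circle zeta ->
    (f zeta)%:E = ((avg phi 0 (2 * pi))%:E + balayage mu zeta)%E}.
Proof.
have [mu [muA bal]] := layered_charge (@rad01 R) hb mass.
exists mu; split.
  (* The [4] is [2] for the two blocks that cover the arc, times [2] for
     [ell N = 2 * ell N.+1 < 2 * len I]. *)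
  have sq I N : circle_arc I -> ell N.+1 < len I <= ell N ->
      (carleson_ratio (abs_charge mu) I <= (4 * K * w N)%:E)%E.
    move=> aI /andP[l1 l2]; have e1 := @ell_gt0 R N.+1.
    have l0 : 0 < len I by exact: lt_trans l1.
    rewrite /carleson_ratio inver gt_eqF// lee_pdivrMr//.
    apply: le_trans (muA _ _) _.
      by apply: measurableI; [exact: measurable_carleson_square|exact: measurable_disk].
    apply: le_trans (layers_square aI l2) _; rewrite -EFinM lee_fin ellS.
    have kw : 0 <= K * w N by rewrite mulr_ge0.
    have := ler_wpM2l kw (ltW l1); lra.
  have arcN (I : set (R * R)) : circle_arc I -> exists N, ell N.+1 < len I <= ell N.
    move=> [a [b [x [y [ab b2 ->]]]]]; apply: ell_between; rewrite len_arc//.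
    by apply/andP; split; lra.
  split.
    apply: (@le_lt_trans _ _ (4 * K * w 0)%:E); last exact: ltry.
    apply: ge_ereal_sup => _ [I aI <-]; have [N hN] := arcN I aI.
    apply: le_trans (sq I N aI hN) _; rewrite lee_fin; apply: ler_wpM2l; first by rewrite mulr_ge0.
    exact: wdec.
  move=> e e0.
  have k1 : 0 < 4 * K + 1 by rewrite ltr_pwDr// mulr_ge0.
  have /cvgrPdist_lt /(_ _ (divr_gt0 e0 k1))[n _ wn] := max_oscillation_cvg0 hf.
  exists (ell n); first exact: ell_gt0.
  move=> I aI lI; have [N /andP[N1 N2]] := arcN I aI.
  apply: le_lt_trans (sq I N aI _) _; first by rewrite N1.
  have nN : (n <= N)%N.
    rewrite leqNgt; apply/negP => Nn; have := @ell_mono R _ _ Nn; lra.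
  have := wn N nN; rewrite sub0r normrN ger0_norm ?w0// ltr_pdivlMr// => h1.
  rewrite lte_fin; have := w0 N; rewrite -/w in h1; nra.
pose B z := avg phi 0 (2 * pi) + fine (balayage mu z).
have mB : measurable_fun setT B.
  apply: measurable_funD => //; apply: (measurableT_comp (fine_measurable measurableT)).
  exact: measurable_balayage.
have mf : measurable_fun circle f by exact: in_L1_measurable bmo.1.
have Cw0 : (fun n => C * w n) @ \oo --> 0.
  by rewrite -(mulr0 C); apply: cvgM; [exact: cvg_cst|exact: max_oscillation_cvg0].
have cvU : {ae arclength, forall zeta, circle zeta -> forall x, cis x = zeta ->
     (approx phi w)^~ x @ \oo --> B zeta}.
  apply: filterS bal => zeta H cz x xz; have [_ cv] := H cz x xz.
  (* Each generation has three layers, so the [approx] are every third partial sum of the balayage,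
     up to the mean of [f]. *)
  have -> : (approx phi w)^~ x = (fun N => avg phi 0 (2 * pi) + (fun M => \sum_(i < M)
     iint (fun t => h i t * pker (rad i) (x - t)) 0 (2 * pi)) (N * 3)%N).
    by apply/funext => N; rewrite approxE.
  apply: cvgD; first exact: cvg_cst.
  apply: (cvg_comp (fun N => (N * 3)%N) (fun M => \sum_(i < M)
     iint (fun t => h i t * pker (rad i) (x - t)) 0 (2 * pi)) _ cv).
  move=> P [n _ nP]; exists n => // m /= nm; apply: nP => /=; lia.
have lA N : locint (approx phi w N) by exact: approx_locint.
have near2 : \forall n \near \oo, iint (fun x => `|f (cis x) - approx phi w n x|) 0 (2 * pi) <= C * w n.
  by exists 2%N => // n /= n2; exact: hC.
have fB := ae_eq_of_L1 mf mB lA lphi cvU near2 Cw0.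
apply: filterS2 fB bal => zeta fB H cz.
have [x _ xz] := cis_surj 0 cz; have [bf _] := H cz x xz.
by rewrite fB// /B EFinD fineK.
Qed.

End vmo_balayage.

Lemma vmo_balayage (R : realType) (f : R * R -> R) : VMO f ->
  exists (mu : {charge set (R * R)%type -> \bar R}) (g : R * R -> R),
    [/\ CM0 (abs_charge mu), continuous_on_circle g &
        {ae arclength, forall zeta, circle zeta ->
          (f zeta)%:E = ((g zeta)%:E + balayage mu zeta)%E}].
Proof.
move=> hf; have bmo := hf.1.
have lphi : locint (f \o cis) by exact: in_L1_locint bmo.1.
have phi2pi x : (f \o cis) (x + 2 * pi) = (f \o cis) x by rewrite /= cisD2pi.
have w0 n : 0 <= max_oscillation f n by exact: max_oscillation_ge0.
have wdec n m : (n <= m)%N -> max_oscillation f m <= max_oscillation f n by exact: max_oscillation_dec.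
have osc := avg_oscillation bmo.
have [K K0 hK] := den_sum lphi phi2pi w0 wdec osc.
have [C C0 hC] := approx_L1 lphi phi2pi w0 osc.
have [mu [cm ae]] := vmo_balayage_of_bounds hf K0 hK C0 hC.
(* The continuous function is a constant, the mean of [f]: it is the value of the process at
   generation 0. *)
exists mu, (cst (avg (f \o cis) 0 (2 * pi))); split => //.
by apply: continuous_subspaceT => z; exact: cvg_cst.
Qed.

(** * Smoothness of the extended balayage *)

Section kernel_syntax.
Context {R : realType}.
Implicit Types (w z : R * R) (b : bool).

Definition coord b z : R := if b then z.2 else z.1.

(* This is |1 - conj(z) w|^2. *)
Definition szego w z : R := 1 - 2 * (z.1 * w.1 + z.2 * w.2) + sqnorm z * sqnorm w.

(* Syntax of the kernels in (w, z) that arise by differentiating 1/szego in w. *)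
Inductive kexpr :=
  | KC of R | KZ of bool | KW of bool | KAdd of kexpr & kexpr | KMul of kexpr & kexpr | KInv.

Fixpoint keval e w z : R :=
  match e with
  | KC c => c
  | KZ b => coord b z
  | KW b => coord b w
  | KAdd e1 e2 => keval e1 w z + keval e2 w z
  | KMul e1 e2 => keval e1 w z * keval e2 w z
  | KInv => (szego w z)^-1
  end.

(** The derivative [2 (|z| ^ 2 w_b - z_b)] of [szego] in the coordinate [b] of [w]. *)
Definition kszego_der b : kexpr :=
  KMul (KC 2) (KAdd (KMul (KC (-1)) (KZ b))
    (KMul (KAdd (KMul (KZ false) (KZ false)) (KMul (KZ true) (KZ true))) (KW b))).

Fixpoint kder b e : kexpr :=
  match e with
  | KC _ => KC 0
  | KZ _ => KC 0
  | KW b' => KC (b == b')%:R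
  | KAdd e1 e2 => KAdd (kder b e1) (kder b e2)
  | KMul e1 e2 => KAdd (KMul (kder b e1) e2) (KMul e1 (kder b e2))
  | KInv => KMul (KMul (KC (-1)) (kszego_der b)) (KMul KInv KInv)
  end.

Definition dist1 w w0 : R := `|w.1 - w0.1| + `|w.2 - w0.2|.

(** First-order expansion in [w] with quadratic remainder. The constants do not depend on [z], so
    that the expansion can be integrated in [z] against a finite measure. *)
Definition taylor (k k1 k2 : R * R -> R * R -> R) w0 := exists M d : R,
  [/\ 0 < M, 0 < d &
   forall z, disk z -> [/\ `|k w0 z| <= M, `|k1 w0 z| <= M, `|k2 w0 z| <= M &
     forall w, dist1 w w0 <= d ->
       `|k w z - k w0 z - ((w.1 - w0.1) * k1 w0 z + (w.2 - w0.2) * k2 w0 z)|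
         <= M * dist1 w w0 ^+ 2]].

Lemma dist1_ge0 w w0 : 0 <= dist1 w w0. Proof. by rewrite addr_ge0. Qed.

Lemma disk_coord b z : disk z -> `|coord b z| <= 1.
Proof.
rewrite /disk/= /sqnorm => dz; have := sqr_ge0 z.1; have := sqr_ge0 z.2 => h1 h2.
have : coord b z ^+ 2 <= 1 by rewrite /coord; case: b; lra.
by move: (coord b z) => c c1; rewrite ler_norml; apply/andP; split; nra.
Qed.

(** With [s] the scalar product of [z] and [w], Cauchy-Schwarz gives [szego w z >= (1 - s) ^ 2], and
    [s <= |w| <= (1 + |w| ^ 2) / 2]. The bound does not depend on [z]. *)
Lemma szego_ge w z : sqnorm w < 1 -> sqnorm z <= 1 -> ((1 - sqnorm w) / 2) ^+ 2 <= szego w z.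
Proof.
move=> w1 z1; pose s := z.1 * w.1 + z.2 * w.2.
have cs : s ^+ 2 <= sqnorm z * sqnorm w.
  rewrite /s /sqnorm -subr_ge0 (_ : _ - _ = (z.1 * w.2 - z.2 * w.1) ^+ 2) ?sqr_ge0//; ring.
have s2 : s ^+ 2 <= sqnorm w.
  by apply: le_trans cs _; rewrite ler_piMl// sqnorm_ge0.
have s1 : -1 < s < 1 by rewrite -ltr_norml -(@ltr_pXn2r _ 2)// ?nnegrE// real_normK ?num_real// expr1n; lra.
have h : (1 - sqnorm w) / 2 <= 1 - s by case/andP: s1; nra.
have h0 : 0 <= (1 - sqnorm w) / 2 by lra.
rewrite /szego -/s; have := sqr_ge0 (1 - s); nra.
Qed.

Lemma szego_gt0 w z : sqnorm w < 1 -> sqnorm z <= 1 -> 0 < szego w z.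
Proof.
by move=> w1 z1; apply: lt_le_trans (szego_ge w1 z1); rewrite exprn_gt0//; lra.
Qed.

Lemma sqnorm_near w w0 : sqnorm w0 < 1 -> dist1 w w0 <= (1 - sqnorm w0) / 6 ->
  sqnorm w <= (1 + sqnorm w0) / 2.
Proof.
move=> w01 wd.
have d1 := ler_norm (w.1 - w0.1); have d2 := ler_norm (w.2 - w0.2).
have c1 := disk_coord false w01; have c2 := disk_coord true w01.
have n0 := dist1_ge0 w w0.
have e : sqnorm w = sqnorm w0 + (2 * w0.1 * (w.1 - w0.1) + 2 * w0.2 * (w.2 - w0.2)) +
   ((w.1 - w0.1) ^+ 2 + (w.2 - w0.2) ^+ 2) by rewrite /sqnorm; ring.
have h1 : 2 * w0.1 * (w.1 - w0.1) + 2 * w0.2 * (w.2 - w0.2) <= 2 * dist1 w w0.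
  rewrite /dist1 mulrDr -!mulrA -!mulrDr ler_pM2l//; apply: lerD.
    by apply: le_trans (ler_norm _) _; rewrite normrM ler_piMl.
  by apply: le_trans (ler_norm _) _; rewrite normrM ler_piMl.
have h2 : (w.1 - w0.1) ^+ 2 + (w.2 - w0.2) ^+ 2 <= dist1 w w0 ^+ 2.
  rewrite /dist1 -(real_normK (num_real (w.1 - w0.1))) -(real_normK (num_real (w.2 - w0.2))).
  by have := normr_ge0 (w.1 - w0.1); have := normr_ge0 (w.2 - w0.2); nra.
have q0 := sqnorm_ge0 w0.
have h3 : dist1 w w0 ^+ 2 <= dist1 w w0 by rewrite expr2 ler_piMl//; lra.
lra.
Qed.

Lemma taylorD k k1 k2 l l1 l2 w0 : taylor k k1 k2 w0 -> taylor l l1 l2 w0 ->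
  taylor (fun w z => k w z + l w z) (fun w z => k1 w z + l1 w z) (fun w z => k2 w z + l2 w z) w0.
Proof.
move=> [M [d [M0 d0 kM]]] [N [c [N0 c0 lN]]].
exists (M + N), (Num.min d c); split; [exact: addr_gt0|by rewrite lt_min d0|].
move=> z dz; have [k3 k4 k5 k6] := kM z dz; have [l3 l4 l5 l6] := lN z dz.
split; try by apply: le_trans (ler_normD _ _) _; exact: lerD.
move=> w; rewrite le_min => /andP[wd wc].
rewrite [leRHS]mulrDl; apply: le_trans (lerD (k6 w wd) (l6 w wc)).
apply: le_trans (ler_normD _ _); rewrite le_eqVlt; apply/orP; left; apply/eqP; congr `| _ |; ring.
Qed.

Lemma taylorM k k1 k2 l l1 l2 w0 : taylor k k1 k2 w0 -> taylor l l1 l2 w0 ->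
  taylor (fun w z => k w z * l w z) (fun w z => k1 w z * l w z + k w z * l1 w z)
    (fun w z => k2 w z * l w z + k w z * l2 w z) w0.
Proof.
move=> [M [d [M0 d0 kM]]] [N [c [N0 c0 lN]]].
have MN := mulr_gt0 M0 N0.
(* The product of the two expansions leaves six terms of second order or higher, each at most
   [M * N * n ^ 2] because [n <= 1]. *)
exists (6 * (M * N)), (Num.min 1 (Num.min d c)); split; [lra|by rewrite !lt_min d0 c0 ltr01|].
move=> z dz; have [k3 k4 k5 k6] := kM z dz; have [l3 l4 l5 l6] := lN z dz.
have bd (x y : R) : `|x| <= M -> `|y| <= N -> `|x * y| <= M * N by move=> *; rewrite normrM ler_pM.
split.
- by apply: le_trans (bd _ _ k3 l3) _; lra.
- apply: le_trans (ler_normD _ _) _; apply: le_trans (lerD (bd _ _ k4 l3) (bd _ _ k3 l4)) _; lra.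
- apply: le_trans (ler_normD _ _) _; apply: le_trans (lerD (bd _ _ k5 l3) (bd _ _ k3 l5)) _; lra.
move=> w; rewrite !le_min => /and3P[w1 wd wc].
have n0 := dist1_ge0 w w0; set n := dist1 w w0 in w1 wd wc n0 *.
pose a := (w.1 - w0.1) * k1 w0 z + (w.2 - w0.2) * k2 w0 z.
pose b := (w.1 - w0.1) * l1 w0 z + (w.2 - w0.2) * l2 w0 z.
have lin (A u v : R) : 0 < A -> `|u| <= A -> `|v| <= A ->
    `|(w.1 - w0.1) * u + (w.2 - w0.2) * v| <= A * n.
  move=> A0 uA vA; apply: le_trans (ler_normD _ _) _; rewrite !normrM /n /dist1.
  have := ler_wpM2l (normr_ge0 (w.1 - w0.1)) uA.
  have := ler_wpM2l (normr_ge0 (w.2 - w0.2)) vA; lra.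
have an : `|a| <= M * n by exact: lin.
have bn : `|b| <= N * n by exact: lin.
pose al := k w z - k w0 z - a; pose be := l w z - l w0 z - b.
have alM : `|al| <= M * n ^+ 2 by exact: k6.
have beN : `|be| <= N * n ^+ 2 by exact: l6.
have -> : k w z * l w z - k w0 z * l w0 z -
  ((w.1 - w0.1) * (k1 w0 z * l w0 z + k w0 z * l1 w0 z) + (w.2 - w0.2) * (k2 w0 z * l w0 z + k w0 z * l2 w0 z)) =
  k w0 z * be + a * b + a * be + al * l w0 z + al * b + al * be.
  by rewrite /al /be /a /b; ring.
have nn : n ^+ 2 <= n by rewrite expr2 ler_piMl.
have n20 := sqr_ge0 n.
have pm (x y A B : R) : `|x| <= A -> `|y| <= B -> A * B <= M * N * n ^+ 2 -> `|x * y| <= M * N * n ^+ 2.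
  by move=> xA yB; apply: le_trans; rewrite normrM ler_pM.
have t1 : `|k w0 z * be| <= M * N * n ^+ 2 by apply: (pm _ _ _ _ k3 beN); rewrite mulrA.
have t2 : `|a * b| <= M * N * n ^+ 2 by apply: (pm _ _ _ _ an bn); rewrite mulrACA expr2.
have t3 : `|a * be| <= M * N * n ^+ 2.
  by apply: (pm _ _ _ _ an beN); rewrite mulrACA ler_wpM2l ?(ltW MN)// ler_piMl.
have t4 : `|al * l w0 z| <= M * N * n ^+ 2 by apply: (pm _ _ _ _ alM l3); rewrite mulrAC.
have t5 : `|al * b| <= M * N * n ^+ 2.
  by apply: (pm _ _ _ _ alM bn); rewrite mulrACA ler_wpM2l ?(ltW MN)// ler_piMr.
have t6 : `|al * be| <= M * N * n ^+ 2.
  apply: (pm _ _ _ _ alM beN); rewrite mulrACA ler_wpM2l ?(ltW MN)// ler_piMl//.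
  exact: le_trans nn w1.
have h2 (x y A B : R) : `|x| <= A -> `|y| <= B -> `|x + y| <= A + B.
  by move=> xA yB; apply: le_trans (ler_normD _ _) _; exact: lerD.
apply: le_trans (h2 _ _ _ _ (h2 _ _ _ _ (h2 _ _ _ _ (h2 _ _ _ _ (h2 _ _ _ _ t1 t2) t3) t4) t5) t6) _.
by rewrite le_eqVlt; apply/orP; left; apply/eqP; ring.
Qed.

Lemma taylor_inv_szego w0 : disk w0 ->
  taylor (keval KInv) (keval (kder false KInv)) (keval (kder true KInv)) w0.
Proof.
rewrite /disk/= => w01.
(* For [w] near [w0] the quantity [1 - |w| ^ 2] is at least half of [1 - |w0| ^ 2], so [szego_ge]
   gives the common lower bound [c]. *)
pose c : R := ((1 - sqnorm w0) / 4) ^+ 2.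
have c0 : 0 < c by rewrite exprn_gt0//; lra.
have q0 := sqnorm_ge0 w0.
have c1 : c <= 1.
  rewrite /c -[X in _ <= X](expr1n _ 2) lerXn2r ?nnegrE//; lra.
have ic : 1 <= c^-1 by rewrite invf_ge1.
exists (82 * (c^-1 * c^-1 * c^-1)), ((1 - sqnorm w0) / 6); split.
- by rewrite !mulr_gt0 ?invr_gt0.
- lra.
move=> z dz; have z1 : sqnorm z <= 1 by exact: ltW.
have ge_c w : dist1 w w0 <= (1 - sqnorm w0) / 6 -> c <= szego w z.
  move=> wd; have wq := sqnorm_near w01 wd.
  apply: le_trans (@szego_ge w z _ z1); last lra.
  by rewrite /c lerXn2r ?nnegrE; lra.
have D0 : c <= szego w0 z by apply: ge_c; rewrite /dist1 !subrr normr0 addr0; lra.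
have iD0 : (szego w0 z)^-1 <= c^-1 by rewrite lef_pV2// posrE (lt_le_trans c0).
have D0p : 0 < szego w0 z by exact: lt_le_trans D0.
have iD0p : 0 <= (szego w0 z)^-1 by rewrite invr_ge0 ltW.
pose g b := 2 * (- coord b z + sqnorm z * coord b w0).
have gE b : keval (kszego_der b) w0 z = g b by rewrite /= /g /sqnorm /coord; case: b; ring.
have g4 b : `|g b| <= 4.
  rewrite /g (normrM 2) ger0_norm//.
  have h1 := disk_coord b dz; have h2 := disk_coord b w01.
  have h3 : `|sqnorm z * coord b w0| <= 1.
    by rewrite (normrM (sqnorm z)) -[leRHS]mulr1 ler_pM// ger0_norm// sqnorm_ge0.
  have := ler_normD (- coord b z) (sqnorm z * coord b w0); rewrite normrN; lra.
have kE b : keval (kder b KInv) w0 z = - g b * ((szego w0 z)^-1 * (szego w0 z)^-1).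
  by rewrite -gE /=; ring.
have kb b : `|keval (kder b KInv) w0 z| <= 82 * (c^-1 * c^-1 * c^-1).
  have h : `|(szego w0 z)^-1 * (szego w0 z)^-1| <= c^-1 * c^-1.
    by rewrite ger0_norm ?mulr_ge0// ler_pM.
  rewrite kE (normrM (- g b)) normrN.
  apply: (@le_trans _ _ (4 * (c^-1 * c^-1))); first exact: ler_pM (g4 b) h.
  have : 0 <= c^-1 * c^-1 by rewrite mulr_ge0 ?invr_ge0 ?(ltW c0).
  nra.
split; [|exact: (kb false)|exact: (kb true)|].
  rewrite /= ger0_norm//; apply: le_trans iD0 _; nra.
move: (kE false) (kE true) => /= k1E k2E w wd; rewrite k1E k2E.
have Dw := ge_c w wd; have Dp : 0 < szego w z by exact: lt_le_trans Dw.
set n := dist1 w w0; have n0 : 0 <= n := dist1_ge0 w w0.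
pose e := szego w z - szego w0 z.
have eE : e = (w.1 - w0.1) * g false + (w.2 - w0.2) * g true +
   sqnorm z * ((w.1 - w0.1) ^+ 2 + (w.2 - w0.2) ^+ 2).
  by rewrite /e /szego /g /sqnorm /coord; ring.
pose q := sqnorm z * ((w.1 - w0.1) ^+ 2 + (w.2 - w0.2) ^+ 2).
have qn : 0 <= q <= n ^+ 2.
  have h : (w.1 - w0.1) ^+ 2 + (w.2 - w0.2) ^+ 2 <= n ^+ 2.
    rewrite /n /dist1 -(real_normK (num_real (w.1 - w0.1))) -(real_normK (num_real (w.2 - w0.2))).
    by have := normr_ge0 (w.1 - w0.1); have := normr_ge0 (w.2 - w0.2); nra.
  have h' : 0 <= (w.1 - w0.1) ^+ 2 + (w.2 - w0.2) ^+ 2 by rewrite addr_ge0// sqr_ge0.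
  rewrite /q mulr_ge0 ?sqnorm_ge0//=; apply: le_trans h; by rewrite ler_piMl.
have n1 : n <= 1 by apply: le_trans wd _; lra.
have en : `|e| <= 5 * n.
  rewrite eE -/q; apply: le_trans (ler_normD _ _) _; apply: le_trans (lerD (ler_normD _ _) (lexx _)) _.
  rewrite (normrM (w.1 - w0.1)) (normrM (w.2 - w0.2)); have g1 := g4 false; have g2 := g4 true.
  have a1 : `|w.1 - w0.1| * `|g false| <= `|w.1 - w0.1| * 4 by rewrite ler_wpM2l.
  have a2 : `|w.2 - w0.2| * `|g true| <= `|w.2 - w0.2| * 4 by rewrite ler_wpM2l.
  have a3 : `|q| <= n by case/andP: qn => q1 q2; rewrite ger0_norm// (le_trans q2)// expr2 ler_piMl.
  have nE : n = `|w.1 - w0.1| + `|w.2 - w0.2| by [].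
  lra.
(* Exact remainder of the inverse: [e] is the increment of [szego] and [q] its quadratic part. As
   [|e| <= 5 n] and [q <= n ^ 2], the two terms contribute [25] and [1] times [n ^ 2], up to powers
   of [1 / c]. *)
have -> : (szego w z)^-1 - (szego w0 z)^-1 -
  ((w.1 - w0.1) * (- g false * ((szego w0 z)^-1 * (szego w0 z)^-1)) +
   (w.2 - w0.2) * (- g true * ((szego w0 z)^-1 * (szego w0 z)^-1))) =
  e ^+ 2 * ((szego w z)^-1 * (szego w0 z)^-1 * (szego w0 z)^-1) - q * ((szego w0 z)^-1 * (szego w0 z)^-1).
  have -> : q = e - ((w.1 - w0.1) * g false + (w.2 - w0.2) * g true) by rewrite eE /q; ring.
  by rewrite /e; field; rewrite !gt_eqF.
have iD : (szego w z)^-1 <= c^-1 by rewrite lef_pV2// posrE.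
have iDp : 0 <= (szego w z)^-1 by rewrite invr_ge0 ltW.
have e2 : e ^+ 2 <= 25 * n ^+ 2.
  rewrite -(real_normK (num_real e)) (_ : 25 * n ^+ 2 = (5 * n) ^+ 2); last by ring.
  by rewrite lerXn2r// nnegrE mulr_ge0.
have c20 : 0 <= c^-1 * c^-1 by rewrite mulr_ge0 ?invr_ge0 ?(ltW c0).
have p2 : (szego w0 z)^-1 * (szego w0 z)^-1 <= c^-1 * c^-1 by exact: ler_pM.
have p3 : (szego w z)^-1 * (szego w0 z)^-1 * (szego w0 z)^-1 <= c^-1 * c^-1 * c^-1.
  by apply: ler_pM => //; [rewrite mulr_ge0|exact: ler_pM].
have p20 : 0 <= (szego w0 z)^-1 * (szego w0 z)^-1 by rewrite mulr_ge0.
have p30 : 0 <= (szego w z)^-1 * (szego w0 z)^-1 * (szego w0 z)^-1 by rewrite !mulr_ge0.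
have t1 : e ^+ 2 * ((szego w z)^-1 * (szego w0 z)^-1 * (szego w0 z)^-1) <= 25 * n ^+ 2 * (c^-1 * c^-1 * c^-1).
  by apply: ler_pM => //; exact: sqr_ge0.
have t10 : 0 <= e ^+ 2 * ((szego w z)^-1 * (szego w0 z)^-1 * (szego w0 z)^-1) by rewrite mulr_ge0// sqr_ge0.
case/andP: qn => q10 q1.
have t2 : q * ((szego w0 z)^-1 * (szego w0 z)^-1) <= n ^+ 2 * (c^-1 * c^-1) by exact: ler_pM.
have t20 : 0 <= q * ((szego w0 z)^-1 * (szego w0 z)^-1) by rewrite mulr_ge0.
have t3 : n ^+ 2 * (c^-1 * c^-1) <= n ^+ 2 * (c^-1 * c^-1 * c^-1).
  by rewrite ler_wpM2l ?sqr_ge0// ler_peMr.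
have t4 : 0 <= n ^+ 2 * (c^-1 * c^-1 * c^-1) by rewrite mulr_ge0 ?sqr_ge0// mulr_ge0// invr_ge0 ltW.
move: t1 t10 t2 t20 t3 t4; move: (e ^+ 2 * _) (q * _) (n ^+ 2 * (c^-1 * c^-1)) => A B A'.
move: (c^-1 * c^-1 * c^-1) (n ^+ 2); clear => k N2 ? ? ? ? ? ?.
by rewrite ler_norml; apply/andP; split; lra.
Qed.

Lemma taylor_keval e w0 : disk w0 -> taylor (keval e) (keval (kder false e)) (keval (kder true e)) w0.
Proof.
move=> dw; elim: e => [c|b|b|e1 t1 e2 t2|e1 t1 e2 t2|].
- exists (`|c| + 1), 1; split; [by rewrite ltr_wpDl|by []|].
  move=> z dz; split => /=; rewrite ?normr0 ?lerDl ?addr_ge0//.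
  move=> w _; rewrite subrr !mulr0 addr0 subr0 normr0 mulr_ge0 ?sqr_ge0// addr_ge0//.
- exists 1, 1; split => // z dz; split => /=; rewrite ?normr0//; first exact: disk_coord.
  by move=> w _; rewrite subrr !mulr0 addr0 subr0 normr0 mulr_ge0 ?sqr_ge0.
- exists 1, 1; split => // z dz; split => /=.
  + exact: disk_coord.
  + by case: b => /=; rewrite ?normr0 ?normr1.
  + by case: b => /=; rewrite ?normr0 ?normr1.
  + move=> w _; apply: (@le_trans _ _ 0); last by rewrite mulr_ge0 ?sqr_ge0.
    by case: b => /=; rewrite /coord ?mulr0 ?mulr1 ?addr0 ?add0r subrr normr0.
- exact: taylorD.
- exact: taylorM.
- exact: taylor_inv_szego.
Qed.

End kernel_syntax.

(** * Differentiation under the integral sign *)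

Section kernel_integral.
Context {R : realType}.
Variable m : {finite_measure set (R * R)%type -> \bar R}.
Implicit Types (w z : R * R) (b : bool) (e : @kexpr R).

Let mD := @measurable_disk R.

Lemma measurable_keval e w : measurable_fun setT (keval e w).
Proof.
have mc b : measurable_fun setT (@coord R b) by case: b; [exact: measurable_snd|exact: measurable_fst].
elim: e => [c|b|b|e1 h1 e2 h2|e1 h1 e2 h2|] /=.
- exact: measurable_cst.
- exact: mc.
- exact: measurable_cst.
- exact: measurable_funD.
- exact: measurable_funM.
apply: measurable_fun_inv; apply: measurable_funD.
  apply: measurable_funB => //; apply: measurable_funM => //; apply: measurable_funD; apply: measurable_funM => //.
apply: measurable_funM => //; exact: measurable_fun_sqnorm.
Qed.

Definition kint e w : R := \int[m]_(z in disk) keval e w z.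

Let mfin : (m disk < +oo)%E.
Proof. by rewrite -ge0_fin_numE// fin_num_measure. Qed.

Lemma bounded_integrable (g : R * R -> R) M : measurable_fun setT g ->
  (forall z, disk z -> `|g z| <= M) -> m.-integrable disk (EFin \o g).
Proof.
move=> mg gM; apply: measurable_bounded_integrable => //; first exact: measurable_funTS.
by exists M; split; [exact: num_real|move=> N MN z dz; apply: le_trans (gM z dz) (ltW MN)].
Qed.

Lemma norm_Rintegral_le (g : R * R -> R) M : measurable_fun setT g ->
  (forall z, disk z -> `|g z| <= M) -> `|\int[m]_(z in disk) g z| <= M * fine (m disk).
Proof.
move=> mg gM; have ig := bounded_integrable mg gM.
apply: le_trans (le_normr_Rintegral mD ig) _.
rewrite -(Rintegral_cst m mD M); apply: le_Rintegral => //.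
- by apply: (bounded_integrable (M := M)) => [|z dz]; [exact: measurableT_comp|rewrite normr_id gM].
- by apply: (bounded_integrable (M := `|M|)).
Qed.

Lemma keval_integrable e w : disk w -> m.-integrable disk (EFin \o keval e w).
Proof.
move=> dw; have [M [d [_ _ H]]] := taylor_keval e dw.
by apply: (bounded_integrable (M := M)) => [|z dz]; [exact: measurable_keval|have [] := H z dz].
Qed.

Lemma disk_dist1 w0 : disk w0 -> exists2 d, 0 < d & forall w, dist1 w w0 <= d -> disk w.
Proof.
rewrite /disk/= => w1; exists ((1 - sqnorm w0) / 6); first lra.
by move=> w wd; have := sqnorm_near w1 wd; lra.
Qed.

Lemma kint_taylor e w0 : disk w0 -> exists M d, [/\ 0 < M, 0 < d & forall w, dist1 w w0 <= d ->
  `|kint e w - kint e w0 - ((w.1 - w0.1) * kint (kder false e) w0 + (w.2 - w0.2) * kint (kder true e) w0)|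
   <= M * dist1 w w0 ^+ 2].
Proof.
move=> dw; have [M [d [M0 d0 H]]] := taylor_keval e dw; have [d' d'0 wd'] := disk_dist1 dw.
exists (M * fine (m disk) + 1), (Num.min d d'); split.
- by rewrite ltr_wpDl// mulr_ge0 ?(ltW M0)// fine_ge0.
- by rewrite lt_min d0.
move=> w; rewrite le_min => /andP[wd /wd' dw'].
have i0 e' : m.-integrable disk (EFin \o keval e' w0) by exact: keval_integrable.
have i1 := keval_integrable e dw'.
have iZ c (k : R * R -> R) : m.-integrable disk (EFin \o k) -> m.-integrable disk (EFin \o (fun z => c * k z)).
  by move=> ik; exact: (integrableZl mD c ik).
rewrite /kint -!RintegralZl// -RintegralB// -RintegralD//; [|exact: iZ|exact: iZ].
have iB : m.-integrable disk (EFin \o (fun z => keval e w z - keval e w0 z)).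
  by rewrite (_ : EFin \o _ = (EFin \o keval e w) \- (EFin \o keval e w0))%E//; exact: integrableB.
have iD : m.-integrable disk (EFin \o (fun z => (w.1 - w0.1) * keval (kder false e) w0 z + (w.2 - w0.2) * keval (kder true e) w0 z)).
  exact: (integrableD mD (iZ _ _ (i0 _)) (iZ _ _ (i0 _))).
rewrite -RintegralB//.
apply: (@le_trans _ _ (M * dist1 w w0 ^+ 2 * fine (m disk))).
  apply: norm_Rintegral_le; last by move=> z dz; have [_ _ _] := H z dz; exact.
  apply: measurable_funB; first by apply: measurable_funB; exact: measurable_keval.
  by apply: measurable_funD; apply: measurable_funM => //; exact: measurable_keval.
rewrite mulrDl mul1r mulrAC lerDl; exact: sqr_ge0.
Qed.

Lemma dist1_scale w0 b (h : R) : dist1 (h *: unit_vector b + w0) w0 = `|h|.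
Proof.
by rewrite /dist1 /unit_vector; case: b => /=; rewrite !addrK /GRing.scale/= ?mulr0 ?mulr1 normr0 ?addr0 ?add0r.
Qed.

Lemma kint_derive e w0 b : disk w0 -> is_derive w0 (unit_vector b) (kint e) (kint (kder b e) w0).
Proof.
move=> dw; have [M [d [M0 d0 H]]] := kint_taylor e dw.
have cv : (fun h => h^-1 *: ((kint e \o shift w0) (h *: unit_vector b) - kint e w0)) @ 0^' --> kint (kder b e) w0.
  apply/cvgrPdist_le => eps eps0.
  have h0 : 0 < Num.min d (eps / M) by rewrite lt_min d0 divr_gt0.
  near=> h.
  have hn : h != 0 by near: h; exact: nbhs_dnbhs_neq.
  have hd : `|h| < Num.min d (eps / M).
    near: h; apply: dnbhs0_lt => //.
  move: hd; rewrite lt_min => /andP[hd he].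
  rewrite distrC /=.
  have := H (h *: unit_vector b + w0); rewrite dist1_scale => /(_ (ltW hd)).
  have -> : ((h *: unit_vector b + w0).1 - w0.1) * kint (kder false e) w0 +
     ((h *: unit_vector b + w0).2 - w0.2) * kint (kder true e) w0 = h * kint (kder b e) w0.
    by rewrite /unit_vector; case: b => /=; rewrite !addrK /GRing.scale/= ?mulr0 ?mulr1 ?mul0r ?addr0 ?add0r.
  move=> Hh.
  have -> : h^-1 *: (kint e (h *: unit_vector b + w0) - kint e w0) - kint (kder b e) w0 =
    h^-1 * (kint e (h *: unit_vector b + w0) - kint e w0 - h * kint (kder b e) w0).
    by rewrite mulrBr mulrA mulVf// mul1r.
  rewrite normrM normfV ler_pdivrMl ?normr_gt0//; apply: le_trans Hh _.
  rewrite expr2 mulrA mulrC ler_wpM2l//; rewrite -ler_pdivlMl//; first by rewrite mulrC ltW.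
by apply: DeriveDef; [exact: cvgP cv|exact: cvg_lim cv].
Unshelve. all: by end_near. Qed.

Lemma kint_continuous e w0 : disk w0 -> {for w0, continuous (kint e)}.
Proof.
move=> dw; have [M [d [M0 d0 H]]] := kint_taylor e dw.
pose A := `|kint (kder false e) w0| + `|kint (kder true e) w0|.
have A0 : 0 <= A by rewrite addr_ge0.
apply/cvgrPdist_le => eps eps0.
pose r := Num.min (Num.min d 1) (eps / (M + A)) / 2.
have MA : 0 < M + A by rewrite ltr_pwDl.
have r0 : 0 < r by rewrite divr_gt0// !lt_min d0 ltr01 divr_gt0.
have nb : nbhs w0 (ball w0 r) := nbhsx_ballx w0 r r0.
apply: filterS nb => w [/=]; rewrite -ball_normE /= => w1 w2.
have n0 := dist1_ge0 w w0.
have : dist1 w w0 < Num.min (Num.min d 1) (eps / (M + A)).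
  by rewrite /dist1 (distrC w.1) (distrC w.2); move: w1 w2; rewrite /r; lra.
rewrite !lt_min => /andP[/andP[wd wn] we].
pose L := (w.1 - w0.1) * kint (kder false e) w0 + (w.2 - w0.2) * kint (kder true e) w0.
have HL : `|kint e w - kint e w0 - L| <= M * dist1 w w0 ^+ 2 := H w (ltW wd).
have LA : `|L| <= A * dist1 w w0.
  apply: le_trans (ler_normD _ _) _; rewrite (normrM (w.1 - w0.1)) (normrM (w.2 - w0.2)) /A /dist1.
  have := normr_ge0 (w.1 - w0.1); have := normr_ge0 (w.2 - w0.2).
  have := normr_ge0 (kint (kder false e) w0); have := normr_ge0 (kint (kder true e) w0); nra.
rewrite distrC -(subrK L (kint e w - kint e w0)).
apply: le_trans (ler_normD _ _) _; apply: le_trans (lerD HL LA) _.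
rewrite ltr_pdivlMr// in we.
have nn : dist1 w w0 ^+ 2 <= dist1 w w0 by rewrite expr2 ler_piMl// ltW.
have := ler_wpM2l (ltW M0) nn; lra.
Qed.

End kernel_integral.

(** By induction on the list of derivatives, each iterated partial of [F] coincides on the disk with
    the integrals of the formally differentiated kernel. Differentiability is local and the disk
    open, so agreement on the disk is enough. Two measures occur because of the Jordan
    decomposition. *)
Lemma kint_smooth (R : realType) (m1 m2 : {finite_measure set (R * R)%type -> \bar R})
    (F : R * R -> R) e :
  (forall w, disk w -> F w = kint m1 e w - kint m2 e w) -> smooth_on_disk F /\
  forall b w, disk w -> partial b F w = kint m1 (kder b e) w - kint m2 (kder b e) w.
Proof.
move=> FE.
have near_disk (P : R * R -> Prop) w : disk w -> (forall w, disk w -> P w) -> \forall w' \near w, P w'.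
  by move=> dw HP; apply: filterS (open_nbhs_nbhs (conj (@open_disk R) dw)) => w' /HP.
pose G s w := kint m1 (foldr kder e s) w - kint m2 (foldr kder e s) w.
have dG s b w : disk w -> is_derive w (unit_vector b) (G s) (G (b :: s) w).
  by move=> dw; apply: is_deriveB; exact: kint_derive.
have step H s : (forall w, disk w -> H w = G s w) -> forall b w, disk w ->
    is_derive w (unit_vector b) H (G (b :: s) w).
  move=> HE b w dw; apply: near_eq_is_derive (dG s b w dw).
  by apply: near_disk dw _ => w' dw'; rewrite HE.
have FG s w : disk w -> foldr partial F s w = G s w.
  elim: s w => [|b s IH] w dw; first exact: FE.
  by rewrite /= /partial; have [_ ->] := step _ _ IH b w dw.
split; last by move=> b w dw; exact: (FG [:: b]).
move=> s w dw /=; split; last by move=> b; have [] := step _ _ (FG s) b w dw.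
have cG : {for w, continuous (G s)} by apply: cvgB; exact: kint_continuous.
rewrite /continuous_at /prop_for FG//; apply: cvg_trans cG; apply: near_eq_cvg.
by apply: near_disk dw _ => w' dw'; rewrite FG.
Qed.

(** * The gradient of the extended balayage *)

Section euclidean_norm.
Context {R : realType}.
Implicit Types (w z : R * R).

Definition enorm z : R := Num.sqrt (sqnorm z).

Lemma enorm_ge0 z : 0 <= enorm z. Proof. exact: sqrtr_ge0. Qed.

Lemma enorm_sqr z : enorm z ^+ 2 = sqnorm z.
Proof. by rewrite sqr_sqrtr// sqnorm_ge0. Qed.

Lemma enorm_le z (h : R) : 0 <= h -> (enorm z <= h) = (sqnorm z <= h ^+ 2).
Proof. by move=> h0; rewrite -enorm_sqr ler_pXn2r// nnegrE// enorm_ge0. Qed.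

Lemma enormD w z : enorm (w + z) <= enorm w + enorm z.
Proof.
rewrite enorm_le ?addr_ge0 ?enorm_ge0// sqrrD !enorm_sqr.
have cs : w.1 * z.1 + w.2 * z.2 <= enorm w * enorm z.
  apply: le_trans (ler_norm _) _.
  rewrite -(@ler_pXn2r _ 2)// ?nnegrE ?mulr_ge0 ?enorm_ge0// real_normK ?num_real// exprMn !enorm_sqr.
  rewrite /sqnorm -subr_ge0 (_ : _ - _ = (w.1 * z.2 - w.2 * z.1) ^+ 2) ?sqr_ge0//; ring.
by rewrite /sqnorm/= -mulr_natr; lra.
Qed.

Lemma enormN z : enorm (- z) = enorm z.
Proof. by rewrite /enorm /sqnorm/= !sqrrN. Qed.

Lemma enormBC w z : enorm (w - z) = enorm (z - w).
Proof. by rewrite -enormN opprB. Qed.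

Lemma enorm_cis (r t : R) : 0 <= r -> enorm (r *: cis t) = r.
Proof. by move=> r0; rewrite /enorm sqnorm_cis sqrtr_sqr ger0_norm. Qed.

Lemma sqnorm_cisB (r t c : R) :
  sqnorm (r *: cis t - cis c) = (1 - r) ^+ 2 + r * (2 - 2 * cos (t - c)).
Proof.
rewrite /sqnorm/= cosB; have := cos2Dsin2 t; have := cos2Dsin2 c.
move: (cos t) (sin t) (cos c) (sin c) => a b a' b' h1 h2.
transitivity (r ^+ 2 * (a ^+ 2 + b ^+ 2) - 2 * r * (a * a' + b * b') + (a' ^+ 2 + b' ^+ 2)).
  by rewrite /GRing.scale/=; ring.
by rewrite h1 h2; ring.
Qed.

Lemma szego_sym w z : szego w z = szego z w.
Proof. by rewrite /szego; ring. Qed.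

Lemma szegoE w z : szego w z = sqnorm (w - z) + (1 - sqnorm z) * (1 - sqnorm w).
Proof. by rewrite /szego /sqnorm/=; ring. Qed.

Lemma sqrt_szego_ge_dist w z : sqnorm w <= 1 -> sqnorm z <= 1 -> enorm (w - z) <= Num.sqrt (szego w z).
Proof.
move=> w1 z1; rewrite /enorm ler_wsqrtr// szegoE lerDl mulr_ge0// subr_ge0//.
Qed.

Lemma coord_le_enorm (b : bool) z : `|coord b z| <= enorm z.
Proof.
rewrite /enorm -sqrtr_sqr ler_wsqrtr// /sqnorm /coord; have := sqr_ge0 z.1; have := sqr_ge0 z.2.
by case: b; lra.
Qed.

Lemma sqrt_szego_ge w z : sqnorm w <= 1 -> disk z -> (1 - sqnorm z) / 2 <= Num.sqrt (szego w z).
Proof.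
rewrite /disk/= => w1 z1; rewrite -[leLHS]ger0_norm; last lra.
by rewrite -sqrtr_sqr ler_wsqrtr// szego_sym szego_ge.
Qed.

Lemma enorm_disk_le z c : disk z -> 1 - sqnorm z <= 2 * enorm (z - cis c).
Proof.
move=> dz; have : enorm (cis c) = 1 by rewrite -[cis c]scale1r enorm_cis.
have := enormD z (cis c - z); rewrite addrC subrK => h e.
have h1 : 1 - enorm z <= enorm (z - cis c) by rewrite enormBC; lra.
have z1 : enorm z <= 1 by rewrite enorm_le// expr1n ltW.
by rewrite -enorm_sqr; have := enorm_ge0 z; nra.
Qed.

End euclidean_norm.

(** * Mass of the gradient of the kernel *)

Section gradient_kernel.
Context {R : realType}.
Implicit Types (w z : R * R).

Definition pois_ext : @kexpr R :=
  KMul (KAdd (KC 1) (KMul (KC (-1)) (KAdd (KMul (KZ false) (KZ false)) (KMul (KZ true) (KZ true))))) KInv.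

Lemma pois_extE w z : keval pois_ext w z = (1 - sqnorm z) / szego w z.
Proof. by rewrite /= /coord /sqnorm; congr (_ / _); ring. Qed.

(** Twice a bound for each of the two partial derivatives of the kernel, hence a bound for its
    gradient. *)
Definition gker w z : R := 4 * (1 - sqnorm z) * (Num.sqrt (szego w z)) ^- 3.

(** The gradient of [szego] in [w] has length [2 |z| s], where [s] is the square root of [szego].
    Dividing by [s ^ 4] leaves [s ^ -3]. *)
Lemma pois_ext_der b w z : disk w -> disk z -> `|keval (kder b pois_ext) w z| <= gker w z / 2.
Proof.
move=> dw dz; have D0 : 0 < szego w z by apply: szego_gt0 => //; exact: ltW.
set s := Num.sqrt (szego w z); have s0 : 0 < s by rewrite sqrtr_gt0.
have sE : szego w z = s ^+ 2 by rewrite sqr_sqrtr// ltW.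
pose g b := 2 * (- coord b z + sqnorm z * coord b w).
have -> : keval (kder b pois_ext) w z = (1 - sqnorm z) * (- g b) * (s ^- 2 * s ^- 2).
  by rewrite -!sE /= /g /sqnorm /coord; case: b; ring.
have gb : `|g b| <= 2 * s.
  have h : g false ^+ 2 + g true ^+ 2 = 4 * sqnorm z * s ^+ 2.
    by rewrite -sE /szego /g /sqnorm /coord; ring.
  have gb2 : g b ^+ 2 <= (2 * s) ^+ 2.
    have : 4 * sqnorm z * s ^+ 2 <= 4 * s ^+ 2.
      by rewrite -mulrA ler_pM2l// ler_piMl ?sqr_ge0// ltW.
    have := sqr_ge0 (g false); have := sqr_ge0 (g true); have -> : (2 * s) ^+ 2 = 4 * s ^+ 2 by ring.
    by case: (b); lra.
  by rewrite -(@ler_pXn2r _ 2)// ?nnegrE ?mulr_ge0 ?(ltW s0)// real_normK ?num_real.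
have z0 : 0 <= 1 - sqnorm z by rewrite subr_ge0 ltW.
rewrite (normrM (_ * - g b)) (normrM (1 - sqnorm z)) normrN (@ger0_norm _ (1 - sqnorm z))// ger0_norm; last first.
  by rewrite mulr_ge0 ?invr_ge0 ?exprn_ge0// ltW.
have -> : gker w z / 2 = (1 - sqnorm z) * (2 * s) * (s ^- 2 * s ^- 2).
  by rewrite /gker -/s; field; rewrite gt_eqF.
apply: ler_wpM2r; first by rewrite mulr_ge0 ?invr_ge0 ?exprn_ge0// ltW.
exact: ler_wpM2l.
Qed.

Lemma gker_ge0 w z : disk z -> 0 <= gker w z.
Proof.
move=> dz; rewrite /gker mulr_ge0 ?invr_ge0 ?exprn_ge0 ?sqrtr_ge0// mulr_ge0// subr_ge0 ltW//.
Qed.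

Lemma measurable_gker : measurable_fun setT (fun p : (R * R) * (R * R) => gker p.1 p.2).
Proof.
have m1 : measurable_fun setT (fun p : (R * R) * (R * R) => p.1.1) by exact: measurableT_comp.
have m2 : measurable_fun setT (fun p : (R * R) * (R * R) => p.1.2) by exact: measurableT_comp.
have m3 : measurable_fun setT (fun p : (R * R) * (R * R) => p.2.1) by exact: measurableT_comp.
have m4 : measurable_fun setT (fun p : (R * R) * (R * R) => p.2.2) by exact: measurableT_comp.
have mz : measurable_fun setT (fun p : (R * R) * (R * R) => sqnorm p.2) by exact: (measurableT_comp measurable_fun_sqnorm).
have mw : measurable_fun setT (fun p : (R * R) * (R * R) => sqnorm p.1) by exact: (measurableT_comp measurable_fun_sqnorm).
apply: measurable_funM.
  by apply: measurable_funM => //; exact: measurable_funB.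
apply: measurable_fun_inv; apply: measurable_funX.
have ms : measurable_fun setT (@Num.sqrt R) by apply: continuous_measurable_fun; exact: sqrt_continuous.
apply: (measurableT_comp ms).
apply: measurable_funD; last exact: measurable_funM.
apply: measurable_funB => //; apply: measurable_funM => //; apply: measurable_funD; exact: measurable_funM.
Qed.

Lemma even_mass (g : R -> R) (B c a b : R) : bddmeas g -> (forall s, 0 <= g s) ->
  (forall s, g (- s) = g s) -> (forall L, 0 <= L -> iint g 0 L <= B) -> a <= b ->
  iint (fun t => g (t - c)) a b <= 2 * B.
Proof.
move=> bg g0 gN gB ab; have mg := bg.1; have lg := bddmeas_locint bg.
have lgc : locint (fun t => g (t - c)).
  apply: bddmeas_locint; have [_ [M gM]] := bg; split; last by exists M.
  exact: (measurableT_comp mg (measurable_funB (@measurable_id _ _ setT) (measurable_cst c))).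
pose a' := Num.min a c; pose b' := Num.max b c.
have a1 : a' <= a by rewrite ge_min lexx.
have a2 : a' <= c by rewrite ge_min lexx orbT.
have b1 : b <= b' by rewrite le_max lexx.
have b2 : c <= b' by rewrite le_max lexx orbT.
apply: le_trans (iint_sub lgc (fun t => g0 _) a1 ab b1) _.
rewrite (@iint_split _ _ a' c b')//.
have -> : iint (fun t => g (t - c)) a' c = iint g 0 (c - a').
  rewrite (@eq_iint _ _ (fun t => g (c - t))); last by move=> t _; rewrite -gN opprB.
  by rewrite (@iint_reflect _ g)// subrr.
rewrite (@iint_translate _ g)// subrr mulrDl mul1r.
by apply: lerD; apply: gB; rewrite subr_ge0.
Qed.

Lemma bddmeas_cubic (a : R) : 0 < a -> bddmeas (fun s : R => (a + `|s|) ^- 2).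
Proof.
move=> a0; have [m1 [K kK]] := bddmeas_kmaj1 a0.
have e (s : R) : (a + `|s|) ^- 2 = a ^- 2 * ((a + `|s|) * kmaj a s).
  have h : 0 < a + `|s| by rewrite ltr_pwDl.
  by rewrite /kmaj; field; rewrite !gt_eqF.
rewrite (_ : (fun s => _) = fun s => a ^- 2 * ((a + `|s|) * kmaj a s)); last exact/funext.
split; first exact: measurable_funM.
by exists (`|a ^- 2| * K) => t; rewrite (normrM (a ^- 2)) ler_wpM2l.
Qed.

Lemma bddmeas2_cubic (a c c' : R) : 0 < a ->
  bddmeas2 (fun p : R * R => (a + `|p.1 - c| + `|p.2 - c'|) ^- 3).
Proof.
move=> a0.
have m1 : measurable_fun setT (fun p : R * R => p.1 - c).
  by apply: measurable_funB => //; exact: measurable_fst.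
have m2 : measurable_fun setT (fun p : R * R => p.2 - c').
  by apply: measurable_funB => //; exact: measurable_snd.
have n1 : measurable_fun setT (fun p : R * R => `|p.1 - c|) by exact: measurableT_comp.
have n2 : measurable_fun setT (fun p : R * R => `|p.2 - c'|) by exact: measurableT_comp.
have m3 : measurable_fun setT (fun p : R * R => a + `|p.1 - c| + `|p.2 - c'|).
  by apply: measurable_funD => //; exact: measurable_funD.
split; first by apply: measurable_fun_inv; exact: measurable_funX.
exists (a ^- 3) => p; rewrite ger0_norm ?invr_ge0 ?exprn_ge0 ?addr_ge0 ?(ltW a0)//.
rewrite lef_pV2 ?posrE ?exprn_gt0//; last by rewrite -addrA ltr_pwDl// addr_ge0.
by rewrite lerXn2r ?nnegrE ?addr_ge0 ?(ltW a0)// -addrA lerDl addr_ge0.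
Qed.

(** Each of the two integrations lowers the exponent by one and costs at most a factor 2. *)
Lemma cubic_mass (a c c' : R) : 0 < a ->
  iint2 (fun p => (a + `|p.1 - c| + `|p.2 - c'|) ^- 3) (-1) 1 <= 4 / a.
Proof.
move=> a0; have pos (s : R) : 0 < a + `|s| by rewrite ltr_pwDl.
have m11 : -1 <= 1 :> R by lra.
have inner (Y : R) : 0 < Y -> iint (fun t => (Y + `|t - c'|) ^- 3) (-1) 1 <= 2 * Y ^- 2.
  move=> Y0; have bk := bddmeas_kmaj Y0.
  have lk : locint (fun t => kmaj Y (t - c')).
    apply: bddmeas_locint; have [mk [M kM]] := bk; split; last by exists M.
    exact: (measurableT_comp mk (measurable_funB (@measurable_id _ _ setT) (measurable_cst c'))).
  rewrite (@eq_iint _ _ (fun t => Y ^- 2 * kmaj Y (t - c'))); last first.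
    by move=> t _; rewrite /kmaj mulrA mulVf ?mul1r// gt_eqF// exprn_gt0.
  rewrite iintZ// mulrC ler_wpM2r ?invr_ge0 ?exprn_ge0 ?(ltW Y0)//.
  rewrite -[leRHS]mulr1; apply: even_mass => //.
  - by move=> s; exact: kmaj_ge0.
  - exact: kmajN.
  - move=> L L0; apply: le_trans (iint_kmaj Y0 (lexx 0) L0) _.
    by rewrite addr0 divff// gt_eqF// exprn_gt0.
have bc := bddmeas_cubic a0.
have lc : locint (fun s => (a + `|s - c|) ^- 2).
  apply: bddmeas_locint; have [mk [M kM]] := bc; split; last by exists M.
  exact: (measurableT_comp mk (measurable_funB (@measurable_id _ _ setT) (measurable_cst c))).
have b2 := bddmeas2_cubic c c' a0.
apply: (@le_trans _ _ (iint (fun x => 2 * (a + `|x - c|) ^- 2) (-1) 1)).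
  apply: le_iint; [exact: bddmeas_locint (bddmeas2_iint m11 b2)|exact: locintZ|].
  by move=> x _; exact: (inner (a + `|x - c|) (pos _)).
rewrite iintZ//.
suff : iint (fun x => (a + `|x - c|) ^- 2) (-1) 1 <= 2 * a^-1 by lra.
apply: (@even_mass (fun s => (a + `|s|) ^- 2)) => //.
- by move=> s; rewrite invr_ge0 exprn_ge0// ltW.
- by move=> s; rewrite normrN.
move=> L L0; have [m1 [K kK]] := bddmeas_kmaj1 a0.
have lk : locint (fun s => (a + `|s|) * kmaj a s) by apply: bddmeas_locint; split => //; exists K.
rewrite (@eq_iint _ _ (fun s => a ^- 2 * ((a + `|s|) * kmaj a s))); last first.
  by move=> s _; rewrite /kmaj; have := pos s; move: (a + `|s|) => q q0; field; rewrite !gt_eqF.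
rewrite iintZ//; apply: le_trans (ler_wpM2l _ (iint_kmaj1 a0 (lexx 0) L0)) _.
  by rewrite invr_ge0 exprn_ge0// ltW.
by rewrite addr0 le_eqVlt; apply/orP; left; apply/eqP; field; rewrite gt_eqF.
Qed.

Let lam2 := (@lebesgue_measure R \x @lebesgue_measure R)%E.

Lemma integral_square (q : R * R -> R) : bddmeas2 q -> (forall p, 0 <= q p) ->
  (\int[lam2]_(p in `[(-1)%R, 1%R] `*` `[(-1)%R, 1%R]) (q p)%:E = (iint2 q (-1) 1)%:E)%E.
Proof.
move=> bq q0; have m11 : -1 <= 1 :> R by lra.
pose f (p : R * R) : \bar R := ((\1_(`[(-1)%R, 1%R]%classic : set R) p.1)%:E * ((\1_(`[(-1)%R, 1%R]%classic : set R) p.2)%:E * (q p)%:E))%E.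
have mf : measurable_fun setT f.
  by do ! apply: emeasurable_funM; apply/measurable_EFinP; [apply: (measurableT_comp _ measurable_fst); exact: measurable_indic|apply: (measurableT_comp _ measurable_snd); exact: measurable_indic|exact: bq.1].
have f0 p : (0 <= f p)%E by rewrite /f !mule_ge0// lee_fin.
transitivity (\int[lam2]_p f p)%E.
  rewrite [LHS]integral_mkcond; apply: eq_integral => -[x y] _; rewrite patchE /f !indicE in_setX/=.
  by case: (x \in _); case: (y \in _); rewrite ?mul1e ?mul0e.
transitivity (\int[lebesgue_measure]_x fubini_F lebesgue_measure f x)%E; first exact: (@fubini_tonelli1 _ _ (measurableTypeR R) (measurableTypeR R) R lebesgue_measure lebesgue_measure f mf f0).
rewrite /fubini_F /iint2 iint_EFin; last exact: bddmeas_locint (bddmeas2_iint m11 bq).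
rewrite [RHS]integral_mkcond; apply: eq_integral => x _; rewrite patchE /f/= indicE.
case: ifPn => _; last by under eq_integral do rewrite mul0e; rewrite integral0.
rewrite iint_EFin; last exact: bddmeas_locint (bddmeas2_slice x bq).
rewrite [RHS]integral_mkcond; apply: eq_integral => y _; rewrite patchE indicE mul1e.
by case: ifPn => _; rewrite ?mul1e ?mul0e.
Qed.

Definition gker_mass (A : set (R * R)) z : \bar R := (\int[lam2]_(w in A) (gker w z)%:E)%E.

Let mgz z A : measurable_fun A (fun w => (gker w z)%:E).
Proof.
by apply: measurable_funTS; apply/measurable_EFinP; exact: (measurableT_comp measurable_gker (pair2_measurable z)).
Qed.

(** The square root of [szego] dominates [a = (1 - |z| ^ 2) / 2] and both coordinates of [w - z],
    hence a third of their sum. This gives [8 a * 27 = 216 a] in front of the cubic kernel, whose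
    mass [4 / a] makes the bound [864] independent of [z]. *)
Lemma gker_mass_le A z : measurable A -> A `<=` disk -> disk z -> (gker_mass A z <= 864%:E)%E.
Proof.
move=> mA Ad dz; pose a := (1 - sqnorm z) / 2.
have a0 : 0 < a by rewrite /a divr_gt0// subr_gt0.
pose q (p : R * R) := 216 * a * (a + `|p.1 - z.1| + `|p.2 - z.2|) ^- 3.
have b2 := bddmeas2_cubic z.1 z.2 a0.
have bq : bddmeas2 q by apply: bddmeas2M => //; exact: bddmeas2_cst.
have a216 : 0 <= 216 * a by have := a0; lra.
have q0 p : 0 <= q p.
  apply: mulr_ge0; first exact: a216.
  by rewrite invr_ge0 exprn_ge0// !addr_ge0// ltW.
have m11 : -1 <= 1 :> R by lra.
have msq : measurable (`[(-1)%R, 1%R] `*` `[(-1)%R, 1%R] : set (R * R)) by exact: measurableX.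
have dsq : (disk : set (R * R)) `<=` `[(-1)%R, 1%R] `*` `[(-1)%R, 1%R].
  move=> w dw; split; rewrite /= in_itv/= -ler_norml; [exact: (disk_coord false)|exact: (disk_coord true)].
apply: (@le_trans _ _ (\int[lam2]_(w in A) (q w)%:E)%E).
  apply: ge0_le_integral => //.
  - by move=> w Aw; rewrite lee_fin gker_ge0.
  - exact: mgz.
  - by apply: measurable_funTS; apply/measurable_EFinP; exact: bq.1.
  move=> w Aw; rewrite lee_fin; have dw := Ad w Aw.
  have w1 : sqnorm w <= 1 by exact: ltW.
  have z1 : sqnorm z <= 1 by exact: ltW.
  set s := Num.sqrt (szego w z).
  have sa : a <= s by exact: sqrt_szego_ge.
  have d := sqrt_szego_ge_dist w1 z1; rewrite -/s in d.
  have s1 : `|w.1 - z.1| <= s by apply: le_trans (coord_le_enorm false (w - z)) d.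
  have s2 : `|w.2 - z.2| <= s by apply: le_trans (coord_le_enorm true (w - z)) d.
  have s0 : 0 < s by exact: lt_le_trans sa.
  have t0 : 0 < a + `|w.1 - z.1| + `|w.2 - z.2| by rewrite ltr_pwDl// addrC ltr_pwDr.
  have h : s ^- 3 <= 27 * (a + `|w.1 - z.1| + `|w.2 - z.2|) ^- 3.
    rewrite (_ : 27 * _ = ((a + `|w.1 - z.1| + `|w.2 - z.2|) / 3) ^- 3); last by rewrite expr_div_n invf_div; congr (_ / _); ring.
    rewrite lef_pV2 ?posrE ?exprn_gt0 ?divr_gt0// lerXn2r ?nnegrE ?divr_ge0 ?(ltW t0) ?(ltW s0)//; lra.
  rewrite /gker -/s (_ : 4 * (1 - sqnorm z) = 8 * a); last by rewrite /a; lra.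
  rewrite /q (_ : 216 * a = 8 * a * 27); last by ring.
  by rewrite -[leRHS]mulrA ler_wpM2l// mulr_ge0// ltW.
apply: (@le_trans _ _ (\int[lam2]_(w in `[(-1)%R, 1%R] `*` `[(-1)%R, 1%R]) (q w)%:E)%E).
  apply: ge0_subset_integral => //.
  - by apply: measurable_funTS; apply/measurable_EFinP; exact: bq.1.
  - by move=> w _; rewrite lee_fin.
  - exact: subset_trans Ad dsq.
rewrite integral_square// lee_fin /q iint2Z//.
have := ler_wpM2l (_ : 0 <= 216 * a) (cubic_mass z.1 z.2 a0).
rewrite (_ : 216 * a * (4 / a) = 864); last by field; rewrite gt_eqF.
by apply; exact: a216.
Qed.

(** If [z] is at distance [D >= 2 h] from the centre, the square root of [szego] is at least [D / 2]
    and [1 - |z| ^ 2 <= 2 D], so that [gker] is at most [64 / D ^ 2] on a set of area at most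
    [(2 h) ^ 2]. The constant [864] is kept to match the bound for near [z]. *)
Lemma gker_mass_far A z (c h : R) (k : nat) : 0 < h -> measurable A -> A `<=` disk -> disk z ->
  (forall w, A w -> enorm (w - cis c) <= h) -> 2 ^+ k * (2 * h) <= enorm (z - cis c) ->
  (gker_mass A z <= (864 * 4 ^- k)%:E)%E.
Proof.
move=> h0 mA Ad dz Ah zk; set D := enorm (z - cis c) in zk.
have k0 : 0 < 2 ^+ k :> R by exact: exprn_gt0.
have D0 : 0 < D by apply: lt_le_trans zk; rewrite !mulr_gt0.
have hD : 2 * h <= D.
  by apply: le_trans zk; rewrite ler_peMl ?mulr_ge0 ?(ltW h0)// exprn_ege1// ler1n.
have bnd w : A w -> gker w z <= 64 * D ^- 2.
  move=> Aw; have dw := Ad w Aw.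
  have s1 := sqrt_szego_ge_dist (ltW dw) (ltW dz); set s := Num.sqrt _ in s1.
  have sD : D / 2 <= s.
    have h1 : D <= enorm (w - z) + enorm (w - cis c).
      by have := enormD (z - w) (w - cis c); rewrite addrA subrK -/D (enormBC z).
    have h2 : enorm (w - cis c) <= h := Ah w Aw.
    move: h1 h2 hD s1; lra.
  have s0 : 0 < s by apply: lt_le_trans sD; rewrite divr_gt0.
  have z1 : 1 - sqnorm z <= 2 * D by exact: enorm_disk_le.
  have -> : 64 * D ^- 2 = (4 * (2 * D)) * (D / 2) ^- 3.
    by field; rewrite gt_eqF.
  apply: ler_pM; rewrite ?invr_ge0 ?exprn_ge0 ?(ltW s0)//.
  - by rewrite mulr_ge0// subr_ge0 ltW.
  - by rewrite ler_pM2l.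
  - by rewrite lef_pV2 ?posrE ?exprn_gt0 ?divr_gt0// lerXn2r ?nnegrE ?divr_ge0 ?(ltW D0) ?(ltW s0).
pose J (x : R) : set R := `[x - h, x + h]%classic.
have AJ : A `<=` J (cos c) `*` J (sin c).
  move=> w Aw; have wh : enorm (w - cis c) <= h := Ah w Aw.
  have := le_trans (coord_le_enorm false (w - cis c)) wh.
  have := le_trans (coord_le_enorm true (w - cis c)) wh.
  rewrite /coord /= !ler_norml => /andP[h1 h2] /andP[h3 h4].
  by split; rewrite /J /= in_itv/=; apply/andP; split; lra.
have mJ : measurable (J (cos c) `*` J (sin c)) by apply: measurableX; exact: measurable_itv.
apply: (@le_trans _ _ (\int[lam2]_(w in J (cos c) `*` J (sin c)) (64 * D ^- 2)%:E)%E).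
  apply: (@le_trans _ _ (\int[lam2]_(w in A) (64 * D ^- 2)%:E)%E).
    apply: ge0_le_integral => //; first by move=> w Aw; rewrite lee_fin gker_ge0.
    exact: mgz.
  apply: ge0_subset_integral => // w _; rewrite lee_fin.
  by rewrite mulr_ge0// invr_ge0 exprn_ge0// ltW.
rewrite integral_cst//.
have lJ x : lebesgue_measure (J x) = (2 * h)%:E.
  rewrite /J lebesgue_measure_itv/= lte_fin ltrD2l gtrN//.
  by rewrite -EFinB; congr EFin; ring.
have lamE : lam2 (J (cos c) `*` J (sin c)) = ((2 * h) * (2 * h))%:E.
  transitivity (lebesgue_measure (J (cos c)) * lebesgue_measure (J (sin c)))%E.
    exact: (product_measure1E lebesgue_measure lebesgue_measure (measurable_itv _) (measurable_itv _)).
  by rewrite !lJ.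
apply: (@le_trans _ _ ((64 * D ^- 2)%:E * ((2 * h) * (2 * h))%:E)%E).
  by rewrite -lamE.
rewrite -EFinM lee_fin.
have d2 : D ^- 2 <= (2 ^+ k * (2 * h)) ^- 2.
  by rewrite lef_pV2 ?posrE ?exprn_gt0 ?mulr_gt0// lerXn2r ?nnegrE ?mulr_ge0 ?(ltW D0) ?(ltW k0) ?(ltW h0).
have h2 : 0 <= 64 * (2 * h * (2 * h)) by rewrite !mulr_ge0// ltW.
rewrite mulrAC; apply: le_trans (ler_wpM2l h2 d2) _.
have -> : 64 * (2 * h * (2 * h)) * (2 ^+ k * (2 * h)) ^- 2 = 64 * 4 ^- k.
  rewrite !exprMn -exprM mulnC exprM (_ : 2 ^+ 2 = 4); last by ring.
  by field; rewrite !gt_eqF// exprn_gt0.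
by rewrite ler_wpM2r ?invr_ge0 ?exprn_ge0//; lra.
Qed.

End gradient_kernel.

Section planar_lebesgue.
Context {R : realType}.

(* The library's own instance for products of sigma-finite measures is
   shadowed by the one for subprobabilities. *)
Definition planar_lebesgue : set (measurableTypeR R * measurableTypeR R)%type -> \bar R :=
  (@lebesgue_measure R \x @lebesgue_measure R)%E.

HB.instance Definition _ := Measure.copy planar_lebesgue (@lebesgue_measure R \x @lebesgue_measure R)%E.

Let planar_lebesgue_sigma_finite : sigma_finite setT planar_lebesgue.
Proof.
have mI n : measurable (`[- n%:R, n%:R]%classic : set (measurableTypeR R)) by exact: measurable_itv.
exists (fun n => `[- n%:R, n%:R]%classic `*` `[- n%:R, n%:R]%classic).
  apply/seteqP; split => // -[x y] _; exists (Num.truncn (`|x| + `|y|)).+1 => //.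
  have h := truncnS_gt (`|x| + `|y|).
  split; rewrite /= in_itv/= -ler_norml ltW//; apply: le_lt_trans h.
    by rewrite lerDl.
  by rewrite lerDr.
move=> n; split; first exact: measurableX.
have fin : (@lebesgue_measure R `[(- n%:R)%R, n%:R%R]%classic < +oo)%E.
  by rewrite lebesgue_measure_itv/=; case: ifPn => // _; rewrite -EFinB ltry.
have -> : planar_lebesgue (`[- n%:R, n%:R]%classic `*` `[- n%:R, n%:R]%classic) =
    (@lebesgue_measure R `[(- n%:R)%R, n%:R%R]%classic * @lebesgue_measure R `[(- n%:R)%R, n%:R%R]%classic)%E.
  exact: (product_measure1E (@lebesgue_measure R) (@lebesgue_measure R) (mI n) (mI n)).
by rewrite lte_mul_pinfty// ge0_fin_numE.
Qed.

HB.instance Definition _ := Measure_isSigmaFinite.Build _ _ _ planar_lebesgue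
  planar_lebesgue_sigma_finite.

End planar_lebesgue.

(** * Gradient mass over small Carleson squares *)

Section carleson_gradient.
Context {R : realType}.
Implicit Types (w z : R * R) (c h t : R).

Lemma sin_le_id x : 0 <= x -> `|sin x| <= x :> R.
Proof.
rewrite le_eqVlt => /predU1P[<-|x0]; first by rewrite sin0 normr0.
have [y _] := @MVT_segment R (sin : R -> R) cos 0 x (ltW x0) (fun y _ => is_derive_sin y)
  (continuous_subspaceT (@continuous_sin R)).
rewrite sin0 !subr0 => ->; rewrite (normrM (cos y)) (gtr0_norm x0) ler_piMl ?(ltW x0)//.
exact: cos_max.
Qed.

Lemma one_cos_le (s : R) : 2 - 2 * cos s <= s ^+ 2.
Proof.
wlog s0 : s / 0 <= s.
  move=> H; have [s0|s0] := leP 0 s; first exact: H.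
  by rewrite -cosN -sqrrN; apply: H; rewrite oppr_ge0 ltW.
have := @sin_le_id (s / 2); rewrite divr_ge0// => /(_ isT) h.
have -> : cos s = 1 - 2 * sin (s / 2) ^+ 2.
  rewrite [in LHS](_ : s = (s / 2) *+ 2); last by rewrite mulr2n -splitr.
  by rewrite cos_mulr2n cos2sin2 mulr2n; ring.
have : `|sin (s / 2)| ^+ 2 <= (s / 2) ^+ 2 by rewrite lerXn2r// ?nnegrE// divr_ge0.
by rewrite real_normK ?num_real//; lra.
Qed.

(** Let [s] be the angle from [c]. Since [r >= 1 / 2], the distance to [cis c] controls both
    [1 - r < rho] and [s ^ 2 < 8 rho ^ 2]. The arc of length [8 * rho] is long enough for the square
    to have depth [rho], as [pi <= 4]. *)
Lemma ball_square c (rho : R) z : 0 < rho <= 2^-1 -> disk z -> enorm (z - cis c) < rho ->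
  carleson_square (cis @` [set` Interval (BSide true (c - 4 * rho)) (BSide false (c + 4 * rho))]) z.
Proof.
move=> /andP[r0 r2]; have [r [t0 [r'0 ->]]] := polarP z.
have [t tpi <-] := cis_surj (c - pi) (circle_cis t0).
rewrite disk_cis// => r1 zr.
have p4 : pi <= 4 :> R by have [/andP[_ h] _] := pihalf_02_cos_pihalf R; lra.
have p2 := pi_ge2 R.
have : sqnorm (r *: cis t - cis c) < rho ^+ 2.
  by rewrite -enorm_sqr ltr_pXn2r// nnegrE ?enorm_ge0// ltW.
rewrite sqnorm_cisB => sq.
have tc : `|t - c| <= pi by rewrite ler_norml; move/andP: tpi => [? ?]; lra.
have oc := one_cos_ge tc.
have o0 : 0 <= 2 - 2 * cos (t - c) by have := cos_le1 (t - c); lra.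
have r1' : (1 - r) ^+ 2 < rho ^+ 2 by have := mulr_ge0 r'0 o0; lra.
have rr : 1 - r < rho by rewrite -(@ltr_pXn2r _ 2)// nnegrE; lra.
have rh : 2^-1 <= r by lra.
have tt : (t - c) ^+ 2 < 8 * rho ^+ 2 by have := sqr_ge0 (1 - r); have := sqr_ge0 (t - c); nra.
have ts : `|t - c| < 4 * rho.
  rewrite -(@ltr_pXn2r _ 2)// ?nnegrE ?mulr_ge0 ?(ltW r0)// real_normK ?num_real// exprMn.
  by rewrite (_ : 4 ^+ 2 = 16); [have := sqr_ge0 rho; lra|ring].
exists r; last exists (cis t) => //.
  rewrite /= in_itv/= (ltW r1) andbT len_arc; [|lra|lra].
  have -> : c + 4 * rho - (c - 4 * rho) = 8 * rho by ring.
  have h : rho <= 8 * rho / (2 * pi) by rewrite ler_pdivlMr; nra.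
  lra.
exists t => //; rewrite /= in_itv/=; move: ts; rewrite ltr_norml => /andP[? ?]; apply/andP; split; lra.
Qed.

(** The depth of the square is at most a quarter of [b - a] and the angle differs from the middle
    one by at most half of it; the sum of the two squares stays below [(b - a) ^ 2]. *)
Lemma square_near (a b : R) (x y : bool) w : a < b -> b <= a + 2 * pi ->
  carleson_square (cis @` [set` Interval (BSide x a) (BSide y b)]) w -> disk w ->
  enorm (w - cis ((a + b) / 2)) <= b - a.
Proof.
move=> ab b2 [r rI [_ [t tI <-] <-]] dw; have pp := pi_ge2 R.
move: rI; rewrite len_arc//= in_itv/= => /andP[r1 r2].
have h1 : (b - a) / (2 * pi) <= 1 by rewrite ler_pdivrMr; lra.
have r0 : 0 <= r by lra.
have /andP[ta tb] : a <= t <= b.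
  move: tI; rewrite /= itv_boundlr => /andP[k1 k2].
  by apply/andP; split; [move: k1; case: (x); rewrite bnd_simp// => /ltW|move: k2; case: (y); rewrite bnd_simp// => /ltW].
rewrite enorm_le; last lra.
rewrite sqnorm_cisB; set s := t - _.
have s2 : s ^+ 2 <= ((b - a) / 2) ^+ 2.
  rewrite -(real_normK (num_real s)) lerXn2r// ?nnegrE; [lra|].
  by rewrite ler_norml /s; lra.
have c2 := one_cos_le s.
have o0 : 0 <= 2 - 2 * cos s by have := cos_le1 s; lra.
have h2 : (b - a) / (2 * pi) <= (b - a) / 4.
  by rewrite ler_pM2l ?subr_gt0// lef_pV2 ?posrE; lra.
have q : (1 - r) ^+ 2 <= ((b - a) / 4) ^+ 2 by rewrite lerXn2r// ?nnegrE; lra.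
have m : r * (2 - 2 * cos s) <= 2 - 2 * cos s by rewrite ler_piMl.
have := sqr_ge0 (b - a); lra.
Qed.

Variable m : {finite_measure set (R * R)%type -> \bar R}.

Local Notation lam2 := (@lebesgue_measure R \x @lebesgue_measure R)%E.

Let mR := measurableTypeR R.

Let mD := @measurable_disk R.

Definition total_gker (A : set (R * R)) : \bar R := (\int[m]_(z in disk) gker_mass A z)%E.

Let P A (p : (R * R) * (R * R)) : \bar R :=
  ((\1_A p.1)%:E * ((\1_disk p.2)%:E * `|gker p.1 p.2|%:E))%E.

Let mP A : measurable A -> measurable_fun setT (P A).
Proof.
move=> mA; apply: emeasurable_funM; last apply: emeasurable_funM; apply/measurable_EFinP.
- by apply: (measurableT_comp _ measurable_fst); exact: measurable_indic.
- by apply: (measurableT_comp _ measurable_snd); exact: measurable_indic.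
- by apply: measurableT_comp => //; exact: measurable_gker.
Qed.

Let P0 A p : (0 <= P A p)%E. Proof. by rewrite /P !mule_ge0// lee_fin. Qed.

Let PE A z : disk z -> gker_mass A z = (\int[lam2]_w P A (w, z))%E.
Proof.
move=> dz; rewrite /gker_mass [LHS]integral_mkcond; apply: eq_integral => w _.
rewrite patchE /P/= !indicE (mem_set dz) mul1e; case: ifPn => _; rewrite ?mul1e ?mul0e//.
by rewrite ger0_norm// gker_ge0.
Qed.

Lemma measurable_gker_mass (A : set (R * R)) : measurable A -> measurable_fun disk (@gker_mass R A).
Proof.
move=> mA; apply: (@eq_measurable_fun _ _ _ _ _ (fun z => \int[lam2]_w P A (w, z))%E).
  by move=> z /set_mem dz; rewrite PE.
apply: measurable_funTS.
exact: (@measurable_fun_fubini_tonelli_G _ _ (mR * mR)%type (R * R)%type R planar_lebesgue (P A) (mP mA) (P0 A)).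
Qed.

Lemma gker_mass_ge0 A z : disk z -> (0 <= gker_mass A z)%E.
Proof. by move=> dz; rewrite PE// integral_ge0. Qed.

Lemma total_gkerE A : measurable A -> A `<=` disk ->
  total_gker A = (\int[lam2]_(w in A) \int[m]_(z in disk) (gker w z)%:E)%E.
Proof.
move=> mA Ad; transitivity (\int[m]_z \int[lam2]_w P A (w, z))%E.
  rewrite /total_gker [LHS]integral_mkcond; apply: eq_integral => z _; rewrite patchE.
  case: ifPn => [/set_mem dz|dz]; first by rewrite PE.
  by rewrite integral0_eq// => w _; rewrite /P/= [\1_disk z]indicE (negbTE dz) mul0e mule0.
transitivity (\int[lam2]_w \int[m]_z P A (w, z))%E.
  by apply/esym; exact: (@fubini_tonelli _ _ (mR * mR)%type (R * R)%type R planar_lebesgue m (P A) (mP mA) (P0 A)).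
rewrite [RHS]integral_mkcond; apply: eq_integral => w _; rewrite patchE.
case: ifPn => Aw; last by rewrite integral0_eq// => z _; rewrite /P/= [\1_A w]indicE (negbTE Aw) mul0e.
rewrite [RHS]integral_mkcond; apply: eq_integral => z _; rewrite patchE /P/= !indicE Aw mul1e.
case: ifPn => [/set_mem dz|_]; last by rewrite mul0e.
by rewrite mul1e ger0_norm// gker_ge0.
Qed.

Let mfin : m disk \is a fin_num. Proof. exact: fin_num_measure. Qed.

Lemma total_gker_le A : measurable A -> A `<=` disk -> (total_gker A <= 864%:E * m disk)%E.
Proof.
move=> mA Ad; rewrite -integral_cst//; apply: ge0_le_integral => //.
- by move=> z dz; exact: gker_mass_ge0.
- exact: measurable_gker_mass.
- by move=> z dz; exact: gker_mass_le.
Qed.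

Let B c (rho : R) : set (R * R) := disk `&` [set z | enorm (z - cis c) < rho].

Let mB c rho : measurable (B c rho).
Proof.
apply: measurableI => //.
have mc : measurable_fun setT (fun z : R * R => enorm (z - cis c)).
  have ms : measurable_fun setT (@Num.sqrt R) by apply: continuous_measurable_fun; exact: sqrt_continuous.
  apply: (measurableT_comp ms); apply: (measurableT_comp measurable_fun_sqnorm).
  have -> : +%R^~ (- cis c) = (fun z : R * R => (z.1 - cos c, z.2 - sin c)) by [].
  by apply: measurable_fun_pair; apply: measurable_funB.
have -> : [set z : R * R | enorm (z - cis c) < rho] = setT `&` (fun z : R * R => enorm (z - cis c)) @^-1` `]-oo, rho[%classic.
  by rewrite setTI; apply/seteqP; split => z /=; rewrite in_itv.
exact: mc.
Qed.

(** If [z] lies in the ball of radius [2 ^ n * (4 * h)], the new indicator takes over the old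
    remainder [4 ^ -n]. Otherwise the far estimate holds with exponent [n + 1], because
    [2 ^ n * (4 * h) = 2 ^ (n + 1) * (2 * h)]. *)
Lemma gker_mass_dyadic A c h (n : nat) z : 0 < h -> measurable A -> A `<=` disk -> disk z ->
  (forall w, A w -> enorm (w - cis c) <= h) ->
  (gker_mass A z <= (864 * (\sum_(k < n) 4 ^- k * \1_(B c (2 ^+ k * (4 * h))) z + 4 ^- n))%:E)%E.
Proof.
move=> h0 mA Ad dz Ah; elim: n => [|n IH].
  by rewrite big_ord0 add0r expr0 invr1 mulr1; exact: gker_mass_le.
have S0 : (0 : R) <= \sum_(k < n) 4 ^- k * \1_(B c (2 ^+ k * (4 * h))) z.
  by apply: sumr_ge0 => k _; rewrite mulr_ge0// invr_ge0 exprn_ge0.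
have c0 : (0 : R) <= 864 by lra.
rewrite big_ord_recr/= [\1_(B c (2 ^+ n * (4 * h))) z]indicE.
move: S0 IH; set S := \sum_(k < n) _ => S0 IH.
have q0 : 0 <= 4 ^- n.+1 :> R by rewrite invr_ge0 exprn_ge0.
have [_|zB] := boolP (z \in _).
  apply: le_trans IH _; rewrite lee_fin mulr1; apply: (ler_wpM2l c0).
  by rewrite lerDl.
have zf : 2 ^+ n.+1 * (2 * h) <= enorm (z - cis c).
  rewrite leNgt; apply: contra zB => zl; apply/mem_set; split => //=.
  by apply: lt_le_trans zl _; rewrite exprS le_eqVlt; apply/orP; left; apply/eqP; ring.
apply: le_trans (gker_mass_far h0 mA Ad dz Ah zf) _; rewrite lee_fin mulr0 addr0.
by apply: (ler_wpM2l c0); rewrite lerDr.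
Qed.

Let mB_fin c rho : m (B c rho) \is a fin_num. Proof. exact: fin_num_measure. Qed.

Lemma total_gker_dyadic (C : R) A c h (n : nat) : 0 <= C -> measurable A ->
  (forall z, disk z -> (gker_mass A z <=
     (C * (\sum_(k < n) 4 ^- k * \1_(B c (2 ^+ k * (4 * h))) z + 4 ^- n))%:E)%E) ->
  (total_gker A <= \sum_(k < n) (C * 4 ^- k)%:E * m (B c (2 ^+ k * (4 * h))) + (C * 4 ^- n)%:E * m disk)%E.
Proof.
move=> C0 mA HC.
have c0 (k : nat) : (0 : R) <= C * 4 ^- k by rewrite mulr_ge0// invr_ge0 exprn_ge0.
pose g (k : nat) z : \bar R := ((C * 4 ^- k)%:E * (\1_(B c (2 ^+ k * (4 * h))) z)%:E)%E.
have g0 k z : (0 <= g k z)%E by rewrite /g -EFinM lee_fin mulr_ge0.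
have mg k : measurable_fun disk (g k).
  by apply: emeasurable_funM => //; apply/measurable_EFinP; exact: measurable_indic.
have -> : (\sum_(k < n) (C * 4 ^- k)%:E * m (B c (2 ^+ k * (4 * h))) + (C * 4 ^- n)%:E * m disk)%E =
    (\int[m]_(z in disk) (\sum_(k < n) g k z + (C * 4 ^- n)%:E))%E.
  rewrite ge0_integralD//; last 3 first.
  - by move=> z _; apply: sume_ge0.
  - exact: emeasurable_sum.
  - by move=> z _; rewrite lee_fin.
  rewrite integral_cst// ge0_integral_sum//; congr (_ + _)%E; apply: eq_bigr => k _.
  rewrite /g ge0_integralZl_EFin//.
    by rewrite integral_indic// setIidl// => z [].
  by apply/measurable_EFinP; exact: measurable_indic.
apply: ge0_le_integral => //.
- by move=> z dz; exact: gker_mass_ge0.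
- exact: measurable_gker_mass.
- by apply: emeasurable_funD => //; exact: emeasurable_sum.
- move=> z dz; apply: le_trans (HC z dz) _.
  rewrite mulrDr mulr_sumr EFinD -sumEFin.
  apply: leeD; last exact: lexx.
  rewrite le_eqVlt; apply/orP; left; apply/eqP; apply: eq_bigr => k _.
  by rewrite /g -EFinM; congr EFin; rewrite [LHS]mulrA.
Qed.

Hypothesis m_cm0 : CM0 m.

(** Balls up to a fixed radius [rho] sit in short Carleson squares, whose measure the vanishing
    condition makes a small multiple of the radius; the weights [4 ^ -k] make these sum to a small
    multiple of [h]. The mass beyond [rho] carries a weight of order [(h / rho) ^ 2], which is small
    compared with [h]. *)
Lemma total_gker_carleson (e : R) : 0 < e -> exists2 d : R, 0 < d &
  forall I, circle_arc I -> len I < d -> (total_gker (carleson_square I `&` disk) <= (e * len I)%:E)%E.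
Proof.
move=> e0; set M := fine (m disk).
have M0 : 0 <= M by exact: fine_ge0.
have mE : m disk = M%:E by rewrite fineK.
have [C [C0 HC]] : exists C : R, 0 < C /\ forall A c h (n : nat), 0 < h -> measurable A -> A `<=` disk ->
  (forall w, A w -> enorm (w - cis c) <= h) ->
  (total_gker A <= \sum_(k < n) (C * 4 ^- k)%:E * m (B c (2 ^+ k * (4 * h))) + (C * 4 ^- n)%:E * m disk)%E.
  exists 864; split=> [|A c h n h0 mA Ad Ah]; first by lra.
  by apply: total_gker_dyadic => [|//|z dz]; [lra|exact: gker_mass_dyadic].
have e'0 : 0 < e / (2 * (C * 64)) by rewrite divr_gt0// !mulr_gt0.
have [d0 d0_gt0 hd0] := m_cm0.2 _ e'0; set e' := e / _ in e'0 hd0.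
pose rho : R := Num.min 2^-1 (d0 / 16).
have r0 : 0 < rho by rewrite lt_min invr_gt0 ltr0n/= divr_gt0.
have rh : rho <= 2^-1 by rewrite ge_min lexx.
have rd : 16 * rho <= d0 by rewrite mulrC -ler_pdivlMr// ge_min lexx orbT.
(* [rho / 4] ensures that the smallest ball fits below [rho]; the second bound makes the far part at
   most [e * h / 2]. [M + 1] keeps the denominator positive. *)
pose d := Num.min (rho / 4) (e * rho ^+ 2 / (2 * (C * 64 * (M + 1)))).
have M1 : 0 < M + 1 by rewrite ltr_wpDl.
exists d; first by rewrite lt_min !divr_gt0 ?mulr_gt0 ?exprn_gt0.
move=> _ [a [b [x [y [ab b2 ->]]]]]; set I := cis @` _; rewrite {1}/I len_arc// => hd.
set h := b - a in hd *; have h0 : 0 < h by rewrite subr_gt0.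
have lenI : len I = h by rewrite /I len_arc.
have hr : 4 * h <= rho.
  by rewrite mulrC -ler_pdivlMr//; apply: ltW; apply: lt_le_trans hd _; rewrite ge_min lexx.
have he : h * (2 * (C * 64 * (M + 1))) <= e * rho ^+ 2.
  by rewrite -ler_pdivlMr ?mulr_gt0//; apply: ltW; apply: lt_le_trans hd _; rewrite ge_min lexx orbT.
(* [n] indexes the last ball of radius at most [rho]. It is found by rescaling so that [ell_between]
   applies. *)
have [n n1 n2] : exists2 n : nat, 2 ^+ n * (4 * h) <= rho & rho < 2 ^+ n.+1 * (4 * h).
  have p0 := pi_gt0 R.
  have hh : 0 < 2 * pi * (4 * h / rho) <= 2 * pi.
    rewrite !mulr_gt0 ?invr_gt0//= ler_piMr ?mulr_ge0 ?(ltW p0)//.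
    by rewrite ler_pdivrMr// mul1r.
  have [n /andP[n1 n2]] := ell_between hh.
  have t0 (k : nat) : 0 < 2 ^+ k :> R by exact: exprn_gt0.
  exists n.
    by move: n2; rewrite /ell ler_pM2l ?mulr_gt0// ler_pdivrMr// [_ * rho]mulrC ler_pdivlMr// mulrC.
  by move: n1; rewrite /ell ltr_pM2l ?mulr_gt0// ltr_pdivlMr// ltr_pdivrMl.
have mS : measurable (carleson_square I `&` disk).
  by apply: measurableI => //; apply: measurable_carleson_square; exists a, b, x, y.
apply: le_trans (HC _ ((a + b) / 2) h n h0 mS (@subIsetr _ _ _) _) _.
  by move=> w [Iw dw]; exact: square_near Iw dw.
rewrite mE.
have Bk (k : 'I_n) : (m (B ((a + b) / 2) (2 ^+ k * (4 * h))) <= (e' * (8 * (2 ^+ k * (4 * h))))%:E)%E.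
  set rk := 2 ^+ k * _; set c := (a + b) / 2.
  have rk0 : 0 < rk by rewrite !mulr_gt0// exprn_gt0.
  have rkr : rk <= rho.
    apply: le_trans n1; rewrite ler_pM2r ?mulr_gt0// ler_weXn2l ?ler1n//.
    by apply: ltnW.
  pose J := cis @` [set` Interval (BSide true (c - 4 * rk)) (BSide false (c + 4 * rk))].
  have p2 := pi_ge2 R.
  have Jarc : circle_arc J.
    by exists (c - 4 * rk), (c + 4 * rk), true, false; split => //; lra.
  have lJ : len J = 8 * rk by rewrite len_arc; [ring|lra|lra].
  have := hd0 J Jarc; rewrite lJ /carleson_ratio lJ => /(_ _) H.
  have : (m (carleson_square J `&` disk) <= (e' * (8 * rk))%:E)%E.
    have l0 : 0 < 8 * rk by rewrite mulr_gt0.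
    have ld : 8 * rk < d0 by lra.
    have H' := H ld.
    by move: (ltW H'); rewrite inver gt_eqF// lee_pdivrMr// -EFinM.
  apply: le_trans; apply: le_measure; rewrite ?inE//.
    by apply: measurableI => //; exact: measurable_carleson_square.
  move=> z [dz zr]; split => //; apply: ball_square => //.
  by rewrite rk0 (le_trans rkr).
apply: (@le_trans _ _ (\sum_(k < n) (C * 4 ^- k * (e' * (8 * (2 ^+ k * (4 * h)))))%:E + (C * 4 ^- n * M)%:E)%E).
  apply: leeD; last by rewrite EFinM.
  apply: lee_sum => k _; rewrite [X in (_ <= X)%E]EFinM.
  by apply: lee_wpmul2l => //; rewrite lee_fin mulr_ge0 ?(ltW C0)// invr_ge0 exprn_ge0.
rewrite sumEFin -EFinD lee_fin.
have -> : \sum_(k < n) C * 4 ^- k * (e' * (8 * (2 ^+ k * (4 * h)))) = C * 32 * e' * h * \sum_(k < n) 2 ^- k.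
  rewrite mulr_sumr; apply: eq_bigr => k _.
  have t0 : 2 ^+ k != 0 :> R by rewrite expf_neq0.
  have -> : 4 ^+ k = 2 ^+ k * 2 ^+ k :> R by rewrite -exprMn; congr (_ ^+ _); ring.
  by field.
have geo : \sum_(k < n) 2 ^- k <= 2 :> R.
  have -> : \sum_(k < n) 2 ^- k = 2 - 2 * 2 ^- n :> R.
    elim: (n) => [|k IH]; first by rewrite big_ord0 expr0 invr1; ring.
    by rewrite big_ord_recr/= IH exprS invfM; lra.
  by rewrite lerBlDr lerDl mulr_ge0// invr_ge0 exprn_ge0.
have near : C * 32 * e' * h * \sum_(k < n) 2 ^- k <= e * h / 2.
  have -> : e * h / 2 = C * 32 * e' * h * 2 by rewrite /e'; field; rewrite gt_eqF.
  apply: ler_wpM2l geo; apply: mulr_ge0 (ltW h0); apply: mulr_ge0 (ltW e'0); lra.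
have far : C * 4 ^- n * M <= e * h / 2.
  have t0 : 0 < 2 ^+ n :> R by exact: exprn_gt0.
  have q : 4 ^- n * rho ^+ 2 <= 64 * h ^+ 2.
    have -> : 4 ^+ n = 2 ^+ n ^+ 2 :> R by rewrite -exprM mulnC exprM; congr (_ ^+ _); ring.
    rewrite ler_pdivrMl ?exprn_gt0//.
    have -> : 2 ^+ n ^+ 2 * (64 * h ^+ 2) = (2 ^+ n.+1 * (4 * h)) ^+ 2 by rewrite [2 ^+ n.+1]exprS; ring.
    by rewrite lerXn2r ?nnegrE ?(ltW n2) ?(ltW r0)// !mulr_ge0 ?exprn_ge0 ?ltW.
  have rr : 0 < rho ^+ 2 by exact: exprn_gt0.
  rewrite -(ler_pM2r rr).
  have -> : C * 4 ^- n * M * rho ^+ 2 = C * M * (4 ^- n * rho ^+ 2) by ring.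
  apply: le_trans (ler_wpM2l _ q) _; first by rewrite mulr_ge0// ltW.
  have -> : e * h / 2 * rho ^+ 2 = h / 2 * (e * rho ^+ 2) by ring.
  apply: le_trans (ler_wpM2l _ he); last by rewrite divr_ge0// ltW.
  have -> : h / 2 * (h * (2 * (C * 64 * (M + 1)))) = C * M * (64 * h ^+ 2) + C * 64 * h ^+ 2 by field.
  by rewrite lerDl !mulr_ge0 ?exprn_ge0 ?ltW.
have : C * 32 * e' * h * (\sum_(k < n) 2 ^- k) + C * 4 ^- n * M <= e * h / 2 + e * h / 2 by exact: lerD.
by rewrite -splitr.
Qed.

End carleson_gradient.

(** * Criteria for vanishing Carleson measures *)

Section carleson_criteria.
Context {R : realType}.
Implicit Types (nu : set (R * R) -> \bar R) (I : set (R * R)).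

Lemma len_arc_gt0 I : circle_arc I -> 0 < len I :> R.
Proof. by move=> [a [b [x [y [ab b2 ->]]]]]; rewrite len_arc// subr_gt0. Qed.

Lemma carleson_ratio_leP nu I (e : R) : circle_arc I ->
  (carleson_ratio nu I <= e%:E)%E = (nu (carleson_square I `&` disk) <= (e * len I)%:E)%E.
Proof.
by move=> /len_arc_gt0 l0; rewrite /carleson_ratio inver gt_eqF// lee_pdivrMr// EFinM.
Qed.

(** Short arcs satisfy the Carleson bound by the vanishing condition with [e = 1]; for arcs of
    length at least [d] the uniform bound [K] is at most [|K| / d] times the length. *)
Lemma CM0_intro nu (K : R) :
  (forall I, circle_arc I -> (nu (carleson_square I `&` disk) <= K%:E)%E) ->
  (forall e : R, 0 < e -> exists2 d : R, 0 < d & forall I, circle_arc I -> len I < d ->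
    (nu (carleson_square I `&` disk) <= (e * len I)%:E)%E) -> CM0 nu.
Proof.
move=> nuK nue; split.
  have [d d0 hd] := nue 1 ltr01.
  apply: (@le_lt_trans _ _ (`|K| / d + 1)%:E); last exact: ltry.
  apply: ge_ereal_sup => _ [I aI <-]; rewrite carleson_ratio_leP//.
  have l0 := len_arc_gt0 aI; have k0 : 0 <= `|K| / d by rewrite divr_ge0// ltW.
  have [ld|dl] := ltP (len I) d.
    apply: le_trans (hd I aI ld) _; rewrite lee_fin; apply: ler_wpM2r; first exact: ltW.
    by rewrite lerDr.
  apply: le_trans (nuK I aI) _; rewrite lee_fin.
  apply: (@le_trans _ _ (`|K| / d * d)).
    by rewrite divfK ?gt_eqF// ler_norm.
  by apply: ler_pM => //; [exact: ltW|rewrite lerDl].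
move=> e e0; have [d d0 hd] := nue (e / 2) (divr_gt0 e0 (ltr0Sn R 1)).
exists d => // I aI ld; apply: (@le_lt_trans _ _ (e / 2)%:E).
  by rewrite carleson_ratio_leP// hd.
by rewrite lte_fin; lra.
Qed.

Lemma CM0_le nu nu' :
  (forall I, circle_arc I -> (nu (carleson_square I `&` disk) <= nu' (carleson_square I `&` disk))%E) ->
  CM0 nu' -> CM0 nu.
Proof.
move=> le [cm cm0].
have r I : circle_arc I -> (carleson_ratio nu I <= carleson_ratio nu' I)%E.
  move=> aI; have l0 := len_arc_gt0 aI.
  rewrite /carleson_ratio inver gt_eqF//; apply: lee_wpmul2r; last exact: le.
  by rewrite lee_fin invr_ge0 ltW.
split.
  apply: le_lt_trans cm; apply: ge_ereal_sup => _ [I aI <-]; apply: le_trans (r I aI) _.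
  by apply: ereal_sup_ubound; exists I.
move=> e e0; have [d d0 hd] := cm0 e e0; exists d => // I aI ld.
exact: le_lt_trans (r I aI) (hd I aI ld).
Qed.

Lemma measurable_grad_norm (F : R * R -> R) : smooth_on_disk F -> measurable_fun disk (grad_norm F).
Proof.
move=> sF; have mp b : measurable_fun disk (partial b F).
  apply: continuous_measurable_plane; first exact: open_disk.
  by move=> z dz; have [] := sF [:: b] z dz.
have ms : measurable_fun setT (@Num.sqrt R).
  by apply: continuous_measurable_fun; exact: sqrt_continuous.
apply: (measurableT_comp ms); apply: measurable_funD; exact: measurable_funX.
Qed.

End carleson_criteria.

(** * Radial limits of the extended Poisson integral *)

Section poisson_extension.
Context {R : realType}.
Variable m : {finite_measure set (R * R)%type -> \bar R}.

Let mD := @measurable_disk R.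

Let mkeval e w : measurable_fun setT (keval e w : R * R -> R). Proof. exact: measurable_keval. Qed.

Let mgk (w : R * R) : measurable_fun disk (fun z => (gker w z)%:E).
Proof.
by apply: measurable_funTS; apply/measurable_EFinP; exact: (measurableT_comp measurable_gker (pair1_measurable w)).
Qed.

Lemma measurable_gker_integral :
  measurable_fun setT (fun w => \int[m]_(z in disk) (gker w z)%:E)%E.
Proof.
pose P (p : (R * R) * (R * R)) : \bar R := ((\1_disk p.2)%:E * `|gker p.1 p.2|%:E)%E.
have mP : measurable_fun setT P.
  apply: emeasurable_funM; apply/measurable_EFinP.
    by apply: (measurableT_comp _ measurable_snd); exact: measurable_indic.
  by apply: measurableT_comp => //; exact: measurable_gker.
have P0 p : (0 <= P p)%E by rewrite /P mule_ge0// lee_fin.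
rewrite (_ : (fun w => _) = fun w => (\int[m]_z P (w, z))%E); last first.
  apply/funext => w; rewrite [LHS]integral_mkcond; apply: eq_integral => z _.
  rewrite patchE /P/= !indicE; case: ifPn => [/set_mem dz|_]; last by rewrite mul0e.
  by rewrite mul1e ger0_norm// gker_ge0.
exact: (@measurable_fun_fubini_tonelli_F _ _ (R * R)%type (R * R)%type R m P mP P0).
Qed.

Lemma kint_pois_ext_der b w : disk w ->
  ((`|kint m (kder b pois_ext) w|)%:E <= (2^-1)%:E * \int[m]_(z in disk) (gker w z)%:E)%E.
Proof.
move=> dw; have ik := @keval_integrable R m (kder b pois_ext) w dw.
apply: (@le_trans _ _ (\int[m]_(z in disk) (`|keval (kder b pois_ext) w z|)%:E)%E).
  have ik' := integrable_norm ik.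
  have fi : (\int[m]_(z in disk) (`|keval (kder b pois_ext) w z|)%:E)%E \is a fin_num.
    exact: (integrable_fin_num mD ik').
  rewrite -(fineK fi) lee_fin; exact: le_normr_Rintegral.
rewrite -ge0_integralZl_EFin//; last first.
  by move=> z dz; rewrite lee_fin gker_ge0.
apply: ge0_le_integral => //.
- by apply: measurable_funTS; apply/measurable_EFinP; exact: measurableT_comp.
- by apply: emeasurable_funM => //; exact: mgk.
- by move=> z dz; rewrite -EFinM lee_fin mulrC; exact: pois_ext_der.
Qed.

Lemma sqnormZ (c : R) (z : R * R) : sqnorm (c *: z) = c ^+ 2 * sqnorm z.
Proof. by rewrite /sqnorm/= !exprMn -mulrDr. Qed.

(** For [|zeta| = 1] the value of [szego] at [r *: zeta] is [|zeta - r z| ^ 2], and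
    [(1 - r) |z| <= 1 - r |z| <= |zeta - r z|]. It provides the majorant, four times the Poisson
    kernel, for dominated convergence along a radius. *)
Lemma szego_radial (zeta z : R * R) (r : R) : circle zeta -> disk z -> 0 <= r <= 1 ->
  sqnorm (zeta - z) <= 4 * szego (r *: zeta) z.
Proof.
move=> cz dz /andP[r0 r1].
have -> : szego (r *: zeta) z = enorm (zeta - r *: z) ^+ 2.
  move: cz; rewrite enorm_sqr /circle/= /szego /sqnorm/= /GRing.scale/= => cz.
  have -> : (zeta.1 - r * z.1) ^+ 2 + (zeta.2 - r * z.2) ^+ 2 =
    (zeta.1 ^+ 2 + zeta.2 ^+ 2) - 2 * (r * (z.1 * zeta.1 + z.2 * zeta.2)) + r ^+ 2 * (z.1 ^+ 2 + z.2 ^+ 2) by ring.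
  have -> : (r * zeta.1) ^+ 2 + (r * zeta.2) ^+ 2 = r ^+ 2 by rewrite !exprMn -mulrDr cz mulr1.
  by rewrite cz; ring.
rewrite -enorm_sqr (_ : 4 * _ = (2 * enorm (zeta - r *: z)) ^+ 2); last by rewrite exprMn; ring.
rewrite lerXn2r ?nnegrE ?mulr_ge0 ?enorm_ge0//.
have z1 : enorm zeta = 1 by rewrite /enorm cz sqrtr1.
have nz : enorm z <= 1 by rewrite enorm_le// expr1n ltW.
have eZ (c : R) : 0 <= c -> enorm (c *: z) = c * enorm z.
  move=> c0; by rewrite /enorm sqnormZ sqrtrM ?sqr_ge0// sqrtr_sqr ger0_norm.
have h1 : enorm (zeta - z) <= enorm (zeta - r *: z) + (1 - r) * enorm z.
  have -> : zeta - z = (zeta - r *: z) + - ((1 - r) *: z).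
    by rewrite scalerBl scale1r opprB addrA subrK.
  by apply: le_trans (enormD _ _) _; rewrite enormN eZ// subr_ge0.
have h2 : 1 <= enorm (zeta - r *: z) + r * enorm z.
  by rewrite -z1 -eZ//; apply: le_trans (enormD _ _); rewrite subrK.
have := enorm_ge0 z; nra.
Qed.

Lemma kint_pois_ext_radial zeta : circle zeta -> (poisson_integral m zeta < +oo)%E ->
  kint m pois_ext (r *: zeta) @[r --> 1^'-] --> fine (poisson_integral m zeta).
Proof.
move=> cz fz; apply/cvg_at_leftP => u [u1 uc].
(* A sequence that tends to 1 from the left may start with negative terms; they are replaced by 0 to
   stay in the range of [szego_radial]. *)
pose v n := Num.max 0 (u n).
have v01 n : 0 <= v n < 1 by rewrite le_max lexx/= gt_max ltr01 u1.
have vc : v n @[n --> \oo] --> (1 : R).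
  apply: (cvg_trans _ uc); apply: near_eq_cvg; near=> n; apply/esym/max_idPr.
  by near: n; apply: (cvgr_ge _ uc); exact: ltr01.
suff H : kint m pois_ext (v n *: zeta) @[n --> \oo] --> fine (poisson_integral m zeta).
  apply: cvg_trans H; apply: near_eq_cvg.
  have vE n : 0 <= u n -> v n = u n by move=> h; apply/max_idPr.
  near=> n; rewrite vE//.
  near: n; apply: (cvgr_ge _ uc); exact: ltr01.
have dv n : disk (v n *: zeta).
  move: cz (v01 n); rewrite /circle /disk/= => c1 /andP[v0 v1].
  by rewrite sqnormZ c1 mulr1 expr_lt1.
have p0 z : disk z -> 0 <= poisson z zeta by move=> dz; exact: poisson_ge0.
have mP : measurable_fun disk (fun z => (poisson z zeta)%:E).
  by apply: measurable_funTS; apply/measurable_EFinP; exact: (measurableT_comp measurable_poisson (pair2_measurable zeta)).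
have iP : m.-integrable disk (fun z => (poisson z zeta)%:E).
  apply/integrableP; split => //; rewrite (_ : (\int[m]_(z in disk) _)%E = poisson_integral m zeta)//.
  by apply: eq_integral => z /set_mem dz; rewrite gee0_abs// lee_fin p0.
pose f n z := (keval pois_ext (v n *: zeta) z)%:E.
have mf n : measurable_fun disk (f n).
  by apply: measurable_funTS; apply/measurable_EFinP; exact: measurable_keval.
have szegoz z : szego zeta z = sqnorm (zeta - z) by rewrite szegoE cz subrr mulr0 addr0.
have sz z : disk z -> 0 < sqnorm (zeta - z).
  by move=> dz; rewrite -szegoz szego_sym szego_gt0// le_eqVlt cz eqxx.
have szegov z (r : R) : szego (r *: zeta) z =
    1 - r * (2 * (z.1 * zeta.1 + z.2 * zeta.2)) + r * r * (sqnorm z * sqnorm zeta).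
  rewrite /szego sqnormZ (_ : (r *: zeta).1 = r * zeta.1)// (_ : (r *: zeta).2 = r * zeta.2)//.
  by ring.
have fc : {ae m, forall z, disk z -> f n z @[n --> \oo] --> (poisson z zeta)%:E}.
  apply: aeW => z dz; apply: cvg_EFin; first exact: nearW.
  rewrite (_ : fine \o f^~ z = fun n => (1 - sqnorm z) / (1 - v n * (2 * (z.1 * zeta.1 + z.2 * zeta.2))
      + v n * v n * (sqnorm z * sqnorm zeta))); last first.
    by apply/funext => n; rewrite /f/= -szegov -pois_extE.
  rewrite /poisson -szegoz -[zeta in X in _ --> X]scale1r szegov.
  apply: cvgM; first exact: cvg_cst.
  apply: cvgV; first by rewrite -szegov scale1r szegoz gt_eqF// sz.
  apply: cvgD; last by apply: cvgM; [exact: cvgM|exact: cvg_cst].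
  by apply: cvgB; [exact: cvg_cst|apply: cvgM => //; exact: cvg_cst].
have fd : {ae m, forall z n, disk z -> (`|f n z| <= (4 * poisson z zeta)%:E)%E}.
  apply: aeW => z n dz; rewrite /f; move: (pois_extE (v n *: zeta) z) => ->.
  rewrite abse_EFin lee_fin.
  have h := szego_radial cz dz (introT andP (conj (andP (v01 n)).1 (ltW (andP (v01 n)).2))).
  have s0 := sz z dz; have s1 : 0 < szego (v n *: zeta) z by lra.
  have z1 : 0 <= 1 - sqnorm z by rewrite subr_ge0 ltW.
  rewrite ger0_norm ?divr_ge0 ?(ltW s1)// /poisson mulrCA; apply: ler_wpM2l => //.
  by rewrite ler_pdivlMr// mulrC ler_pdivrMr.
have i4 : m.-integrable disk (fun z => (4 * poisson z zeta)%:E).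
  rewrite (_ : (fun z => _) = (fun z => (4%:E * (poisson z zeta)%:E)%E)); last by apply/funext => z; rewrite EFinM.
  exact: integrableZl.
have [_ _ H] := dominated_convergence mD mf mP fc i4 fd.
have : fine (\int[m]_(z in disk) f n z)%E @[n --> \oo] --> fine (poisson_integral m zeta).
  apply: fine_cvg; rewrite fineK; first exact: H.
  by rewrite ge0_fin_numE// integral_ge0// => z dz; rewrite lee_fin p0.
by [].
Unshelve. all: by end_near. Qed.

End poisson_extension.

Lemma sqrt_sqrD_le (R : realType) (x y : R) : Num.sqrt (x ^+ 2 + y ^+ 2) <= `|x| + `|y|.
Proof.
rewrite -[leRHS]ger0_norm ?addr_ge0// -sqrtr_sqr ler_wsqrtr// sqrrD.
by rewrite !real_normK ?num_real// lerD2r lerDl mulrn_wge0// mulr_ge0.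
Qed.

(** * The extension of a balayage and its gradient measure *)

Section balayage_extension.
Context {R : realType}.
Variables (mu : {charge set (R * R)%type -> \bar R}) (f g : R * R -> R).
Hypothesis mu_cm0 : CM0 (abs_charge mu).
Hypothesis cg : continuous_on_circle g.
Hypothesis fE : {ae arclength, forall zeta, circle zeta ->
  (f zeta)%:E = ((g zeta)%:E + balayage mu zeta)%E}.

Let m1 := jordan_pos (hahnP mu).
Let m2 := jordan_neg (hahnP mu).
Let F w : R := kint m1 pois_ext w - kint m2 pois_ext w.
Let mD := @measurable_disk R.

Let cm1 : CM0 m1.
Proof. by apply: CM0_le mu_cm0 => I _; apply: leeDl; exact: measure_ge0. Qed.

Let cm2 : CM0 m2.
Proof. by apply: CM0_le mu_cm0 => I _; apply: leeDr; exact: measure_ge0. Qed.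

Let sF : smooth_on_disk F.
Proof. by have [] := @kint_smooth R m1 m2 F pois_ext (fun _ _ => erefl). Qed.

Let grad_le w : disk w -> ((grad_norm F w)%:E <=
  \int[m1]_(z in disk) (gker w z)%:E + \int[m2]_(z in disk) (gker w z)%:E)%E.
Proof.
move=> dw; have [_ pF] := @kint_smooth R m1 m2 F pois_ext (fun _ _ => erefl).
apply: (@le_trans _ _ (`|partial false F w| + `|partial true F w|)%:E).
  by rewrite lee_fin; exact: sqrt_sqrD_le.
have h b : ((`|partial b F w|)%:E <= (2^-1)%:E * \int[m1]_(z in disk) (gker w z)%:E +
    (2^-1)%:E * \int[m2]_(z in disk) (gker w z)%:E)%E.
  rewrite pF//; apply: (@le_trans _ _ ((`|kint m1 (kder b pois_ext) w|)%:E + (`|kint m2 (kder b pois_ext) w|)%:E)%E).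
    by rewrite -EFinD lee_fin ler_normB.
  by apply: leeD; exact: kint_pois_ext_der.
rewrite EFinD; apply: le_trans (leeD (h false) (h true)) _.
have i0 (m : {measure set (R * R)%type -> \bar R}) : (0 <= \int[m]_(z in disk) (gker w z)%:E)%E.
  by apply: integral_ge0 => z dz; rewrite lee_fin gker_ge0.
have half (x : \bar R) : (0 <= x)%E -> ((2^-1)%:E * x + (2^-1)%:E * x = x)%E.
  move=> x0; rewrite -ge0_muleDl ?lee_fin// -EFinD (_ : 2^-1 + 2^-1 = 1) ?mul1e//.
  by lra.
by rewrite addeACA (half _ (i0 _)) (half _ (i0 _)).
Qed.

Let grad_total I : circle_arc I -> (grad_measure F (carleson_square I `&` disk) <=
  total_gker m1 (carleson_square I `&` disk) + total_gker m2 (carleson_square I `&` disk))%E.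
Proof.
move=> aI; set A := carleson_square I `&` disk.
have mA : measurable A by apply: measurableI => //; exact: measurable_carleson_square.
have Ad : A `<=` disk by move=> z [].
have mG (m : {finite_measure set (R * R)%type -> \bar R}) :
    measurable_fun A (fun w => \int[m]_(z in disk) (gker w z)%:E)%E.
  by apply: measurable_funTS; exact: measurable_gker_integral.
have i0 (m : {measure set (R * R)%type -> \bar R}) w : (0 <= \int[m]_(z in disk) (gker w z)%:E)%E.
  by apply: integral_ge0 => z dz; rewrite lee_fin gker_ge0.
rewrite (total_gkerE m1 mA Ad) (total_gkerE m2 mA Ad) /grad_measure setIidl//.
apply: (@le_trans _ _ (\int[lebesgue_measure \x lebesgue_measure]_(w in A)
   (\int[m1]_(z in disk) (gker w z)%:E + \int[m2]_(z in disk) (gker w z)%:E))%E).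
  apply: ge0_le_integral => //.
  - by move=> w _; rewrite lee_fin sqrtr_ge0.
  - apply/measurable_EFinP; exact: measurable_funS (measurable_grad_norm sF).
  - exact: (emeasurable_funD (mG m1) (mG m2)).
  - by move=> w [_ dw]; exact: grad_le.
rewrite le_eqVlt; apply/orP; left; apply/eqP; apply: ge0_integralD => //.
- by move=> w _; exact: i0.
- exact: (mG m1).
- by move=> w _; exact: i0.
- exact: (mG m2).
Qed.

Lemma grad_measure_CM0 : CM0 (grad_measure F).
Proof.
have sub I : carleson_square I `&` disk `<=` @disk R by move=> z [].
have mS I : circle_arc I -> measurable (carleson_square I `&` @disk R).
  by move=> aI; apply: measurableI => //; exact: measurable_carleson_square.
apply: (@CM0_intro R _ (fine (864%:E * m1 disk + 864%:E * m2 disk))%E).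
  move=> I aI; rewrite fineK; last first.
    by rewrite fin_numD !fin_numM// fin_num_measure.
  by apply: le_trans (grad_total aI) _; apply: leeD; apply: total_gker_le => //; exact: mS.
move=> e e0; have e2 : 0 < e / 2 by rewrite divr_gt0.
have [d1 d10 h1] := total_gker_carleson cm1 e2.
have [d2 d20 h2] := total_gker_carleson cm2 e2.
exists (Num.min d1 d2); first by rewrite lt_min d10.
move=> I aI; rewrite lt_min => /andP[l1 l2]; apply: le_trans (grad_total aI) _.
by apply: le_trans (leeD (h1 I aI l1) (h2 I aI l2)) _; rewrite -EFinD lee_fin -mulrDl -splitr.
Qed.

Lemma balayage_extension : exists F : R * R -> R,
  [/\ smooth_on_disk F,
    {ae arclength, forall zeta, circle zeta -> cvg (radial F zeta r @[r --> 1^'-])},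
    (exists2 g : R * R -> R, continuous_on_circle g &
      {ae arclength, forall zeta, circle zeta ->
        lim (radial F zeta r @[r --> 1^'-]) - f zeta = g zeta}) &
    CM0 (grad_measure F)].
Proof.
pose L zeta := fine (poisson_integral m1 zeta) - fine (poisson_integral m2 zeta).
have cF : {ae arclength, forall zeta, circle zeta ->
    [/\ radial F zeta r @[r --> 1^'-] --> L zeta, (poisson_integral m1 zeta < +oo)%E & (poisson_integral m2 zeta < +oo)%E]}.
  apply: filterS2 (poisson_integral_fin_ae m1) (poisson_integral_fin_ae m2) => zeta h1 h2 cz.
  split; [|exact: h1|exact: h2].
  by apply: cvgB; apply: kint_pois_ext_radial => //; [exact: h1|exact: h2].
exists F; split => //.
- by apply: filterS cF => zeta h cz; have [c _ _] := h cz; apply/cvg_ex; exists (L zeta).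
(* The radial limit of [F] is the balayage, so the limit minus [f] is the opposite of [g]. *)
- exists (fun zeta => - g zeta).
    by move=> z; apply: cvgN; exact: cg.
  apply: filterS2 cF fE => zeta h fz cz; have [c p1 p2] := h cz.
  have -> : lim (radial F zeta r @[r --> 1^'-]) = L zeta by apply: cvg_lim.
  have := fz cz; rewrite /balayage -/m1 -/m2.
  have q (m : {finite_measure set (R * R)%type -> \bar R}) : (poisson_integral m zeta < +oo)%E ->
      (\int[m]_(z in disk) (poisson z zeta)%:E)%E = (fine (poisson_integral m zeta))%:E.
    move=> lt; rewrite fineK// ge0_fin_numE// integral_ge0// => z dz.
    by rewrite lee_fin poisson_ge0.
  rewrite (q m1 p1) (q m2 p2) -EFinB -EFinD => -[->].
  by rewrite /L; ring.
- exact: grad_measure_CM0.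
Qed.

End balayage_extension.

(** * Polar coordinates *)

Section one_dimensional_substitution.
Context {R : realType}.
Local Open Scope ereal_scope.
Local Notation lam := (@lebesgue_measure R).

Lemma integral_indicM (A : set R) (f : R -> \bar R) :
  \int[lam]_(x in A) f x = \int[lam]_x ((\1_A x)%:E * f x).
Proof.
rewrite [LHS]integral_mkcond; apply: eq_integral => x _.
by rewrite patchE indicE; case: ifPn => _; rewrite ?mul1e ?mul0e.
Qed.

Lemma lebesgue_measure_reflect A : measurable A ->
  pushforward lam (-%R : R -> measurableTypeR R) A = lam A.
Proof.
move=> mA; apply/esym.
have mN : measurable_fun setT (-%R : R -> measurableTypeR R) by exact: measurable_funN.
pose m := measure_function_pushforward__canonical__measure_function_Measure lam mN.
apply: (@lebesgue_measure_unique R m) => // _ [[a b]] _ <-.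
rewrite /m /= /pushforward (_ : _ @^-1` _ = `[- b, - a[%classic)%R.
  rewrite !lebesgue_measure_itv /= !lte_fin ltrN2; case: ifPn => // _.
  by rewrite -!EFinB; congr EFin; ring.
by apply/seteqP; split=> x /=; rewrite !in_itv/= ltrNr lerNl andbC.
Qed.

Lemma ge0_integral_reflect (f : R -> \bar R) : measurable_fun setT f -> (forall x, 0 <= f x) ->
  \int[lam]_x f (- x)%R = \int[lam]_x f x.
Proof.
move=> mf f0.
have mN : measurable_fun setT (-%R : R -> measurableTypeR R) by exact: measurable_funN.
rewrite -(@ge0_integral_pushforward _ _ (measurableTypeR R) (measurableTypeR R) _ _ mN lam setT f)//.
pose m := measure_function_pushforward__canonical__measure_function_Measure lam mN.
apply: (eq_measure_integral lam (m1 := m)) => A mA _.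
by have := lebesgue_measure_reflect mA.
Qed.

Let I : set R := `](- (pi / 2))%R, (pi / 2)%R[%classic.

Let mI : measurable (I : set (measurableTypeR R)). Proof. exact: measurable_itv. Qed.

Let cos0 t : I t -> (0 < cos t)%R.
Proof. by rewrite /I/= in_itv/= => h; apply: cos_gt0_pihalf. Qed.

Lemma measurable_tan : measurable_fun setT (@tan R).
Proof.
apply: measurable_funM; first by apply: continuous_measurable_fun; exact: continuous_sin.
by apply: measurable_fun_inv; apply: continuous_measurable_fun; exact: continuous_cos.
Qed.

Let g (t : R) : \bar R := ((cos t) ^- 2)%:E.

Let mg : measurable_fun setT g.
Proof.
apply/measurable_EFinP; apply: measurable_fun_inv; apply: measurable_funX.
by apply: continuous_measurable_fun; exact: continuous_cos.
Qed.

Let g0 t : 0 <= g t. Proof. by rewrite lee_fin invr_ge0 exprn_even_ge0. Qed.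

(** The measure of density [cos ^ -2] on []- pi / 2, pi / 2[], pushed forward by [tan], agrees with
    Lebesgue measure on half-open intervals, hence everywhere. *)
Lemma tan_substitution (h : R -> \bar R) : measurable_fun setT h -> (forall u, 0 <= h u) ->
  \int[lam]_u h u = \int[lam]_(t in I) (h (tan t) * g t).
Proof.
move=> mh h0.
have mt : measurable_fun setT (@tan R : measurableTypeR R -> measurableTypeR R) by exact: measurable_tan.
have mpre (a b : R) : measurable (@tan R @^-1` `]a, b]%classic : set (measurableTypeR R)).
  by rewrite -[X in measurable X]setTI; apply: mt => //; exact: measurable_itv.
pose den := density (mrestr lam mI) mg g0.
pose mu := measure_function_pushforward__canonical__measure_function_Measure den mt.
transitivity (\int[mu]_u h u).
  apply: eq_measure_integral => A mA _; apply: (@lebesgue_measure_unique R mu) => // _ [[a b]] _ <-.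
  have mab := mpre a b.
  rewrite /mu/= /pushforward /den /density ge0_integral_mrestr//; last exact: measurable_funTS.
  have [ab|ba] := ltP a b; last first.
    rewrite (_ : `]a, b]%classic = set0) ?preimage_set0 ?set0I ?integral_set0 ?measure0//.
    by rewrite set_itv_ge// bnd_simp -leNgt.
  rewrite (_ : _ `&` I = `]atan a, atan b]%classic); last first.
    have aI (x : R) : atan x \in `](- (pi / 2))%R, (pi / 2)%R[.
      by rewrite in_itv/= atan_gtNpi2 atan_ltpi2.
    apply/seteqP; split => [x [/=]|x].
      rewrite /I/= in_itv/= => /andP[h1 h2] xI; rewrite in_itv/=.
      by rewrite -(ltr_tan (aI a) xI) atanK h1 leNgt -(ltr_tan (aI b) xI) atanK -leNgt.
    rewrite /= in_itv/= => /andP[h1 h2].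
    have xI : x \in `](- (pi / 2))%R, (pi / 2)%R[.
      by rewrite in_itv/= (lt_trans (atan_gtNpi2 a) h1) (le_lt_trans h2 (atan_ltpi2 b)).
    split => //; rewrite /= in_itv/= -{1}(atanK a) (ltr_tan (aI a) xI) h1/=.
    by rewrite leNgt -(atanK b) (ltr_tan (aI b) xI) -leNgt.
  rewrite integral_itv_obnd_cbnd; last exact: measurable_funTS.
  have inI x : (atan a <= x <= atan b)%R -> I x.
    move=> /andP[h1 h2]; rewrite /I/= in_itv/=; apply/andP; split.
      exact: lt_le_trans (atan_gtNpi2 a) h1.
    exact: le_lt_trans h2 (atan_ltpi2 b).
  have -> : \int[lam]_(x in `[atan a, atan b]) g x = (tan (atan b) - tan (atan a))%:E.
    apply: integral_FTC; first exact/ltW/lt_atan.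
      by move=> x /inI/cos0 c0; apply: is_derive_tan; rewrite gt_eqF.
    move=> x /inI/cos0 c0; apply: cvgV; first by rewrite sqrf_eq0 gt_eqF.
    apply: (@continuous_comp _ _ _ (@cos R) (fun y => y ^+ 2)%R); first exact: continuous_cos.
    exact: exprn_continuous.
  by rewrite !atanK lebesgue_measure_itv/= lte_fin ab.
rewrite (@ge0_integral_pushforward _ _ (measurableTypeR R) (measurableTypeR R) _ _ mt den setT h)//.
rewrite preimage_setT /den ge0_integral_density; [|exact: measurableT|exact: (measurableT_comp mh mt)|by move=> x _; exact: h0].
rewrite ge0_integral_mrestr// ?setTI//.
- by apply: emeasurable_funM => //; exact: (measurableT_comp mh mt).
- by move=> x _; apply: mule_ge0; [exact: h0|exact: g0].
Qed.

End one_dimensional_substitution.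

(** * Polar coordinates on sectors *)

Section polar_coordinates.
Context {R : realType}.
Local Open Scope ereal_scope.
Local Notation lam := (@lebesgue_measure R).
Local Notation lam2 := (lam \x lam).
Implicit Types (phi : R * R -> \bar R).
Let mR := measurableTypeR R.

(** A quarter turn is an exchange of the coordinates and a reflection, so Tonelli and the reflection
    of the line suffice. *)
Lemma ge0_integral_quarter_turn phi : measurable_fun setT phi -> (forall z, 0 <= phi z) ->
  \int[lam2]_z phi (- z.2, z.1)%R = \int[lam2]_z phi z.
Proof.
move=> mp p0.
have m1 : measurable_fun setT (fun z : mR * mR => phi (- z.2, z.1)%R).
  apply: (measurableT_comp mp); apply: measurable_fun_pair; last exact: measurable_fst.
  by apply: measurableT_comp => //; exact: measurable_snd.
have m2 : measurable_fun setT (fun z : mR * mR => phi (z.2, z.1)).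
  by apply: (measurableT_comp mp); apply: measurable_fun_pair; [exact: measurable_snd|exact: measurable_fst].
transitivity (\int[lam]_x \int[lam]_y phi (- y, x)%R).
  exact: (@fubini_tonelli1 _ _ mR mR R lam lam _ m1).
transitivity (\int[lam]_x \int[lam]_y phi (y, x)).
  apply: eq_integral => x _; apply: (@ge0_integral_reflect R (fun y => phi (y, x))) => //.
  exact: (measurableT_comp mp (pair2_measurable x)).
transitivity (\int[lam]_y \int[lam]_x phi (y, x)).
  exact: (@fubini_tonelli _ _ mR mR R lam lam _ m2).
by apply/esym; exact: (@fubini_tonelli1 _ _ mR mR R lam lam phi mp p0).
Qed.

Definition polar_mass phi (t : R) : \bar R := \int[lam]_(r in `]0%R, +oo[) (phi (r *: cis t) * r%:E).

Lemma measurable_polar : measurable_fun setT (fun p : mR * mR => (p.1 *: cis p.2 : R * R)).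
Proof.
have -> : (fun p : mR * mR => (p.1 *: cis p.2 : R * R)) = (fun p => (p.1 * cos p.2, p.1 * sin p.2))%R by [].
apply: measurable_fun_pair; apply: measurable_funM; [exact: measurable_fst| |exact: measurable_fst|].
- by apply: (measurableT_comp _ measurable_snd); apply: continuous_measurable_fun; exact: continuous_cos.
- by apply: (measurableT_comp _ measurable_snd); apply: continuous_measurable_fun; exact: continuous_sin.
Qed.

Lemma measurable_polar_mass phi : measurable_fun setT phi -> (forall z, 0 <= phi z) ->
  measurable_fun setT (polar_mass phi).
Proof.
move=> mp p0.
pose H (p : mR * mR) := (\1_(`]0%R, +oo[ : set R) p.1)%:E * (phi (p.1 *: cis p.2) * `|p.1|%:E).
have mH : measurable_fun setT H.
  apply: emeasurable_funM; first by apply/measurable_EFinP; apply: (measurableT_comp _ measurable_fst).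
  apply: emeasurable_funM; first exact: (measurableT_comp mp measurable_polar).
  by apply/measurable_EFinP; apply: (measurableT_comp _ measurable_fst).
have H0 p : 0 <= H p by rewrite /H !mule_ge0// lee_fin.
rewrite (_ : polar_mass phi = fun t => \int[lam]_r H (r, t)).
  exact: (@measurable_fun_fubini_tonelli_G _ _ mR mR R lam H mH H0).
apply/funext => t; rewrite /polar_mass integral_indicM; apply: eq_integral => r _.
rewrite /H/= indicE; case: (boolP (r \in _)) => [/set_mem/=|]; last by rewrite !mul0e.
by rewrite in_itv/= andbT => r0; rewrite gtr0_norm.
Qed.

Lemma polar_mass_ge0 phi t : (forall z, 0 <= phi z) -> 0 <= polar_mass phi t.
Proof. by move=> p0; apply: integral_ge0 => r /=; rewrite in_itv/= andbT => r0; rewrite mule_ge0// lee_fin ltW. Qed.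

Let I : set R := `](- (pi / 2))%R, (pi / 2)%R[%classic.

Let cos0 t : I t -> (0 < cos t)%R.
Proof. by rewrite /I/= in_itv/= => h; apply: cos_gt0_pihalf. Qed.

(** Polar coordinates on the half plane [x > 0] in two one-dimensional steps: [x = r cos t] for
    fixed [t] and, after Tonelli, [y = x tan t] for fixed [x]. The inequality only drops the other
    half plane. *)
Lemma polar_half_plane phi : measurable_fun setT phi -> (forall z, 0 <= phi z) ->
  \int[lam]_(t in I) polar_mass phi t <= \int[lam2]_z phi z.
Proof.
move=> mp p0; pose P : set R := `]0%R, +oo[%classic.
pose H (p : mR * mR) := (\1_P p.1)%:E * ((\1_I p.2)%:E *
  (phi (p.1, p.1 * tan p.2)%R * (`|p.1| * (cos p.2) ^- 2)%:E)).
have mcos : measurable_fun setT (fun t : mR => (cos t) ^- 2)%R.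
  apply: measurable_fun_inv; apply: measurable_funX.
  by apply: continuous_measurable_fun; exact: continuous_cos.
have mH : measurable_fun setT H.
  apply: emeasurable_funM.
    by apply/measurable_EFinP; apply: (measurableT_comp _ measurable_fst); apply: measurable_indic; exact: measurable_itv.
  apply: emeasurable_funM.
    by apply/measurable_EFinP; apply: (measurableT_comp _ measurable_snd); apply: measurable_indic; exact: measurable_itv.
  apply: emeasurable_funM.
    apply: (measurableT_comp mp); apply: measurable_fun_pair; first exact: measurable_fst.
    apply: measurable_funM; first exact: measurable_fst.
    exact: (measurableT_comp measurable_tan measurable_snd).
  apply/measurable_EFinP; apply: measurable_funM; first by apply: (measurableT_comp _ measurable_fst).
  exact: (measurableT_comp mcos measurable_snd).
have H0 p : 0 <= H p.
  by rewrite /H !mule_ge0// ?lee_fin// mulr_ge0// invr_ge0 exprn_even_ge0.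
have slice (x : R) : measurable_fun setT (fun y : R => phi (x, y)).
  exact: (measurableT_comp mp (pair1_measurable x)).
apply: (@le_trans _ _ (\int[lam]_(x in P) \int[lam]_y phi (x, y))); last first.
  rewrite (_ : \int[lam2]_z phi z = \int[lam]_x \int[lam]_y phi (x, y)); last first.
    exact: (@fubini_tonelli1 _ _ mR mR R lam lam phi mp p0).
  apply: ge0_subset_integral => //.
  - exact: measurable_itv.
  - exact: (@measurable_fun_fubini_tonelli_F _ _ mR mR R lam phi mp p0).
  - by move=> x _; apply: integral_ge0.
rewrite le_eqVlt; apply/orP; left; apply/eqP.
transitivity (\int[lam]_t \int[lam]_x H (x, t)).
  rewrite integral_indicM; apply: eq_integral => t _.
  rewrite indicE; case: (boolP (t \in I)) => tI; last first.
    rewrite mul0e integral0_eq// => x _.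
    by rewrite /H/= [\1_I t]indicE (negbTE tI) mul0e mule0.
  have c0 := cos0 (set_mem tI).
  pose k x := (\1_P x)%:E * (phi (x, x * tan t)%R * (`|x| * (cos t) ^- 2)%:E).
  have mk : measurable_fun setT k.
    have := measurableT_comp mH (pair2_measurable t); rewrite (_ : H \o pair^~ t = k)//.
    by apply/funext => x; rewrite /H/k/= [\1_I t]indicE tI mul1e.
  have k0 x : 0 <= k x by rewrite /k !mule_ge0// lee_fin// mulr_ge0// invr_ge0 exprn_even_ge0.
  rewrite mul1e; transitivity (\int[lam]_x k x); last first.
    by apply: eq_integral => x _; rewrite /H/k/= [\1_I t]indicE tI mul1e.
  rewrite -(@ge0_integral_scale R (cos t) setT k c0)//.
  rewrite (_ : [set r | [set: R] (cos t * r)%R] = setT); last by apply/seteqP.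
  rewrite -ge0_integralZl_EFin//; last 2 first.
  - by apply: (measurableT_comp mk); exact: measurable_funM.
  - exact: ltW.
  rewrite /polar_mass integral_indicM; apply: eq_integral => r _.
  have PE (y : R) : (y \in P) = (0 < y)%R.
    by apply/idP/idP => [/set_mem|y0]; [|apply/mem_set]; rewrite /P/= in_itv/= andbT.
  rewrite /k !indicE !PE pmulr_rgt0//.
  have [r0|r0] := ltP 0%R r; last by rewrite !mul0e mule0.
  rewrite !mul1e muleCA; congr (_ * _).
    congr phi; rewrite (_ : r *: cis t = (r * cos t, r * sin t)%R)//; congr pair.
      by rewrite mulrC.
    by rewrite /tan (mulrC (cos t)) mulrA mulrAC mulfK ?gt_eqF.
  rewrite gtr0_norm ?mulr_gt0// -EFinM; congr EFin; field; by rewrite gt_eqF.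
transitivity (\int[lam]_x \int[lam]_t H (x, t)).
  by apply/esym; exact: (@fubini_tonelli _ _ mR mR R lam lam H mH H0).
rewrite [RHS]integral_indicM; apply: eq_integral => x _.
rewrite indicE; case: (boolP (x \in P)) => xP; last first.
  rewrite mul0e integral0_eq// => t _.
  by rewrite /H/= [\1_P x]indicE (negbTE xP) mul0e.
have x0 : (0 < x)%R by move: (set_mem xP); rewrite /P/= in_itv/= andbT.
rewrite mul1e -(@ge0_integral_scale R x setT (fun y => phi (x, y)) x0)//.
rewrite (_ : [set u | [set: R] (x * u)%R] = setT); last by apply/seteqP.
rewrite -ge0_integralZl_EFin//; last 2 first.
- by apply: (measurableT_comp (slice x)); exact: measurable_funM.
- exact: ltW.
rewrite (@tan_substitution R (fun u => x%:E * phi (x, x * u)%R)); last 2 first.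
- by apply: measurable_funeM; apply: (measurableT_comp (slice x)); exact: measurable_funM.
- by move=> u; rewrite mule_ge0// lee_fin ltW.
rewrite [RHS]integral_indicM; apply: eq_integral => t _.
rewrite /H/= [\1_P x]indicE xP mul1e; congr (_ * _).
by rewrite gtr0_norm// EFinM muleA; congr (_ * _); rewrite muleC.
Qed.

Lemma polar_quarters phi (k : nat) : measurable_fun setT phi -> (forall z, 0 <= phi z) ->
  \int[lam]_(t in I) polar_mass phi (t + k%:R * (pi / 2))%R <= \int[lam2]_z phi z.
Proof.
elim: k phi => [|k IH] phi mp p0.
  apply: le_trans (polar_half_plane mp p0); rewrite le_eqVlt; apply/orP; left; apply/eqP.
  by apply: eq_integral => t _; rewrite mul0r addr0.
have mQ : measurable_fun setT (fun z : R * R => phi (- z.2, z.1)%R).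
  apply: (measurableT_comp mp); apply: measurable_fun_pair; last exact: measurable_fst.
  by apply: measurableT_comp => //; exact: measurable_snd.
rewrite -(ge0_integral_quarter_turn mp p0); apply: le_trans (IH _ mQ (fun z => p0 _)).
rewrite le_eqVlt; apply/orP; left; apply/eqP; apply: eq_integral => t _.
apply: eq_integral => r _; congr (phi _ * _).
have -> : (t + k.+1%:R * (pi / 2) = (t + k%:R * (pi / 2)) + pi / 2)%R by rewrite -natr1; ring.
rewrite /cis cosDpihalf sinDpihalf /=; congr pair.
by rewrite /GRing.scale/= mulrN.
Qed.

(** After a suitable number of quarter turns, an interval of angles shorter than [pi / 2] lies in
    []- pi / 2, pi / 2[]. *)
Lemma polar_arc phi (a b : R) : measurable_fun setT phi -> (forall z, 0 <= phi z) ->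
  (b - a < pi / 2)%R -> \int[lam]_(t in `[a, b]) polar_mass phi t <= \int[lam2]_z phi z.
Proof.
move=> mp p0 ab; pose c := ((a + b) / 2)%R.
have [t tpi tc] := cis_surj 0 (circle_cis c).
have pp := pi_gt0 R.
(* The middle of the interval is rounded to the nearest multiple of [pi / 2]. The error [pi / 4] and
   half of the length, less than [pi / 4], stay below [pi / 2]. *)
have [k [kl ku]] : exists k : nat, (- (pi / 4) <= t - k%:R * (pi / 2) /\ t - k%:R * (pi / 2) <= pi / 4)%R.
  move/andP: tpi => [t0 t1].
  have [h0|h0] := (leP t (pi / 4))%R; first by exists 0%N; split; lra.
  have [h1|h1] := (leP t (3 * (pi / 4)))%R; first by exists 1%N; split; lra.
  have [h2|h2] := (leP t (5 * (pi / 4)))%R; first by exists 2%N; split; lra.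
  have [h3|h3] := (leP t (7 * (pi / 4)))%R; first by exists 3%N; split; lra.
  by exists 4%N; split; lra.
set d := (t - _)%R in kl ku.
have cs s : cis (s + c) = cis (s + t)%R.
  by move: tc; rewrite /cis => -[e1 e2]; rewrite !cosD !sinD e1 e2.
apply: le_trans (polar_quarters k mp p0).
rewrite -(@ge0_integral_shift_itv R (c - d) a b true false (polar_mass phi)); last 2 first.
- by apply: measurable_funTS; exact: measurable_polar_mass.
- by move=> x _; exact: polar_mass_ge0.
have -> : \int[lam]_(x in `[(a - (c - d))%R, (b - (c - d))%R]) polar_mass phi (x + (c - d))%R =
    \int[lam]_(x in `[(a - (c - d))%R, (b - (c - d))%R]) polar_mass phi (x + k%:R * (pi / 2))%R.
  apply: eq_integral => x _; apply: eq_integral => r _; congr (phi (_ *: _) * _).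
  have -> : (x + (c - d) = (x - d) + c)%R by ring.
  by rewrite cs; congr cis; rewrite /d; ring.
apply: ge0_subset_integral => //.
- exact: measurable_itv.
- apply: measurable_funTS; apply: (measurableT_comp (measurable_polar_mass mp p0)).
  by apply: measurable_funD.
- by move=> x _; exact: polar_mass_ge0.
- move=> x; rewrite /I/= !in_itv/= /c => /andP[x1 x2]; apply/andP; split; lra.
Qed.

End polar_coordinates.

(** * From the gradient to the mean oscillation *)

Section chain_rule.
Context {R : realType}.
Implicit Types (F : R * R -> R) (g : R -> R).

Lemma mvt_linear g (dg : R -> R) (c e x0 x : R) :
  (forall s, `|s - x0| <= `|x - x0| -> is_derive s 1 g (dg s)) ->
  (forall s, `|s - x0| <= `|x - x0| -> `|dg s - c| <= e) ->
  `|g x - g x0 - (x - x0) * c| <= e * `|x - x0|.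
Proof.
move=> dgE dgc.
have cg s : `|s - x0| <= `|x - x0| -> {for s, continuous g}.
  by move=> /dgE[dx _]; apply: differentiable_continuous; apply/derivable1_diffP.
suff [s sx ->] : exists2 s, `|s - x0| <= `|x - x0| & g x - g x0 = dg s * (x - x0).
  by rewrite [dg s * _]mulrC -mulrBr (normrM (x - x0)) mulrC; apply: ler_wpM2r => //; exact: dgc.
have [xx|xx] := leP x0 x.
  have h s : x0 <= s <= x -> `|s - x0| <= `|x - x0|.
    by move=> /andP[h1 h2]; rewrite !ger0_norm ?subr_ge0// lerD2r.
  have [||s sI ->] := @MVT_segment R g dg x0 x xx.
  - by move=> s; rewrite in_itv/= => /andP[h1 h2]; apply: dgE; apply: h; rewrite !ltW.
  - by apply: continuous_in_subspaceT => s /set_mem; rewrite /= in_itv/= => hs; apply/cg/h.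
  by exists s => //; apply: h; move: sI; rewrite in_itv.
have h s : x <= s <= x0 -> `|s - x0| <= `|x - x0|.
  by move=> /andP[h1 h2]; rewrite !ler0_norm ?subr_le0 ?(ltW xx)// lerN2 lerD2r.
have [||s sI E] := @MVT_segment R g dg x x0 (ltW xx).
- by move=> s; rewrite in_itv/= => /andP[h1 h2]; apply: dgE; apply: h; rewrite !ltW.
- by apply: continuous_in_subspaceT => s /set_mem; rewrite /= in_itv/= => hs; apply/cg/h.
exists s; first by apply: h; move: sI; rewrite in_itv.
by rewrite -opprB E -mulrN opprB.
Qed.

Lemma is_derive_fst F (x y : R) : derivable F (x, y) (unit_vector false) ->
  is_derive x 1 (fun s => F (s, y)) (partial false F (x, y)).
Proof.
have E : (fun h : R => h^-1 *: (((fun s => F (s, y)) \o shift x) (h *: 1) - F (x, y))) =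
    (fun h : R => h^-1 *: ((F \o shift (x, y)) (h *: unit_vector false) - F (x, y))).
  apply/funext => h; congr (_ *: (F _ - _)).
  have -> : (shift (x, y)) (h *: unit_vector false) = (h * 1 + x, h * 0 + y) by [].
  by rewrite mulr0 add0r.
by move=> d; apply: DeriveDef; rewrite /derivable /partial /derive E.
Qed.

Lemma is_derive_snd F (x y : R) : derivable F (x, y) (unit_vector true) ->
  is_derive y 1 (fun s => F (x, s)) (partial true F (x, y)).
Proof.
have E : (fun h : R => h^-1 *: (((fun s => F (x, s)) \o shift y) (h *: 1) - F (x, y))) =
    (fun h : R => h^-1 *: ((F \o shift (x, y)) (h *: unit_vector true) - F (x, y))).
  apply/funext => h; congr (_ *: (F _ - _)).
  have -> : (shift (x, y)) (h *: unit_vector true) = (h * 0 + x, h * 1 + y) by [].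
  by rewrite mulr0 add0r.
by move=> d; apply: DeriveDef; rewrite /derivable /partial /derive E.
Qed.

Variable F : R * R -> R.
Hypothesis sF : smooth_on_disk F.

(** Differentiability from continuous partial derivatives, which are all that [smooth_on_disk]
    provides: the mean value theorem is applied along one coordinate after the other. *)
Lemma smooth_taylor z (e : R) : disk z -> 0 < e -> exists2 d : R, 0 < d &
  forall x y, `|x - z.1| <= d -> `|y - z.2| <= d ->
  `|F (x, y) - F z - ((x - z.1) * partial false F z + (y - z.2) * partial true F z)|
    <= e * (`|x - z.1| + `|y - z.2|).
Proof.
move=> dz e0.
have cp b : \forall w \near z, `|partial b F z - partial b F w| <= e.
  by have [/cvgrPdist_le/(_ e e0)] := sF [:: b] dz.
have /nbhs_ballP[d /= d0 H] : \forall w \near z, [/\ disk w, `|partial false F z - partial false F w| <= e & `|partial true F z - partial true F w| <= e].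
  have od := open_nbhs_nbhs (conj (@open_disk R) dz).
  by apply: filterS3 od (cp false) (cp true).
have Hw x y : `|x - z.1| <= d / 2 -> `|y - z.2| <= d / 2 -> [/\ disk (x, y), `|partial false F z - partial false F (x, y)| <= e & `|partial true F z - partial true F (x, y)| <= e].
  move=> hx hy; apply: H; split; rewrite -ball_normE/= distrC; lra.
exists (d / 2); first by rewrite divr_gt0.
move=> x y hx hy.
have h1 : `|F (x, y) - F (z.1, y) - (x - z.1) * partial false F z| <= e * `|x - z.1|.
  apply: (@mvt_linear (fun s => F (s, y)) (fun s => partial false F (s, y))) => s hs.
    by apply: is_derive_fst; have [ds _ _] := Hw s y (le_trans hs hx) hy; have [_] := sF [::] ds; exact.
  by have [_ h _] := Hw s y (le_trans hs hx) hy; rewrite distrC; exact: h.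
have h2 : `|F (z.1, y) - F (z.1, z.2) - (y - z.2) * partial true F z| <= e * `|y - z.2|.
  have z0 : `|z.1 - z.1| <= d / 2 by rewrite subrr normr0 divr_ge0// ltW.
  apply: (@mvt_linear (fun s => F (z.1, s)) (fun s => partial true F (z.1, s))) => s hs.
    by apply: is_derive_snd; have [ds _ _] := Hw z.1 s z0 (le_trans hs hy); have [_] := sF [::] ds; exact.
  by have [_ _ h] := Hw z.1 s z0 (le_trans hs hy); rewrite distrC; exact: h.
rewrite mulrDr; apply: le_trans (lerD h1 h2); apply: le_trans (ler_normD _ _).
by rewrite -surjective_pairing le_eqVlt; apply/orP; left; apply/eqP; congr `|_|; ring.
Qed.

Lemma chain_rule (p1 p2 : R -> R) (s v1 v2 : R) : disk (p1 s, p2 s) ->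
  is_derive s 1 p1 v1 -> is_derive s 1 p2 v2 ->
  is_derive s 1 (fun t => F (p1 t, p2 t))
    (v1 * partial false F (p1 s, p2 s) + v2 * partial true F (p1 s, p2 s)).
Proof.
move=> dp d1 d2; set z := (p1 s, p2 s); set a := partial false F z; set b := partial true F z.
have dq (p : R -> R) v : is_derive s 1 p v ->
    (fun h : R => h^-1 *: ((p \o shift s) (h *: 1) - p s)) @ 0^' --> v.
  by move=> [dp' <-]; exact: dp'.
have cq (p : R -> R) v d : 0 < d -> is_derive s 1 p v -> \forall h \near 0^', `|p (h + s) - p s| <= d.
  move=> d0 [dp' _]; have /cvgrPdist_le/(_ d d0) cp : {for s, continuous p}.
    by apply: differentiable_continuous; apply/derivable1_diffP.
  have /nbhs_ballP[r /= r0 H] := cp.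
  near=> h; rewrite distrC; apply: H; rewrite -ball_normE/= opprD addrCA subrr addr0 normrN.
  by near: h; exact: dnbhs0_lt.
have cv : (fun h : R => h^-1 *: (((fun t => F (p1 t, p2 t)) \o shift s) (h *: 1) - F z)) @ 0^' --> v1 * a + v2 * b.
  apply/cvgrPdist_le => eps eps0.
  (* Once [eta <= 1], [V] bounds the sum of the two difference quotients, while [A] bounds the sum
     of the partial derivatives; each of the two errors is then at most [eps / 2]. *)
  pose V := `|v1| + `|v2| + 2; have V0 : 0 < V by rewrite ltr_wpDl// addr_ge0.
  pose A := `|a| + `|b| + 1; have A0 : 0 < A by rewrite ltr_wpDl// addr_ge0.
  have e0 : 0 < eps / (2 * V) by rewrite divr_gt0// mulr_gt0.
  have [d d0 H] := smooth_taylor dp e0.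
  pose eta := Num.min 1 (eps / (2 * A)).
  have eta0 : 0 < eta by rewrite lt_min ltr01 divr_gt0// mulr_gt0.
  have /cvgrPdist_le/(_ eta eta0) c1 := dq _ _ d1.
  have /cvgrPdist_le/(_ eta eta0) c2 := dq _ _ d2.
  near=> h.
  have hn : h != 0 by near: h; exact: nbhs_dnbhs_neq.
  have h1 : `|v1 - h^-1 * (p1 (h + s) - p1 s)| <= eta.
    have : `|v1 - h^-1 *: ((p1 \o shift s) (h *: 1) - p1 s)| <= eta by near: h.
    by rewrite /= /GRing.scale/= mulr1.
  have h2 : `|v2 - h^-1 * (p2 (h + s) - p2 s)| <= eta.
    have : `|v2 - h^-1 *: ((p2 \o shift s) (h *: 1) - p2 s)| <= eta by near: h.
    by rewrite /= /GRing.scale/= mulr1.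
  have k1 : `|p1 (h + s) - p1 s| <= d by near: h; exact: cq d1.
  have k2 : `|p2 (h + s) - p2 s| <= d by near: h; exact: cq d2.
  have := H _ _ k1 k2; rewrite -/z -/a -/b.
  rewrite /= /GRing.scale/= mulr1.
  set x := p1 (h + s) in h1 k1 *; set y := p2 (h + s) in h2 k2 *.
  set a1 := h^-1 * (x - p1 s) in h1 *; set a2 := h^-1 * (y - p2 s) in h2 *.
  move=> T.
  have hi : 0 < `|h|^-1 by rewrite invr_gt0 normr_gt0.
  have T' : `|h^-1 * (F (x, y) - F z) - (a1 * a + a2 * b)| <= eps / (2 * V) * (`|a1| + `|a2|).
    have -> : h^-1 * (F (x, y) - F z) - (a1 * a + a2 * b) =
      h^-1 * (F (x, y) - F z - ((x - p1 s) * a + (y - p2 s) * b)) by rewrite /a1 /a2; ring.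
    rewrite (normrM h^-1) /a1 /a2 !(normrM h^-1) normfV -mulrDr mulrCA.
    exact: (ler_wpM2l (ltW hi) T).
  have n1 : `|a1| <= `|v1| + eta.
    rewrite -[a1](subKr v1); apply: le_trans (ler_normB _ _) _; by rewrite lerD2l.
  have n2 : `|a2| <= `|v2| + eta.
    rewrite -[a2](subKr v2); apply: le_trans (ler_normB _ _) _; by rewrite lerD2l.
  have eta1 : eta <= 1 by rewrite ge_min lexx.
  have etaA : eta * A <= eps / 2.
    have : eta <= eps / (2 * A) by rewrite ge_min lexx orbT.
    by rewrite ler_pdivlMr ?mulr_gt0//; lra.
  have B1 : eps / (2 * V) * (`|a1| + `|a2|) <= eps / 2.
    have -> : eps / 2 = eps / (2 * V) * V by field; rewrite gt_eqF.
    apply: ler_wpM2l; [exact: ltW|rewrite /V; lra].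
  have B2 : `|v1 * a + v2 * b - (a1 * a + a2 * b)| <= eta * A.
    have -> : v1 * a + v2 * b - (a1 * a + a2 * b) = (v1 - a1) * a + (v2 - a2) * b by ring.
    apply: le_trans (ler_normD _ _) _; rewrite (normrM (v1 - a1)) (normrM (v2 - a2)).
    apply: le_trans (lerD (ler_wpM2r (normr_ge0 a) h1) (ler_wpM2r (normr_ge0 b) h2)) _.
    by rewrite /A !mulrDr mulr1 lerDl ltW.
  have -> : v1 * a + v2 * b - h^-1 * (F (x, y) - F z) =
    (v1 * a + v2 * b - (a1 * a + a2 * b)) - (h^-1 * (F (x, y) - F z) - (a1 * a + a2 * b)) by ring.
  apply: le_trans (ler_normB _ _) _; lra.
by apply: DeriveDef; [exact: cvgP cv|exact: cvg_lim cv].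
Unshelve. all: by end_near. Qed.

Let lam := @lebesgue_measure R.

(** The derivative of [F] along a curve of speed at most 1 is bounded by [grad_norm F]. The majorant
    [W] will be the gradient cut off outside a Carleson square, whose measurability is at hand on
    the whole plane. *)
Lemma variation_le (p1 p2 v1 v2 : R -> R) (s0 s1 : R) (W : R -> \bar R) : s0 <= s1 ->
  (forall s, s0 <= s <= s1 -> [/\ disk (p1 s, p2 s), is_derive s 1 p1 (v1 s), is_derive s 1 p2 (v2 s),
    {for s, continuous v1} & {for s, continuous v2}]) ->
  (forall s, s0 <= s <= s1 -> v1 s ^+ 2 + v2 s ^+ 2 <= 1) ->
  measurable_fun `[s0, s1] W ->
  (forall s, s0 <= s <= s1 -> ((grad_norm F (p1 s, p2 s))%:E <= W s)%E) ->
  ((`|F (p1 s1, p2 s1) - F (p1 s0, p2 s0)|)%:E <= \int[lam]_(s in `[s0, s1]) W s)%E.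
Proof.
move=> s01 hp v1v2 mW gW.
pose f s := v1 s * partial false F (p1 s, p2 s) + v2 s * partial true F (p1 s, p2 s).
have cf s : s0 <= s <= s1 -> {for s, continuous f}.
  move=> hs; have [dp d1 d2 c1 c2] := hp s hs.
  have cp (p : R -> R) v : is_derive s 1 p v -> {for s, continuous p}.
    by move=> [dx _]; apply: differentiable_continuous; apply/derivable1_diffP.
  have cpart b : {for s, continuous (fun s => partial b F (p1 s, p2 s))}.
    apply: (@continuous_comp _ _ _ (fun s => (p1 s, p2 s)) (partial b F)).
      exact: (cvg_pair (cp _ _ d1) (cp _ _ d2)).
    by have [] := sF [:: b] dp.
  by apply: cvgD; apply: cvgM => //; exact: cpart.
have FTC := @integral_FTC R (fun t => F (p1 t, p2 t)) f s0 s1 s01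
  (fun s hs => let: And5 dp d1 d2 _ _ := hp s hs in chain_rule dp d1 d2) cf.
have mf : measurable_fun `[s0, s1] (EFin \o f).
  apply/measurable_EFinP; apply: subspace_continuous_measurable_fun => //.
  by apply: continuous_in_subspaceT => x /set_mem/=; rewrite in_itv/=; exact: cf.
rewrite -abse_EFin -FTC.
apply: (@le_trans _ _ (\int[lam]_(s in `[s0, s1]) `|(f s)%:E|)%E); first exact: le_abse_integral.
apply: ge0_le_integral => //.
- exact: measurableT_comp.
- move=> s; rewrite /= in_itv/= => hs; apply: le_trans (gW s hs).
  rewrite lee_fin /f; set a := partial _ _ _; set b := partial _ _ _.
  have := v1v2 s hs; set x := v1 s; set y := v2 s => xy.
  rewrite /grad_norm -/a -/b -[leLHS]sqrtr_sqr ler_wsqrtr//.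
  have : (x * a + y * b) ^+ 2 <= (x ^+ 2 + y ^+ 2) * (a ^+ 2 + b ^+ 2).
    by have := sqr_ge0 (x * b - y * a); lra.
  move=> h; apply: le_trans h _; rewrite ler_piMl// addr_ge0// sqr_ge0//.
Qed.

End chain_rule.

(** * A criterion for vanishing mean oscillation *)

Section mean_oscillation_criterion.
Context {R : realType}.
Implicit Types (u : R -> R) (f g : R * R -> R).
Local Notation lam := (@lebesgue_measure R).

Lemma oscillation_le_any_constant u (q a b : R) : locint u -> a < b ->
  iint (fun t => `|u t - avg u a b|) a b <= 2 * iint (fun t => `|u t - q|) a b.
Proof.
move=> lu ab; have h0 : 0 < b - a by rewrite subr_gt0.
have lc (c : R) : locint (fun t => u t - c) by apply: locintB => //; exact: locint_cst.
have l1 (c : R) : locint (fun t => `|u t - c|) by exact: locint_norm.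
have aq : `|avg u a b - q| * (b - a) <= iint (fun t => `|u t - q|) a b.
  apply: le_trans (le_norm_iint a b (lc q)).
  rewrite -[X in _ * X](gtr0_norm h0) -(normrM (avg u a b - q)) mulrBl /avg divfK ?gt_eqF//.
  rewrite (iintB a b lu (locint_cst q)) (iint_cst q (ltW ab)) lexx//.
apply: (@le_trans _ _ (iint (fun t => `|u t - q| + cst `|avg u a b - q| t) a b)).
  apply: le_iint => //; first by apply: locintD => //; exact: locint_cst.
  move=> t _ /=; rewrite (_ : u t - avg u a b = (u t - q) - (avg u a b - q)); last by ring.
  exact: ler_normB.
rewrite (iintD a b (l1 q) (locint_cst `|avg u a b - q|)) (iint_cst _ (ltW ab)); lra.
Qed.

(** Replacing the mean by any constant [q] costs a factor 2. Boundedness of the oscillation follows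
    as well: short arcs fall under the case [e = 1], and on arcs of length at least [d] the L^1 norm
    of [f] suffices. *)
Lemma VMO_intro f : in_L1 f ->
  (forall e : R, 0 < e -> exists2 d : R, 0 < d & forall a b, a < b -> b <= a + 2 * pi -> b - a < d ->
    exists q, iint (fun t => `|f (cis t) - q|) a b <= e * (b - a)) -> VMO f.
Proof.
move=> hf H; have lf := in_L1_locint hf.
have small (e : R) : 0 < e -> exists2 d : R, 0 < d & forall I, circle_arc I -> len I < d -> oscillation f I < e.
  move=> e0; have [d d0 hd] := H (e / 3) (divr_gt0 e0 (ltr0Sn R 2)).
  exists d => // _ [a [b [x [y [ab b2 ->]]]]]; rewrite len_arc// => abd.
  have h0 : 0 < b - a by rewrite subr_gt0.
  have [q hq] := hd a b ab b2 abd.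
  rewrite oscillation_arc// ltr_pdivrMr//.
  apply: le_lt_trans (oscillation_le_any_constant q lf ab) _.
  apply: le_lt_trans (ler_wpM2l _ hq) _ => //.
  have := mulr_gt0 e0 h0; lra.
split; last exact: small.
split=> //; have [d d0 hd] := small 1 ltr01.
pose M := iint (fun t => `|f (cis t)|) 0 (2 * pi).
have M0 : 0 <= M by apply: iint_ge0.
exists (1 + 2 * M / d) => _ [I aI <-].
have k0 : 0 <= 2 * M / d by rewrite divr_ge0 ?mulr_ge0// ltW.
have [ld|dl] := ltP (len I) d.
  by apply: le_trans (ltW (hd I aI ld)) _; rewrite lerDl.
move: aI dl => [a [b [x [y [ab b2 ->]]]]]; rewrite len_arc// => dl.
have h0 : 0 < b - a by rewrite subr_gt0.
rewrite oscillation_arc// ler_pdivrMr//.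
apply: le_trans (oscillation_le_any_constant 0 lf ab) _.
have le : iint (fun t => `|(f \o cis) t - 0|) a b <= M.
  rewrite (@eq_iint R _ (fun t => `|f (cis t)|)); last by move=> t _; rewrite subr0.
  have ln := locint_norm lf.
  rewrite /M -(@iint_period R (2 * pi) a (fun t => `|f (cis t)|)) ?mulr_gt0 ?pi_gt0//.
    by apply: iint_sub => //; lra.
  by move=> t; rewrite cisD2pi.
have h1 : 2 * M <= 2 * M / d * (b - a) by rewrite mulrAC ler_pdivlMr// ler_wpM2l// mulr_ge0.
by apply: le_trans (ler_wpM2l _ le) _ => //; rewrite mulrDl; lra.
Qed.

(** The exceptional set is pulled back by [cis]; its Lebesgue measure in [[a, b]] is the arclength
    of its trace on the arc. *)
Lemma ae_arc (P : R * R -> Prop) (a b : R) : a < b -> b <= a + 2 * pi ->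
  {ae arclength, forall zeta, circle zeta -> P zeta} ->
  {ae lam, forall t, `[a, b]%classic t -> P (cis t)}.
Proof.
move=> ab b2 [N [mN N0 sN]].
have mcN : measurable (cis @^-1` N : set (measurableTypeR R)).
  by rewrite -[X in measurable X]setTI; exact: measurable_cis.
exists (cis @^-1` N `&` `[a, b]%classic); split.
- by apply: measurableI => //; exact: measurable_itv.
- apply/eqP; rewrite eq_le measure_ge0 andbT -integral_indic//.
  pose J := cis @` [set` Interval (BSide true a) (BSide false b)].
  have -> : (\int[lam]_(t in `[a, b]) (\1_(cis @^-1` N) t)%:E = \int[arclength]_(z in J) (\1_N z)%:E)%E.
    rewrite (@integral_arc R (fun z => (\1_N z)%:E) a b true false)//.
    by apply: measurable_funTS; apply/measurable_EFinP; exact: measurable_indic.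
  have mJ : measurable J by apply: measurable_arc; exists a, b, true, false.
  rewrite integral_indic//.
  have := le_measure arclength (mem_set (measurableI _ _ mN mJ)) (mem_set mN) (@subIsetl _ N J).
  move=> h; apply: le_trans h _; rewrite le_eqVlt; apply/orP; left; apply/eqP; exact: N0.
- move=> t /=; apply: contra_notP => nt tab; apply: contrapT => nP; apply: nt; split => //.
  by apply: sN => /= h; apply: nP; apply: h; exact: circle_cis.
Qed.

Lemma circle_unif_continuous g (e : R) : continuous_on_circle g -> 0 < e -> exists2 d : R, 0 < d &
  forall a t, `|t - a| < d -> `|g (cis t) - g (cis a)| <= e.
Proof.
move=> cg e0; have e2 : 0 < e / 2 by rewrite divr_gt0.
have gc : forall t, \forall s \near t, `|g (cis t) - g (cis s)| <= e / 2.
  move=> t; have := cg (cis t) => /cvgrPdist_le/(_ _ e2).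
  rewrite /nbhs/= -nbhs_subspace_in; last exact: circle_cis.
  move=> H; have H' : \forall s \near t, circle (cis s) -> `|g (cis t) - g (cis s)| <= e / 2 :=
    @continuous_cis R t _ H.
  by apply: filterS H' => s h; exact: (h (circle_cis s)).
have /compact_near_coveringP nc := @segment_compact R 0 (2 * pi).
(* The absolute value of [d] makes [P] meaningful for all [d] near 0, as the covering form of
   compactness requires. *)
pose P (d x : R) := forall s, `|s - x| < `|d| -> `|g (cis s) - g (cis x)| <= e.
have : \forall d \near (0 : R), `[0, 2 * pi]%classic `<=` P d.
  apply: (nc R (nbhs (0 : R)) P _) => x _; have /nbhs_ballP[r /= r0 H] := gc x.
  have r2 : 0 < r / 2 by rewrite divr_gt0.
  exists (ball x (r / 2), ball 0 (r / 2)); first by split; exact: nbhsx_ballx.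
  move=> [x' d] /= [h1 h2] s sx; rewrite /P.
  move: h1 h2; rewrite -!ball_normE/= sub0r normrN => h1 h2.
  have k1 : `|g (cis x) - g (cis x')| <= e / 2 by apply: H; rewrite -ball_normE/=; lra.
  have k2 : `|g (cis x) - g (cis s)| <= e / 2.
    apply: H; rewrite -ball_normE/= -(subrKA x').
    by apply: le_lt_trans (ler_normD _ _) _; rewrite (distrC x' s); lra.
  rewrite -(subrKA (g (cis x))); apply: le_trans (ler_normD _ _) _.
  by rewrite (distrC (g (cis s))); lra.
move=> /nbhs_ballP[r /= r0 H].
have r2 : 0 < r / 2 by rewrite divr_gt0.
exists (r / 2) => // a t ta.
have [a0 /andP[a1 a2] aE] := cis_surj 0 (circle_cis a).
have Ps : P (r / 2) a0.
  apply: H; first by rewrite -ball_normE/= sub0r normrN gtr0_norm//; lra.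
  by rewrite /= in_itv/= a1/= ltW//; move: a2; rewrite add0r.
have -> : cis t = cis (a0 + (t - a)).
  have [e1 e2'] := aE.
  have [s ->] : exists s, t = a + s by exists (t - a); rewrite addrC subrK.
  rewrite (_ : a + s - a = s); last by ring.
  by rewrite /cis !cosD !sinD e1 e2'.
have E : a0 + (t - a) - a0 = t - a by ring.
by rewrite -aE; apply: Ps; rewrite E (gtr0_norm r2).
Qed.

End mean_oscillation_criterion.

(** * Variation of a function over a Carleson square *)

Section gradient_oscillation.
Context {R : realType}.
Variable F : R * R -> R.
Hypothesis sF : smooth_on_disk F.
Variables a b : R.
Hypothesis ab : a < b.
(** It keeps the square at radii at least [1 / 2], where [dr] and [r dr] are comparable, and the arc
    shorter than [pi / 2], as [polar_arc] requires. *)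
Hypothesis ab1 : b - a < 1.
Local Notation lam := (@lebesgue_measure R).
Let mR := measurableTypeR R.

Let J : set (R * R) := cis @` [set` Interval (BSide true a) (BSide false b)].
Let S : set (R * R) := carleson_square J `&` disk.
Let rho : R := 1 - (b - a) / (2 * pi).
(** Cut off outside the square, so that integrals over the whole plane only see the gradient mass of
    the square. *)
Let phi : R * R -> \bar R := (EFin \o grad_norm F) \_ S.

Let pp : 2 <= pi :> R. Proof. exact: pi_ge2. Qed.

Let b2 : b <= a + 2 * pi. Proof. by move: ab1 pp; lra. Qed.

Let J_arc : circle_arc J. Proof. by exists a, b, true, false. Qed.

Let h4 : (b - a) / (2 * pi) <= 4^-1.
Proof. by rewrite ler_pdivrMr; move: ab1 pp; lra. Qed.

Let rho_lt1 : rho < 1.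
Proof. by rewrite /rho ltrBlDr ltrDl divr_gt0 ?subr_gt0// mulr_gt0// pi_gt0. Qed.

Let rho_ge : 2^-1 <= rho. Proof. by move: h4; rewrite /rho; lra. Qed.

Let mS : measurable S.
Proof. by apply: measurableI; [exact: measurable_carleson_square|exact: measurable_disk]. Qed.

Let phi_ge0 z : (0 <= phi z)%E.
Proof. by apply: erestrict_ge0 => w _; rewrite lee_fin sqrtr_ge0. Qed.

Let mphi : measurable_fun setT phi.
Proof.
apply/(measurable_restrictT _ mS); apply/measurable_EFinP.
by apply: measurable_funS (measurable_grad_norm sF); [exact: measurable_disk|move=> z []].
Qed.

Let integral_phi : (\int[lam \x lam]_z phi z)%E = grad_measure F S.
Proof.
rewrite /grad_measure setIidl; last by move=> z [].
by rewrite [RHS]integral_mkcond.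
Qed.

Let S_polar r t : rho <= r < 1 -> a <= t <= b -> S (r *: cis t).
Proof.
move=> /andP[r1 r2] tab; split; last by rewrite disk_cis//; move: rho_ge; lra.
exists r; last exists (cis t) => //.
  by rewrite /= in_itv/= len_arc// r1 ltW.
by exists t.
Qed.

Let phi_polar r t : rho <= r < 1 -> a <= t <= b -> phi (r *: cis t) = (grad_norm F (r *: cis t))%:E.
Proof. by move=> hr ht; rewrite /phi patchE mem_set//; exact: S_polar. Qed.

Definition radial_gradient (t : R) : \bar R := (\int[lam]_(r in `[rho, 1%R[) phi (r *: cis t))%E.

Definition circular_gradient (r : R) : \bar R := (\int[lam]_(t in `[a, b]) phi (r *: cis t))%E.

Let mrad t : measurable_fun setT (fun r : R => phi (r *: cis t)).
Proof. exact: (measurableT_comp mphi (measurableT_comp measurable_polar (pair2_measurable t))). Qed.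

Let mcirc r : measurable_fun setT (fun t : R => phi (r *: cis t)).
Proof. exact: (measurableT_comp mphi (measurableT_comp measurable_polar (pair1_measurable r))). Qed.

Let H (p : mR * mR) : \bar R := ((\1_(`[rho, 1%R[ : set R) p.1)%:E * ((\1_(`[a, b] : set R) p.2)%:E * phi (p.1 *: cis p.2)))%E.

Let mH : measurable_fun setT H.
Proof.
apply: emeasurable_funM.
  by apply/measurable_EFinP; apply: (measurableT_comp _ measurable_fst); apply: measurable_indic; exact: measurable_itv.
apply: emeasurable_funM.
  by apply/measurable_EFinP; apply: (measurableT_comp _ measurable_snd); apply: measurable_indic; exact: measurable_itv.
exact: (measurableT_comp mphi measurable_polar).
Qed.

Let H0 p : (0 <= H p)%E. Proof. by rewrite /H !mule_ge0// lee_fin. Qed.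

Let radialE t : a <= t <= b -> radial_gradient t = (\int[lam]_r H (r, t))%E.
Proof.
move=> tab; rewrite /radial_gradient integral_indicM; apply: eq_integral => r _.
by rewrite /H/= [\1_(`[a, b]) t]indicE mem_set ?mul1e//= in_itv.
Qed.

Lemma measurable_radial_gradient : measurable_fun `[a, b] radial_gradient.
Proof.
apply: (@eq_measurable_fun _ _ _ _ _ (fun t => (\int[lam]_r H (r, t))%E)).
  by move=> t /set_mem; rewrite /= in_itv/= => tab; rewrite radialE.
by apply: measurable_funTS; exact: (@measurable_fun_fubini_tonelli_G _ _ mR mR R lam H mH H0).
Qed.

Lemma radial_gradient_ge0 t : (0 <= radial_gradient t)%E.
Proof. exact: integral_ge0. Qed.

Lemma integral_radial_gradient_le : (\int[lam]_(t in `[a, b]) radial_gradient t <= 2%:E * grad_measure F S)%E.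
Proof.
have mpm := measurable_polar_mass mphi phi_ge0.
apply: (@le_trans _ _ (\int[lam]_(t in `[a, b]) (2%:E * polar_mass phi t))%E); last first.
  rewrite ge0_integralZl_EFin//; last 2 first.
  - by move=> t _; exact: polar_mass_ge0.
  - exact: measurable_funTS mpm.
  rewrite -integral_phi; apply: lee_wpmul2l => //; apply: polar_arc => //.
  by move: ab1 pp; lra.
apply: ge0_le_integral => //.
- by move=> t _; exact: radial_gradient_ge0.
- exact: measurable_radial_gradient.
- by apply: measurable_funeM; exact: measurable_funTS mpm.
move=> t _; rewrite /polar_mass -ge0_integralZl_EFin//; last 2 first.
- by move=> r; rewrite /= in_itv/= andbT => r0; rewrite mule_ge0// lee_fin ltW.
- by apply: measurable_funTS; apply: emeasurable_funM => //; exact: mrad.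
have mg : measurable_fun setT (fun r : R => (2%:E * (phi (r *: cis t) * r%:E))%E).
  by apply: measurable_funeM; apply: emeasurable_funM => //; exact: mrad.
(* As [2 * r >= 1] on the square, the factor 2 turns [dr] into the polar element [r dr]. *)
apply: (@le_trans _ _ (\int[lam]_(r in `[rho, 1%R[) (2%:E * (phi (r *: cis t) * r%:E)))%E).
  apply: ge0_le_integral => //; [exact: measurable_funTS (mrad t)|exact: measurable_funTS mg|].
  move=> r; rewrite /= in_itv/= => /andP[r1 _].
  rewrite muleCA -EFinM -[leLHS]mule1; apply: lee_wpmul2l => //.
  by rewrite lee_fin; move: rho_ge; lra.
apply: ge0_subset_integral => //.
- exact: measurable_funTS mg.
- by move=> r; rewrite /= in_itv/= andbT => r0; rewrite mule_ge0// mule_ge0// lee_fin ltW.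
- by move=> r; rewrite /= !in_itv/= andbT => /andP[r1 _]; move: rho_ge; lra.
Qed.

(** By Tonelli the integral is also the one of [circular_gradient] over the heights, an interval of
    length [(b - a) / (2 * pi)]; not all heights can exceed [c]. *)
Lemma circular_gradient_small (c : R) :
  (\int[lam]_(t in `[a, b]) radial_gradient t < (c * ((b - a) / (2 * pi)))%:E)%E ->
  exists2 r, rho <= r < 1 & (circular_gradient r <= c%:E)%E.
Proof.
move=> lt; apply: contrapT => nex.
have big r : rho <= r < 1 -> (c%:E <= circular_gradient r)%E.
  move=> hr; rewrite leNgt; apply/negP => l; apply: nex; exists r => //; exact: ltW.
move: lt; apply/negP; rewrite -leNgt.
have swap : (\int[lam]_(t in `[a, b]) radial_gradient t = \int[lam]_(r in `[rho, 1%R[) circular_gradient r)%E.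
  transitivity (\int[lam]_t \int[lam]_r H (r, t))%E.
    rewrite [LHS]integral_indicM; apply: eq_integral => t _.
    rewrite indicE; case: (boolP (t \in _)) => [tab|tab].
      by rewrite mul1e radialE//; move: (set_mem tab); rewrite /= in_itv.
    by rewrite mul0e integral0_eq// => r _; rewrite /H/= [\1_(`[a, b]) t]indicE (negbTE tab) mul0e mule0.
  transitivity (\int[lam]_r \int[lam]_t H (r, t))%E.
    by apply/esym; exact: (@fubini_tonelli _ _ mR mR R lam lam H mH H0).
  rewrite [RHS]integral_indicM; apply: eq_integral => r _.
  rewrite indicE; case: (boolP (r \in _)) => [rr|rr].
    rewrite mul1e [RHS]integral_indicM; apply: eq_integral => t _.
    by rewrite /H/= [\1_(`[rho, 1%R[) r]indicE rr mul1e.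
  by rewrite mul0e integral0_eq// => t _; rewrite /H/= [\1_(`[rho, 1%R[) r]indicE (negbTE rr) mul0e.
rewrite swap; have [c0|c0] := leP c 0.
  apply: (@le_trans _ _ 0%E); last by apply: integral_ge0 => r _; exact: integral_ge0.
  have h0 : 0 <= (b - a) / (2 * pi) by move: rho_lt1; rewrite /rho; lra.
  by rewrite lee_fin; exact: mulr_le0_ge0.
apply: (@le_trans _ _ (\int[lam]_(r in `[rho, 1%R[) c%:E)%E).
  have lI : lam `[rho, 1[%classic = ((b - a) / (2 * pi))%:E.
    rewrite lebesgue_measure_itv/= lte_fin; move: rho_lt1 => ->.
    by rewrite -EFinB /rho; congr EFin; rewrite opprB addrC subrK.
  have -> : (\int[lam]_(r in `[rho, 1%R[) c%:E = c%:E * lam `[rho, 1%R[%classic)%E.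
    by apply: integral_cst; exact: measurable_itv.
  by rewrite lI -EFinM.
apply: ge0_le_integral.
- exact: measurable_itv.
- by move=> r _; rewrite lee_fin ltW.
- exact: measurable_cst.
- have mF := @measurable_fun_fubini_tonelli_F _ _ mR mR R lam H mH H0.
  apply: (@eq_measurable_fun _ _ _ _ _ (fun r => (\int[lam]_t H (r, t))%E)); last exact: measurable_funTS mF.
  move=> r rr; rewrite [RHS]integral_indicM; apply: eq_integral => t _.
  by rewrite /H/= [\1_(`[rho, 1%R[) r]indicE rr mul1e.
- by move=> r; rewrite /= in_itv/=; exact: big.
Qed.

Let dsin (r t : R) : is_derive t 1 (fun t => r * sin t) (r * cos t).
Proof. by apply: is_derive_eq; rewrite /GRing.scale/=; ring. Qed.

Let dcos (r t : R) : is_derive t 1 (fun t => r * cos t) (- (r * sin t)).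
Proof. by apply: is_derive_eq; rewrite /GRing.scale/=; ring. Qed.

Let did (k r : R) : is_derive r 1 (fun r => r * k) k.
Proof. by apply: is_derive_eq; rewrite /GRing.scale/=; ring. Qed.

Lemma circular_variation (r s t : R) : rho <= r < 1 -> a <= s <= b -> a <= t <= b ->
  ((`|F (r *: cis t) - F (r *: cis s)|)%:E <= circular_gradient r)%E.
Proof.
move=> hr; have /andP[r1 r2] := hr; have r0 : 0 <= r by move: rho_ge; lra.
wlog st : s t / s <= t.
  move=> W hs ht; have [st|/ltW ts] := leP s t; first exact: W.
  by rewrite distrC; exact: W.
move=> /andP[s1 s2] /andP[t1 t2].
apply: (@le_trans _ _ (\int[lam]_(x in `[s, t]) phi (r *: cis x))%E); last first.
  apply: ge0_subset_integral => //; first exact: measurable_funTS (mcirc r).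
  by move=> x; rewrite /= !in_itv/= => /andP[x1 x2]; apply/andP; split; lra.
apply: (variation_le sF (v1 := fun x => - (r * sin x)) (v2 := fun x => r * cos x) (p1 := fun x => r * cos x) (p2 := fun x => r * sin x) st).
- move=> x _; split.
  + by have := @disk_cis R r x r0; rewrite r2 => ->.
  + exact: dcos.
  + exact: dsin.
  + by apply: cvgN; apply: cvgM; [exact: cvg_cst|exact: continuous_sin].
  + by apply: cvgM; [exact: cvg_cst|exact: continuous_cos].
- move=> x _; rewrite sqrrN !exprMn -mulrDr addrC cos2Dsin2 mulr1.
  by rewrite expr_le1// ltW.
- exact: measurable_funTS (mcirc r).
- move=> x /andP[x1 x2]; rewrite -(_ : r *: cis x = (r * cos x, r * sin x))// phi_polar//.
  by apply/andP; split; lra.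
Qed.

(** The variation up to radius [s < 1] is bounded by the integral along the whole radius,
    independently of [s]; the bound passes to the limit. *)
Lemma radial_variation (r t l : R) : rho <= r < 1 -> a <= t <= b ->
  radial F (cis t) s @[s --> 1^'-] --> l ->
  ((`|l - F (r *: cis t)|)%:E <= radial_gradient t)%E.
Proof.
move=> /andP[r1 r2] ht cl.
have var s : r <= s < 1 -> ((`|F (s *: cis t) - F (r *: cis t)|)%:E <= radial_gradient t)%E.
  move=> /andP[rs s1].
  apply: (@le_trans _ _ (\int[lam]_(x in `[r, s]) phi (x *: cis t))%E); last first.
    apply: ge0_subset_integral => //; first exact: measurable_funTS (mrad t).
    by move=> x; rewrite /= !in_itv/= => /andP[x1 x2]; apply/andP; split; lra.
  apply: (variation_le sF (v1 := cst (cos t)) (v2 := cst (sin t)) (p1 := fun x => x * cos t) (p2 := fun x => x * sin t) rs).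
  - move=> x /andP[x1 x2]; split; [|exact: did|exact: did|exact: cst_continuous|exact: cst_continuous].
    have x0 : 0 <= x by move: rho_ge; lra.
    by have := @disk_cis R x t x0; rewrite (le_lt_trans x2 s1) => ->.
  - by move=> x _; rewrite /= cos2Dsin2.
  - exact: measurable_funTS (mrad t).
  - move=> x /andP[x1 x2]; rewrite -(_ : x *: cis t = (x * cos t, x * sin t))// phi_polar//.
    by apply/andP; split; lra.
have g0 := radial_gradient_ge0 t.
case E : (radial_gradient t) => [k| |]; [|by rewrite leey|by move: g0; rewrite E].
rewrite lee_fin; have cn : `|radial F (cis t) s - F (r *: cis t)| @[s --> 1^'-] --> `|l - F (r *: cis t)|.
  by apply: cvg_norm; apply: cvgB => //; exact: cvg_cst.
rewrite -(cvg_lim _ cn)//; apply: limr_le; first exact: cvgP cn.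
near=> s; rewrite -lee_fin -E; apply: var; apply/andP; split; last by near: s; exact: nbhs_left_lt.
by near: s; exact: nbhs_left_ge.
Unshelve. all: by end_near. Qed.

End gradient_oscillation.

Lemma gradient_VMO (R : realType) (F f g : R * R -> R) : in_L1 f -> smooth_on_disk F ->
  {ae arclength, forall zeta, circle zeta -> cvg (radial F zeta r @[r --> 1^'-])} ->
  continuous_on_circle g ->
  {ae arclength, forall zeta, circle zeta ->
    lim (radial F zeta r @[r --> 1^'-]) - f zeta = g zeta} ->
  CM0 (grad_measure F) -> VMO f.
Proof.
move=> hf sF hcv cg hlim [_ cm0]; have lf := in_L1_locint hf.
have pp := pi_ge2 R; have p4 : pi <= 4 :> R by have [/andP[_ h] _] := pihalf_02_cos_pihalf R; lra.
(* The [20] is [2 + 17 + 1]: [2] for the radial variation, by polar coordinates; [17] for the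
   circular one, since [2 * (2 * pi) <= 16 < 17] leaves a height with that bound; [1] for the
   oscillation of [g]. *)
apply: VMO_intro => // e e0; pose eps := e / 20; have eps0 : 0 < eps by rewrite divr_gt0.
have [d1 d10 hd1] := cm0 eps eps0.
have [d2 d20 hd2] := circle_unif_continuous cg eps0.
exists (Num.min (Num.min d1 d2) 1); first by rewrite !lt_min d10 d20 ltr01.
move=> a b ab b2; rewrite !lt_min => /andP[/andP[bd1 bd2] b1].
have h0 : 0 < b - a by rewrite subr_gt0.
pose J : set (R * R) := cis @` [set` Interval (BSide true a) (BSide false b)].
have aJ : circle_arc J by exists a, b, true, false.
have lJ : len J = b - a by rewrite len_arc.
have gm : (grad_measure F (carleson_square J `&` disk) <= (eps * (b - a))%:E)%E.
  by rewrite -lJ -carleson_ratio_leP//; apply/ltW/hd1 => //; rewrite lJ.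
have KI := integral_radial_gradient_le sF ab b1; rewrite -/J in KI.
have KI' : (\int[lebesgue_measure]_(t in `[a, b]) radial_gradient F a b t <= (2 * eps * (b - a))%:E)%E.
  apply: le_trans KI _; rewrite -mulrA EFinM; exact: lee_wpmul2l.
have [r hr Ar] : exists2 r, 1 - (b - a) / (2 * pi) <= r < 1 & (circular_gradient F a b r <= (17 * eps)%:E)%E.
  apply: (circular_gradient_small sF ab b1); apply: le_lt_trans KI' _.
  rewrite lte_fin mulrA ltr_pdivlMr ?mulr_gt0 ?pi_gt0//.
  have eh : 0 < eps * (b - a) by exact: mulr_gt0.
  have := ler_wpM2l (ltW eh) p4; lra.
(* Almost everywhere the radial limit is [f + g], so [f] is compared with one value of [F] minus the
   nearby value of [g]. *)
exists (F (r *: cis a) - g (cis a)); set q := F _ - g _.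
have aab : a <= a <= b by rewrite lexx ltW.
have ptw : {ae lebesgue_measure, forall t, `[a, b]%classic t ->
    ((`|f (cis t) - q|)%:E <= radial_gradient F a b t + (18 * eps)%:E)%E}.
  have H : {ae arclength, forall zeta, circle zeta -> cvg (radial F zeta r @[r --> 1^'-]) /\
      lim (radial F zeta r @[r --> 1^'-]) - f zeta = g zeta}.
    by apply: filterS2 hcv hlim => zeta h1 h2 cz; split; [exact: h1|exact: h2].
  have [N [mN N0 sN]] := ae_arc ab b2 H; exists N; split => //.
  apply: subset_trans sN => t; apply: contra_not => Ht tab; have [cl lE] := Ht tab.
  have {}tab : a <= t <= b by move: tab; rewrite /= in_itv.
  set l := lim _ in lE.
  have v1 : ((`|l - F (r *: cis t)|)%:E <= radial_gradient F a b t)%E.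
    exact: (radial_variation sF ab b1 hr tab cl).
  have v2 : `|F (r *: cis t) - F (r *: cis a)| <= 17 * eps.
    by rewrite -lee_fin; apply: le_trans (circular_variation sF ab b1 hr aab tab) Ar.
  have v3 : `|g (cis t) - g (cis a)| <= eps.
    by apply: hd2; move/andP: tab => [t1 t2]; rewrite ger0_norm ?subr_ge0//; lra.
  apply: (@le_trans _ _ ((`|l - F (r *: cis t)|)%:E + (18 * eps)%:E)%E); last exact: leeD2r.
  rewrite -EFinD lee_fin.
  have -> : f (cis t) - q = (l - F (r *: cis t)) + ((F (r *: cis t) - F (r *: cis a)) - (g (cis t) - g (cis a))).
    by rewrite /q -lE; ring.
  apply: le_trans (ler_normD _ _) _; rewrite lerD2l.
  by apply: le_trans (ler_normB _ _) _; lra.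
have lfq : locint (fun t => `|f (cis t) - q|).
  by apply: locint_norm; apply: locintB => //; exact: locint_cst.
have mK := measurable_radial_gradient sF ab b1.
rewrite -lee_fin (iint_EFin a b lfq).
apply: (@le_trans _ _ (\int[lebesgue_measure]_(t in `[a, b]) (radial_gradient F a b t + (18 * eps)%:E))%E).
  apply: ae_ge0_le_integral => //.
  - by apply/measurable_EFinP; apply: measurable_funTS; exact: locint_measurable lfq.
  - by move=> t _; apply: adde_ge0; [exact: radial_gradient_ge0|rewrite lee_fin mulr_ge0// ltW].
  - exact: emeasurable_funD.
rewrite ge0_integralD//; last 2 first.
- by move=> t _; exact: radial_gradient_ge0.
- by move=> t _; rewrite lee_fin mulr_ge0// ltW.
rewrite integral_cst//= lebesgue_measure_itv/= lte_fin ab -EFinB -EFinM.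
have -> : (e * (b - a))%:E = ((2 * eps * (b - a))%:E + (18 * eps * (b - a))%:E)%E.
  by rewrite -EFinD /eps; congr EFin; field.
exact: leeD2r.
Qed.

Unset Implicit Arguments.
Set Strict Implicit.
Set Printing Implicit Defensive.

Theorem theorem1p1 (R : realType) (f : R * R -> R) (hf : in_L1 f) :
  let V1 : Prop := VMO f in
  let V2 : Prop :=
    exists (mu : {charge set (R * R)%type -> \bar R}) (g : R * R -> R),
      [/\ CM0 (abs_charge mu),
          continuous_on_circle g &
          {ae arclength, forall zeta, circle zeta ->
            (f zeta)%:E = ((g zeta)%:E + balayage mu zeta)%E}] in
  let V3 : Prop :=
    exists F : R * R -> R,
      [/\ smooth_on_disk F,
          {ae arclength, forall zeta, circle zeta ->
            cvg (radial F zeta r @[r --> 1^'-])},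
          (exists2 g : R * R -> R, continuous_on_circle g &
            {ae arclength, forall zeta, circle zeta ->
              lim (radial F zeta r @[r --> 1^'-]) - f zeta = g zeta}) &
          CM0 (grad_measure F)] in
  (V1 <-> V2) /\ (V2 <-> V3).
Proof.
move=> V1 V2 V3.
have V12 : V1 -> V2 by exact: vmo_balayage.
have V23 : V2 -> V3 by move=> [mu [g [mu0 cg fE]]]; exact: balayage_extension mu0 cg fE.
have V31 : V3 -> V1.
  by move=> [F [sF cF [g cg gE] F0]]; exact: gradient_VMO hf sF cF cg gE F0.
split; split=> h; [exact: V12|exact/V31/V23|exact: V23|exact/V12/V31].
Qed.
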